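(* Let $(\mathbb E;Q,B;M)$ be a VB-Courant algebroid with anchor $\Theta:\mathbb E\to TB$, side anchor $\rho_Q:Q\to TM$ and core-anchor $\partial_B:Q^*\to B$, and let $\Sigma:Q\times_MB\to\mathbb E$ be a Lagrangian splitting with horizontal lift $\sigma_Q:\Gamma(Q)\to\Gamma^l_B(\mathbb E)$. Then there exists a Dorfman $2$-representation $(\Delta,\nabla,R)$ of $(Q,\rho_Q)$ on $\partial_B:Q^*\to B$ such that $$\Theta(\sigma_Q(q))=\widehat{\nabla_q},\qquad [\![\sigma_Q(q_1),\sigma_Q(q_2)]\!]=\sigma_Q([\![q_1,q_2]\!]_\Delta)-\widetilde{R(q_1,q_2)},\qquad [\![\sigma_Q(q),\tau^\dagger]\!]=(\Delta_q\tau)^\dagger$$ for all $q,q_1,q_2\in\Gamma(Q)$, $\tau\in\Gamma(Q^* )$, where $[\![\cdot,\cdot]\!]_\Delta$ is the dull bracket on $\Gamma(Q)$ dual to $\Delta$. Conversely, let $(\mathbb E;Q,B;M)$ be a metric double vector bundle with a Lagrangian splitting $\Sigma:Q\times_MB\to\mathbb E$, let $(Q,\rho_Q)$ be anchored and let $(\partial_B,\Delta,\nabla,R)$ be a Dorfman $2$-representation of $(Q,\rho_Q)$. Then the three displayed equations, together with $\Theta(\tau^\dagger)=(\partial_B\tau)^\uparrow$ and $[\![\tau_1^\dagger,\tau_2^\dagger]\!]=0$, define a linear Courant algebroid structure on $\mathbb E\to B$, i.e. make $(\mathbb E;Q,B;M)$ a VB-Courant algebroid.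
   Context: **Courant algebroids.** A Courant algebroid is a vector bundle $\mathsf E\to N$ with a nondegenerate symmetric pairing, anchor $\rho:\mathsf E\to TN$ and $\mathbb R$-bilinear bracket $[\![\cdot,\cdot]\!]$ on sections with $[\![e_1,[\![e_2,e_3]\!]]\!]=[\![[\![e_1,e_2]\!],e_3]\!]+[\![e_2,[\![e_1,e_3]\!]]\!]$, $\rho(e_1)\langle e_2,e_3\rangle=\langle[\![e_1,e_2]\!],e_3\rangle+\langle e_2,[\![e_1,e_3]\!]\rangle$, $[\![e_1,e_2]\!]+[\![e_2,e_1]\!]=\mathcal D\langle e_1,e_2\rangle$, where $\langle\mathcal Df,e\rangle=\rho(e)f$. **Double vector bundles.** A double vector bundle $(D;A,B;M)$ is a commutative square of vector bundles $\pi_A:D\to A$, $\pi_B:D\to B$, $A\to M$, $q_B:B\to M$ such that the structure maps of $D\to B$ are vector bundle morphisms over those of $A\to M$; core $C=\ker\pi_A\cap\ker\pi_B$, $\overline c\in D$ for $c\in C$. For $c\in\Gamma(C)$, $c^\dagger(b_m)=0_{b_m}+_A\overline{c(m)}$ (core section of $D\to B$; the space of these is $\Gamma^c_B(D)$). $\Gamma^l_B(D)$ is the space of linear sections: those that are vector bundle morphisms $(B\to M)\to(D\to A)$ over some $a\in\Gamma(A)$. For $\phi\in\Gamma(\mathrm{Hom}(B,C))$, $\widetilde\phi(b_m)=0_{b_m}+_A\overline{\phi(b_m)}$. A linear splitting $\Sigma:A\times_MB\to D$ is an injective morphism of double vector bundles over the identities on $A$ and $B$; $\sigma_A(a)(b_m)=\Sigma(a(m),b_m)$.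 **Metric double vector bundles.** $(\mathbb E;Q,B;M)$: double vector bundle with sides $Q,B$ and a symmetric nondegenerate pairing on $\mathbb E\to B$ such that the induced map $\mathbb E\to\mathbb E^*_B$ to the dual over $B$ is an isomorphism of double vector bundles; the core is then identified with $Q^*$. A linear splitting is Lagrangian if its image is maximal isotropic in $\mathbb E\to B$, equivalently $\langle\sigma_Q(q_1),\sigma_Q(q_2)\rangle=0$ for all $q_1,q_2$. **VB-Courant algebroid.** A metric double vector bundle $(\mathbb E;Q,B;M)$ with a Courant algebroid structure on $\mathbb E\to B$ with the given pairing, such that the anchor $\Theta:\mathbb E\to TB$ is a morphism of double vector bundles (over $\mathrm{id}_B$ and some $\rho_Q:Q\to TM$), and $[\![\Gamma^l_B,\Gamma^l_B]\!]\subseteq\Gamma^l_B$, $[\![\Gamma^l_B,\Gamma^c_B]\!]\subseteq\Gamma^c_B$, $[\![\Gamma^c_B,\Gamma^c_B]\!]=0$. The core-anchor $\partial_B:Q^*\to B$ is defined by $\Theta(\tau^\dagger)=(\partial_B\tau)^\uparrow$, $b^\uparrow\in\mathfrak X(B)$ being the vertical lift of $b\in\Gamma(B)$. For a derivation $D$ of $\Gamma(B)$ over $X\in\mathfrak X(M)$, $\widehat D\in\mathfrak X(B)$ is the vector field with $\widehat D(q_B^*f)=q_B^*(Xf)$, $\widehat D(\ell_\beta)=\ell_{D^*\beta}$, $\ell_\beta$ the linear function of $\beta\in\Gamma(B^* )$ and $D^*$ the dual derivation. **Dorfman $2$-representations.** Let $(Q,\rho_Q:Q\to TM)$ be an anchored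 vector bundle. A Dorfman connection is an $\mathbb R$-bilinear $\Delta:\Gamma(Q)\times\Gamma(Q^* )\to\Gamma(Q^* )$ with $\Delta_q(f\tau)=f\Delta_q\tau+\rho_Q(q)(f)\tau$, $\Delta_{fq}\tau=f\Delta_q\tau+\langle q,\tau\rangle\rho_Q^*\mathbf df$, $\Delta_q(\rho_Q^*\mathbf df)=\rho_Q^*\mathbf d(\rho_Q(q)f)$. Its dual dull bracket is $\langle[\![q_1,q_2]\!]_\Delta,\tau\rangle=\rho_Q(q_1)\langle q_2,\tau\rangle-\langle q_2,\Delta_{q_1}\tau\rangle$. A Dorfman $2$-representation of $(Q,\rho_Q)$ is $(\partial_B,\Delta,\nabla,R)$ (also: $(\Delta,\nabla,R)$ on $\partial_B$) with $\partial_B:Q^*\to B$ a vector bundle map, $\Delta$ a Dorfman connection, $\nabla:\Gamma(Q)\times\Gamma(B)\to\Gamma(B)$ a linear connection, $R\in\Omega^2(Q,\mathrm{Hom}(B,Q^* ))$ such that (D1) $\partial_B\circ\Delta_q=\nabla_q\circ\partial_B$; (D2) $[\![\cdot,\cdot]\!]_\Delta$ is skew-symmetric; (D3) $\nabla^*_{\partial_B^*\xi_1}\xi_2+\nabla^*_{\partial_B^*\xi_2}\xi_1=0$ for $\xi_i\in\Gamma(B^* )$; (D4) $\partial_B\circ R(q_1,q_2)=R_\nabla(q_1,q_2)$, $R(q_1,q_2)\circ\partial_B=R_\Delta(q_1,q_2)$ (curvatures computed with $[\![\cdot,\cdot]\!]_\Delta$); (D5) $R(q_1,q_2)^*q_3=-R(q_1,q_3)^*q_2$;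 (D6) $\lozenge_{q_1}R(q_2,q_3)-\lozenge_{q_2}R(q_1,q_3)+\lozenge_{q_3}R(q_1,q_2)-R([\![q_1,q_2]\!]_\Delta,q_3)+R([\![q_1,q_3]\!]_\Delta,q_2)-R([\![q_2,q_3]\!]_\Delta,q_1)=\nabla^*_\cdot(R(q_1,q_2)^*q_3)$, where $\lozenge_q\Phi=\Delta_q\circ\Phi-\Phi\circ\nabla_q$ and the right side is the element $b\mapsto(q\mapsto\langle\nabla^*_q(R(q_1,q_2)^*q_3),b\rangle)$ of $\Gamma(\mathrm{Hom}(B,Q^* ))$. *)

(* Defs.v *)
From HB Require Import structures.
From mathcomp Require Import all_boot all_order all_algebra.
From mathcomp Require Import all_classical all_reals all_analysis.

Set Implicit Arguments.
Unset Strict Implicit.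
Unset Printing Implicit Defensive.

Import Order.TTheory GRing.Theory Num.Theory.
Import numFieldNormedType.Exports.

Local Open Scope classical_set_scope.
Local Open Scope ring_scope.

(** Conventions.
    - A vector bundle is given by its total space and its base, both manifolds;
      fibrewise operations are total functions whose values on elements of
      different fibres are unconstrained.
    - Operators on sections (brackets, connections) take arbitrary maps as
      arguments and are only constrained on smooth sections.
    - Tangent vectors act as derivations on functions and are only compared on
      smooth functions. *)

Section SmoothOn.
Variables (R : realType) (V W : normedModType R).

Fixpoint Ck (k : nat) (U : set V) (f : V -> W) : Prop :=
  (forall x, U x -> {for x, continuous f}) /\
  if k is k'.+1 then
    forall v : V, (forall x, U x -> derivable f x v) /\
                  Ck k' U (fun x => 'D_v f x)
  else True.

Definition smooth_on (U : set V) (f : V -> W) : Prop := forall k, Ck k U f.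

End SmoothOn.

Record chart (R : realType) (n : nat) (X : topologicalType) := Chart {
  cdom : set X;
  cmap : X -> 'rV[R]_n;
  cinv : 'rV[R]_n -> X;
  cdom_open : open cdom;
  ccod_open : open (cmap @` cdom);
  cmapK : forall x, cdom x -> cinv (cmap x) = x;
  cmap_cont : forall x, cdom x -> {for x, continuous cmap};
  cinv_cont : forall u, (cmap @` cdom) u -> {for u, continuous cinv} }.

Definition chart_compat (R : realType) (n p : nat) (X : topologicalType)
    (c : chart R n X) (d : chart R p X) : Prop :=
  smooth_on (cmap c @` (cdom c `&` cdom d)) (cmap d \o cinv c) /\
  smooth_on (cmap d @` (cdom c `&` cdom d)) (cmap c \o cinv d).

Record manifold (R : realType) := Manifold {
  mcar :> topologicalType;
  mdim : nat;
  atlas : set (chart R mdim mcar);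
  atlas_cover : forall x, exists2 c, atlas c & cdom c x;
  atlas_compat : forall c d, atlas c -> atlas d -> chart_compat c d;
  manifold_hausdorff : hausdorff_space mcar;
  manifold_second_countable : @second_countable mcar }.

Section Manifolds.
Variable R : realType.
Implicit Types M N P : manifold R.

Definition smooth_chart (n : nat) M (d : chart R n M) : Prop :=
  forall c, atlas c -> chart_compat c d.

Definition smooth_fun M (f : M -> R) : Prop :=
  forall c : chart R _ M, atlas c ->
    smooth_on (cmap c @` cdom c) (f \o cinv c : 'rV[R]_(mdim M) -> R^o).

Definition smooth_map M N (F : M -> N) : Prop :=
  continuous F /\
  forall (c : chart R _ M) (d : chart R _ N), atlas c -> atlas d ->
    smooth_on (cmap c @` (cdom c `&` F @^-1` cdom d))
              (cmap d \o F \o cinv c).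

Definition smooth_curve N (g : R -> N) : Prop :=
  continuous g /\
  forall d : chart R _ N, atlas d ->
    smooth_on (g @^-1` cdom d) (cmap d \o g : R^o -> 'rV[R]_(mdim N)).

(** The fibre product of [p1 : N1 -> M] and [p2 : N2 -> M] (one of them a
    submersion) is represented by the smooth maps from manifolds [P] into it:
    a map defined on it is smooth iff it is so along all of these. *)
Definition smooth_fun_fp N1 N2 M (p1 : N1 -> M) (p2 : N2 -> M)
    (F : N1 -> N2 -> R) : Prop :=
  forall P (f : P -> N1) (g : P -> N2), smooth_map f -> smooth_map g ->
    (forall x, p1 (f x) = p2 (g x)) -> smooth_fun (fun x => F (f x) (g x)).

Definition smooth_map_fp N1 N2 M N (p1 : N1 -> M) (p2 : N2 -> M)
    (F : N1 -> N2 -> N) : Prop :=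
  forall P (f : P -> N1) (g : P -> N2), smooth_map f -> smooth_map g ->
    (forall x, p1 (f x) = p2 (g x)) -> smooth_map (fun x => F (f x) (g x)).

Definition velocity N (g : R -> N) (f : N -> R) : R := derive1 (f \o g) 0.

Definition tangent N (x : N) (v : (N -> R) -> R) : Prop :=
  exists g : R -> N, [/\ smooth_curve g, g 0 = x
    & forall f, smooth_fun f -> v f = velocity g f].

Definition vector_field N (X : N -> (N -> R) -> R) : Prop :=
  (forall x, tangent x (X x)) /\
  (forall f, smooth_fun f -> smooth_fun (fun x => X x f)).

Definition pushforward M N (F : M -> N) (v : (M -> R) -> R) : (N -> R) -> R :=
  fun f => v (f \o F).

End Manifolds.

(** [vb_triv]: [(cmap d)] is [(base coordinates, fibre coordinates)], where the
    fibre coordinates restrict to linear isomorphisms from the fibres to R^k;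
    the vector space axioms in the fibres follow. *)
Record vbundle (R : realType) (E N : manifold R) := VBundle {
  vproj : E -> N;
  vzero : N -> E;
  vadd : E -> E -> E;
  vscale : R -> E -> E;
  vrank : nat;
  vproj_smooth : smooth_map vproj;
  vproj_zero : forall x, vproj (vzero x) = x;
  vproj_add : forall e e', vproj e = vproj e' -> vproj (vadd e e') = vproj e;
  vproj_scale : forall r e, vproj (vscale r e) = vproj e;
  vb_triv : forall x : N,
    exists c : chart R (mdim N) N, exists d : chart R (mdim N + vrank) E,
      [/\ smooth_chart c, smooth_chart d, cdom c x, cdom d = vproj @^-1` cdom c
        & [/\ forall e, cdom d e -> lsubmx (cmap d e) = cmap c (vproj e),
          forall y (u : 'rV[R]_vrank), cdom c y ->
            exists2 e, cdom d e & cmap d e = row_mx (cmap c y) u,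
          forall y, cdom c y -> rsubmx (cmap d (vzero y)) = 0,
          forall e e', cdom d e -> vproj e = vproj e' ->
            rsubmx (cmap d (vadd e e')) =
            rsubmx (cmap d e) + rsubmx (cmap d e')
        & forall r e, cdom d e ->
            rsubmx (cmap d (vscale r e)) = r *: rsubmx (cmap d e)]] }.

Notation "x +[ E ] y" := (vadd E x y)
  (at level 50, E at level 200, left associativity,
   format "x  +[ E ]  y") : ring_scope.
Notation "r *[ E ] x" := (vscale E r x)
  (at level 40, E at level 200, left associativity,
   format "r  *[ E ]  x") : ring_scope.

Section VectorBundles.
Variable R : realType.

Definition vb_morphism (E N E' N' : manifold R) (V : vbundle E N)
    (V' : vbundle E' N') (f : N -> N') (F : E -> E') : Prop :=
  [/\ smooth_map f, smooth_map F,
      forall e, vproj V' (F e) = f (vproj V e),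
      forall e e', vproj V e = vproj V e' -> F (e +[V] e') = F e +[V'] F e'
    & forall r e, F (r *[V] e) = r *[V'] F e].

Variables (E N : manifold R) (V : vbundle E N).

Definition section (s : N -> E) : Prop :=
  smooth_map s /\ forall x, vproj V (s x) = x.

Definition sadd (s s' : N -> E) : N -> E := fun x => s x +[V] s' x.
Definition sscale (f : N -> R) (s : N -> E) : N -> E := fun x => f x *[V] s x.

(** Elements of the dual bundle over [x] are functions on [E] that are linear on
    the fibre over [x], considered through their restriction to this fibre. *)
Definition covector (x : N) (a : E -> R) : Prop :=
  (forall e e', vproj V e = x -> vproj V e' = x ->
     a (e +[V] e') = a e + a e') /\
  (forall r e, vproj V e = x -> a (r *[V] e) = r * a e).

(** A section [t] of the dual bundle is a fibrewise linear smooth function on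
    [E]; hence [t] is also its own associated linear function on the total
    space, and the pairing of [t] with a section [s] is [t \o s]. *)
Definition dual_section (t : E -> R) : Prop :=
  smooth_fun t /\ forall x, covector x t.

(** A vector bundle morphism from [E] to the tangent bundle of [N], over the
    identity. It is smooth iff its composition with every [df] is, [f] being a
    smooth function on [N]. *)
Definition anchored (rho : E -> (N -> R) -> R) : Prop :=
  [/\ forall e, tangent (vproj V e) (rho e),
      forall f, smooth_fun f -> smooth_fun (fun e => rho e f),
      forall e e' f, vproj V e = vproj V e' -> smooth_fun f ->
        rho (e +[V] e') f = rho e f + rho e' f
    & forall r e f, smooth_fun f -> rho (r *[V] e) f = r * rho e f].

Definition metric (pair : E -> E -> R) : Prop :=
  [/\ smooth_fun_fp (vproj V) (vproj V) pair,
      forall e e', vproj V e = vproj V e' -> pair e e' = pair e' e,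
      forall e, covector (vproj V e) (pair e)
    & forall e, (forall e', vproj V e' = vproj V e -> pair e e' = 0) ->
        e = vzero V (vproj V e)].

Definition vertical_lift (s : N -> E) (e : E) : (E -> R) -> R :=
  velocity (fun t : R => e +[V] (t *[V] s (vproj V e))).

(** [w] is the image of [(v1, v2)], tangent to the fibre product of [E] with
    itself, under the tangent map of the addition of [E]. *)
Definition tangent_add (v1 v2 w : (E -> R) -> R) : Prop :=
  exists g1 g2 : R -> E,
    [/\ smooth_curve g1, smooth_curve g2,
        forall t, vproj V (g1 t) = vproj V (g2 t)
      & forall f, smooth_fun f ->
          [/\ v1 f = velocity g1 f, v2 f = velocity g2 f
            & w f = velocity (fun t => g1 t +[V] g2 t) f]].

Definition tangent_scale (r : R) (v : (E -> R) -> R) : (E -> R) -> R :=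
  pushforward (vscale V r) v.

(** [<D^* t, s> = X <t, s> - <t, D s>] *)
Definition dual_derivation (X : N -> (N -> R) -> R) (D : (N -> E) -> N -> E)
    (t : E -> R) (s : N -> E) : N -> R :=
  fun x => X x (t \o s) - t (D s x).

(** [Xh] is the linear vector field on [E] defined by [D]; note that the
    function [Xh(l_t)] is required to be the linear function of [D^* t]. *)
Definition is_hat (X : N -> (N -> R) -> R) (D : (N -> E) -> N -> E)
    (Xh : E -> (E -> R) -> R) : Prop :=
  [/\ vector_field Xh,
      forall f e, smooth_fun f -> Xh e (f \o vproj V) = X (vproj V e) f
    & forall t, dual_section t ->
        dual_section (fun e => Xh e t) /\
        forall s x, section s -> Xh (s x) t = dual_derivation X D t s x].

Definition bracket_on_sections (br : (N -> E) -> (N -> E) -> N -> E) : Prop :=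
  [/\ forall s1 s2, section s1 -> section s2 -> section (br s1 s2),
      forall s1 s2 s3, section s1 -> section s2 -> section s3 ->
        br (sadd s1 s2) s3 =1 sadd (br s1 s3) (br s2 s3),
      forall s1 s2 s3, section s1 -> section s2 -> section s3 ->
        br s1 (sadd s2 s3) =1 sadd (br s1 s2) (br s1 s3),
      forall (r : R) s1 s2, section s1 -> section s2 ->
        br (sscale (cst r) s1) s2 =1 sscale (cst r) (br s1 s2)
    & forall (r : R) s1 s2, section s1 -> section s2 ->
        br s1 (sscale (cst r) s2) =1 sscale (cst r) (br s1 s2)].

Record courant_algebroid (pair : E -> E -> R) (rho : E -> (N -> R) -> R)
    (br : (N -> E) -> (N -> E) -> N -> E) : Prop := CourantAlgebroid {
  ca_metric : metric pair;
  ca_anchored : anchored rho;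
  ca_bracket : bracket_on_sections br;
  ca_jacobi : forall e1 e2 e3, section e1 -> section e2 -> section e3 ->
    br e1 (br e2 e3) =1 sadd (br (br e1 e2) e3) (br e2 (br e1 e3));
  ca_invariance : forall e1 e2 e3 x,
    section e1 -> section e2 -> section e3 ->
    rho (e1 x) (fun y => pair (e2 y) (e3 y)) =
    pair (br e1 e2 x) (e3 x) + pair (e2 x) (br e1 e3 x);
  (* the right-hand side is [<D <e1, e2>, e3>] *)
  ca_symmetric : forall e1 e2 e3 x,
    section e1 -> section e2 -> section e3 ->
    pair (sadd (br e1 e2) (br e2 e1) x) (e3 x) =
    rho (e3 x) (fun y => pair (e1 y) (e2 y)) }.

End VectorBundles.

(** [dA], [dB] are the structures of [D] over [A] and [B]; [sA], [sB] those of
    the sides. The last four fields say that the projection, the zero section,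
    the scalar multiplication and the addition of [D -> B] are vector bundle
    morphisms over those of [A -> M]. *)
Record dvb (R : realType) (D A B M : manifold R) := DVB {
  dA : vbundle D A;
  dB : vbundle D B;
  sA : vbundle A M;
  sB : vbundle B M;
  dvb_proj : vb_morphism dA sB (vproj sA) (vproj dB);
  dvb_zero : vb_morphism sB dA (vzero sA) (vzero dB);
  dvb_scale : forall r : R, vb_morphism dA dA (vscale sA r) (vscale dB r);
  dvb_add :
    [/\ forall d d', vproj dB d = vproj dB d' ->
          vproj dA (d +[dB] d') = vproj dA d +[sA] vproj dA d',
        forall d1 d2 d3 d4,
          vproj dB d1 = vproj dB d2 -> vproj dB d3 = vproj dB d4 ->
          vproj dA d1 = vproj dA d3 -> vproj dA d2 = vproj dA d4 ->
          (d1 +[dA] d3) +[dB] (d2 +[dA] d4) =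
          (d1 +[dB] d2) +[dA] (d3 +[dB] d4)
      & forall r d d', vproj dB d = vproj dB d' ->
          (r *[dA] d) +[dB] (r *[dA] d') = r *[dA] (d +[dB] d')] }.

Section DoubleVectorBundles.
Variables (R : realType) (D A B M : manifold R) (DD : dvb D A B M).

Definition is_core (m : M) (c : D) : Prop :=
  vproj (dA DD) c = vzero (sA DD) m /\ vproj (dB DD) c = vzero (sB DD) m.

Definition core_at (b : B) (c : D) : D := vzero (dB DD) b +[dA DD] c.

Definition dagger (c : M -> D) : B -> D :=
  fun b => core_at b (c (vproj (sB DD) b)).

Definition core_section (s : B -> D) : Prop :=
  exists c : M -> D,
    [/\ smooth_map c, forall m, is_core m (c m) & s =1 dagger c].

Definition linear_section (s : B -> D) : Prop :=
  section (dB DD) s /\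
  exists2 a : M -> A, section (sA DD) a & vb_morphism (sB DD) (dA DD) a s.

Record linear_splitting (S : A -> B -> D) : Prop := LinearSplitting {
  ls_smooth : smooth_map_fp (vproj (sA DD)) (vproj (sB DD)) S;
  ls_inj : forall a b a' b', vproj (sA DD) a = vproj (sB DD) b ->
    vproj (sA DD) a' = vproj (sB DD) b' -> S a b = S a' b' ->
    a = a' /\ b = b';
  ls_projA : forall a b, vproj (sA DD) a = vproj (sB DD) b ->
    vproj (dA DD) (S a b) = a;
  ls_projB : forall a b, vproj (sA DD) a = vproj (sB DD) b ->
    vproj (dB DD) (S a b) = b;
  ls_addA : forall a a' b, vproj (sA DD) a = vproj (sB DD) b ->
    vproj (sA DD) a' = vproj (sB DD) b ->
    S (a +[sA DD] a') b = S a b +[dB DD] S a' b;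
  ls_addB : forall a b b', vproj (sA DD) a = vproj (sB DD) b ->
    vproj (sA DD) a = vproj (sB DD) b' ->
    S a (b +[sB DD] b') = S a b +[dA DD] S a b';
  ls_scaleA : forall r a b, vproj (sA DD) a = vproj (sB DD) b ->
    S (r *[sA DD] a) b = r *[dB DD] S a b;
  ls_scaleB : forall r a b, vproj (sA DD) a = vproj (sB DD) b ->
    S a (r *[sB DD] b) = r *[dA DD] S a b }.

Definition horizontal_lift (S : A -> B -> D) (a : M -> A) : B -> D :=
  fun b => S (a (vproj (sB DD) b)) b.

(** A morphism from [(D; A, B; M)] to the double vector bundle
    [(TB; TM, B; M)], over the identity of [B] and [rho : A -> TM]. *)
Record tangent_dvb_morphism (Theta : D -> (B -> R) -> R)
    (rho : A -> (M -> R) -> R) : Prop := TangentDvbMorphism {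
  tdm_B : anchored (dB DD) Theta;
  tdm_side : anchored (sA DD) rho;
  tdm_proj : forall d f, smooth_fun f ->
    pushforward (vproj (sB DD)) (Theta d) f = rho (vproj (dA DD) d) f;
  tdm_add : forall d d', vproj (dA DD) d = vproj (dA DD) d' ->
    tangent_add (sB DD) (Theta d) (Theta d') (Theta (d +[dA DD] d'));
  tdm_scale : forall r d f, smooth_fun f ->
    Theta (r *[dA DD] d) f = tangent_scale (sB DD) r (Theta d) f }.

End DoubleVectorBundles.

Section VBCourant.
Variables (R : realType) (E Q B M : manifold R) (DD : dvb E Q B M).
Variable pair : E -> E -> R.

Definition core_covector (m : M) (a : E -> R) : Prop :=
  (forall c c', is_core DD m c -> is_core DD m c' ->
     a (c +[dB DD] c') = a c + a c') /\
  (forall r c, is_core DD m c -> a (r *[dB DD] c) = r * a c).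

(** The dual of [E -> B] is a double vector bundle with sides [B] and [C^*], [C]
    being the core of [E]: an element [phi] of the fibre over [b] projects to
    [c |-> phi (0_b + c)] in [C^*], and the addition over [C^*] is determined by
    [(phi + phi') (d + d') = phi d + phi' d'], where [d + d'] is the addition in
    [E -> Q], and similarly for the multiplication by scalars. The map
    [e |-> pair e] from [E] to its dual over [B] is an isomorphism of double
    vector bundles, with side morphisms the identity of [B] and [lambda]. *)
Record metric_dvb : Prop := MetricDvb {
  md_metric : metric (dB DD) pair;
  md_side : exists lambda : Q -> E -> R,
    [/\ forall e m c, vproj (sB DD) (vproj (dB DD) e) = m -> is_core DD m c ->
          pair e (core_at DD (vproj (dB DD) e) c) =
          lambda (vproj (dA DD) e) c,
        forall q, core_covector (vproj (sA DD) q) (lambda q),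
        forall q q' c, vproj (sA DD) q = vproj (sA DD) q' ->
          is_core DD (vproj (sA DD) q) c ->
          lambda (q +[sA DD] q') c = lambda q c + lambda q' c,
        forall r q c, is_core DD (vproj (sA DD) q) c ->
          lambda (r *[sA DD] q) c = r * lambda q c
      & forall m a, core_covector m a ->
          exists! q, vproj (sA DD) q = m /\
            forall c, is_core DD m c -> lambda q c = a c];
  md_add : forall e1 e1' e2 e2',
    vproj (dB DD) e1 = vproj (dB DD) e2 ->
    vproj (dB DD) e1' = vproj (dB DD) e2' ->
    vproj (dA DD) e1 = vproj (dA DD) e1' ->
    vproj (dA DD) e2 = vproj (dA DD) e2' ->
    pair (e1 +[dA DD] e1') (e2 +[dA DD] e2') = pair e1 e2 + pair e1' e2';
  md_scale : forall r e1 e2, vproj (dB DD) e1 = vproj (dB DD) e2 ->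
    pair (r *[dA DD] e1) (r *[dA DD] e2) = r * pair e1 e2 }.

(** The core element over [m] identified with the covector [a] in [Q^*]. The
    core of the dual of [E -> B] is [Q^*], where [a] corresponds to the
    functional [e |-> a (vproj dA e)] on the fibre of [E] over [0_m] in [B]. *)
Definition core_of (m : M) (a : Q -> R) : E :=
  xget (vzero (dB DD) (vzero (sB DD) m))
    [set c | is_core DD m c /\
       forall e, vproj (dB DD) e = vzero (sB DD) m ->
         pair c e = a (vproj (dA DD) e)].

Definition dual_dagger (tau : Q -> R) : B -> E :=
  dagger DD (fun m => core_of m tau).

Definition hom_tilde (phi : B -> Q -> R) : B -> E :=
  fun b => core_at DD b (core_of (vproj (sB DD) b) (phi b)).

Record lagrangian_splitting (S : Q -> B -> E) : Prop := LagrangianSplitting {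
  lag_linear : linear_splitting DD S;
  lag_isotropic : forall q q' b,
    vproj (sA DD) q = vproj (sB DD) b -> vproj (sA DD) q' = vproj (sB DD) b ->
    pair (S q b) (S q' b) = 0;
  lag_maximal : forall e b, vproj (dB DD) e = b -> pair e e = 0 ->
    (forall q, vproj (sA DD) q = vproj (sB DD) b -> pair e (S q b) = 0) ->
    exists2 q, vproj (sA DD) q = vproj (sB DD) b & e = S q b }.

Record vb_courant (Theta : E -> (B -> R) -> R) (rho : Q -> (M -> R) -> R)
    (br : (B -> E) -> (B -> E) -> B -> E) : Prop := VBCourant {
  vbc_metric : metric_dvb;
  vbc_courant : courant_algebroid (dB DD) pair Theta br;
  vbc_anchor : tangent_dvb_morphism DD Theta rho;
  vbc_ll : forall s s', linear_section DD s -> linear_section DD s' ->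
    linear_section DD (br s s');
  vbc_lc : forall s s', linear_section DD s -> core_section DD s' ->
    core_section DD (br s s');
  vbc_cc : forall s s', core_section DD s -> core_section DD s' ->
    br s s' =1 vzero (dB DD) }.

End VBCourant.

(** A vector bundle morphism over the identity from the dual of [Q] to [B]. *)
Record dual_bundle_map (R : realType) (Q B M : manifold R) (VQ : vbundle Q M)
    (VB : vbundle B M) (del : M -> (Q -> R) -> B) : Prop := DualBundleMap {
  dbm_fibre : forall m a a',
    (forall q, vproj VQ q = m -> a q = a' q) -> del m a = del m a';
  dbm_proj : forall m a, covector VQ m a -> vproj VB (del m a) = m;
  dbm_add : forall m a a', covector VQ m a -> covector VQ m a' ->
    del m (fun q => a q + a' q) = del m a +[VB] del m a';
  dbm_scale : forall m (r : R) a, covector VQ m a ->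
    del m (fun q => r * a q) = r *[VB] del m a;
  dbm_smooth : forall tau, dual_section VQ tau ->
    smooth_map (fun m => del m tau) }.

Definition core_anchor (R : realType) (E Q B M : manifold R)
    (DD : dvb E Q B M) (pair : E -> E -> R) (Theta : E -> (B -> R) -> R)
    (del : M -> (Q -> R) -> B) : Prop :=
  forall tau b f, dual_section (sA DD) tau -> smooth_fun f ->
    Theta (dual_dagger DD pair tau b) f =
    vertical_lift (sB DD) (fun m => del m tau) b f.

Section Dorfman.
Variables (R : realType) (Q B M : manifold R).
Variables (VQ : vbundle Q M) (VB : vbundle B M).
Variable rho : Q -> (M -> R) -> R.

(** [fun e => rho e f] is [rho^* df]. *)
Record dorfman_connection (Delta : (M -> Q) -> (Q -> R) -> Q -> R) : Prop :=
  DorfmanConnection {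
  dc_section : forall q t, section VQ q -> dual_section VQ t ->
    dual_section VQ (Delta q t);
  dc_addl : forall q q' t, section VQ q -> section VQ q' ->
    dual_section VQ t ->
    Delta (sadd VQ q q') t =1 (fun e => Delta q t e + Delta q' t e);
  dc_addr : forall q t t', section VQ q -> dual_section VQ t ->
    dual_section VQ t' ->
    Delta q (fun e => t e + t' e) =1 (fun e => Delta q t e + Delta q t' e);
  dc_leibniz : forall q t f, section VQ q -> dual_section VQ t ->
    smooth_fun f ->
    Delta q (fun e => f (vproj VQ e) * t e) =1
    (fun e => f (vproj VQ e) * Delta q t e + rho (q (vproj VQ e)) f * t e);
  dc_scalel : forall q t f, section VQ q -> dual_section VQ t ->
    smooth_fun f ->
    Delta (sscale VQ f q) t =1
    (fun e => f (vproj VQ e) * Delta q t e + t (q (vproj VQ e)) * rho e f);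
  dc_exact : forall q f, section VQ q -> smooth_fun f ->
    Delta q (fun e => rho e f) =1 (fun e => rho e (fun m => rho (q m) f)) }.

Definition dual_dull_bracket (Delta : (M -> Q) -> (Q -> R) -> Q -> R)
    (br : (M -> Q) -> (M -> Q) -> M -> Q) : Prop :=
  forall q1 q2, section VQ q1 -> section VQ q2 ->
    section VQ (br q1 q2) /\
    forall t m, dual_section VQ t ->
      t (br q1 q2 m) = rho (q1 m) (t \o q2) - Delta q1 t (q2 m).

Record linear_connection (nabla : (M -> Q) -> (M -> B) -> M -> B) : Prop :=
  LinearConnection {
  lc_section : forall q b, section VQ q -> section VB b ->
    section VB (nabla q b);
  lc_addl : forall q q' b, section VQ q -> section VQ q' -> section VB b ->
    nabla (sadd VQ q q') b =1 sadd VB (nabla q b) (nabla q' b);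
  lc_scalel : forall f q b, smooth_fun f -> section VQ q -> section VB b ->
    nabla (sscale VQ f q) b =1 sscale VB f (nabla q b);
  lc_addr : forall q b b', section VQ q -> section VB b -> section VB b' ->
    nabla q (sadd VB b b') =1 sadd VB (nabla q b) (nabla q b');
  lc_leibniz : forall q f b, section VQ q -> smooth_fun f -> section VB b ->
    nabla q (sscale VB f b) =1
    sadd VB (sscale VB f (nabla q b)) (sscale VB (fun m => rho (q m) f) b) }.

(** [<nabla^*_q xi, b>] *)
Definition dual_connection (nabla : (M -> Q) -> (M -> B) -> M -> B)
    (q : M -> Q) (xi : B -> R) (b : M -> B) : M -> R :=
  dual_derivation (fun m => rho (q m)) (nabla q) xi b.

(** A 2-form on [Q] with values in the vector bundle morphisms from [B] to [Q^*]:
    [Om q1 q2 b q3] is [<Om(q1, q2)(b), q3>], for elements of the fibres over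
    the same point. *)
Record hom_two_form (Om : Q -> Q -> B -> Q -> R) : Prop := HomTwoForm {
  htf_1 : forall q2 b q3, vproj VB b = vproj VQ q2 ->
    vproj VQ q3 = vproj VQ q2 ->
    covector VQ (vproj VQ q2) (fun q1 => Om q1 q2 b q3);
  htf_alt : forall q1 q2 b q3, vproj VQ q1 = vproj VQ q2 ->
    vproj VB b = vproj VQ q2 -> vproj VQ q3 = vproj VQ q2 ->
    Om q1 q2 b q3 = - Om q2 q1 b q3;
  htf_3 : forall q1 q2 q3, vproj VQ q1 = vproj VQ q2 ->
    vproj VQ q3 = vproj VQ q2 ->
    covector VB (vproj VQ q2) (fun b => Om q1 q2 b q3);
  htf_4 : forall q1 q2 b, vproj VQ q1 = vproj VQ q2 ->
    vproj VB b = vproj VQ q2 ->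
    covector VQ (vproj VQ q2) (Om q1 q2 b);
  htf_smooth : forall q1 q2 b q3, section VQ q1 -> section VQ q2 ->
    section VB b -> section VQ q3 ->
    smooth_fun (fun m => Om (q1 m) (q2 m) (b m) (q3 m)) }.

Definition om_section (Om : Q -> Q -> B -> Q -> R) (q1 q2 : M -> Q)
    (b : M -> B) : Q -> R :=
  fun e => Om (q1 (vproj VQ e)) (q2 (vproj VQ e)) (b (vproj VQ e)) e.

(** [<R(q1, q2)^* q3, b>] *)
Definition om_star (Om : Q -> Q -> B -> Q -> R) (q1 q2 q3 : M -> Q) : B -> R :=
  fun b => Om (q1 (vproj VB b)) (q2 (vproj VB b)) b (q3 (vproj VB b)).

(** [Phi] is the operator on sections induced by a vector bundle map from [B] to
    [Q^*], and the result is [(lozenge_q Phi)(b)]. *)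
Definition lozenge (Delta : (M -> Q) -> (Q -> R) -> Q -> R)
    (nabla : (M -> Q) -> (M -> B) -> M -> B) (q : M -> Q)
    (Phi : (M -> B) -> Q -> R) (b : M -> B) : Q -> R :=
  fun e => Delta q (Phi b) e - Phi (nabla q b) e.

(** [br] is included as a parameter since it is uniquely determined by [Delta]. *)
Record dorfman_2rep (del : M -> (Q -> R) -> B)
    (Delta : (M -> Q) -> (Q -> R) -> Q -> R)
    (nabla : (M -> Q) -> (M -> B) -> M -> B)
    (Om : Q -> Q -> B -> Q -> R)
    (br : (M -> Q) -> (M -> Q) -> M -> Q) : Prop := Dorfman2Rep {
  d2_del : dual_bundle_map VQ VB del;
  d2_Delta : dorfman_connection Delta;
  d2_br : dual_dull_bracket Delta br;
  d2_nabla : linear_connection nabla;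
  d2_Om : hom_two_form Om;
  d2_D1 : forall q t m, section VQ q -> dual_section VQ t ->
    del m (Delta q t) = nabla q (fun m' => del m' t) m;
  d2_D2 : forall q1 q2, section VQ q1 -> section VQ q2 ->
    br q1 q2 =1 sscale VQ (cst (-1)) (br q2 q1);
  (* [q1] and [q2] are the images of [xi1] and [xi2] under the dual of [del] *)
  d2_D3 : forall xi1 xi2 q1 q2, dual_section VB xi1 -> dual_section VB xi2 ->
    section VQ q1 -> section VQ q2 ->
    (forall t m, dual_section VQ t -> t (q1 m) = xi1 (del m t)) ->
    (forall t m, dual_section VQ t -> t (q2 m) = xi2 (del m t)) ->
    forall b m, section VB b ->
      dual_connection nabla q1 xi2 b m + dual_connection nabla q2 xi1 b m = 0;
  d2_D4_nabla : forall q1 q2 b m, section VQ q1 -> section VQ q2 ->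
    section VB b ->
    del m (Om (q1 m) (q2 m) (b m)) =
    nabla q1 (nabla q2 b) m +[VB] (-1) *[VB] nabla q2 (nabla q1 b) m
      +[VB] (-1) *[VB] nabla (br q1 q2) b m;
  d2_D4_Delta : forall q1 q2 t, section VQ q1 -> section VQ q2 ->
    dual_section VQ t ->
    om_section Om q1 q2 (fun m => del m t) =1
    (fun e => Delta q1 (Delta q2 t) e - Delta q2 (Delta q1 t) e
              - Delta (br q1 q2) t e);
  d2_D5 : forall q1 q2 q3 b, vproj VQ q1 = vproj VB b ->
    vproj VQ q2 = vproj VB b -> vproj VQ q3 = vproj VB b ->
    Om q1 q2 b q3 = - Om q1 q3 b q2;
  (* evaluated at [b] and then at [q] *)
  d2_D6 : forall q1 q2 q3 b q m, section VQ q1 -> section VQ q2 ->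
    section VQ q3 -> section VB b -> section VQ q ->
    let loz p p1 p2 := lozenge Delta nabla p (om_section Om p1 p2) b (q m) in
    let om p1 p2 := om_section Om p1 p2 b (q m) in
    loz q1 q2 q3 - loz q2 q1 q3 + loz q3 q1 q2
      - om (br q1 q2) q3 + om (br q1 q3) q2 - om (br q2 q3) q1 =
    dual_connection nabla q (om_star Om q1 q2 q3) b m }.

End Dorfman.

Record splitting_equations (R : realType) (E Q B M : manifold R)
    (DD : dvb E Q B M) (pair : E -> E -> R) (S : Q -> B -> E)
    (rho : Q -> (M -> R) -> R)
    (Delta : (M -> Q) -> (Q -> R) -> Q -> R)
    (nabla : (M -> Q) -> (M -> B) -> M -> B)
    (Om : Q -> Q -> B -> Q -> R) (br : (M -> Q) -> (M -> Q) -> M -> Q)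
    (Theta : E -> (B -> R) -> R)
    (brE : (B -> E) -> (B -> E) -> B -> E) : Prop := SplittingEquations {
  se_anchor : forall q, section (sA DD) q ->
    is_hat (sB DD) (fun m => rho (q m)) (nabla q)
      (fun b => Theta (horizontal_lift DD S q b));
  se_ll : forall q1 q2, section (sA DD) q1 -> section (sA DD) q2 ->
    brE (horizontal_lift DD S q1) (horizontal_lift DD S q2) =1
    sadd (dB DD) (horizontal_lift DD S (br q1 q2))
      (sscale (dB DD) (cst (-1))
        (hom_tilde DD pair (fun b =>
           Om (q1 (vproj (sB DD) b)) (q2 (vproj (sB DD) b)) b)));
  se_lc : forall q t, section (sA DD) q -> dual_section (sA DD) t ->
    brE (horizontal_lift DD S q) (dual_dagger DD pair t) =1
    dual_dagger DD pair (Delta q t) }.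

(* Main.v *)
(** In a Lagrangian splitting, the horizontal lifts [sigma q] and the core sections
    [tau^dagger] generate the sections of [E -> B] over the functions of [B].

    Given a VB-Courant algebroid, the brackets and anchors of generators define
    [Delta], [nabla] and [R], and the axioms of a Dorfman 2-representation are the
    axioms of a Courant algebroid evaluated on generators: (D2) is the symmetry of
    the bracket, (D5) the invariance of the pairing, (D1) and the first part of (D4)
    the compatibility of the anchor with brackets, (D3) the vanishing of the anchor
    on the image of [D], the second part of (D4) and (D6) the Jacobi identity.

    Conversely, the anchor is determined on functions that are linear or basic, and
    the prescribed brackets of generators satisfy the Leibniz rule over the functions
    of [M], invariance and symmetry. These three properties force the extension of
    the bracket to all sections, first in the second argument and then in the first.
    The failure of the anchor to be compatible with brackets is then tensorial, as
    the anchor vanishes on the image of [D], and it is a derivation in the function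
    by the symmetry of second derivatives, so it vanishes because it does so on
    generators and functions that are linear or basic. After that the Jacobiator is
    an alternating tensor, which vanishes because it does so on generators. *)
From HB Require Import structures.
From mathcomp Require Import all_boot all_order all_algebra.
From mathcomp Require Import all_classical all_reals all_analysis.
From mathcomp Require Import ring lra.
Require Import Defs.

Set Implicit Arguments.
Unset Strict Implicit.
Unset Printing Implicit Defensive.

Import Order.TTheory GRing.Theory Num.Theory.
Import numFieldNormedType.Exports.

Local Open Scope classical_set_scope.
Local Open Scope ring_scope.

(** * Calculus *)

Section Calculus.
Variable R : realType.
Implicit Types V W : normedModType R.

(** Objects are tested rather than built: smooth maps through pulled back functions, elements of [E]
    through their projections and pairings, tangent vectors to [B] through linear and basic
    functions. As vectors act only on global functions, coordinates and frames are made global by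
    cutoffs. Sections of [E] arise from prescribed pairings by nondegeneracy.

    A Courant algebroid is not assumed to have an anchor that respects brackets. In one direction
    this is extracted from the Jacobi identity by rescaling its third argument. In the other it must
    come before the Jacobiator is tensorial, and the obstacle is that the anchor has to kill all
    gradients. For two linear functions this is (D3). The gradient of a basic function is the core
    section of [rho^* df], and [del] kills [rho^* df] since (D1) is compatible with rescaling [q]
    only if the extra term of the Dorfman connection disappears under [del]. Each transposition of
    the arguments then changes the sign of the Jacobiator up to one anchor defect applied to a
    pairing. *)

Lemma Ck_pointwise V W k (U : set V) (f : V -> W) :
  Ck k U f <-> forall x, U x -> Ck k [set x] f.
Proof.
elim: k f => [|k IH] f /=.
  split=> [[cf _] x Ux|cf]; first by split=> // y ->; exact: cf.
  by split=> // x Ux; exact: (cf x Ux).1.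
split=> [[cf df] x Ux|h].
  split=> [y ->|v]; first exact: cf.
  split=> [y ->|]; first exact: (df v).1.
  by have /IH := (df v).2; apply.
split=> [x Ux|v]; first exact: (h x Ux).1.
split=> [x Ux|]; first exact: ((h x Ux).2 v).1.
by apply/IH => x Ux; exact: ((h x Ux).2 v).2.
Qed.

Lemma Ck_near V W k (x : V) (f g : V -> W) :
  (\forall y \near x, f y = g y) -> Ck k [set x] f -> Ck k [set x] g.
Proof.
elim: k f g => [|k IH] f g fg /= [cf df].
  split=> // y ->; have {}cf := cf x erefl.
  move: cf; rewrite /prop_for /continuous_at (nbhs_singleton fg).
  by apply: cvg_trans; apply: near_eq_cvg.
split=> [y ->|v].
  have {}cf := cf x erefl.
  move: cf; rewrite /prop_for /continuous_at (nbhs_singleton fg).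
  by apply: cvg_trans; apply: near_eq_cvg.
split=> [y ->|].
  by apply: near_eq_derivable fg _; exact: (df v).1.
apply: IH (df v).2; have := nbhs_interior fg.
by apply: filterS => y; exact: near_eq_derive.
Qed.

Lemma Ck_open_eq V W k (U : set V) (f g : V -> W) : open U ->
  (forall x, U x -> f x = g x) -> Ck k U f -> Ck k U g.
Proof.
move=> oU fg /Ck_pointwise h; apply/Ck_pointwise => x Ux.
apply: Ck_near (h x Ux); have : nbhs x U by exact: open_nbhs_nbhs.
by apply: filterS => y; exact: fg.
Qed.

Lemma CkS V W k (U : set V) (f : V -> W) : Ck k.+1 U f -> Ck k U f.
Proof.
elim: k f => [|k IH] f /= [cf df]; split=> // v.
by split; [exact: (df v).1|exact: IH (df v).2].
Qed.

(** Continuity and derivability are taken in the whole space [V], so smoothness on a set is a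
    condition on germs at its points. A singleton expresses smoothness at a point, the form in which
    local arguments are glued. *)
Lemma smooth_on_pointwise V W (U : set V) (f : V -> W) :
  smooth_on U f <-> forall x, U x -> smooth_on [set x] f.
Proof.
split=> [h x Ux k|h k]; first by have /Ck_pointwise := h k; exact.
by apply/Ck_pointwise => x Ux; exact: h.
Qed.

Lemma smooth_on_near V W (x : V) (f g : V -> W) :
  (\forall y \near x, f y = g y) -> smooth_on [set x] f -> smooth_on [set x] g.
Proof. by move=> fg h k; apply: Ck_near fg (h k). Qed.

Lemma smooth_on_eq V W (U : set V) (f g : V -> W) : open U ->
  (forall x, U x -> f x = g x) -> smooth_on U f -> smooth_on U g.
Proof. by move=> oU fg h k; apply: Ck_open_eq fg (h k). Qed.

Lemma smooth_onW V W (A U : set V) (f : V -> W) :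
  A `<=` U -> smooth_on U f -> smooth_on A f.
Proof.
by move=> AU /smooth_on_pointwise h; apply/smooth_on_pointwise => x /AU; exact: h.
Qed.

Lemma smooth_on_cont V W (U : set V) (f : V -> W) x :
  smooth_on U f -> U x -> {for x, continuous f}.
Proof. by move=> h Ux; have [+ _] := h 0; apply. Qed.

Lemma smooth_on_derivable V W (U : set V) (f : V -> W) x v :
  smooth_on U f -> U x -> derivable f x v.
Proof. by move=> h Ux; have [_ /(_ v)[+ _]] := h 1; apply. Qed.

Lemma smooth_on_derive V W (U : set V) (f : V -> W) v :
  smooth_on U f -> smooth_on U (fun x => 'D_v f x).
Proof. by move=> h k; have [_ /(_ v)[]] := h k.+1. Qed.

Lemma Ck_cst V W k (U : set V) (a : W) : Ck k U (fun _ => a).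
Proof.
elim: k a => [|k IH] a; split=> //.
- by move=> x _; exact: cvg_cst.
- by move=> x _; exact: cvg_cst.
move=> v; split=> [x _|]; first exact: derivable_cst.
rewrite (_ : 'D_v _ = (fun=> 0)); first exact: IH.
by apply/funext => x; rewrite derive_cst.
Qed.

Lemma smooth_cst V W (U : set V) (a : W) : smooth_on U (fun _ => a).
Proof. by move=> k; exact: Ck_cst. Qed.

Lemma CkD V W k (U : set V) (f g : V -> W) : open U ->
  Ck k U f -> Ck k U g -> Ck k U (fun x => f x + g x).
Proof.
move=> oU; elim: k f g => [|k IH] f g [cf df] [cg dg]; split=> //.
- by move=> x Ux; apply: cvgD; [exact: cf|exact: cg].
- by move=> x Ux; apply: cvgD; [exact: cf|exact: cg].
move=> v; split=> [x Ux|].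
  by apply: derivableD; [exact: (df v).1|exact: (dg v).1].
apply: (@Ck_open_eq _ _ _ _ (fun x => 'D_v f x + 'D_v g x)) => // [x Ux|].
  by rewrite deriveD //; [exact: (df v).1|exact: (dg v).1].
by apply: IH; [exact: (df v).2|exact: (dg v).2].
Qed.

Lemma smoothD V W (U : set V) (f g : V -> W) : open U ->
  smooth_on U f -> smooth_on U g -> smooth_on U (fun x => f x + g x).
Proof. by move=> oU hf hg k; exact: CkD. Qed.

Lemma CkM V k (U : set V) (f g : V -> R^o) : open U ->
  Ck k U f -> Ck k U g -> Ck k U (fun x => f x * g x : R^o).
Proof.
move=> oU; elim: k f g => [|k IH] f g hf hg.
  by split=> // x Ux; apply: cvgM; [exact: hf.1|exact: hg.1].
have [cf df] := hf; have [cg dg] := hg.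
split=> [x Ux|v]; first by apply: cvgM; [exact: cf|exact: cg].
split=> [x Ux|].
  by apply: derivableM; [exact: (df v).1|exact: (dg v).1].
apply: (@Ck_open_eq _ _ _ _ (fun x => f x * 'D_v g x + g x * 'D_v f x)) => // [x Ux|].
  by rewrite deriveM //; [exact: (df v).1|exact: (dg v).1].
apply: CkD => //; apply: IH.
- exact: CkS hf.
- exact: (dg v).2.
- exact: CkS hg.
- exact: (df v).2.
Qed.

Lemma smoothM V (U : set V) (f g : V -> R^o) : open U ->
  smooth_on U f -> smooth_on U g -> smooth_on U (fun x => f x * g x : R^o).
Proof. by move=> oU hf hg k; exact: CkM. Qed.

Lemma smooth_sum V (I : Type) (r : seq I) (U : set V) (f : I -> V -> R^o) :
  open U -> (forall i, smooth_on U (f i)) ->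
  smooth_on U (fun x => \sum_(i <- r) f i x).
Proof.
move=> oU h; elim: r => [|i r IH].
  apply: (@smooth_on_eq _ _ _ (fun=> 0)) => //; last exact: smooth_cst.
  by move=> x _; rewrite big_nil.
apply: (@smooth_on_eq _ _ _ (fun x => f i x + \sum_(i <- r) f i x)) => //.
  by move=> x _; rewrite big_cons.
exact: smoothD.
Qed.

Lemma CkV V k (U : set V) (f : V -> R^o) : open U ->
  (forall x, U x -> f x != 0) -> Ck k U f -> Ck k U (fun x => (f x)^-1 : R^o).
Proof.
move=> oU f0; elim: k => [|k IH] hf.
  by split=> // x Ux; apply: cvgV; [exact: f0|exact: hf.1].
have [cf df] := hf.
split=> [x Ux|v]; first by apply: cvgV; [exact: f0|exact: cf].
split=> [x Ux|].
  by apply: derivableV; [exact: f0|exact: (df v).1].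
have hV := IH (CkS hf).
apply: (@Ck_open_eq _ _ _ _ (fun x => (- 1 * ((f x)^-1 * (f x)^-1)) * 'D_v f x)) => // [x Ux|].
  rewrite deriveV //; [|exact: f0|exact: (df v).1].
  by rewrite /GRing.scale /= -exprVn expr2 mulN1r.
apply: CkM => //; last exact: (df v).2.
apply: CkM => //; first exact: Ck_cst.
exact: CkM.
Qed.

Lemma smoothV V (U : set V) (f : V -> R^o) : open U ->
  (forall x, U x -> f x != 0) -> smooth_on U f ->
  smooth_on U (fun x => (f x)^-1 : R^o).
Proof. by move=> oU f0 h k; exact: CkV. Qed.

Lemma smooth_lin V (U : set V) (f : {linear V -> R^o}) :
  continuous f -> smooth_on U f.
Proof.
move=> cf; case=> [|k]; split=> //; try by move=> x _; exact: cf.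
move=> v; split=> [x _|].
  by apply: diff_derivable; exact: linear_differentiable.
rewrite (_ : (fun _ => _) = (fun=> f v)); first exact: Ck_cst.
apply/funext => x; rewrite deriveE; last exact: linear_differentiable.
by rewrite diff_lin.
Qed.

Lemma smooth_id1 (U : set R^o) : smooth_on U (fun x : R^o => x : R^o).
Proof. by apply: (@smooth_lin R^o U idfun) => x; exact: cvg_id. Qed.

Definition coordf n (j : 'I_n) (x : 'rV[R]_n) : R^o := x 0 j.

Fact coordf_linear n (j : 'I_n) : linear (@coordf n j).
Proof. by move=> a x y; rewrite /coordf !mxE. Qed.

HB.instance Definition _ n (j : 'I_n) :=
  GRing.isLinear.Build R 'rV[R]_n R^o _ (@coordf n j) (coordf_linear j).

Lemma coordf_continuous n (j : 'I_n) : continuous (@coordf n j).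
Proof. by move=> x; exact: coord_continuous. Qed.

Lemma smooth_coord n (U : set 'rV[R]_n) (j : 'I_n) :
  smooth_on U (fun x : 'rV[R]_n => x 0 j : R^o).
Proof. exact: (@smooth_lin _ U (@coordf n j)) (@coordf_continuous n j). Qed.

Lemma cont_rV V n (f : V -> 'rV[R]_n) x :
  (forall j, {for x, continuous (fun y => f y 0 j : R^o)}) ->
  {for x, continuous f}.
Proof.
move=> h; apply/cvgrPdist_lt => e e0; near=> y.
rewrite -[_ - _]opprB normrN [ltLHS]/Num.Def.normr /= mx_normrE; apply/bigmax_ltP; split => // -[i j] _ /=.
rewrite (ord1 i) !mxE; move: j; near: y; apply: filter_forall => j.
have /cvgrPdist_lt /(_ e e0) := h j; apply: filterS => y.
by rewrite -[f x 0 j - _]opprB normrN.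
Unshelve. all: by end_near. Qed.

Lemma Ck_rV V n k (U : set V) (f : V -> 'rV[R]_n) : open U ->
  Ck k U f <-> forall j, Ck k U (fun x => f x 0 j : R^o).
Proof.
move=> oU; elim: k f => [|k IH] f /=.
  split=> [[cf _] j|h].
    split=> // x Ux; apply: (@continuous_comp _ _ _ f (@coordf n j)).
      exact: cf.
    exact: coord_continuous.
  by split=> // x Ux; apply: cont_rV => j; exact: (h j).1.
split=> [[cf df] j|h].
  split=> [x Ux|v].
    apply: (@continuous_comp _ _ _ f (@coordf n j)); first exact: cf.
    exact: coord_continuous.
  split=> [x Ux|].
    by have /derivable_mxP := (df v).1 x Ux; apply.
  have /IH /(_ j) := (df v).2; apply: Ck_open_eq => // x Ux.
  by rewrite derive_mx ?mxE //; exact: (df v).1.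
split=> [x Ux|v]; first by apply: cont_rV => j; exact: (h j).1.
have dfv x : U x -> derivable f x v.
  by move=> Ux; apply/derivable_mxP => i j; rewrite (ord1 i); exact: ((h j).2 v).1.
split=> //; apply/IH => j.
have := ((h j).2 v).2; apply: Ck_open_eq => // x Ux.
by rewrite derive_mx ?mxE //; exact: dfv.
Qed.

Lemma smooth_rV V n (U : set V) (f : V -> 'rV[R]_n) : open U ->
  smooth_on U f <-> forall j, smooth_on U (fun x => f x 0 j : R^o).
Proof.
move=> oU; split=> [h j k|h k]; first by have /Ck_rV := h k; apply.
by apply/Ck_rV => // j; exact: h.
Qed.

(** * Mean values, differentials and the chain rule *)

Lemma line_quotient V W (g : V -> W) z v s :
  (fun h : R => h^-1 *: (((fun t : R => g (t *: v + z)) \o shift s) (h *: 1) -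
     g (s *: v + z))) =
  (fun h : R => h^-1 *: ((g \o shift (s *: v + z)) (h *: v) - g (s *: v + z))).
Proof. by apply/funext => h /=; rewrite [h%:A]mulr1 scalerDl addrA. Qed.

Lemma derivable_line V W (g : V -> W) z v s : derivable g (s *: v + z) v ->
  derivable (fun t : R => g (t *: v + z)) s 1.
Proof. by rewrite /derivable line_quotient. Qed.

Lemma derive_line V W (g : V -> W) z v s :
  'D_1 (fun t : R => g (t *: v + z)) s = 'D_v g (s *: v + z).
Proof. by rewrite /derive line_quotient. Qed.

Lemma mvt_line V (g : V -> R^o) z v :
  (forall s, 0 <= s <= 1 -> derivable g (s *: v + z) v) ->
  exists2 s, 0 <= s <= 1 & g (v + z) - g z = 'D_v g (s *: v + z).
Proof.
move=> dg; pose f t : R := g (t *: v + z).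
have df t : 0 <= t <= 1 -> derivable f t 1 by move=> /dg; exact: derivable_line.
have [|t t01|c c01] := @MVT_segment R f (fun t => 'D_v g (t *: v + z)) 0 1 ler01.
- move=> t; rewrite in_itv /= => /andP[t0 t1].
  by apply: DeriveDef; [apply: df; rewrite !ltW|exact: derive_line].
- by apply: derivable_within_continuous t t01 => y; rewrite in_itv; exact: df.
move: c01; rewrite in_itv => c01 /=.
by rewrite /f scale1r scale0r add0r subr0 mulr1; exists c.
Qed.

Lemma derivable_scale V (g : V -> R^o) x v a :
  derivable g x v -> derivable g x (a *: v).
Proof.
move=> dg; apply/derivable1P.
rewrite (_ : (fun h => _) = (fun t : R => g (t *: v + x)) \o ( *%R ^~ a)); last first.
  by apply/funext => h /=; rewrite scalerA.
apply/derivable1_diffP; apply: differentiable_comp => //.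
rewrite /= mul0r; apply/derivable1_diffP; apply: derivable_line.
by rewrite scale0r add0r.
Qed.

Lemma derive_scale V (g : V -> R^o) x v a :
  derivable g x v -> 'D_(a *: v) g x = a * 'D_v g x.
Proof.
move=> dg; have -> : 'D_(a *: v) g x = 'D_1 (fun t : R => g (t *: (a *: v) + x)) 0.
  by rewrite derive_line scale0r add0r.
rewrite (_ : (fun h => _) = (fun t : R => g (t *: v + x)) \o ( *%R ^~ a)); last first.
  by apply/funext => h /=; rewrite scalerA.
rewrite -derive1E derive1_comp //=; last first.
  by rewrite mul0r; apply: derivable_line; rewrite scale0r add0r.
rewrite !derive1E mul0r derive_line scale0r add0r mulrC; congr (_ * _).
rewrite (_ : *%R^~ a = (fun t : R => id (t *: (a : R^o) + 0))); last first.
  by apply/funext => t; rewrite addr0.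
by rewrite (@derive_line R^o R^o id) derive_id.
Qed.

Lemma derive_chain V W (f : V -> W) (g : W -> R^o) x v :
  derivable f x v -> differentiable g (f x) ->
  derivable (g \o f) x v /\ 'D_v (g \o f) x = 'd g (f x) ('D_v f x).
Proof.
move=> dfx dg; have /derivable1_diffP df := (derivable1P f x v).1 dfx.
have f0 : f (0 *: v + x) = f x by rewrite scale0r add0r.
have dgf : differentiable (g \o (fun h : R => f (h *: v + x))) 0.
  by apply: differentiable_comp => //; rewrite f0.
split; first by apply/derivable1P/derivable1_diffP.
have -> : 'D_v (g \o f) x = 'D_1 (g \o (fun h : R => f (h *: v + x))) 0.
  by rewrite (derive_line (g \o f)) scale0r add0r.
rewrite deriveE // diff_comp //= ?f0 //; congr ('d g _ _).
by rewrite -deriveE // derive_line scale0r add0r.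
Qed.

Lemma rV_norm_le n (x : 'rV[R]_n) r : 0 <= r -> (forall j, `|x 0 j| <= r) -> `|x| <= r.
Proof.
move=> r0 h; rewrite [leLHS]/Num.Def.normr /= mx_normrE; apply/bigmax_leP.
by split => // -[i j] _ /=; rewrite (ord1 i).
Qed.

Lemma rV_coord_le n (x : 'rV[R]_n) j : `|x 0 j| <= `|x|.
Proof.
rewrite [leRHS]/Num.Def.normr /= mx_normrE.
exact: (le_bigmax _ _ (0, j)).
Qed.

Lemma Ck_le V W k l (U : set V) (f : V -> W) : (k <= l)%N -> Ck l U f -> Ck k U f.
Proof.
move=> /subnK <-; elim: (l - k)%N => [//|m IH].
by rewrite addSn => /CkS.
Qed.

(** Continuous partial derivatives give a differential: the increment of [g] is telescoped through
    the points [P k + y], consecutive ones differing in one coordinate, and the mean value theorem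
    compares each step with the partial derivative at [y]. *)
Lemma C1_differentiable n (U : set 'rV[R]_n) (g : 'rV[R]_n -> R^o) y :
  open U -> U y -> Ck 1 U g -> differentiable g y.
Proof.
move=> oU Uy [_ dg].
pose e j : 'rV[R]_n := delta_mx 0 j.
pose L (h : 'rV[R]_n) : R^o := \sum_j h 0 j * 'D_(e j) g y.
have linL : linear L.
  move=> a u w; rewrite /L scaler_sumr -big_split; apply: eq_bigr => j _.
  by rewrite !mxE mulrDl -mulrA.
pose LM := GRing.isLinear.Build _ _ _ _ _ linL.
pose LL : {linear _ -> _} := HB.pack L LM.
have cL : continuous L.
  move=> u; apply: (@smooth_on_cont _ R^o setT) => //.
  apply: smooth_sum => [|j]; first exact: openT.
  apply: smoothM; [exact: openT|exact: smooth_coord|exact: smooth_cst].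
have dU := @diff_unique _ _ R^o g LL y cL.
(* The premise of [diff_unique] is the little-o estimate of the remainder; it is read off from the
   type of [dU] instead of being restated. *)
match type of dU with ?P -> _ => assert (key : P) end.
  apply/eqaddoP => eps eps0.
  (* Each of the [n] steps costs at most [e'] times the norm of [h]; the denominator [n.+1] keeps
     the constant meaningful for [n = 0]. *)
  pose e' := eps / n.+1%:R.
  have e'0 : 0 < e' by rewrite divr_gt0.
  have : \forall z \near y, U z /\ forall j, `|'D_(e j) g y - 'D_(e j) g z| < e'.
    near=> z; split; first by near: z; exact: open_nbhs_nbhs.
    move=> j; move: j; near: z; apply: filter_forall => j.
    have cj := (dg (e j)).2.1 y Uy.
    by have /cvgrPdist_lt /(_ _ e'0) := cj.
  move=> /nbhs_ballP[d /= d0 hd].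
  near=> h.
  have hd' : `|h| < d.
    near: h; apply/nbhs_ballP; exists d => // h.
    by rewrite -ball_normE /= sub0r normrN.
  pose P k : 'rV[R]_n := \row_j (if (j < k)%N then h 0 j else 0).
  have PS (k : 'I_n) : P k.+1 = h 0 k *: e k + P k.
    apply/rowP => j; rewrite !mxE /= ltnS leq_eqVlt.
    have [->|jk] := eqVneq j k; first by rewrite eqxx ltnn mulr1 addr0.
    have -> : (j == k :> nat) = false by apply/negbTE.
    by rewrite /= mulr0 add0r.
  have bnd (k : 'I_n) s : 0 <= s <= 1 ->
      ball y d (s *: (h 0 k *: e k) + (P k + y)).
    move=> /andP[s0 s1]; rewrite -ball_normE /= addrA opprD addrCA subrr addr0 normrN.
    apply: le_lt_trans hd'; apply: rV_norm_le => // j; rewrite !mxE /=.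
    have [->|jk] := eqVneq j k.
      rewrite ltnn addr0 mulr1 normrM (ger0_norm s0).
      by rewrite (le_trans _ (rV_coord_le _ k)) // ler_piMl.
    rewrite !mulr0 add0r; case: ifP => _; first exact: rV_coord_le.
    by rewrite normr0.
  have step (k : 'I_n) :
      `|g (P k.+1 + y) - g (P k + y) - h 0 k * 'D_(e k) g y| <= e' * `|h|.
    have [s s01|s s01 hs] := @mvt_line _ g (P k + y) (h 0 k *: e k).
      apply: derivable_scale; apply: (dg (e k)).1.
      by have [] := hd _ (bnd k s s01).
    have [_ /(_ k)] := hd _ (bnd k s s01).
    set z := s *: _ + _ in hs * => hz.
    have dz : derivable g z (e k) by apply: (dg (e k)).1; have [] := hd _ (bnd k s s01).
    rewrite PS -(addrA _ _ y) hs derive_scale // -mulrBr normrM mulrC.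
    by apply: ler_pM => //; [rewrite distrC ltW|exact: rV_coord_le].
  change (`|g (h + y) - (g y + L h)| <= eps * `|h|).
  have -> : g (h + y) - (g y + L h) =
      \sum_(k < n) (g (P k.+1 + y) - g (P k + y) - h 0 k * 'D_(e k) g y).
    rewrite sumrB /L opprD addrA; congr (_ - _).
    rewrite -(big_mkord xpredT (fun k => g (P k.+1 + y) - g (P k + y))).
    rewrite telescope_sumr //; congr (g (_ + _) - g _).
      by apply/rowP => j; rewrite mxE ltn_ord.
    rewrite -[LHS]add0r; congr (_ + _).
    by apply/rowP => j; rewrite !mxE.
  apply: le_trans (ler_norm_sum _ _ _) _.
  apply: (@le_trans _ _ (\sum_(k < n) e' * `|h|)); first exact: ler_sum.
  rewrite sumr_const card_ord -mulr_natl mulrA ler_wpM2r //.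
  rewrite /e' mulrA ler_pdivrMr // mulrC ler_wpM2l ?ler_nat //.
  exact: ltW.
apply/diff_locallyP; rewrite (dU key).
by split.
Unshelve. all: by end_near. Qed.

Lemma deriveE_sum n (U : set 'rV[R]_n) (g : 'rV[R]_n -> R^o) y v :
  open U -> U y -> Ck 1 U g ->
  'D_v g y = \sum_j v 0 j * 'D_(delta_mx 0 j) g y.
Proof.
move=> oU Uy hg; have dg := C1_differentiable oU Uy hg.
rewrite deriveE // [in LHS](row_sum_delta v) linear_sum; apply: eq_bigr => j _.
by rewrite linearZ /= deriveE.
Qed.

Lemma derive_comp V n (U : set 'rV[R]_n) (f : V -> 'rV[R]_n) (g : 'rV[R]_n -> R^o) x v :
  open U -> U (f x) -> Ck 1 U g -> derivable f x v ->
  derivable (g \o f) x v /\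
  'D_v (g \o f) x = \sum_j 'D_v (fun y => f y 0 j : R^o) x * 'D_(delta_mx 0 j) g (f x).
Proof.
move=> oU Uy hg df; have dg := C1_differentiable oU Uy hg.
have [d1 ->] := derive_chain df dg; split => //.
rewrite -deriveE // (deriveE_sum _ oU) //; apply: eq_bigr => j _.
by rewrite derive_mx // mxE.
Qed.

(** The derivative of [g \o f] is a sum of products of derivatives of [f] with partial derivatives
    of [g] composed with [f]; the induction hypothesis, general in [g], applies to the latter. *)
Lemma Ck_comp V n k (A : set V) (U : set 'rV[R]_n) (f : V -> 'rV[R]_n)
    (g : 'rV[R]_n -> R^o) :
  open A -> open U -> (forall x, A x -> U (f x)) ->
  Ck k A f -> Ck k U g -> Ck k A (g \o f).
Proof.
move=> oA oU AU; elim: k g => [|k IH] g hf hg.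
  split=> // x Ax; apply: continuous_comp; first exact: hf.1.
  by apply: hg.1; exact: AU.
have g1 : Ck 1 U g by apply: Ck_le hg.
split=> [x Ax|v].
  apply: continuous_comp; first exact: hf.1.
  by apply: hg.1; exact: AU.
have df x : A x -> derivable f x v by exact: (hf.2 v).1.
split=> [x Ax|].
  by have [] := derive_comp oU (AU _ Ax) g1 (df x Ax).
apply: (@Ck_open_eq _ _ _ _ (fun x => \sum_j 'D_v (fun y => f y 0 j : R^o) x *
    'D_(delta_mx 0 j) g (f x))) => // [x Ax|].
  by have [_ ->] := derive_comp oU (AU _ Ax) g1 (df x Ax).
elim: (index_enum _) => [|j r IHr].
  apply: (@Ck_open_eq _ _ _ _ (fun=> 0)) => // [x _|]; last exact: Ck_cst.
  by rewrite big_nil.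
apply: (@Ck_open_eq _ _ _ _ (fun x => 'D_v (fun y => f y 0 j : R^o) x *
    'D_(delta_mx 0 j) g (f x) + \sum_(j <- r) 'D_v (fun y => f y 0 j : R^o) x *
    'D_(delta_mx 0 j) g (f x))) => // [x _|].
  by rewrite big_cons.
apply: CkD => //; apply: CkM => //.
  have /Ck_rV /(_ j) := hf; move=> /(_ oA) [_ /(_ v)]; by case.
apply: (IH (fun z => 'D_(delta_mx 0 j) g z)); first exact: CkS.
exact: (hg.2 _).2.
Qed.

Lemma smooth_comp V n (A : set V) (U : set 'rV[R]_n) (f : V -> 'rV[R]_n)
    (g : 'rV[R]_n -> R^o) :
  open A -> open U -> (forall x, A x -> U (f x)) ->
  smooth_on A f -> smooth_on U g -> smooth_on A (g \o f).
Proof. by move=> oA oU AU hf hg k; exact: (@Ck_comp _ _ k A U). Qed.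

Lemma CkcompR V k (A : set V) (f : V -> R^o) (g : R^o -> R^o) : open A ->
  Ck k A f -> Ck k setT g -> Ck k A (g \o f).
Proof.
move=> oA; elim: k g => [|k IH] g hf hg.
  by split=> // x Ax; apply: continuous_comp; [exact: hf.1|exact: hg.1].
split=> [x Ax|v].
  by apply: continuous_comp; [exact: hf.1|exact: hg.1].
have dg y : differentiable g y by apply/derivable1_diffP; exact: (hg.2 1).1.
have dc x (Ax : A x) := derive_chain ((hf.2 v).1 x Ax) (dg (f x)).
split=> [x Ax|]; first by have [] := dc x Ax.
apply: (@Ck_open_eq _ _ _ _ (fun x => 'D_v f x * 'D_1 g (f x))) => // [x Ax|].
  by have [_ ->] := dc x Ax; rewrite diff1E // derive1E.
apply: CkM => //; first exact: (hf.2 v).2.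
by apply: (IH (fun y => 'D_1 g y)); [exact: CkS|exact: (hg.2 1).2].
Qed.

Lemma smooth_compR V (A : set V) (f : V -> R^o) (g : R^o -> R^o) : open A ->
  smooth_on A f -> smooth_on setT g -> smooth_on A (g \o f).
Proof. by move=> oA hf hg k; exact: CkcompR. Qed.

(** * Symmetry of second derivatives *)

Lemma shift_quotient V (f : V -> R^o) z c w :
  (fun h : R => h^-1 *: (((fun y => f (c + y)) \o shift z) (h *: w) - f (c + z))) =
  (fun h : R => h^-1 *: ((f \o shift (c + z)) (h *: w) - f (c + z))).
Proof. by apply/funext => h /=; rewrite addrCA. Qed.

Lemma derivable_shift_arg V (f : V -> R^o) z c w :
  derivable f (c + z) w -> derivable (fun y => f (c + y)) z w.
Proof. by rewrite /derivable shift_quotient. Qed.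

Lemma derive_shift_arg V (f : V -> R^o) z c w :
  'D_w (fun y => f (c + y)) z = 'D_w f (c + z).
Proof. by rewrite /derive shift_quotient. Qed.

(** The left-hand side is symmetric in [u] and [v], hence Schwarz's theorem below. *)
Lemma second_difference V (f : V -> R^o) (U : set V) x u v : Ck 2 U f ->
  (forall s s', 0 <= s <= 1 -> 0 <= s' <= 1 -> U (s' *: v + (s *: u + x))) ->
  exists s s', [/\ 0 <= s <= 1, 0 <= s' <= 1 &
    f (v + (u + x)) - f (u + x) - (f (v + x) - f x) =
    'D_v (fun z => 'D_u f z) (s' *: v + (s *: u + x))].
Proof.
move=> [_ df] hU.
have d0 s : 0 <= s <= 1 -> derivable f (s *: u + x) u.
  move=> s01; apply: (df u).1; have := hU s 0 s01; rewrite scale0r add0r.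
  by apply; rewrite lexx ler01.
have d1 s : 0 <= s <= 1 -> derivable f (v + (s *: u + x)) u.
  move=> s01; apply: (df u).1; have := hU s 1 s01; rewrite scale1r.
  by apply; rewrite lexx ler01.
have dG s : 0 <= s <= 1 -> derivable (fun z => f (v + z) - f z) (s *: u + x) u.
  by move=> s01; apply: derivableB; [apply: derivable_shift_arg; exact: d1|exact: d0].
have [s s01 /= ->] := @mvt_line _ (fun z => f (v + z) - f z) x u dG.
have [|s' s01' hs'] := @mvt_line _ (fun z => 'D_u f z) (s *: u + x) v.
  by move=> s' s01'; apply: ((df u).2.2 v).1; exact: hU.
exists s, s'; split => //; rewrite -hs' deriveB ?derive_shift_arg //.
  by apply: derivable_shift_arg; exact: d1.
exact: d0.
Qed.

Lemma continuous_dist_lt V (f : V -> R^o) x (e : R) : 0 < e ->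
  {for x, continuous f} -> \forall z \near x, `|(f x : R) - f z| < e.
Proof. by move=> e0 /cvgrPdist_lt /(_ e e0). Qed.

(** Taking [second_difference] in both orders equates a value of one mixed derivative with a value
    of the other, at points close to [x]. If the two limits differed, continuity would put each
    value within half of their distance from its own limit, a contradiction. *)
Lemma derive_symmetric V (f : V -> R^o) (U : set V) x u v : open U -> U x ->
  Ck 2 U f -> 'D_u (fun z => 'D_v f z) x = 'D_v (fun z => 'D_u f z) x.
Proof.
move=> oU Ux hf.
have cont w w' : {for x, continuous (fun z => 'D_w (fun z => 'D_w' f z) z)}.
  by have := ((hf.2 w').2.2 w).2.1 x Ux.
apply/subr0_eq/eqP; rewrite -normr_eq0; apply/negPn/negP => n0.
pose a : R := 'D_u (fun z => 'D_v f z) x; pose b : R := 'D_v (fun z => 'D_u f z) x.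
rewrite -/a -/b in n0.
pose e := `|a - b| / 2.
have e0 : 0 < e by rewrite divr_gt0 // lt_def n0 normr_ge0.
have h1 := continuous_dist_lt e0 (cont u v).
have h2 := continuous_dist_lt e0 (cont v u).
have h3 : nbhs x U by exact: open_nbhs_nbhs.
have [d /= d0 hd] := (nbhs_ballP _ _).1 (filterI h3 (filterI h1 h2)).
clear h1 h2 h3.
have k0 : 0 < `|u| + `|v| + 1 by rewrite ltr_wpDl ?addr_ge0.
(* The scale [t] keeps the parallelogram spanned by [t *: u] and [t *: v] inside the ball of radius
   [d]; the summand 1 covers [u = v = 0] and makes the bound strict. *)
have [t t0 td] : exists2 t : R, 0 < t & t * (`|u| + `|v| + 1) = d.
  by exists (d / (`|u| + `|v| + 1)); rewrite ?divr_gt0 // divfK // gt_eqF.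
have bnd w w' s s' : `|w| + `|w'| <= `|u| + `|v| -> 0 <= s <= 1 -> 0 <= s' <= 1 ->
    ball x d (s' *: (t *: w') + (s *: (t *: w) + x)).
  move=> ww /andP[s0 s1] /andP[s0' s1'].
  rewrite -ball_normE /= addrA opprD addrCA subrr addr0 normrN.
  apply: (@le_lt_trans _ _ (t * (`|w| + `|w'|))).
    apply: le_trans (ler_normD _ _) _; rewrite !normrZ mulrDr addrC.
    rewrite (gtr0_norm t0) (ger0_norm s0) (ger0_norm s0').
    by rewrite lerD // mulrA ler_wpM2r // ler_piMl // ltW.
  rewrite -td ltr_pM2l //.
  by rewrite (le_lt_trans ww) // ltrDl.
have [|s [s' [s01 s01' h1]]] := @second_difference _ f U x (t *: u) (t *: v) hf.
  by move=> s s' hs hs'; have [] := hd _ (bnd u v s s' (lexx _) hs hs').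
have vu : `|v| + `|u| <= `|u| + `|v| by rewrite addrC.
have [|r [r' [r01 r01' h2]]] := @second_difference _ f U x (t *: v) (t *: u) hf.
  by move=> r r' hr hr'; have [] := hd _ (bnd v u r r' vu hr hr').
have scale2 w w' z : U z ->
    'D_(t *: w) (fun z => 'D_(t *: w') f z) z = t * (t * 'D_w (fun z => 'D_w' f z) z).
  move=> Uz; rewrite derive_scale; last exact: ((hf.2 (t *: w')).2.2 w).1.
  congr (_ * _).
  rewrite (@near_eq_derive _ _ _ _ (fun z => t * 'D_w' f z)).
    rewrite (@deriveZ _ _ _ (fun z => 'D_w' f z) t) //.
    exact: ((hf.2 w').2.2 w).1.
  have : nbhs z U by exact: open_nbhs_nbhs.
  by apply: filterS => y Uy; rewrite derive_scale //; exact: (hf.2 w').1.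
have [U1 [_ B1]] := hd _ (bnd u v s s' (lexx _) s01 s01').
have [U2 [B2 _]] := hd _ (bnd v u r r' vu r01 r01').
rewrite (scale2 _ _ _ U1) in h1; rewrite (scale2 _ _ _ U2) in h2.
move: B1 B2 h1 h2; set z1 := s' *: _ + _; set z2 := r' *: _ + _ => B1 B2 h1 h2.
have E : 'D_v (fun z => 'D_u f z) z1 = 'D_u (fun z => 'D_v f z) z2.
  apply: (mulfI (lt0r_neq0 t0)); apply: (mulfI (lt0r_neq0 t0)).
  have comm4 (p q w z : R) : p - q - (w - z) = p - w - (q - z) by ring.
  apply: etrans (esym h1) (etrans _ h2); rewrite (addrCA (t *: v)).
  exact: comm4.
have : `|a - b| < e + e.
  rewrite -(subrKA ('D_u (fun z => 'D_v f z) z2)).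
  apply: le_lt_trans (ler_normD _ _) _; apply: ltrD; first exact: B2.
  by rewrite -E distrC; exact: B1.
by rewrite /e -splitr ltxx.
Qed.

(** The powers of [x^-1] make this family stable under differentiation. *)
Definition flat n (x : R^o) : R^o := if 0 < x then x^-1 ^+ n * expR (- x^-1) else 0.

(** With [y = x^-1], [expR y] is the power [n.+1] of [expR (y / n.+1)], hence at least
    [(y / n.+1) ^+ n.+1]. The exponent exceeds [n] by one, which leaves the factor [x] and thus
    continuity at 0. *)
Lemma flat_le n (x : R) : 0 < x -> 0 <= flat n x <= (n.+1%:R) ^+ n.+1 * x.
Proof.
move=> x0; rewrite /flat x0; apply/andP; split.
  by rewrite mulr_ge0 ?expR_ge0 // exprn_ge0 // invr_ge0 ltW.
set y := x^-1; have y0 : 0 < y by rewrite invr_gt0.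
have h : (y / n.+1%:R) ^+ n.+1 <= expR y.
  have -> : expR y = expR (y / n.+1%:R) ^+ n.+1.
    by rewrite -expRM_natr divfK // pnatr_eq0.
  rewrite lerXn2r // ?nnegrE ?expR_ge0 ?divr_ge0 ?ltW //.
  by apply: le_lt_trans (expR_gt1Dx _) ; rewrite ?lerDr // gt_eqF // divr_gt0.
have e0 : 0 < expR y by exact: expR_gt0.
rewrite expRN ler_pdivrMr // -[x]invrK -/y.
have -> : y ^+ n = (n.+1%:R ^+ n.+1 / y) * (y / n.+1%:R) ^+ n.+1.
  rewrite expr_div_n [y ^+ n.+1]exprS; field.
  by rewrite expf_neq0 ?pnatr_eq0 //= lt0r_neq0.
by rewrite ler_wpM2l // divr_ge0 ?exprn_ge0 ?ltW.
Qed.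

Lemma flat0 n (x : R) : x <= 0 -> flat n x = 0.
Proof. by rewrite /flat; case: ltP => // /lt_geF ->. Qed.

Lemma flat_ge0 n (x : R) : 0 <= flat n x.
Proof.
have [x0|x0] := ltP 0 x; last by rewrite flat0.
by have /andP[] := flat_le n x0.
Qed.

Lemma flat_cvg0 n : flat n x @[x --> (0 : R^o)] --> (0 : R^o).
Proof.
pose c : R := (n.+1%:R) ^+ n.+1.
have h : (fun x : R^o => c * `|x|) x @[x --> (0 : R^o)] --> (0 : R^o).
  rewrite -[X in _ --> X](mulr0 c); apply: cvgM; first exact: cvg_cst.
  by rewrite -[X in _ --> X](@normr0 _ R^o); apply: cvg_norm.
apply: squeeze_cvgr (@cvg_cst _ (0 : R^o) _ _ _) h.
near=> x; rewrite flat_ge0 /=; have [x0|x0] := ltP 0 x.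
  by have /andP[_] := flat_le n x0; rewrite gtr0_norm.
by rewrite flat0 // mulr_ge0 // exprn_ge0.
Unshelve. all: by end_near. Qed.

Lemma is_derive_flat n (x : R) :
  is_derive (x : R^o) 1 (flat n) (flat n.+2 x - n%:R * flat n.+1 x : R^o).
Proof.
have [x0|x0|->] := ltgtP x 0.
- rewrite !flat0 ?ltW // mulr0 subr0.
  apply: (@near_eq_is_derive _ _ _ (fun=> 0)).
    by near=> y; rewrite flat0 // ltW //; near: y; exact: lt_nbhsl.
- have E : \forall y \near (x : R^o), (((fun y : R^o => y^-1 : R^o) ^+ n) *
      (fun y : R^o => expR (- y^-1) : R^o)) y = flat n y.
    by near=> y; rewrite !fctE /flat ifT //; near: y; apply: open_nbhs_nbhs; split; [exact: open_gt|].
  apply: (near_eq_is_derive E).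
  have xn0 : x != 0 by rewrite gt_eqF.
  have dV : is_derive (x : R^o) 1 (fun y : R^o => y^-1 : R^o) (- x ^- 2).
    apply: DeriveDef; first by apply: derivableV => //; exact: derivable_id.
    by rewrite (@deriveV _ _ id) // derive_id [_ *: _]mulr1.
  have dX := @is_deriveX _ _ _ n x 1 _ dV.
  have dE : is_derive (x : R^o) 1 (fun y : R^o => expR (- y^-1) : R^o)
      (x ^- 2 * expR (- x^-1)).
    have dN := is_deriveN dV.
    apply: is_derive_eq (is_derive1_comp (is_derive_expR _) dN) _.
    by rewrite opprK /GRing.scale /= mulrC.
  apply: is_derive_eq (is_deriveM dX dE) _.
  rewrite /GRing.scale /= /flat x0 !fctE.
  case: n dX {E} => [|n] _ /=; first by field.
  by rewrite -!exprVn !exprS; ring.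
rewrite !flat0 // mulr0 subrr.
(* At 0 the difference quotient of [flat n] is [flat n.+1] itself, which tends to 0. *)
have q : (fun h : R => h^-1 *: ((flat n \o shift (0 : R^o)) (h *: (1 : R^o)) - flat n 0))
    @ 0^' --> (0 : R^o).
  apply: (@cvg_trans _ (flat n.+1 h @[h --> (0:R)^'])); last first.
    apply: cvg_within_filter; exact: flat_cvg0.
  apply: near_eq_cvg; near=> h => /=.
  have h0 : h != 0 by near: h; exact: nbhs_dnbhs_neq.
  rewrite addr0 [h%:A]mulr1 (flat0 n (lexx 0)) subr0 /flat; case: ifP => _.
    by rewrite exprS -mulrA.
  by rewrite scaler0.
apply: DeriveDef; last exact: cvg_lim q.
by apply/cvg_ex; exists 0.
Unshelve. all: by end_near. Qed.

Lemma Ck_flat k n : Ck k setT (flat n).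
Proof.
elim: k n => [|k IH] n.
  split=> // x _; apply/differentiable_continuous/derivable1_diffP.
  by have := is_derive_flat n x; case.
have dv (v : R) x : is_derive (x : R^o) (v : R^o) (flat n)
    (v * (flat n.+2 x - n%:R * flat n.+1 x) : R^o).
  have [d1 e1] := is_derive_flat n x.
  rewrite -[v in is_derive _ v]mulr1; apply: DeriveDef.
    exact: (@derivable_scale R^o).
  by rewrite (@derive_scale R^o) // e1.
split=> [x _|v].
  apply/differentiable_continuous/derivable1_diffP.
  by have := is_derive_flat n x; case.
split=> [x _|]; first by have [] := dv v x.
rewrite (_ : 'D_v _ =
    (fun x => v * (flat n.+2 x + (- n%:R) * flat n.+1 x))); last first.
  by apply/funext => x; rewrite derive_val mulNr.
apply: CkM; [exact: openT|exact: Ck_cst|].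
apply: CkD; [exact: openT|exact: IH|].
by apply: CkM; [exact: openT|exact: Ck_cst|exact: IH].
Qed.

Definition step (x : R^o) : R^o := flat 0 x / (flat 0 x + flat 0 (1 - x)).

Lemma flat_gt0 n (x : R) : 0 < x -> 0 < flat n x.
Proof.
by move=> x0; rewrite /flat x0 mulr_gt0 ?expR_gt0 // exprn_gt0 // invr_gt0.
Qed.

Lemma step_den x : flat 0 x + flat 0 (1 - x) != 0.
Proof.
apply/lt0r_neq0; have [x0|x0] := ltP 0 x.
  by rewrite ltr_pwDl ?flat_ge0 // flat_gt0.
by rewrite ltr_wpDl ?flat_ge0 // flat_gt0 // subr_gt0 (le_lt_trans x0).
Qed.

Lemma step_eq0 x : x <= 0 -> step x = 0.
Proof. by move=> x0; rewrite /step flat0 // mul0r. Qed.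

Lemma step_eq1 x : 1 <= x -> step x = 1.
Proof.
move=> x1; rewrite /step [flat 0 (1 - x)]flat0 ?subr_le0 // addr0 divff //.
by apply/lt0r_neq0/flat_gt0; exact: lt_le_trans x1.
Qed.

Lemma smooth_flat : smooth_on setT (flat 0). Proof. by move=> k; exact: Ck_flat. Qed.

Lemma smooth_step : smooth_on setT step.
Proof.
have o := @openT R^o.
have h2 : smooth_on setT (fun x : R^o => flat 0 (1 - x) : R^o).
  apply: (@smooth_compR R^o setT (fun x : R^o => 1 - x : R^o)) => //; last exact: smooth_flat.
  apply: (@smooth_on_eq R^o R^o setT (fun x : R^o => 1 + (-1) * x : R^o)) => // [x _|].
    by rewrite mulN1r.
  apply: smoothD => //; first exact: smooth_cst.
  by apply: smoothM => //; [exact: smooth_cst|exact: smooth_id1].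
apply: smoothM => //; first exact: smooth_flat.
apply: smoothV => //; first by move=> x _; exact: step_den.
by apply: smoothD => //; exact: smooth_flat.
Qed.

Lemma bump_rV n (p : 'rV[R]_n) r : 0 < r ->
  exists h : 'rV[R]_n -> R^o, [/\ smooth_on setT h, \near p, h p = 1
    & forall z, r <= `|p - z| -> h z = 0].
Proof.
move=> r0; have o := @openT 'rV[R]_n.
pose N (z : 'rV[R]_n) : R^o := \sum_j (z 0 j - p 0 j) * (z 0 j - p 0 j).
have sN : smooth_on setT N.
  apply: smooth_sum => // j.
  suff s1 : smooth_on setT (fun z : 'rV[R]_n => z 0 j - p 0 j : R^o).
    by apply: smoothM.
  by apply: smoothD => //; [exact: smooth_coord|exact: smooth_cst].
(* [g] equals 2 at [p], so [step \o g] is 1 near [p]; it is at most 0 once [N] reaches [r ^+ 2]. As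
   [N] is the square of the Euclidean distance, this happens wherever the sup norm distance is at
   least [r]. *)
pose g (z : 'rV[R]_n) : R^o := 2 + (- (2 / r ^+ 2)) * N z.
have sg : smooth_on setT g.
  apply: smoothD => //; first exact: smooth_cst.
  by apply: smoothM => //; exact: smooth_cst.
have Np : N p = 0.
  by rewrite /N big1 // => j _; rewrite subrr mulr0.
exists (step \o g); split.
- exact: (smooth_compR o sg smooth_step).
- have : {for p, continuous g} by apply: smooth_on_cont sg _.
  rewrite /prop_for /continuous_at {2}/g Np mulr0 addr0.
  move=> /cvgrPdist_lt /(_ 1 ltr01).
  apply: filterS => z; rewrite ltr_norml => /andP[_ gz] /=.
  by rewrite step_eq1 //; lra.
move=> z rz; rewrite /= step_eq0 //.
suff : r ^+ 2 <= N z.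
  move=> h; rewrite /g mulNr subr_le0 mulrAC ler_pdivlMr ?exprn_gt0 //.
  by rewrite ler_pM2l.
have /ltW r0' := r0.
suff [j hj] : exists j, r <= `|(p - z) 0 j|.
  apply: (@le_trans _ _ ((z 0 j - p 0 j) * (z 0 j - p 0 j))).
    have -> : (z 0 j - p 0 j) * (z 0 j - p 0 j) = `|(p - z) 0 j| ^+ 2.
      by rewrite !mxE real_normK ?num_real // -expr2 -sqrrN opprB.
    by rewrite lerXn2r // nnegrE.
  by rewrite /N (bigD1 j) //= lerDl sumr_ge0 // => i _; rewrite -expr2 sqr_ge0.
apply/not_existsP => h.
have : `|p - z| < r.
  rewrite [ltLHS]/Num.Def.normr /= mx_normrE; apply/bigmax_ltP; split => // -[i j] _ /=.
  by rewrite (ord1 i) ltNge; apply/negP; exact: h.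
by rewrite ltNge rz.
Qed.

End Calculus.

(** * Functions, curves and tangent vectors on manifolds *)

Section ManifoldFunctions.
Variable R : realType.
Implicit Types M N P : manifold R.

Lemma cinv_dom n (X : topologicalType) (c : chart R n X) u :
  (cmap c @` cdom c) u -> cdom c (cinv c u) /\ cmap c (cinv c u) = u.
Proof. by move=> [x cx <-]; rewrite cmapK. Qed.

Lemma cmap_im n (X : topologicalType) (c : chart R n X) x :
  cdom c x -> (cmap c @` cdom c) (cmap c x).
Proof. by move=> cx; exists x. Qed.

Lemma near_cinv n (X : topologicalType) (c : chart R n X) x (A : X -> Prop) :
  cdom c x -> (\forall y \near x, A y) -> \forall u \near cmap c x, A (cinv c u).
Proof.
move=> cx hA; have := cinv_cont (cmap_im cx).
by rewrite /prop_for /continuous_at cmapK //; apply.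
Qed.

Lemma near_cmap n (X : topologicalType) (c : chart R n X) x (A : 'rV[R]_n -> Prop) :
  cdom c x -> (\forall u \near cmap c x, A u) -> \forall y \near x, A (cmap c y).
Proof. by move=> cx hA; have := cmap_cont cx; apply. Qed.

Lemma near_cdom n (X : topologicalType) (c : chart R n X) x :
  cdom c x -> \forall y \near x, cdom c y.
Proof. by move=> cx; apply: open_nbhs_nbhs; split => //; exact: cdom_open. Qed.

Lemma near_ccod n (X : topologicalType) (c : chart R n X) x :
  cdom c x -> \forall u \near cmap c x, (cmap c @` cdom c) u.
Proof.
by move=> cx; apply: open_nbhs_nbhs; split; [exact: ccod_open|exact: cmap_im].
Qed.

Lemma chart_image_open n (X : topologicalType) (c : chart R n X) (U : set X) :
  open U -> open (cmap c @` (cdom c `&` U)).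
Proof.
move=> oU; rewrite openE => _ [x [cx Ux] <-]; rewrite /interior.
have h1 := near_ccod cx.
have h2 : \forall u \near cmap c x, U (cinv c u).
  by apply: near_cinv => //; exact: open_nbhs_nbhs.
apply: filterS2 h1 h2 => u hu Uu; have [cu <-] := cinv_dom hu.
by exists (cinv c u).
Qed.

Lemma smooth_on_at (V W : normedModType R) (A : set V) (f : V -> W) x :
  smooth_on A f -> A x -> smooth_on [set x] f.
Proof. by move=> /smooth_on_pointwise; apply. Qed.

Lemma chart_compat_at n p (X : topologicalType) (c : chart R n X)
    (d : chart R p X) x : chart_compat c d -> cdom c x -> cdom d x ->
  exists2 A : set 'rV[R]_n, open A /\ A (cmap c x) &
    (forall u, A u -> cdom c (cinv c u) /\ cdom d (cinv c u)) /\
    smooth_on A (cmap d \o cinv c).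
Proof.
move=> [h _] cx dx; exists (cmap c @` (cdom c `&` cdom d)).
  by split; [apply: chart_image_open; exact: cdom_open|exists x].
by split=> // _ [y [cy dy] <-]; rewrite cmapK.
Qed.

Lemma chart_compatC n p (X : topologicalType) (c : chart R n X)
    (d : chart R p X) : chart_compat c d -> chart_compat d c.
Proof.
by move=> [h1 h2]; split; rewrite setIC.
Qed.

Lemma compat_transfer n p (X : topologicalType) (c : chart R n X)
    (d : chart R p X) (f : X -> R) x : chart_compat d c -> cdom c x -> cdom d x ->
  (exists2 A : set 'rV[R]_n, open A /\ A (cmap c x) &
     smooth_on A (f \o cinv c : _ -> R^o)) ->
  smooth_on [set cmap d x] (f \o cinv d : _ -> R^o).
Proof.
move=> cd cx dx [A [oA Ax] hA].
have [B [oB Bx] [hB1 hB2]] := chart_compat_at cd dx cx.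
have cB u : B u -> {for u, continuous (cmap c \o cinv d)}.
  by move=> Bu; exact: smooth_on_cont hB2 Bu.
pose C := (B `&` (cmap c \o cinv d) @^-1` A)^°.
have Cx : C (cmap d x).
  rewrite /C /interior; apply: filterI; first exact: open_nbhs_nbhs.
  by apply: (cB _ Bx); rewrite /= cmapK //; exact: open_nbhs_nbhs.
have s : smooth_on C ((f \o cinv c) \o (cmap c \o cinv d) : _ -> R^o).
  apply: (@smooth_comp _ _ _ C A) => //; first exact: open_interior.
    by move=> u /interior_subset [].
  by apply: smooth_onW hB2 => u /interior_subset [].
have := smooth_on_at s Cx; apply: smooth_on_near.
have : nbhs (cmap d x) B by exact: open_nbhs_nbhs.
apply: filterS => u /hB1[du cu] /=; by rewrite cmapK.
Qed.

Lemma smooth_fun_chart N (f : N -> R) n (c : chart R n N) :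
  smooth_chart c -> smooth_fun f -> smooth_on (cmap c @` cdom c) (f \o cinv c : _ -> R^o).
Proof.
move=> sc sf; apply/smooth_on_pointwise => _ [x cx <-].
have [d ad dx] := atlas_cover x.
have := sc d ad => /chart_compatC cd; apply: (compat_transfer cd dx cx).
exists (cmap d @` cdom d); last exact: sf.
by split; [exact: ccod_open|exact: cmap_im].
Qed.

Lemma atlas_smooth_chart N (c : chart R _ N) : atlas c -> smooth_chart c.
Proof. by move=> ac d ad; exact: atlas_compat. Qed.

Lemma smooth_fun_of_charts N (f : N -> R) :
  (forall x, exists n (c : chart R n N), [/\ smooth_chart c, cdom c x &
     exists2 A : set 'rV[R]_n, open A /\ A (cmap c x) &
       smooth_on A (f \o cinv c : _ -> R^o)]) -> smooth_fun f.
Proof.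
move=> h d ad; apply/smooth_on_pointwise => _ [x dx <-].
have [n [c [sc cx hA]]] := h x.
exact: compat_transfer (sc d ad) cx dx hA.
Qed.

Lemma smooth_fun_cont N (f : N -> R) : smooth_fun f -> continuous (f : N -> R^o).
Proof.
move=> sf x; have [c ac cx] := atlas_cover x.
have h := smooth_on_cont (sf c ac) (cmap_im cx).
have : {for x, continuous ((f \o cinv c) \o cmap c : N -> R^o)}.
  by apply: continuous_comp; [exact: cmap_cont|exact: h].
rewrite /prop_for /continuous_at /= cmapK //; apply: cvg_trans.
by apply: near_eq_cvg; apply: filterS (near_cdom cx) => y cy /=; rewrite cmapK.
Qed.

(** A topological space with a class of real functions closed under locally
    composing with smooth functions of finitely many variables; this covers both
    manifolds and the parameter line of a curve. *)
Definition smooth_class (P : topologicalType) (A : set (P -> R)) : Prop :=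
  (forall f, A f -> continuous (f : P -> R^o)) /\
  forall f : P -> R,
    (forall x, exists n (X : P -> 'rV[R]_n) (O : set 'rV[R]_n)
       (F : 'rV[R]_n -> R^o),
       [/\ forall j, A (fun y => X y 0 j), open O, O (X x), smooth_on O F
         & \forall y \near x, f y = F (X y)]) -> A f.

Lemma smooth_on_local_comp (V : normedModType R) (B : set V) (f : V -> R) :
  open B ->
  (forall x, B x -> exists n (X : V -> 'rV[R]_n) (O : set 'rV[R]_n)
       (F : 'rV[R]_n -> R^o),
       [/\ forall j, smooth_on B (fun y => X y 0 j : R^o), open O, O (X x), smooth_on O F
         & \forall y \near x, f y = F (X y)]) -> smooth_on B (f : V -> R^o).
Proof.
move=> oB h; apply/smooth_on_pointwise => x Bx.
have [n [X [U [F [sX oU Ux sF fF]]]]] := h x Bx.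
have sXv : smooth_on B X by apply/smooth_rV.
pose C := (B `&` X @^-1` U)^°.
have Cx : C x.
  rewrite /C /interior; apply: filterI; first exact: open_nbhs_nbhs.
  by apply: (smooth_on_cont sXv Bx); exact: open_nbhs_nbhs.
have s : smooth_on C (F \o X).
  apply: (@smooth_comp _ _ _ C U) => //; first exact: open_interior.
    by move=> u /interior_subset [].
  by apply: smooth_onW sXv => u /interior_subset [].
have := smooth_on_at s Cx; apply: smooth_on_near.
by apply: filterS fF => y ->.
Qed.

Lemma smooth_class_manifold N : @smooth_class N (@smooth_fun R N).
Proof.
split=> [f|f h]; first exact: smooth_fun_cont.
move=> c ac; apply: smooth_on_local_comp; first exact: ccod_open.
move=> _ [x cx <-]; have [n [X [U [F [sX oU Ux sF fF]]]]] := h x.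
exists n, (X \o cinv c), U, F; split=> //=; last exact: (near_cinv cx fF).
  by move=> j; exact: (sX j c ac).
by rewrite cmapK.
Qed.

Lemma smooth_class_line :
  @smooth_class R^o (fun f => smooth_on setT (f : R^o -> R^o)).
Proof.
split=> [f sf x|f h]; first exact: smooth_on_cont sf _.
apply: smooth_on_local_comp; first exact: openT.
by move=> x _; exact: h.
Qed.

Section Closure.
Variables (P : topologicalType) (A : set (P -> R)).
Hypothesis hA : smooth_class A.

Lemma sc_cont f : A f -> continuous (f : P -> R^o). Proof. exact: hA.1. Qed.

Lemma sc_near (f : P -> R) :
  (forall x : P, exists2 g, A g & \forall y \near x, f y = g y) -> A f.
Proof.
move=> h; apply: hA.2 => x; have [g Ag fg] := h x.
exists 1, (fun y => \row_j g y), setT, (fun z => z 0 0); split => //.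
- by move=> j; rewrite (_ : (fun _ => _) = g) //; apply/funext => y; rewrite mxE.
- exact: openT.
- exact: smooth_coord.
by apply: filterS fg => y ->; rewrite mxE.
Qed.

Lemma sc_cst a : A (fun=> a).
Proof.
apply: hA.2 => x; exists 0, (fun=> 0), setT, (fun=> a); split => //.
- by case.
- exact: openT.
- exact: smooth_cst.
- exact: nearW.
Qed.

Let X2 (f g : P -> R) y : 'rV[R]_2 := \row_j (if j == 0 then f y else g y).

Lemma sc_comp2 f g (O : set 'rV[R]_2) F : A f -> A g -> open O ->
  (forall y, O (X2 f g y)) -> smooth_on O (F : _ -> R^o) -> A (F \o X2 f g).
Proof.
move=> Af Ag oO hO sF; apply: hA.2 => x.
exists 2, (X2 f g), O, F; split => //; last exact: nearW.
move=> j; have [->|j0] := eqVneq j 0.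
  by rewrite (_ : (fun _ => _) = f) //; apply/funext => y; rewrite mxE.
by rewrite (_ : (fun _ => _) = g) //; apply/funext => y; rewrite mxE (negbTE j0).
Qed.

Lemma scD f g : A f -> A g -> A (fun y => f y + g y).
Proof.
move=> Af Ag; have := @sc_comp2 f g setT (fun z => z 0 0 + z 0 1) Af Ag (@openT _).
rewrite (_ : _ \o _ = (fun y => f y + g y)); last by apply/funext => y; rewrite /= !mxE.
by apply => //; apply: smoothD; [exact: openT|exact: smooth_coord|exact: smooth_coord].
Qed.

Lemma scM f g : A f -> A g -> A (fun y => f y * g y).
Proof.
move=> Af Ag; have := @sc_comp2 f g setT (fun z => z 0 0 * z 0 1) Af Ag (@openT _).
rewrite (_ : _ \o _ = (fun y => f y * g y)); last by apply/funext => y; rewrite /= !mxE.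
by apply => //; apply: smoothM; [exact: openT|exact: smooth_coord|exact: smooth_coord].
Qed.

Lemma scZ a f : A f -> A (fun y => a * f y).
Proof. by move=> Af; apply: scM => //; exact: sc_cst. Qed.

Lemma scN f : A f -> A (fun y => - f y).
Proof.
move=> Af; rewrite (_ : (fun _ => _) = (fun y => -1 * f y)); first exact: scZ.
by apply/funext => y; rewrite mulN1r.
Qed.

Lemma scB f g : A f -> A g -> A (fun y => f y - g y).
Proof. by move=> Af Ag; apply: scD => //; exact: scN. Qed.

Lemma sc_sum (I : Type) (r : seq I) (Q : pred I) (f : I -> P -> R) :
  (forall i, A (f i)) -> A (fun y => \sum_(i <- r | Q i) f i y).
Proof.
move=> h; elim: r => [|i r IH].
  rewrite (_ : (fun _ => _) = fun=> 0); first exact: sc_cst.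
  by apply/funext => y; rewrite big_nil.
rewrite (_ : (fun _ => _) = fun y =>
    (if Q i then f i y else 0) + \sum_(i <- r | Q i) f i y); last first.
  by apply/funext => y; rewrite big_cons; case: ifP => // _; rewrite add0r.
by apply: scD => //; case: (Q i) => //; exact: sc_cst.
Qed.

Lemma sc_prod (I : Type) (r : seq I) (f : I -> P -> R) :
  (forall i, A (f i)) -> A (fun y => \prod_(i <- r) f i y).
Proof.
move=> h; elim: r => [|i r IH].
  rewrite (_ : (fun _ => _) = fun=> 1); first exact: sc_cst.
  by apply/funext => y; rewrite big_nil.
rewrite (_ : (fun _ => _) = fun y => f i y * \prod_(i <- r) f i y).
  exact: scM.
by apply/funext => y; rewrite big_cons.
Qed.

(** Away from the zeros of [h] the quotient is a smooth function of two variables. The conclusion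
    has the local form used in [smooth_class] because the sections given by Cramer's rule are such
    quotients only near a point. *)
Lemma sc_div_near f (g h : P -> R) x : A g -> A h -> h x != 0 ->
  (\forall y \near x, f y = g y / h y) ->
  exists n (X : P -> 'rV[R]_n) (O : set 'rV[R]_n)
       (F : 'rV[R]_n -> R^o),
       [/\ forall j, A (fun y => X y 0 j), open O, O (X x), smooth_on O F
         & \forall y \near x, f y = F (X y)].
Proof.
move=> Ag Ah hx fgh; pose O : set 'rV[R]_2 := [set z | z 0 1 != 0].
have oO : open O.
  have := @open_comp _ R^o (fun z : 'rV[R]_2 => z 0 1) [set y | y != 0].
  apply => [z _|]; last exact: open_neq.
  exact: coord_continuous.
exists 2, (X2 g h), O, (fun z => z 0 0 * (z 0 1)^-1); split => //.
- move=> j; have [->|j0] := eqVneq j 0.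
    by rewrite (_ : (fun _ => _) = g) //; apply/funext => y; rewrite mxE.
  by rewrite (_ : (fun _ => _) = h) //; apply/funext => y; rewrite mxE (negbTE j0).
- by rewrite /O /= mxE.
- apply: smoothM => //; first exact: smooth_coord.
  by apply: smoothV => //; exact: smooth_coord.
by apply: filterS fgh => y ->; rewrite !mxE.
Qed.

End Closure.

Definition smf N := @smooth_class_manifold N.

(** A bump function of a chart is extended by zero. The image [K] of a closed ball is compact, hence
    closed since the manifold is Hausdorff, so the extension vanishes near every point outside [K].
    The last clause encodes that the support lies in [U]. *)
Lemma manifold_bump N (x : N) (U : set N) : open U -> U x ->
  exists chi : N -> R, [/\ smooth_fun chi, \forall y \near x, chi y = 1
    & forall y, U y \/ \forall z \near y, chi z = 0].
Proof.
move=> oU Ux; have [c ac cx] := atlas_cover x.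
set p := cmap c x.
have h1 := near_ccod cx.
have h2 : \forall u \near cmap c x, U (cinv c u).
  by apply: near_cinv => //; exact: open_nbhs_nbhs.
have [r /= r0 hr] := (nbhs_ballP _ _).1 (filterI h1 h2).
have r20 : 0 < r / 2 by rewrite divr_gt0.
have [h [sh h1' h0]] := bump_rV p r20.
pose B : set 'rV[R]_(mdim N) := [set z | `|p - z| <= r / 2].
have Br : B `<=` ball p r.
  move=> z Bz; rewrite -ball_normE /=; apply: le_lt_trans Bz _.
  by rewrite ltr_pdivrMr // ltr_pMr // ltr1n.
have cB : compact B.
  apply: bounded_closed_compact.
    exists (`|p| + r / 2); split; first exact: num_real.
    move=> M hM z Bz; apply: le_trans (ltW hM).
    rewrite -(subrK p z); apply: le_trans (ler_normD _ _) _.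
    by rewrite addrC lerD // distrC.
  rewrite (_ : B = closed_ball p (r / 2)); first exact: closed_ball_closed.
  by rewrite closed_ballE.
pose K := cinv c @` B.
have cK : closed K.
  apply: compact_closed; first exact: manifold_hausdorff.
  apply: continuous_compact => //.
  apply: continuous_in_subspaceT => z; rewrite inE => /Br /hr[hz _].
  exact: cinv_cont.
pose chi y : R := if `[< cdom c y >] then h (cmap c y) else 0.
have out y : ~ K y -> chi y = 0.
  move=> nK; rewrite /chi; case: asboolP => // cy; apply: h0.
  rewrite leNgt; apply/negP => hy; apply: nK; exists (cmap c y); last by rewrite cmapK.
  exact: ltW.
have nout y : ~ K y -> \forall z \near y, chi z = 0.
  move=> nK; have : nbhs y (~` K).
    by apply: open_nbhs_nbhs; split => //; exact: closed_openC.
  by apply: filterS => z; exact: out.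
exists chi; split.
- apply: smooth_fun_of_charts => y; have [Ky|nK] := pselect (K y).
    have cy : cdom c y.
      by case: Ky => z /Br /hr[/cinv_dom[hz _] _] <-.
    exists (mdim N), c; split => //; first exact: atlas_smooth_chart.
    exists (cmap c @` cdom c); first by split; [exact: ccod_open|exact: cmap_im].
    apply: (@smooth_on_eq _ _ _ _ h); [exact: ccod_open| |exact: smooth_onW sh].
    by move=> u /cinv_dom[cu eu]; rewrite /= /chi asboolT // eu.
  have [d ad dy] := atlas_cover y.
  exists (mdim N), d; split => //; first exact: atlas_smooth_chart.
  have : nbhs (cmap d y) (fun u => chi (cinv d u) = 0).
    exact: (near_cinv (A := fun z => chi z = 0) dy (nout y nK)).
  rewrite nbhsE => -[V [oV Vy] hV]; exists V => //.
  apply: (@smooth_on_eq _ _ _ _ (fun=> 0)) => //; last exact: smooth_cst.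
  by move=> u /hV /= ->.
- have := near_cmap cx h1'; apply: filterS2 (near_cdom cx) => y cy hy.
  by rewrite /chi asboolT.
move=> y; have [Ky|nK] := pselect (K y); last by right; exact: nout.
by left; case: Ky => z /Br /hr[_ hz] <-.
Qed.

(** Tangent vectors act on global functions only, so a function that is smooth near [x] is
    multiplied by a bump function before it can be differentiated. *)
Lemma smooth_extension N (x : N) (g : N -> R) n (c : chart R n N)
    (A : set 'rV[R]_n) :
  smooth_chart c -> cdom c x -> open A -> A (cmap c x) ->
  smooth_on A (g \o cinv c : _ -> R^o) ->
  exists2 f : N -> R, smooth_fun f & \forall y \near x, f y = g y.
Proof.
move=> sc cx oA Ax sg.
pose U := (cdom c `&` cmap c @^-1` A)^°.
have Ux : U x.
  rewrite /U /interior; apply: filterI; first exact: near_cdom.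
  by apply: near_cmap => //; exact: open_nbhs_nbhs.
have [chi [schi chi1 chi0]] := manifold_bump (open_interior _) Ux.
exists (fun y => chi y * g y); last by apply: filterS chi1 => y ->; rewrite mul1r.
apply: smooth_fun_of_charts => y; have [Uy|chiy] := chi0 y.
  have [cy Ay] := interior_subset Uy.
  exists n, c; split => //; exists ((cmap c @` cdom c) `&` A).
    split; first by apply: openI => //; exact: ccod_open.
    by split => //; exact: cmap_im.
  apply: smoothM.
  - by apply: openI => //; exact: ccod_open.
  - by apply: smooth_onW (smooth_fun_chart sc schi) => u [].
  - by apply: smooth_onW sg => u [].
have [d ad dy] := atlas_cover y.
exists (mdim N), d; split => //; first exact: atlas_smooth_chart.
have : nbhs (cmap d y) (fun u => chi (cinv d u) = 0).
  exact: (near_cinv (A := fun z => chi z = 0) dy chiy).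
rewrite nbhsE => -[V [oV Vy] hV]; exists V => //.
apply: (@smooth_on_eq _ _ _ _ (fun=> 0)) => //; last exact: smooth_cst.
by move=> u /hV /= ->; rewrite mul0r.
Qed.

Lemma coordinate_extension N (x : N) n (c : chart R n N) :
  smooth_chart c -> cdom c x ->
  exists2 X : N -> 'rV[R]_n, (forall j, smooth_fun (fun y => X y 0 j)) &
    \forall y \near x, X y = cmap c y.
Proof.
move=> sc cx.
have h j : exists f : N -> R, smooth_fun f /\ \forall y \near x, f y = cmap c y 0 j.
  have [||f sf fE] := @smooth_extension N x (fun y => cmap c y 0 j) n c _ sc cx
    (@ccod_open _ _ _ c); last by exists f.
    exact: cmap_im.
  apply: (@smooth_on_eq _ _ _ _ (fun u : 'rV[R]_n => u 0 j : R^o)); [exact: ccod_open| |exact: smooth_coord].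
  by move=> u /cinv_dom[_ /= ->].
have [f hf] := choice h.
exists (fun y => \row_j f j y).
  move=> j; rewrite (_ : (fun _ => _) = f j); first exact: (hf j).1.
  by apply/funext => y; rewrite mxE.
have : \forall y \near x, forall j, f j y = cmap c y 0 j.
  by apply: filter_forall => j; exact: (hf j).2.
by apply: filterS => y hy; apply/rowP => j; rewrite mxE hy.
Qed.

(** * Smooth maps and curves through pulled back functions *)

Definition sc_map (P : topologicalType) (A : set (P -> R)) N (s : P -> N) :=
  forall f, smooth_fun f -> A (f \o s).

(** Smooth functions determine the topology: a bump function that is 1 at [s p] and supported in [V]
    stays nonzero along [s] near [p], which forces [s] into [V] there. *)
Lemma sc_map_cont (P : topologicalType) (A : set (P -> R)) N (s : P -> N) :
  smooth_class A -> sc_map A s -> continuous s.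
Proof.
move=> hA hs p U; rewrite nbhsE => -[V [oV Vp] VU].
have [chi [schi chi1 chi0]] := manifold_bump oV Vp.
have c := sc_cont hA (hs _ schi) (x := p).
have : \forall y \near p, chi (s y) != 0.
  have : nbhs (chi (s p) : R^o) [set r : R^o | r != 0].
    apply: open_nbhs_nbhs; split; first exact: open_neq.
    by rewrite /= (nbhs_singleton chi1) oner_neq0.
  by move=> /c.
apply: filterS => y hy; apply: VU.
have [//|h0] := chi0 (s y).
by move: hy; rewrite (nbhs_singleton h0) eqxx.
Qed.

Lemma sc_map_chart (P : topologicalType) (A : set (P -> R)) N (s : P -> N) p :
  (exists n (c : chart R n N) (X : P -> 'rV[R]_n), [/\ smooth_chart c,
     \forall y \near p, cdom c (s y),
     forall j, A (fun y => X y 0 j) & \forall y \near p, X y = cmap c (s y)]) ->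
  forall f, smooth_fun f ->
  exists n (X : P -> 'rV[R]_n) (U : set 'rV[R]_n) (F : 'rV[R]_n -> R^o),
       [/\ forall j, A (fun y => X y 0 j), open U, U (X p), smooth_on U F
         & \forall y \near p, f (s y) = F (X y)].
Proof.
move=> [n [c [X [sc cp AX XE]]]] f sf.
exists n, X, (cmap c @` cdom c), (f \o cinv c); split => //.
- exact: ccod_open.
- rewrite (nbhs_singleton XE); apply: cmap_im; exact: (nbhs_singleton cp).
- exact: smooth_fun_chart.
by apply: filterS2 XE cp => y -> cy /=; rewrite cmapK.
Qed.

(** One direction is the chain rule in charts. For the other, the chart coordinates of [N] extend to
    global smooth functions, whose pullbacks recover the coordinate expression of [F]. Operations on
    maps can then be treated for manifolds and for curves at once. *)
Lemma smooth_mapP M N (F : M -> N) :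
  smooth_map F <-> sc_map (@smooth_fun R M) F.
Proof.
split=> [[cF sF] f sf|hF].
  apply: smooth_fun_of_charts => x.
  have [c ac cx] := atlas_cover x; have [d ad dx] := atlas_cover (F x).
  exists (mdim M), c; split; [exact: atlas_smooth_chart|exact: cx|].
  have oF : open (F @^-1` cdom d).
    by apply: open_comp; [move=> y _; exact: cF|exact: cdom_open].
  exists (cmap c @` (cdom c `&` F @^-1` cdom d)).
    by split; [exact: chart_image_open|exists x].
  apply: (@smooth_on_eq _ _ _ _ ((f \o cinv d) \o (cmap d \o F \o cinv c))).
  - exact: chart_image_open.
  - by move=> _ [y [cy dy] <-]; rewrite /= !cmapK.
  - apply: (@smooth_comp _ _ _ _ (cmap d @` cdom d)).
    + exact: chart_image_open.
    + exact: ccod_open.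
    + by move=> _ [y [cy dy] <-]; rewrite /= cmapK //; exact: cmap_im.
    + exact: sF.
    + exact: sf.
have cF := sc_map_cont (@smf M) hF.
split=> // c d ac ad; apply/smooth_on_pointwise => _ [x [cx dx] <-].
have [X sX XE] := coordinate_extension (atlas_smooth_chart ad) dx.
have sY : smooth_on (cmap c @` cdom c) (X \o F \o cinv c).
  by apply/smooth_rV; [exact: ccod_open|move=> j; exact: (hF _ (sX j))].
have := smooth_on_at sY (cmap_im cx); apply: smooth_on_near.
exact: (near_cinv (A := fun y => X (F y) = cmap d (F y)) cx (cF x _ XE)).
Qed.

Lemma smooth_curveP N (g : R -> N) :
  smooth_curve g <-> sc_map (fun f => smooth_on setT (f : R^o -> R^o)) (g : R^o -> N).
Proof.
split=> [[cg sg] f sf|hg].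
  apply/smooth_on_pointwise => t _; have [d ad dt] := atlas_cover (g t).
  have og : open (g @^-1` cdom d).
    by apply: open_comp; [move=> y _; exact: cg|exact: cdom_open].
  have h : smooth_on (g @^-1` cdom d) ((f \o cinv d) \o (cmap d \o g) : R^o -> R^o).
    apply: (@smooth_comp R^o _ _ _ (cmap d @` cdom d)) => //.
    - exact: ccod_open.
    - by move=> y dy; exact: cmap_im.
    - exact: sg.
    - exact: sf.
  apply: smooth_on_near (smooth_on_at h dt).
  have : nbhs (t : R^o) (g @^-1` cdom d) by exact: open_nbhs_nbhs.
  by apply: filterS => y dy /=; rewrite cmapK.
have cg := sc_map_cont smooth_class_line hg.
split=> // d ad; apply/smooth_on_pointwise => t dt.
have [X sX XE] := coordinate_extension (atlas_smooth_chart ad) dt.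
have sY : smooth_on setT (X \o g : R^o -> _).
  by apply/smooth_rV; [exact: openT|move=> j; exact: (hg _ (sX j))].
have : smooth_on [set (t : R^o)] (X \o g : R^o -> _) by exact: smooth_on_at sY _.
by apply: smooth_on_near; exact: (cg t _ XE).
Qed.

Lemma smooth_map_cont M N (F : M -> N) : smooth_map F -> continuous F.
Proof. by case. Qed.

Lemma smooth_map_fun M N (F : M -> N) f :
  smooth_map F -> smooth_fun f -> smooth_fun (f \o F).
Proof. by move=> /smooth_mapP; apply. Qed.

Lemma smooth_map_comp M N P (F : M -> N) (G : N -> P) :
  smooth_map F -> smooth_map G -> smooth_map (G \o F).
Proof. by move=> /smooth_mapP hF /smooth_mapP hG; apply/smooth_mapP => f /hG /hF. Qed.

Lemma smooth_map_curve M N (F : M -> N) (g : R -> M) :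
  smooth_map F -> smooth_curve g -> smooth_curve (F \o g).
Proof. by move=> /smooth_mapP hF /smooth_curveP hg; apply/smooth_curveP => f /hF /hg. Qed.

Lemma smooth_map_id M : smooth_map (@id M).
Proof. by apply/smooth_mapP => f. Qed.

Lemma smooth_map_fun1 M N (F : M -> N) (f : N -> R) : smooth_map F -> smooth_fun f ->
  smooth_fun (fun x => f (F x)).
Proof. exact: smooth_map_fun. Qed.

(** * Velocities and tangent vectors *)

Lemma curve_derivable N (g : R -> N) f t : smooth_curve g -> smooth_fun f ->
  derivable (f \o g : R^o -> R^o) t 1.
Proof.
by move=> /smooth_curveP hg sf; apply: smooth_on_derivable (hg _ sf) _.
Qed.

Lemma velocity_chain N (g : R -> N) (f : N -> R) n (X : N -> 'rV[R]_n)
    (U : set 'rV[R]_n) (F : 'rV[R]_n -> R^o) :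
  smooth_curve g -> (forall j, smooth_fun (fun y => X y 0 j)) ->
  open U -> U (X (g 0)) -> smooth_on U F ->
  (\forall y \near g 0, f y = F (X y)) ->
  velocity g f = \sum_j velocity g (fun y => X y 0 j) * 'D_(delta_mx 0 j) F (X (g 0)).
Proof.
move=> hg sX oU Ux sF fF; rewrite /velocity derive1E.
have nf : \forall t \near (0 : R^o), (f \o g) t = (F \o (X \o g)) t.
  by have [cg _] := hg; exact: (cg 0 _ fF).
rewrite (near_eq_derive _ nf).
have dX : derivable (X \o g : R^o -> _) 0 1.
  by apply/derivable_mxP => i j; rewrite (ord1 i); exact: curve_derivable hg (sX j).
have [_ ->] := @derive_comp R R^o n U (X \o g) F 0 1 oU Ux (sF 1) dX.
by apply: eq_bigr => j _; rewrite derive1E.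
Qed.

Lemma tangent_chain N (x : N) v (f : N -> R) n (X : N -> 'rV[R]_n)
    (U : set 'rV[R]_n) (F : 'rV[R]_n -> R^o) :
  tangent x v -> smooth_fun f -> (forall j, smooth_fun (fun y => X y 0 j)) ->
  open U -> U (X x) -> smooth_on U F ->
  (\forall y \near x, f y = F (X y)) ->
  v f = \sum_j v (fun y => X y 0 j) * 'D_(delta_mx 0 j) F (X x).
Proof.
move=> [g [hg g0 hv]] sf sX oU Ux sF fF; rewrite hv //.
rewrite -g0 in Ux fF *; rewrite (velocity_chain hg sX oU Ux sF fF).
by apply: eq_bigr => j _; rewrite hv.
Qed.

Section TangentRules.
Variables (N : manifold R) (x : N) (v : (N -> R) -> R).
Hypothesis tv : tangent x v.

Lemma tangentD f g : smooth_fun f -> smooth_fun g ->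
  v (fun y => f y + g y) = v f + v g.
Proof.
move=> sf sg; have [c [hc c0 hv]] := tv; rewrite !hv //; last exact: (scD (@smf N)).
by rewrite /velocity !derive1E deriveD //; exact: curve_derivable.
Qed.

Lemma tangentM f g : smooth_fun f -> smooth_fun g ->
  v (fun y => f y * g y) = f x * v g + g x * v f.
Proof.
move=> sf sg; have [c [hc c0 hv]] := tv; rewrite !hv //; last exact: (scM (@smf N)).
rewrite /velocity !derive1E (@deriveM _ _ (f \o c) (g \o c)); try exact: curve_derivable.
by rewrite /= c0.
Qed.

Lemma tangent_cst a : v (fun=> a) = 0.
Proof.
have [c [hc c0 hv]] := tv; rewrite hv; last exact: (sc_cst (@smf N)).
by rewrite /velocity derive1E (_ : _ \o _ = cst a) // derive_cst.
Qed.

Lemma tangentZ a f : smooth_fun f -> v (fun y => a * f y) = a * v f.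
Proof.
by move=> sf; rewrite tangentM ?tangent_cst ?mulr0 ?addr0 //; exact: (sc_cst (@smf N)).
Qed.

Lemma tangent_near f g : smooth_fun f -> smooth_fun g ->
  (\forall y \near x, f y = g y) -> v f = v g.
Proof.
move=> sf sg fg; have [c [hc c0 hv]] := tv; rewrite !hv // /velocity !derive1E.
apply: near_eq_derive; have [cc _] := hc; rewrite -c0 in fg; exact: (cc 0 _ fg).
Qed.

Lemma tangent_sum (I : Type) (r : seq I) (f : I -> N -> R) :
  (forall i, smooth_fun (f i)) ->
  v (fun y => \sum_(i <- r) f i y) = \sum_(i <- r) v (f i).
Proof.
move=> sf; elim: r => [|i r IH].
  rewrite big_nil; transitivity (v (fun=> 0)); last exact: tangent_cst.
  by congr v; apply/funext => y; rewrite big_nil.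
rewrite big_cons -IH -tangentD //; last exact: (sc_sum (@smf N)).
by congr v; apply/funext => y; rewrite big_cons.
Qed.

End TangentRules.

(** A tangent vector is the velocity of a curve on the whole line, so the straight line has to be
    reparametrized to stay in the chart. The function [t / (1 + k^2 t^2)] has derivative 1 at 0 and
    absolute value at most [1 / (2 k)], as [(1 - k |t|)^2] is nonnegative; [k] is chosen so that
    this times the norm of [w] is below [r]. *)
Lemma chart_curve N (x : N) n (c : chart R n N) (w : 'rV[R]_n) :
  smooth_chart c -> cdom c x ->
  exists h : R -> R, [/\ smooth_on setT (h : R^o -> R^o), h 0 = 0, is_derive (0 : R^o) 1 h 1
    & forall t, (cmap c @` cdom c) (cmap c x + h t *: w)].
Proof.
move=> sc cx; have [r /= r0 hr] := (nbhs_ballP _ _).1 (near_ccod cx).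
pose k : R := (`|w| + 1) / r.
have k0 : 0 < k by rewrite divr_gt0 // ltr_wpDl.
pose d (t : R^o) : R^o := 1 + k ^+ 2 * (t * t).
have d0 t : 0 < d t.
  have t2 : 0 <= (t : R) * t by rewrite -expr2 sqr_ge0.
  by apply: ltr_pwDl => //; apply: mulr_ge0 => //; apply: exprn_ge0; exact: ltW.
have sd : smooth_on setT d.
  apply: smoothD; [exact: openT|exact: smooth_cst|].
  apply: smoothM; [exact: openT|exact: smooth_cst|].
  by apply: smoothM; [exact: openT|exact: smooth_id1|exact: smooth_id1].
have sV : smooth_on setT (fun t => (d t)^-1 : R^o).
  by apply: smoothV => //; [exact: openT|move=> t _; rewrite gt_eqF].
exists (fun t => t * (d t)^-1); split.
- by apply: smoothM => //; [exact: openT|exact: smooth_id1].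
- by rewrite mul0r.
- apply: DeriveDef.
    apply: derivableM; first exact: derivable_id.
    exact: smooth_on_derivable sV _.
  rewrite (@deriveM _ _ id (fun t => (d t)^-1)); last 2 first.
  + exact: derivable_id.
  + exact: smooth_on_derivable sV _.
  by rewrite derive_id /= scale0r add0r /GRing.scale /= /d mul0r mulr0 addr0 invr1 mul1r.
move=> t; apply: hr; rewrite -ball_normE /= opprD addNKr normrN normrZ.
rewrite normrM (gtr0_norm (_ : 0 < (d t)^-1)) ?invr_gt0 //.
rewrite mulrAC ltr_pdivrMr //.
have E : r * k = `|w| + 1 by rewrite /k mulrCA divff ?mulr1 // gt_eqF.
have : `|t| * (r * k) < r * d t + `|t|.
  rewrite mulrCA; apply: (@le_lt_trans _ _ (r * d t / 2)); last first.
    rewrite ltr_wpDr // ltr_pdivrMr // ltr_pMr ?ltr1n // mulr_gt0 //.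
  rewrite -mulrA ler_pM2l // ler_pdivlMr // /d -[t * t]expr2 -(real_normK (num_real t)).
  rewrite -subr_ge0 (_ : _ - _ = (1 - k * `|t|) ^+ 2); last by ring.
  exact: sqr_ge0.
by rewrite E mulrDr mulr1 ltrD2r.
Qed.

Lemma velocity_chart N (g : R -> N) n (c : chart R n N) (X : R -> 'rV[R]_n)
    (f : N -> R) :
  smooth_chart c -> smooth_fun f -> (forall t, (cmap c @` cdom c) (X t)) ->
  (forall t, g t = cinv c (X t)) -> derivable (X : R^o -> _) 0 1 ->
  velocity g f = 'D_('D_1 (X : R^o -> _) 0) (f \o cinv c : _ -> R^o) (X 0).
Proof.
move=> sc sf hX gX dX; rewrite /velocity derive1E.
have -> : f \o g = (f \o cinv c) \o X by apply/funext => t; rewrite /= gX.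
have sF := smooth_fun_chart sc sf.
have dF := C1_differentiable (@ccod_open _ _ _ c) (hX 0) (sF 1).
have [_ ->] := @derive_chain R R^o _ X (f \o cinv c) 0 1 dX dF.
by apply: esym; exact: deriveE.
Qed.

Lemma smooth_curve_chart N (g : R -> N) n (c : chart R n N) (X : R -> 'rV[R]_n) :
  smooth_chart c -> (forall t, (cmap c @` cdom c) (X t)) ->
  (forall t, g t = cinv c (X t)) -> smooth_on setT (X : R^o -> _) ->
  smooth_curve g.
Proof.
move=> sc hX gX sX; apply/smooth_curveP => f sf.
rewrite (_ : f \o g = (f \o cinv c) \o X); last by apply/funext => t; rewrite /= gX.
apply: (@smooth_comp _ R^o _ _ (cmap c @` cdom c)) => //.
- exact: openT.
- exact: ccod_open.
- exact: smooth_fun_chart.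
Qed.

Lemma smooth_ray n (a w : 'rV[R]_n) (h : R -> R) : smooth_on setT (h : R^o -> R^o) ->
  smooth_on setT (fun t : R^o => a + h t *: w).
Proof.
move=> sh; apply/smooth_rV; [exact: openT|move=> j].
apply: (@smooth_on_eq _ _ _ _ (fun t : R^o => a 0 j + h t * w 0 j : R^o)).
- exact: openT.
- by move=> t _; rewrite !mxE.
apply: smoothD; [exact: openT|exact: smooth_cst|].
by apply: smoothM; [exact: openT|exact: sh|exact: smooth_cst].
Qed.

Lemma derive_ray n (a w : 'rV[R]_n) (h : R -> R) (l : R) : is_derive (0 : R^o) 1 h l ->
  'D_1 (fun t : R^o => a + h t *: w) 0 = l *: w.
Proof.
move=> [dh hl].
have dj j : is_derive (0 : R^o) 1 (fun t : R^o => a 0 j + w 0 j * h t : R^o) (l * w 0 j).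
  have d1 : derivable (fun t : R^o => w 0 j * h t : R^o) 0 1 by exact: derivableZ.
  have d0 : derivable (fun t : R^o => a 0 j : R^o) 0 1 by exact: derivable_cst.
  apply: DeriveDef; first exact: (derivableD d0 d1).
  apply: (etrans (deriveD d0 d1)); rewrite derive_cst add0r.
  by apply: (etrans (@deriveZ _ _ _ h (w 0 j) 0 1 dh)); rewrite hl mulrC.
have E i j : (fun t : R^o => (a + h t *: w) i j : R^o) = (fun t => a 0 j + w 0 j * h t).
  by apply/funext => t; rewrite (ord1 i) !mxE mulrC.
rewrite derive_mx.
  by apply/matrixP => i j; rewrite !mxE E; have [_ ->] := dj j; rewrite (ord1 i).
by apply/derivable_mxP => i j; rewrite E; case: (dj j).
Qed.

Lemma tangent_of_chart N (x : N) n (c : chart R n N) (w : 'rV[R]_n) v :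
  smooth_chart c -> cdom c x ->
  (forall f, smooth_fun f -> v f = 'D_w (f \o cinv c : _ -> R^o) (cmap c x)) ->
  tangent x v.
Proof.
move=> sc cx hv; have [h [sh h0 dh hh]] := chart_curve w sc cx.
pose X t := cmap c x + h t *: w.
have sX : smooth_on setT (X : R^o -> _) by exact: smooth_ray.
exists (fun t => cinv c (X t)); split.
- exact: (smooth_curve_chart sc hh).
- by rewrite /X h0 scale0r addr0 cmapK.
move=> f sf; rewrite hv //.
rewrite (velocity_chart sc sf hh (fun=> erefl)); last exact: smooth_on_derivable sX _.
by rewrite /X (derive_ray _ _ dh) scale1r h0 scale0r addr0.
Qed.

Lemma tangent_chartE N (x : N) v (f : N -> R) n (c : chart R n N) (X : N -> 'rV[R]_n) :
  smooth_chart c -> cdom c x -> tangent x v -> smooth_fun f ->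
  (forall j, smooth_fun (fun y => X y 0 j)) ->
  (\forall y \near x, X y = cmap c y) ->
  v f = 'D_(\row_j v (fun y => X y 0 j)) (f \o cinv c : _ -> R^o) (cmap c x).
Proof.
move=> sc cx tv sf sX XE; have sF := smooth_fun_chart sc sf.
have oc := @ccod_open _ _ _ c.
have Xx := nbhs_singleton XE.
rewrite (tangent_chain tv sf sX oc _ sF); last 2 first.
- by rewrite Xx; exact: cmap_im.
- by apply: filterS2 XE (near_cdom cx) => y -> cy /=; rewrite cmapK.
rewrite (deriveE_sum _ oc (cmap_im cx) (sF 1)) Xx.
by apply: eq_bigr => j _; rewrite mxE.
Qed.

(** Curves in a manifold cannot be added. In coordinates the combination is again a directional
    derivative, and [tangent_of_chart] realizes it by a curve. *)
Lemma tangent_lin N (x : N) v1 v2 v (a b : R) : tangent x v1 -> tangent x v2 ->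
  (forall f, smooth_fun f -> v f = a * v1 f + b * v2 f) -> tangent x v.
Proof.
move=> t1 t2 hv; have [c ac cx] := atlas_cover x.
have sc := atlas_smooth_chart ac.
have [X sX XE] := coordinate_extension sc cx.
apply: (@tangent_of_chart N x _ c (\row_j (a * v1 (fun y => X y 0 j) + b * v2 (fun y => X y 0 j)))) => //.
move=> f sf; rewrite hv // (tangent_chartE sc cx t1 sf sX XE) (tangent_chartE sc cx t2 sf sX XE).
have oc := @ccod_open _ _ _ c; have sF := smooth_fun_chart sc sf.
rewrite !(deriveE_sum _ oc (cmap_im cx) (sF 1)) !mulr_sumr -big_split.
by apply: eq_bigr => j _; rewrite !mxE /= mulrDl !mulrA.
Qed.

Lemma tangent_pushforward M N (F : M -> N) x v :
  smooth_map F -> tangent x v -> tangent (F x) (pushforward F v).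
Proof.
move=> sF [g [hg <- hv]]; exists (F \o g); split => //.
  exact: smooth_map_curve.
by move=> f sf; rewrite /pushforward hv //; exact: smooth_map_fun.
Qed.

End ManifoldFunctions.

(** * Vector bundles *)

Lemma near_comp (P N : topologicalType) (s : P -> N) (A : N -> Prop) p :
  continuous s -> (\forall y \near s p, A y) -> \forall y \near p, A (s y).
Proof. by move=> cs; exact: cs. Qed.

Section Bundles.
Variables (R : realType) (E N : manifold R) (V : vbundle E N).
Implicit Types (e : E) (x : N).

Definition trivialization (c : chart R (mdim N) N)
    (d : chart R (mdim N + vrank V) E) : Prop :=
  [/\ smooth_chart c, smooth_chart d, cdom d = vproj V @^-1` cdom c
    & [/\ forall e, cdom d e -> lsubmx (cmap d e) = cmap c (vproj V e),
          forall y (u : 'rV[R]_(vrank V)), cdom c y ->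
            exists2 e, cdom d e & cmap d e = row_mx (cmap c y) u,
          forall y, cdom c y -> rsubmx (cmap d (vzero V y)) = 0,
          forall e e', cdom d e -> vproj V e = vproj V e' ->
            rsubmx (cmap d (e +[V] e')) =
            rsubmx (cmap d e) + rsubmx (cmap d e')
        & forall r e, cdom d e ->
            rsubmx (cmap d (r *[V] e)) = r *: rsubmx (cmap d e)]].

Lemma trivialization_at x : exists c d, trivialization c d /\ cdom c x.
Proof.
have [c [d [sc sd cx dE [h1 h2 h3 h4 h5]]]] := vb_triv V x.
by exists c, d; split => //; split.
Qed.

Lemma triv_dom c d e : trivialization c d -> cdom c (vproj V e) -> cdom d e.
Proof. by move=> [_ _ -> _]. Qed.

Lemma triv_inj c d e e' : trivialization c d -> cdom c (vproj V e) ->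
  vproj V e = vproj V e' -> rsubmx (cmap d e) = rsubmx (cmap d e') -> e = e'.
Proof.
move=> T ce ee' h; have de := triv_dom T ce.
have de' : cdom d e' by apply: (triv_dom T); rewrite -ee'.
have [_ _ _ [h1 _ _ _ _]] := T.
rewrite -(cmapK de) -(cmapK de'); congr (cinv d _).
by rewrite -[LHS]hsubmxK -[RHS]hsubmxK h h1 // h1 // ee'.
Qed.

Definition triv_sec (c : chart R (mdim N) N) (d : chart R (mdim N + vrank V) E)
    (y : N) (u : 'rV[R]_(vrank V)) : E := cinv d (row_mx (cmap c y) u).

Lemma triv_secP c d y u : trivialization c d -> cdom c y ->
  [/\ cdom d (triv_sec c d y u), vproj V (triv_sec c d y u) = y
    & cmap d (triv_sec c d y u) = row_mx (cmap c y) u].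
Proof.
move=> T cy; have [_ _ dE [h1 h2 _ _ _]] := T.
have [e de ee] := h2 y u cy.
have E1 : triv_sec c d y u = e by rewrite /triv_sec -ee cmapK.
rewrite E1; split => //.
have ce : cdom c (vproj V e) by move: de; rewrite dE.
rewrite -(cmapK cy) -(cmapK ce); congr (cinv c _).
by rewrite -(h1 _ de) ee row_mxKl.
Qed.

Lemma vzeroE x : vzero V x = 0 *[V] vzero V x.
Proof.
have [c [d [T cx]]] := trivialization_at x.
have cz : cdom c (vproj V (vzero V x)) by rewrite vproj_zero.
apply: (triv_inj T cz); first by rewrite vproj_scale.
have [_ _ _ [_ _ h3 _ h5]] := T.
by rewrite (h5 _ _ (triv_dom T cz)) h3 // scaler0.
Qed.

Lemma covector_zero x a : covector V x a -> a (vzero V x) = 0.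
Proof. by move=> [_ h]; rewrite vzeroE h ?mul0r // vproj_zero. Qed.

Lemma triv_covector c d x j : trivialization c d -> cdom c x ->
  covector V x (fun e => rsubmx (cmap d e) 0 j).
Proof.
move=> T cx; have [_ _ _ [_ _ _ h4 h5]] := T; split.
  move=> e e' ex ex'; rewrite h4 ?ex ?ex' ?mxE //.
  by apply: (triv_dom T); rewrite ex.
by move=> r e ex; rewrite h5 ?mxE //; apply: (triv_dom T); rewrite ex.
Qed.

Lemma covector_sep e e' : vproj V e = vproj V e' ->
  (forall a, covector V (vproj V e) a -> a e = a e') -> e = e'.
Proof.
move=> ee' h; have [c [d [T cx]]] := trivialization_at (vproj V e).
apply: (triv_inj T cx ee'); apply/rowP => j.
exact: h (triv_covector j T cx).
Qed.

Lemma covector_triv_sec c d y a u : trivialization c d -> cdom c y ->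
  covector V y a ->
  a (triv_sec c d y u) = \sum_j u 0 j * a (triv_sec c d y (delta_mx 0 j)).
Proof.
move=> T cy [aD aZ]; have [_ _ _ [_ _ h3 h4 h5]] := T.
have add u1 u2 : a (triv_sec c d y (u1 + u2)) =
    a (triv_sec c d y u1) + a (triv_sec c d y u2).
  have [d1 p1 c1] := triv_secP u1 T cy; have [d2 p2 c2] := triv_secP u2 T cy.
  have [d3 p3 c3] := triv_secP (u1 + u2) T cy.
  rewrite -aD //; congr (a _); apply: (triv_inj T); rewrite ?p3 //.
    by rewrite vproj_add p1 // p2.
  by rewrite h4 // ?p1 ?p2 // c1 c2 c3 !row_mxKr.
have scal r u1 : a (triv_sec c d y (r *: u1)) = r * a (triv_sec c d y u1).
  have [d1 p1 c1] := triv_secP u1 T cy.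
  have [d3 p3 c3] := triv_secP (r *: u1) T cy.
  rewrite -aZ //; congr (a _); apply: (triv_inj T); rewrite ?p3 //.
    by rewrite vproj_scale p1.
  by rewrite h5 // c1 c3 !row_mxKr.
rewrite {1}(row_sum_delta u); elim: (index_enum _) => [|j r IH].
  rewrite !big_nil; have := scal 0 0; rewrite scale0r => ->; exact: mul0r.
by rewrite !big_cons add IH scal.
Qed.

Lemma sc_map_triv (P : topologicalType) (A : set (P -> R)) (s : P -> E) :
  smooth_class A -> sc_map A (vproj V \o s) ->
  (forall p, exists c d (w : P -> 'rV[R]_(vrank V)),
     [/\ trivialization c d, cdom c (vproj V (s p)), forall j, A (fun y => w y 0 j)
       & \forall y \near p, rsubmx (cmap d (s y)) = w y]) ->
  sc_map A s.
Proof.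
move=> hA hp h f sf; apply: hA.2 => p.
have [c [d [w [T cp Aw wE]]]] := h p.
have [sc sd dE [h1 _ _ _ _]] := T.
have [X sX XE] := coordinate_extension sc cp.
have cs := sc_map_cont hA hp.
have nd : \forall y \near p, cdom c (vproj V (s y)).
  exact: (near_comp (s := vproj V \o s) cs (near_cdom cp)).
have nX : \forall y \near p, X (vproj V (s y)) = cmap c (vproj V (s y)).
  exact: (near_comp (s := vproj V \o s) cs XE).
apply: sc_map_chart sf.
exists _, d, (fun y => row_mx (X (vproj V (s y))) (w y)); split => //.
- by rewrite dE.
- move=> j; case: (splitP j) => k jk.
    rewrite (_ : (fun _ => _) = (fun y => X (vproj V (s y)) 0 k)).
      exact: (hp _ (sX k)).
    apply/funext => y; rewrite -(row_mxEl (X (vproj V (s y))) (w y)).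
    by congr (_ _ _); apply: val_inj.
  rewrite (_ : (fun _ => _) = (fun y => w y 0 k)); first exact: Aw.
  apply/funext => y; rewrite -(row_mxEr (X (vproj V (s y))) (w y)).
  by congr (_ _ _); apply: val_inj.
apply: filterS3 nd nX wE => y cy Xy wy.
by rewrite Xy -wy -(h1 _ (triv_dom T cy)) hsubmxK.
Qed.

Lemma sc_map_fibre (P : topologicalType) (A : set (P -> R)) (s : P -> E) c d p :
  smooth_class A -> sc_map A s -> trivialization c d -> cdom c (vproj V (s p)) ->
  exists2 w : P -> 'rV[R]_(vrank V), forall j, A (fun y => w y 0 j)
       & \forall y \near p, rsubmx (cmap d (s y)) = w y.
Proof.
move=> hA hs T cp; have [sc sd dE _] := T.
have [X sX XE] := coordinate_extension sd (triv_dom T cp).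
exists (fun y => rsubmx (X (s y))).
  move=> j; rewrite (_ : (fun _ => _) = (fun y => X (s y) 0 (rshift _ j))).
    exact: (hs _ (sX _)).
  by apply/funext => y; rewrite mxE.
have := near_comp (sc_map_cont hA hs) XE.
by apply: filterS => y ->.
Qed.

Lemma sc_map_vproj (P : topologicalType) (A : set (P -> R)) (s : P -> E) :
  sc_map A s -> sc_map A (vproj V \o s).
Proof. by move=> hs f sf; apply: (hs (f \o vproj V)); exact: smooth_map_fun (vproj_smooth V) sf. Qed.

Lemma sc_map_add (P : topologicalType) (A : set (P -> R)) (s1 s2 : P -> E) :
  smooth_class A -> sc_map A s1 -> sc_map A s2 ->
  (forall y, vproj V (s1 y) = vproj V (s2 y)) ->
  sc_map A (fun y => s1 y +[V] s2 y).
Proof.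
move=> hA h1 h2 p12; apply: sc_map_triv => //.
  rewrite (_ : _ \o _ = vproj V \o s1); first exact: sc_map_vproj.
  by apply/funext => y; rewrite /= vproj_add.
move=> p; have [c [d [T cp]]] := trivialization_at (vproj V (s1 p)).
have [w1 A1 E1] := sc_map_fibre hA h1 T cp.
have cp2 : cdom c (vproj V (s2 p)) by rewrite -p12.
have [w2 A2 E2] := sc_map_fibre hA h2 T cp2.
have [_ _ _ [_ _ _ h4 _]] := T.
exists c, d, (fun y => w1 y + w2 y); split => //.
- by rewrite vproj_add.
- move=> j; rewrite (_ : (fun _ => _) = (fun y => w1 y 0 j + w2 y 0 j)).
    exact: (scD hA).
  by apply/funext => y; rewrite mxE.
have nd : \forall y \near p, cdom c (vproj V (s1 y)).
  exact: (near_comp (s := vproj V \o _) (sc_map_cont hA (sc_map_vproj h1)) (near_cdom cp)).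
by apply: filterS3 nd E1 E2 => y cy <- <-; rewrite h4 //; exact: (triv_dom T).
Qed.

Lemma sc_map_scale (P : topologicalType) (A : set (P -> R)) (f : P -> R) (s : P -> E) :
  smooth_class A -> A f -> sc_map A s -> sc_map A (fun y => f y *[V] s y).
Proof.
move=> hA Af h1; apply: sc_map_triv => //.
  rewrite (_ : _ \o _ = vproj V \o s); first exact: sc_map_vproj.
  by apply/funext => y; rewrite /= vproj_scale.
move=> p; have [c [d [T cp]]] := trivialization_at (vproj V (s p)).
have [w1 A1 E1] := sc_map_fibre hA h1 T cp.
have [_ _ _ [_ _ _ _ h5]] := T.
exists c, d, (fun y => f y *: w1 y); split => //.
- by rewrite vproj_scale.
- move=> j; rewrite (_ : (fun _ => _) = (fun y => f y * w1 y 0 j)).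
    exact: (scM hA).
  by apply/funext => y; rewrite mxE.
have nd : \forall y \near p, cdom c (vproj V (s y)).
  exact: (near_comp (s := vproj V \o _) (sc_map_cont hA (sc_map_vproj h1)) (near_cdom cp)).
by apply: filterS2 nd E1 => y cy <-; rewrite h5 //; exact: (triv_dom T).
Qed.

Lemma vzero_smooth : smooth_map (vzero V).
Proof.
apply/smooth_mapP; apply: sc_map_triv => //; first exact: smf.
  rewrite (_ : _ \o _ = id); first by move=> f.
  by apply/funext => y; rewrite /= vproj_zero.
move=> p; have [c [d [T cp]]] := trivialization_at p.
have [_ _ _ [_ _ h3 _ _]] := T.
exists c, d, (fun=> 0); split => //.
- by rewrite vproj_zero.
- by move=> j; apply: (sc_cst (@smf R N)).
by apply: filterS (near_cdom cp) => y cy; rewrite h3.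
Qed.

Lemma section_zero : section V (vzero V).
Proof. by split; [exact: vzero_smooth|exact: vproj_zero]. Qed.

Lemma sectionP s : section V s <->
  sc_map (@smooth_fun R N) s /\ forall x, vproj V (s x) = x.
Proof. by split=> -[/smooth_mapP]. Qed.

Lemma section_add s s' : section V s -> section V s' -> section V (sadd V s s').
Proof.
move=> /sectionP[h p] /sectionP[h' p']; apply/sectionP; split.
  by apply: sc_map_add => //; [exact: smf|move=> y; rewrite p p'].
by move=> y; rewrite /sadd vproj_add ?p ?p'.
Qed.

Lemma section_scale f s : smooth_fun f -> section V s -> section V (sscale V f s).
Proof.
move=> sf /sectionP[h p]; apply/sectionP; split.
  by apply: sc_map_scale => //; exact: smf.
by move=> y; rewrite /sscale vproj_scale p.
Qed.

Lemma section_proj s x : section V s -> vproj V (s x) = x. Proof. by case. Qed.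

Lemma dual_sectionP t : dual_section V t -> forall x, covector V x t. Proof. by case. Qed.

Lemma dual_section_smooth t : dual_section V t -> smooth_fun t. Proof. by case. Qed.

Lemma dual_smooth_on t s : dual_section V t -> section V s -> smooth_fun (t \o s).
Proof. by move=> [st _] [ss _]; exact: smooth_map_fun. Qed.

Lemma dual_add t e e' : dual_section V t -> vproj V e = vproj V e' ->
  t (e +[V] e') = t e + t e'.
Proof. by move=> [_ /(_ (vproj V e))[h _]] ee'; rewrite h. Qed.

Lemma dual_scale t r e : dual_section V t -> t (r *[V] e) = r * t e.
Proof. by move=> [_ /(_ (vproj V e))[_ h]]; rewrite h. Qed.

Lemma dual_zero t x : dual_section V t -> t (vzero V x) = 0.
Proof. by move=> [_ /(_ x)]; exact: covector_zero. Qed.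

(** Dual frames near [x] that are made global by cutting off: they satisfy the
    relations of dual frames where [chi] is 1. *)
Record is_frame x (chi : N -> R) (s : 'I_(vrank V) -> N -> E)
    (t : 'I_(vrank V) -> E -> R) : Prop := IsFrame {
  fr_smooth : smooth_fun chi;
  fr_near : \forall y \near x, chi y = 1;
  fr_sec : forall i, section V (s i);
  fr_dual : forall i, dual_section V (t i);
  fr_expand : forall e a, covector V (vproj V e) a ->
    chi (vproj V e) * a e = \sum_i t i e * a (s i (vproj V e));
  fr_pair : forall i j y, t i (s j y) = chi y * (i == j)%:R }.

Definition lin_or_basic (g : E -> R) : Prop :=
  (exists2 f, smooth_fun f & g = f \o vproj V) \/ dual_section V g.

Lemma local_linear_coords c d (chi : N -> R) j : trivialization c d ->
  smooth_fun chi ->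
  (forall y, cdom c y \/ \forall z \near y, chi z = 0) ->
  dual_section V (fun e => chi (vproj V e) * rsubmx (cmap d e) 0 j).
Proof.
move=> T schi chi0; have [sc sd dE [_ _ _ h4 h5]] := T; split; last first.
  move=> x; case: (chi0 x) => [cx|/nbhs_singleton c0].
    have [h1 h2] := triv_covector j T cx.
    by split=> [e e' ex ex'|r e ex]; rewrite ?vproj_add ?vproj_scale ?ex ?ex' // ?h1 // ?h2 // ?mulrDr // mulrCA.
  by split=> [e e' ex ex'|r e ex]; rewrite ?vproj_add ?vproj_scale ?ex ?ex' ?c0 ?mul0r ?addr0 ?mulr0.
apply: (sc_near (@smf R E)) => e.
have sp : smooth_fun (chi \o vproj V) by exact: smooth_map_fun (vproj_smooth V) schi.
have cp := smooth_map_cont (vproj_smooth V).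
have [ce|h0] := chi0 (vproj V e).
  have [X sX XE] := coordinate_extension sd (triv_dom T ce).
  exists (fun e => chi (vproj V e) * X e 0 (rshift _ j)).
    exact: (scM (@smf R E)).
  by apply: filterS XE => e' ->; rewrite mxE.
exists (fun=> 0); first exact: (sc_cst (@smf R E)).
have : \forall e' \near e, chi (vproj V e') = 0 by exact: (cp e _ h0).
by apply: filterS => e' ->; rewrite mul0r.
Qed.

Lemma frame_exists x : exists chi s t, is_frame x chi s t.
Proof.
have [c [d [T cx]]] := trivialization_at x.
have [chi [schi chi1 chi0]] := manifold_bump (@cdom_open _ _ _ c) cx.
have [sc sd dE [h1 h2 h3 h4 h5]] := T.
pose t j e := chi (vproj V e) * rsubmx (cmap d e) 0 j.
pose s j y := if `[< cdom c y >] then triv_sec c d y (chi y *: delta_mx 0 j) else vzero V y.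
have sp j y : vproj V (s j y) = y.
  rewrite /s; case: asboolP => cy; last by rewrite vproj_zero.
  by have [] := triv_secP (chi y *: delta_mx 0 j) T cy.
have ts j : section V (s j).
  apply/sectionP; split => //; apply: sc_map_triv; first exact: smf.
    by rewrite (_ : _ \o _ = id); [move=> f|apply/funext => y; rewrite /= sp].
  move=> y; have [cy|h0] := chi0 y.
    exists c, d, (fun y => chi y *: delta_mx 0 j); split => //.
    - by rewrite sp.
    - move=> i; rewrite (_ : (fun _ => _) = (fun y => chi y * (delta_mx 0 j : 'rV[R]__) 0 i)).
        by apply: (scM (@smf R N)) => //; exact: (sc_cst (@smf R N)).
      by apply/funext => z; rewrite !mxE.
    apply: filterS (near_cdom cy) => z cz; rewrite /s asboolT //.
    by have [_ _ ->] := triv_secP (chi z *: delta_mx 0 j) T cz; rewrite row_mxKr.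
  have [c' [d' [T' cy']]] := trivialization_at y.
  exists c', d', (fun=> 0); split => //.
  - by rewrite sp.
  - by move=> i; exact: (sc_cst (@smf R N)).
  have [_ _ _ [_ _ h3' _ _]] := T'.
  apply: filterS2 (near_cdom cy') h0 => z cz' z0.
  suff -> : s j z = vzero V z by rewrite h3'.
  rewrite /s; case: asboolP => // cz; rewrite z0 scale0r.
  have [d1 p1 e1] := triv_secP 0 T cz.
  by apply: (triv_inj T); rewrite ?p1 ?vproj_zero // e1 row_mxKr h3.
(* The sections and the dual sections each carry a factor [chi], so the relations of dual frames
   hold with its square. *)
exists (fun y => chi y * chi y), s, t; split => //.
- exact: (scM (@smf R N)).
- by apply: filterS chi1 => y ->; rewrite mulr1.
- by move=> j; exact: (local_linear_coords j T schi chi0).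
- move=> e a ca; have [ce|/nbhs_singleton c0] := chi0 (vproj V e); last first.
    by rewrite c0 !mul0r big1 // => i _; rewrite /t c0 !mul0r.
  have eE : e = triv_sec c d (vproj V e) (rsubmx (cmap d e)).
    have [d1 p1 e1] := triv_secP (rsubmx (cmap d e)) T ce.
    by apply: (triv_inj T); rewrite ?p1 // e1 row_mxKr.
  have -> : a e = a (triv_sec c d (vproj V e) (rsubmx (cmap d e))) by rewrite -eE.
  rewrite (covector_triv_sec _ T ce ca) mulr_sumr; apply: eq_bigr => i _.
  rewrite /t /s asboolT // (covector_triv_sec (chi (vproj V e) *: delta_mx 0 i) T ce ca).
  rewrite (bigD1 i) //= big1 ?addr0 => [|k ki]; last first.
    by rewrite !mxE (negbTE ki) andbF mulr0 mul0r.
  by rewrite !mxE !eqxx mulr1 /=; ring.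
move=> i j y; rewrite /t sp; have [cy|/nbhs_singleton c0] := chi0 y; last first.
  by rewrite c0 !mul0r.
rewrite /s asboolT //; have [_ _ ->] := triv_secP (chi y *: delta_mx 0 j) T cy.
by rewrite row_mxKr !mxE eqxx /= mulrA.
Qed.

(** * Frame expansions and tensoriality *)

Definition lincomb (I : Type) (r : seq I) (u : I -> N -> R) (s : I -> N -> E) : N -> E :=
  fun y => foldr (fun i => vadd V (u i y *[V] s i y)) (vzero V y) r.

Lemma section_lincomb (I : Type) (r : seq I) (u : I -> N -> R) (s : I -> N -> E) :
  (forall i, smooth_fun (u i)) -> (forall i, section V (s i)) ->
  section V (lincomb r u s).
Proof.
move=> hu hs; elim: r => [|i r IH]; first exact: section_zero.
exact: (section_add (section_scale (hu i) (hs i)) IH).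
Qed.

Lemma covector_lincomb (I : Type) (r : seq I) (u : I -> N -> R) (s : I -> N -> E) y a :
  (forall i, vproj V (s i y) = y) -> covector V y a ->
  a (lincomb r u s y) = \sum_(i <- r) u i y * a (s i y).
Proof.
move=> ps ca; have [aD aZ] := ca.
have pl r' : vproj V (lincomb r' u s y) = y.
  elim: r' => [|i r' IH]; first exact: vproj_zero.
  by rewrite /= vproj_add vproj_scale ps.
elim: r => [|i r IH]; first by rewrite big_nil; exact: covector_zero ca.
by rewrite big_cons /= aD ?vproj_scale ?ps ?pl // aZ // -IH.
Qed.

Lemma dual_sectionD t t' : dual_section V t -> dual_section V t' ->
  dual_section V (fun e => t e + t' e).
Proof.
move=> [st ct] [st' ct']; split; first exact: (scD (@smf R E)).
move=> x; have [h1 h2] := ct x; have [h1' h2'] := ct' x.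
by split=> [e e' ex ex'|r e ex]; rewrite ?h1 ?h1' ?h2 ?h2' // ?mulrDr // addrACA.
Qed.

Lemma smooth_basic f : smooth_fun f -> smooth_fun (f \o vproj V).
Proof. exact: smooth_map_fun (vproj_smooth V). Qed.

Lemma dual_sectionM f t : smooth_fun f -> dual_section V t ->
  dual_section V (fun e => f (vproj V e) * t e).
Proof.
move=> sf [st ct]; split.
  by apply: (scM (@smf R E)) => //; exact: smooth_basic.
move=> x; have [h1 h2] := ct x.
split=> [e e' ex ex'|r e ex]; rewrite ?vproj_add ?vproj_scale ?ex ?ex' ?h1 ?h2 //.
  by rewrite mulrDr.
by rewrite mulrCA.
Qed.

Lemma dual_sectionZ a t : dual_section V t -> dual_section V (fun e => a * t e).
Proof. by move=> dt; apply: (dual_sectionM (f := fun=> a)) => //; exact: (sc_cst (@smf R N)). Qed.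

Lemma dual_section0 : dual_section V (fun=> 0).
Proof.
split; first exact: (sc_cst (@smf R E)).
by move=> x; split=> *; rewrite ?addr0 ?mulr0.
Qed.

Lemma dual_section_sum (I : Type) (r : seq I) (u : I -> N -> R) (t : I -> E -> R) :
  (forall i, smooth_fun (u i)) -> (forall i, dual_section V (t i)) ->
  dual_section V (fun e => \sum_(i <- r) u i (vproj V e) * t i e).
Proof.
move=> hu ht; elim: r => [|i r IH].
  rewrite (_ : (fun _ => _) = fun=> 0); first exact: dual_section0.
  by apply/funext => e; rewrite big_nil.
rewrite (_ : (fun _ => _) = fun e => u i (vproj V e) * t i e +
    \sum_(i <- r) u i (vproj V e) * t i e).
  by apply: dual_sectionD => //; exact: dual_sectionM.
by apply/funext => e; rewrite big_cons.
Qed.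

Lemma covector_eq x a a' : (forall e, vproj V e = x -> a e = a' e) ->
  covector V x a -> covector V x a'.
Proof.
move=> h [h1 h2]; split=> [e e' ex ex'|r e ex].
  by rewrite -!h ?h1 // vproj_add // ex.
by rewrite -!h ?h2 // vproj_scale.
Qed.

Lemma section_through e : exists2 s, section V s & s (vproj V e) = e.
Proof.
have [chi [s [t F]]] := frame_exists (vproj V e).
exists (lincomb (index_enum _) (fun i _ => t i e) s).
  by apply: section_lincomb => i; [exact: (sc_cst (@smf R N))|exact: fr_sec F i].
have sp i y : vproj V (s i y) = y by have [] := fr_sec F i.
have ls : section V (lincomb (index_enum _) (fun i _ => t i e) s).
  by apply: section_lincomb => i; [exact: (sc_cst (@smf R N))|exact: fr_sec F i].
apply: covector_sep; rewrite section_proj // => a ca.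
by rewrite covector_lincomb // -(fr_expand F ca) (nbhs_singleton (fr_near F)) mul1r.
Qed.

Lemma dual_through x a : covector V x a ->
  exists2 t, dual_section V t & forall e, vproj V e = x -> t e = a e.
Proof.
move=> ca; have [chi [s [t F]]] := frame_exists x.
exists (fun e => \sum_i a (s i x) * t i e).
  apply: (@dual_section_sum _ _ (fun i _ => a (s i x)) t) => i.
    exact: (sc_cst (@smf R N)).
  exact: fr_dual F i.
move=> e ex; have := @fr_expand _ _ _ _ F e a; rewrite ex => /(_ ca).
rewrite (nbhs_singleton (fr_near F)) mul1r => ->.
by apply: eq_bigr => i _; rewrite mulrC.
Qed.

Lemma dual_sep e e' : vproj V e = vproj V e' ->
  (forall t, dual_section V t -> t e = t e') -> e = e'.
Proof.
move=> ee' h; apply: covector_sep => // a ca.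
by have [t dt ta] := dual_through ca; rewrite -!ta // h.
Qed.

Lemma section_ext s s' : section V s -> section V s' ->
  (forall t, dual_section V t -> t \o s = t \o s') -> s = s'.
Proof.
move=> hs hs' h; apply/funext => y; apply: dual_sep; first by rewrite !section_proj.
by move=> t dt; have /(congr1 (@^~ y)) := h t dt.
Qed.

Lemma frame_section x chi s t s0 : is_frame x chi s t -> section V s0 ->
  sscale V chi s0 = lincomb (index_enum _) (fun i => t i \o s0) s.
Proof.
move=> F hs0; apply: section_ext.
- exact: section_scale (fr_smooth F) hs0.
- apply: section_lincomb => i; last exact: fr_sec F i.
  by apply: dual_smooth_on => //; exact: fr_dual F i.
move=> t0 dt0; apply/funext => y /=; rewrite /sscale dual_scale //.
rewrite covector_lincomb; last 2 first.
- by move=> i; exact: section_proj (fr_sec F i).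
- exact: dual_sectionP.
have := fr_expand F (dual_sectionP dt0 (vproj V (s0 y))).
by rewrite section_proj.
Qed.

Lemma frame_dual x chi s t t0 : is_frame x chi s t -> dual_section V t0 ->
  (fun e => chi (vproj V e) * t0 e) =
  (fun e => \sum_i (t0 \o s i) (vproj V e) * t i e).
Proof.
move=> F dt; apply/funext => e; rewrite (fr_expand F (dual_sectionP dt _)).
by apply: eq_bigr => i _; rewrite mulrC.
Qed.

Definition section_tensor x (L : (N -> E) -> R) : Prop :=
  (forall s s', section V s -> section V s' -> L (sadd V s s') = L s + L s') /\
  (forall f s, smooth_fun f -> section V s -> L (sscale V f s) = f x * L s).

(** Multiplying the section by [chi], which is 1 at [x], does not change the value of [L], and the
    product is a combination of the global frame sections with smooth coefficients. Hence [L] sees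
    only the value of the section at [x]. *)
Lemma section_tensor_frame x L chi s t s0 : section_tensor x L ->
  is_frame x chi s t -> section V s0 -> L s0 = \sum_i t i (s0 x) * L (s i).
Proof.
move=> [LD LM] F hs0; have chix : chi x = 1 := nbhs_singleton (fr_near F).
rewrite -[LHS]mul1r -chix -LM //; last exact: fr_smooth F.
rewrite (frame_section F hs0).
have hu i : smooth_fun (t i \o s0) by apply: dual_smooth_on => //; exact: fr_dual F i.
have hs i := fr_sec F i.
elim: (index_enum _) => [|i r IH].
  rewrite big_nil -[LHS]/(L (vzero V)).
  have := LM (fun=> 0) (vzero V) (sc_cst (@smf R N) 0) section_zero.
  by rewrite mul0r => <-; congr L; apply/funext => y; rewrite /sscale -vzeroE.
rewrite big_cons -IH -[LHS]/(L (sadd V (sscale V (t i \o s0) (s i))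
  (lincomb r (fun i => t i \o s0) s))).
by rewrite LD ?LM //; [exact: section_scale|exact: section_lincomb].
Qed.

Lemma section_tensor_eq x L s s' : section_tensor x L -> section V s ->
  section V s' -> s x = s' x -> L s = L s'.
Proof.
move=> hL hs hs' ss'; have [chi [s0 [t F]]] := frame_exists x.
by rewrite !(section_tensor_frame hL F) // ss'.
Qed.

Lemma section_tensor_covector x L : section_tensor x L ->
  exists2 a, covector V x a & forall s, section V s -> L s = a (s x).
Proof.
move=> hL; have [chi [s0 [t F]]] := frame_exists x.
exists (fun e => \sum_i L (s0 i) * t i e); last first.
  move=> s hs; rewrite (section_tensor_frame hL F) //.
  by apply: eq_bigr => i _; rewrite mulrC.
apply: dual_sectionP; apply: (@dual_section_sum _ _ (fun i _ => L (s0 i)) t) => i.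
  exact: (sc_cst (@smf R N)).
exact: fr_dual F i.
Qed.

Definition dual_tensor x (W : (E -> R) -> R) : Prop :=
  (forall t t', dual_section V t -> dual_section V t' ->
     W (fun e => t e + t' e) = W t + W t') /\
  (forall f t, smooth_fun f -> dual_section V t ->
     W (fun e => f (vproj V e) * t e) = f x * W t).

(** Biduality in finite rank: the element has the values [W (t i)] as its coordinates in a frame. It
    yields points of a bundle from their pairings, such as values of connections, of transposed maps
    and of vertical components of vectors. *)
Lemma dual_tensor_point x W : dual_tensor x W ->
  exists2 e, vproj V e = x & forall t, dual_section V t -> t e = W t.
Proof.
move=> [WD WM]; have [chi [s [t F]]] := frame_exists x.
exists (lincomb (index_enum _) (fun i _ => W (t i)) s x).
  apply: section_proj; apply: section_lincomb => i; last exact: fr_sec F i.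
  exact: (sc_cst (@smf R N)).
move=> t0 dt0; rewrite covector_lincomb; last 2 first.
- by move=> i; exact: section_proj (fr_sec F i).
- exact: dual_sectionP.
rewrite -[RHS]mul1r -(nbhs_singleton (fr_near F)) -WM //; last exact: fr_smooth F.
rewrite (frame_dual F dt0).
have hu i : smooth_fun (t0 \o s i) by apply: dual_smooth_on => //; exact: fr_sec F i.
have ht i := fr_dual F i.
elim: (index_enum _) => [|i r IH].
  rewrite big_nil; have := WM (fun=> 0) _ (sc_cst (@smf R N) 0) dual_section0.
  rewrite [RHS]mul0r => W0; rewrite -{1}W0; congr W; apply/funext => e.
  by rewrite mul0r big_nil.
rewrite big_cons IH mulrC -(WM (t0 \o s i) (t i)) // -WD; last 2 first.
- exact: dual_sectionM.
- exact: (dual_section_sum _ hu ht).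
by congr W; apply/funext => e; rewrite big_cons.
Qed.

(** Near a fibre, [a] is a sum of products of dual frame sections with the smooth functions
    [a \o s i] of the base point. *)
Lemma dual_section_of_smooth a : (forall x, covector V x a) ->
  (forall s, section V s -> smooth_fun (a \o s)) -> dual_section V a.
Proof.
move=> ca h; split => //; apply: (sc_near (@smf R E)) => e.
have [chi [s [t F]]] := frame_exists (vproj V e).
exists (fun e => \sum_i t i e * (a \o s i) (vproj V e)).
  apply: (sc_sum (@smf R E)) => i; apply: (scM (@smf R E)).
    exact: dual_section_smooth (fr_dual F i).
  by apply: smooth_basic; apply: h; exact: fr_sec F i.
have := near_comp (smooth_map_cont (vproj_smooth V)) (fr_near F).
by apply: filterS => e' c1; rewrite -(fr_expand F (ca _)) c1 mul1r.
Qed.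

Lemma dual_coords_near x : exists (t : 'I_(vrank V) -> E -> R) c d,
  [/\ forall j, dual_section V (t j), trivialization c d, cdom c x &
   \forall y \near x, forall e, vproj V e = y ->
     forall j, rsubmx (cmap d e) 0 j = t j e].
Proof.
have [c [d [T cx]]] := trivialization_at x.
have [chi [schi chi1 chi0]] := manifold_bump (@cdom_open _ _ _ c) cx.
exists (fun j e => chi (vproj V e) * rsubmx (cmap d e) 0 j), c, d; split => //.
  by move=> j; exact: (local_linear_coords j T schi chi0).
by apply: filterS chi1 => y y1 e ey j; rewrite ey y1 mul1r.
Qed.

Lemma sc_map_of_dual (P : topologicalType) (A : set (P -> R)) (s : P -> E) :
  smooth_class A -> sc_map A (vproj V \o s) ->
  (forall t, dual_section V t -> A (t \o s)) -> sc_map A s.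
Proof.
move=> hA hp ht; apply: sc_map_triv => // p.
have [t [c [d [dt T cx tE]]]] := dual_coords_near (vproj V (s p)).
exists c, d, (fun y => \row_j t j (s y)); split => //.
  move=> j; rewrite (_ : (fun _ => _) = t j \o s); first exact: ht.
  by apply/funext => y; rewrite mxE.
have := near_comp (s := vproj V \o s) (sc_map_cont hA hp) tE.
by apply: filterS => y h; apply/rowP => j; rewrite mxE h.
Qed.

Lemma section_of_dual s : (forall x, vproj V (s x) = x) ->
  (forall t, dual_section V t -> smooth_fun (t \o s)) -> section V s.
Proof.
move=> ps h; apply/sectionP; split => //; apply: sc_map_of_dual => //; first exact: smf.
by rewrite (_ : _ \o _ = id) //; apply/funext => y; rewrite /= ps.
Qed.

(** The coordinates of a trivialization become global without losing their type: base coordinates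
    are extended on [N], fibre coordinates are cut off by a function of the base point. Derivatives
    at a point of [E] are therefore determined by linear and basic functions. *)
Lemma linear_coords e : exists n (d : chart R n E) (X : E -> 'rV[R]_n),
  [/\ smooth_chart d, cdom d e, forall j, lin_or_basic (fun e => X e 0 j)
    & \forall e' \near e, X e' = cmap d e'].
Proof.
have [t [c [d [dt T cx tE]]]] := dual_coords_near (vproj V e).
have [sc sd dE [h1 _ _ _ _]] := T.
have [Y sY YE] := coordinate_extension sc cx.
exists _, d, (fun e => row_mx (Y (vproj V e)) (\row_j t j e)); split => //.
- by rewrite dE.
- move=> j; case: (splitP j) => k jk.
    left; exists (fun y => Y y 0 k) => //; apply/funext => e' /=.
    rewrite -(row_mxEl (Y (vproj V e')) (\row_j t j e')).
    by congr (_ _ _); apply: val_inj.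
  right; rewrite (_ : (fun _ => _) = t k); first exact: dt.
  apply/funext => e'; have -> : t k e' = (\row_j t j e') 0 k by rewrite mxE.
  rewrite -(row_mxEr (Y (vproj V e')) (\row_j t j e')).
  by congr (_ _ _); apply: val_inj.
have cp := smooth_map_cont (vproj_smooth V).
have n1 := near_comp cp tE; have n2 := near_comp cp YE.
have n3 := near_comp cp (near_cdom cx).
apply: filterS3 n1 n2 n3 => e' h -> ce; rewrite -(h1 _ (triv_dom T ce)).
rewrite -[RHS]hsubmxK; congr (row_mx _ _).
by apply/rowP => j; rewrite mxE h.
Qed.

Lemma lin_or_basic_smooth g : lin_or_basic g -> smooth_fun g.
Proof. by case=> [[f sf ->]|[]] //; exact: smooth_basic. Qed.

Lemma tangent_bundle_eq e v v' : tangent e v -> tangent e v' ->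
  (forall g, lin_or_basic g -> v g = v' g) -> forall f, smooth_fun f -> v f = v' f.
Proof.
move=> tv tv' h f sf; have [n [d [X [sd de lX XE]]]] := linear_coords e.
have sX j := lin_or_basic_smooth (lX j).
rewrite (tangent_chartE sd de tv sf sX XE) (tangent_chartE sd de tv' sf sX XE).
by congr ('D_ _ _ _); apply/rowP => j; rewrite !mxE; exact: h.
Qed.

Lemma fibre_line_curve e e' : vproj V e = vproj V e' ->
  smooth_curve (fun r : R => e +[V] (r *[V] e')).
Proof.
move=> ee'; apply/smooth_curveP; apply: sc_map_of_dual; first exact: smooth_class_line.
  move=> f sf; rewrite (_ : _ \o _ = fun=> f (vproj V e)); first exact: smooth_cst.
  by apply/funext => r /=; rewrite vproj_add // vproj_scale.
move=> t dt; rewrite (_ : _ \o _ = fun r => t e + r * t e'); last first.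
  by apply/funext => r /=; rewrite dual_add ?vproj_scale // dual_scale.
apply: smoothD; [exact: openT|exact: smooth_cst|].
by apply: smoothM; [exact: openT|exact: smooth_id1|exact: smooth_cst].
Qed.

Lemma fibre_scale0 e e' : vproj V e = vproj V e' -> e +[V] (0 *[V] e') = e.
Proof.
move=> ee'; apply: dual_sep; first by rewrite vproj_add ?vproj_scale.
by move=> t dt; rewrite dual_add ?vproj_scale // dual_scale // mul0r addr0.
Qed.

Lemma vertical_lift_tangent s e : vproj V (s (vproj V e)) = vproj V e ->
  tangent e (vertical_lift V s e).
Proof.
move=> ps; exists (fun r => e +[V] (r *[V] s (vproj V e))); split => //.
  exact: fibre_line_curve.
exact: fibre_scale0.
Qed.

Lemma velocity_cst (N' : manifold R) (g : R -> N') f (r : R) :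
  (forall u, f (g u) = r) -> velocity g f = 0.
Proof.
move=> h; rewrite /velocity derive1E (_ : f \o g = cst r) ?derive_cst //.
by apply/funext => u /=.
Qed.

Lemma velocity_affine (N' : manifold R) (g : R -> N') f (a b : R) :
  (forall u, f (g u) = a + u * b) -> velocity g f = b.
Proof.
move=> h; rewrite /velocity (_ : f \o g = (fun u : R^o => a + u * b)); last first.
  by apply/funext => u /=.
rewrite derive1E; have d0 : derivable (fun u : R^o => a : R^o) 0 1 by exact: derivable_cst.
have d2 : derivable (fun u : R^o => u * b : R^o) 0 1.
  by apply: derivableM; [exact: derivable_id|exact: derivable_cst].
apply: (etrans (deriveD d0 d2)); rewrite derive_cst add0r.
rewrite (_ : (fun u : R^o => u * b) = (fun u => b * u)); last first.
  by apply/funext => u; rewrite mulrC.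
have d3 : derivable (id : R^o -> R^o) 0 1 by exact: derivable_id.
have h1 := @deriveZ R R^o R^o id b 0 1 d3; rewrite derive_id in h1.
by apply: (etrans h1); rewrite [LHS]mulr1.
Qed.

Lemma vertical_lift_basic s e f : vproj V (s (vproj V e)) = vproj V e ->
  vertical_lift V s e (f \o vproj V) = 0.
Proof.
move=> ps; apply: (@velocity_cst _ _ _ (f (vproj V e))) => u /=.
by rewrite vproj_add ?vproj_scale.
Qed.

Lemma vertical_lift_linear s e t : vproj V (s (vproj V e)) = vproj V e ->
  dual_section V t -> vertical_lift V s e t = t (s (vproj V e)).
Proof.
move=> ps dt; apply: (@velocity_affine _ _ _ (t e)) => u.
by rewrite dual_add ?vproj_scale // dual_scale.
Qed.

(** * Fibre metrics and sections with prescribed pairings *)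

Variable pair : E -> E -> R.
Hypothesis pm : metric V pair.

Lemma pairC e e' : vproj V e = vproj V e' -> pair e e' = pair e' e.
Proof. by have [_ h _ _] := pm; exact: h. Qed.

Lemma pair_covector e : covector V (vproj V e) (pair e).
Proof. by have [_ _ h _] := pm. Qed.

Lemma pair_covectorP e x : vproj V e = x -> covector V x (pair e).
Proof. by move=> <-; exact: pair_covector. Qed.

Lemma pairDr e e1 e2 : vproj V e1 = vproj V e -> vproj V e2 = vproj V e ->
  pair e (e1 +[V] e2) = pair e e1 + pair e e2.
Proof. by have [h _] := pair_covector e; exact: h. Qed.

Lemma pairZr e r e1 : vproj V e1 = vproj V e -> pair e (r *[V] e1) = r * pair e e1.
Proof. by have [_ h] := pair_covector e; exact: h. Qed.

Lemma pairDl e e1 e2 : vproj V e1 = vproj V e -> vproj V e2 = vproj V e ->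
  pair (e1 +[V] e2) e = pair e1 e + pair e2 e.
Proof.
move=> h1 h2; rewrite pairC ?vproj_add ?h1 ?h2 // pairDr // (pairC (esym h1)).
by rewrite (pairC (esym h2)).
Qed.

Lemma pairZl e r e1 : vproj V e1 = vproj V e -> pair (r *[V] e1) e = r * pair e1 e.
Proof. by move=> h1; rewrite pairC ?vproj_scale // pairZr // (pairC (esym h1)). Qed.

Lemma pair0l e : pair (vzero V (vproj V e)) e = 0.
Proof. by rewrite pairC ?vproj_zero // (covector_zero (pair_covector e)). Qed.

Lemma pair_sep e e' : vproj V e = vproj V e' ->
  (forall e1, vproj V e1 = vproj V e -> pair e e1 = pair e' e1) -> e = e'.
Proof.
move=> ee' h; have [_ _ _ nd] := pm.
have e0 : e +[V] (-1 *[V] e') = vzero V (vproj V e).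
  rewrite (nd (e +[V] (-1 *[V] e'))) ?vproj_add ?vproj_scale //.
  move=> e1 p1; rewrite pairDl ?vproj_scale // ?p1 // pairZl ?p1 // h //.
  by rewrite mulN1r subrr.
apply: dual_sep => // t dt.
have := congr1 t e0; rewrite dual_add ?vproj_scale // dual_scale // dual_zero //.
by rewrite mulN1r => /subr0_eq.
Qed.

Lemma pair_smooth s s' : section V s -> section V s' ->
  smooth_fun (fun y => pair (s y) (s' y)).
Proof.
move=> [ss ps] [ss' ps']; have [h _ _ _] := pm; apply: h => // y.
by rewrite ps ps'.
Qed.

Let G (k : nat) (s : 'I_k -> N -> E) y : 'M[R]_k := \matrix_(i, j) pair (s i y) (s j y).

Lemma smooth_det k (F : N -> 'M[R]_k) :
  (forall i j, smooth_fun (fun y => F y i j)) -> smooth_fun (fun y => \det (F y)).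
Proof.
move=> h; apply: (sc_sum (@smf R N)) => sg; apply: (scM (@smf R N)).
  exact: (sc_cst (@smf R N)).
by apply: (sc_prod (@smf R N)) => i; exact: h.
Qed.

Lemma smooth_adj k (F : N -> 'M[R]_k) i j :
  (forall i j, smooth_fun (fun y => F y i j)) -> smooth_fun (fun y => \adj (F y) i j).
Proof.
move=> h; rewrite (_ : (fun _ => _) = fun y => (-1) ^+ (j + i) *
    \det (row' j (col' i (F y)))); last by apply/funext => y; rewrite mxE.
apply: (scM (@smf R N)); first exact: (sc_cst (@smf R N)).
apply: smooth_det => i' j'; rewrite (_ : (fun _ => _) = fun y => F y (lift j i') (lift i j')).
  exact: h.
by apply/funext => y; rewrite !mxE.
Qed.

(** A row in the kernel of the Gram matrix is a combination of the frame that is orthogonal to the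
    frame, hence to the fibre. Nondegeneracy makes it zero and the dual frame then kills its
    coefficients. *)
Lemma frame_gram x chi s t y : is_frame x chi s t -> chi y = 1 -> G s y \in unitmx.
Proof.
move=> F c1; rewrite -row_free_unit -kermx_eq0; apply/rowV0P => u.
rewrite sub_kermx => /eqP uG.
have ps i : vproj V (s i y) = y by exact: section_proj (fr_sec F i).
pose e := lincomb (index_enum _) (fun i _ => u 0 i) s y.
have se : section V (lincomb (index_enum _) (fun i _ => u 0 i) s).
  by apply: section_lincomb => i; [exact: (sc_cst (@smf R N))|exact: fr_sec F i].
have pe : vproj V e = y by exact: section_proj se.
have pes j : pair (s j y) e = 0.
  rewrite covector_lincomb //; last exact: pair_covectorP.
  have := congr1 (fun M : 'rV_ _ => M 0 j) uG; rewrite !mxE => h.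
  apply: etrans h; by apply: eq_bigr => i _; rewrite mxE pairC // !ps.
have e0 : e = vzero V y.
  have [_ _ _ nd] := pm; rewrite (nd e) ?pe // => e' pe'.
  have := fr_expand F (e := e') (a := pair e); rewrite pe' c1 mul1r => ->; last exact: pair_covectorP.
  by apply: big1 => i _; rewrite (pairC (e := e)) ?ps // pes mulr0.
apply/rowP => i; have := congr1 (t i) e0; rewrite dual_zero; last exact: fr_dual F i.
rewrite covector_lincomb //; last exact: dual_sectionP (fr_dual F i) _.
rewrite (bigD1 i) //= (fr_pair F) eqxx c1 !mulr1 big1 ?addr0 ?mxE // => j ji.
by rewrite (fr_pair F) eq_sym (negbTE ji) !mulr0.
Qed.

Lemma riesz_local x chi s t a y : is_frame x chi s t -> dual_section V a -> chi y = 1 ->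
  let c i := \sum_j a (s j y) * invmx (G s y) j i in
  let e := lincomb (index_enum _) (fun i _ => c i) s y in
  vproj V e = y /\ forall e', vproj V e' = y -> pair e e' = a e'.
Proof.
move=> F da c1 c e.
have ps i : vproj V (s i y) = y by exact: section_proj (fr_sec F i).
have se : section V (lincomb (index_enum _) (fun i _ => c i) s).
  by apply: section_lincomb => i; [exact: (sc_cst (@smf R N))|exact: fr_sec F i].
have pe : vproj V e = y by exact: section_proj se.
split=> // e' pe'.
have pes j : pair e (s j y) = a (s j y).
  rewrite pairC ?ps ?pe // covector_lincomb //; last first.
    exact: pair_covectorP.
  have gu := frame_gram F c1.
  transitivity (((\row_j a (s j y)) *m invmx (G s y) *m G s y) 0 j).
    rewrite !mxE; apply: eq_bigr => i _; rewrite !mxE; congr (_ * _).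
      by apply: eq_bigr => k _; rewrite mxE.
    by rewrite pairC // !ps.
  by rewrite mulmxKV // mxE.
have := fr_expand F (e := e') (a := pair e); rewrite pe' c1 mul1r => ->; last first.
  exact: pair_covectorP.
have := fr_expand F (e := e') (dual_sectionP da _); rewrite pe' c1 mul1r => ->.
by apply: eq_bigr => i _; rewrite pes.
Qed.

(** Pointwise, the representing element has coefficients given by the inverse Gram matrix of a
    frame. Writing the inverse with the adjugate shows that near [x] they are quotients of smooth
    functions by the determinant, whence smoothness. *)
Lemma riesz a : dual_section V a ->
  exists2 s, section V s & forall e, pair (s (vproj V e)) e = a e.
Proof.
move=> da.
have ex y : exists e, vproj V e = y /\ forall e', vproj V e' = y -> pair e e' = a e'.
  have [chi [s [t F]]] := frame_exists y.
  by have h := riesz_local F da (nbhs_singleton (fr_near F)); eexists; exact: h.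
have [s hs] := choice ex.
exists s; last by move=> e; exact: (hs (vproj V e)).2.
apply: section_of_dual => [y|t0 dt0]; first exact: (hs y).1.
apply: (@smf R N).2 => x; have [chi [s0 [t F]]] := frame_exists x.
have sG i j : smooth_fun (fun y => G s0 y i j).
  rewrite (_ : (fun _ => _) = fun y => pair (s0 i y) (s0 j y)).
    by apply: pair_smooth; exact: fr_sec F _.
  by apply/funext => y; rewrite mxE.
apply: (@sc_div_near _ _ _ _ (fun y => \sum_i (\sum_j a (s0 j y) * \adj (G s0 y) j i) *
  t0 (s0 i y)) (fun y => \det (G s0 y))).
- apply: (sc_sum (@smf R N)) => i; apply: (scM (@smf R N)); last first.
    by apply: dual_smooth_on => //; exact: fr_sec F i.
  apply: (sc_sum (@smf R N)) => j; apply: (scM (@smf R N)).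
    by apply: dual_smooth_on => //; exact: fr_sec F j.
  exact: smooth_adj.
- exact: smooth_det.
- by have := frame_gram F (nbhs_singleton (fr_near F)); rewrite unitmxE unitfE.
have := fr_near F; apply: filterS => y c1.
have [pe he] := riesz_local F da c1; move: pe he; set e := lincomb _ _ _ _ => pe he.
rewrite /=; have -> : s y = e.
  apply: pair_sep; first by rewrite pe (hs y).1.
  by move=> e1; rewrite (hs y).1 => p1; rewrite (hs y).2 // he.
rewrite covector_lincomb; last 2 first.
- by move=> i; exact: section_proj (fr_sec F i).
- exact: dual_sectionP.
rewrite mulr_suml; apply: eq_bigr => i _; rewrite mulrAC; congr (_ * _).
rewrite mulr_suml; apply: eq_bigr => j _; rewrite -mulrA; congr (_ * _).
have := frame_gram F c1; rewrite /invmx => ->.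
by rewrite mxE mulrC.
Qed.

Lemma vadd0l e : vzero V (vproj V e) +[V] e = e.
Proof.
apply: dual_sep; first by rewrite vproj_add vproj_zero.
by move=> t dt; rewrite dual_add ?vproj_zero // dual_zero // add0r.
Qed.

Lemma vaddr0 e : e +[V] vzero V (vproj V e) = e.
Proof.
apply: dual_sep; first by rewrite vproj_add ?vproj_zero.
by move=> t dt; rewrite dual_add ?vproj_zero // dual_zero // addr0.
Qed.

Lemma vscale0 e : 0 *[V] e = vzero V (vproj V e).
Proof.
apply: dual_sep; first by rewrite vproj_scale vproj_zero.
by move=> t dt; rewrite dual_scale // dual_zero // mul0r.
Qed.

Lemma vsubrr e : e +[V] (-1 *[V] e) = vzero V (vproj V e).
Proof.
apply: dual_sep; first by rewrite vproj_add ?vproj_zero ?vproj_scale.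
by move=> t dt; rewrite dual_add ?vproj_scale // dual_scale // dual_zero // mulN1r subrr.
Qed.

Lemma vaddNK e e' : vproj V e = vproj V e' -> e' +[V] (e +[V] (-1 *[V] e')) = e.
Proof.
move=> ee'; apply: dual_sep; first by rewrite vproj_add ?vproj_add ?vproj_scale.
move=> t dt; rewrite !dual_add ?vproj_add ?vproj_scale // dual_scale //.
by rewrite mulN1r addrC subrK.
Qed.

Lemma vscale_zero r x : r *[V] vzero V x = vzero V x.
Proof.
apply: dual_sep => [|t dt]; first exact: vproj_scale.
by rewrite (dual_scale _ _ dt) (dual_zero x dt) mulr0.
Qed.

End Bundles.

(** * Metric double vector bundles *)

Section MetricDoubleBundles.
Variables (R : realType) (E Q B M : manifold R) (DD : dvb E Q B M).
Implicit Types (e : E) (b : B) (m : M).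

Local Notation VA := (dA DD).
Local Notation VB := (dB DD).
Local Notation WQ := (sA DD).
Local Notation WB := (sB DD).
Local Notation pA := (vproj VA).
Local Notation pB := (vproj VB).
Local Notation qA := (vproj WQ).
Local Notation qB := (vproj WB).

Lemma dvb_base e : qB (pB e) = qA (pA e).
Proof. by have [_ _ h _ _] := dvb_proj DD; exact: h. Qed.

Lemma pB_addA e e' : pA e = pA e' -> pB (e +[VA] e') = pB e +[WB] pB e'.
Proof. by have [_ _ _ h _] := dvb_proj DD; exact: h. Qed.

Lemma pB_scaleA r e : pB (r *[VA] e) = r *[WB] pB e.
Proof. by have [_ _ _ _ h] := dvb_proj DD; exact: h. Qed.

Lemma pA_zeroB b : pA (vzero VB b) = vzero WQ (qB b).
Proof. by have [_ _ h _ _] := dvb_zero DD; exact: h. Qed.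

Lemma pA_scaleB r e : pA (r *[VB] e) = r *[WQ] pA e.
Proof. by have [_ _ h _ _] := dvb_scale DD r; exact: h. Qed.

Lemma pA_addB e e' : pB e = pB e' -> pA (e +[VB] e') = pA e +[WQ] pA e'.
Proof. by have [h _ _] := dvb_add DD; exact: h. Qed.

Lemma zeroB_zero m : vzero VB (vzero WB m) = vzero VA (vzero WQ m).
Proof.
have [_ _ _ _ h] := dvb_zero DD.
by rewrite (vzeroE WB m) h vscale0 pA_zeroB vproj_zero.
Qed.

Lemma core_at_pA b c : is_core DD (qB b) c -> pA (core_at DD b c) = vzero WQ (qB b).
Proof. by move=> [cA cB]; rewrite /core_at vproj_add pA_zeroB // cA. Qed.

Lemma core_at_pB b c : is_core DD (qB b) c -> pB (core_at DD b c) = b.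
Proof.
move=> [cA cB]; rewrite /core_at pB_addA ?pA_zeroB ?cA // cB vproj_zero.
exact: vaddr0.
Qed.

Lemma core_at_zero m c : is_core DD m c -> core_at DD (vzero WB m) c = c.
Proof.
by move=> [cA cB]; rewrite /core_at zeroB_zero -cA vadd0l.
Qed.

Lemma kernel_core e : pA e = vzero WQ (qB (pB e)) ->
  exists2 c, is_core DD (qB (pB e)) c & e = core_at DD (pB e) c.
Proof.
move=> ke.
have pz : pA (vzero VB (pB e)) = pA e by rewrite pA_zeroB.
exists (e +[VA] (-1 *[VA] vzero VB (pB e))); last by rewrite /core_at vaddNK.
split; first by rewrite vproj_add ?vproj_scale.
by rewrite pB_addA ?vproj_scale // pB_scaleA vproj_zero vsubrr.
Qed.

Section Metric.
Variables (pair : E -> E -> R) (S : Q -> B -> E).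
Hypotheses (md : metric_dvb DD pair) (lag : lagrangian_splitting DD pair S).

Let pm : metric VB pair := md_metric md.
Let ls : linear_splitting DD S := lag_linear lag.

Lemma split_pA q b : qA q = qB b -> pA (S q b) = q. Proof. exact: (ls_projA ls). Qed.
Lemma split_pB q b : qA q = qB b -> pB (S q b) = b. Proof. exact: (ls_projB ls). Qed.

Lemma split_smooth (P : manifold R) (f : P -> Q) (g : P -> B) :
  smooth_map f -> smooth_map g -> (forall x, qA (f x) = qB (g x)) ->
  smooth_map (fun x => S (f x) (g x)).
Proof. exact: (ls_smooth ls). Qed.

(** Of the side morphism to the dual of the core three facts are kept: the pairing with the core
    factors through [pA], and [lambda] vanishes on the zero vector and on no other. *)
Lemma pair_core_lambda : exists lambda : Q -> E -> R,
  (forall e c, is_core DD (qB (pB e)) c ->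
     pair e (core_at DD (pB e) c) = lambda (pA e) c) /\
  (forall m q, qA q = m -> (forall c, is_core DD m c -> lambda q c = 0) ->
     q = vzero WQ m) /\
  (forall m c, is_core DD m c -> lambda (vzero WQ m) c = 0).
Proof.
have [la [h1 h2 h3 h4 h5]] := md_side md; exists la.
have z m c : is_core DD m c -> la (vzero WQ m) c = 0.
  by move=> hc; rewrite vzeroE h4 ?mul0r // vproj_zero.
split; last split => //.
  by move=> e c hc; exact: (h1 e (qB (pB e)) c).
move=> m q qm hq; have c0 : core_covector DD m (fun=> 0).
  by split=> *; rewrite ?addr0 ?mulr0.
have [q0 [_ uq]] := h5 m _ c0.
rewrite -(uq q) // (uq (vzero WQ m)) //; split; first exact: vproj_zero.
by move=> c; exact: z.
Qed.

Lemma pair_core_indep e e' c : pA e = pA e' -> is_core DD (qA (pA e)) c ->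
  pair e (core_at DD (pB e) c) = pair e' (core_at DD (pB e') c).
Proof.
move=> ee' hc; have [la [h _]] := pair_core_lambda.
by rewrite !h ?dvb_base // -?ee'.
Qed.

Lemma pair_kernel e e' : pB e = pB e' -> pA e = vzero WQ (qB (pB e)) ->
  pA e' = vzero WQ (qB (pB e')) -> pair e e' = 0.
Proof.
move=> ee' ke ke'; have [c hc ->] := kernel_core ke'.
have [la [h [_ hz]]] := pair_core_lambda.
by rewrite -ee' h ?ee' // ke ee' hz.
Qed.

(** The component of [e] in the core [Q^*] with respect to the splitting. *)
Definition acov e : Q -> R := fun q => pair e (S q (pB e)).

Lemma acov_covector e : covector WQ (qB (pB e)) (acov e).
Proof.
split=> [q q' hq hq'|r q hq]; rewrite /acov.
  by rewrite (ls_addA ls) // (pairDr pm) // split_pB.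
by rewrite (ls_scaleA ls) // (pairZr pm) // split_pB.
Qed.

Lemma base_split e : qA (pA e) = qB (pB e). Proof. by rewrite dvb_base. Qed.

(** Subtracting from each element the lift of its projection leaves elements of the kernel of [pA].
    Lifts are isotropic because the splitting is Lagrangian, the kernel is isotropic by
    [pair_kernel], so only the two mixed terms survive. *)
Lemma pair_split e e' : pB e = pB e' -> pair e e' = acov e (pA e') + acov e' (pA e).
Proof.
move=> ee'; set b := pB e.
have h1 : qA (pA e) = qB b by rewrite base_split.
have h2 : qA (pA e') = qB b by rewrite base_split /b ee'.
pose s := S (pA e) b; pose s' := S (pA e') b.
have ps : pB s = b by exact: split_pB.
have ps' : pB s' = b by exact: split_pB.
pose k := e +[VB] (-1 *[VB] s); pose k' := e' +[VB] (-1 *[VB] s').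
have pk : pB k = b by rewrite /k vproj_add ?vproj_scale ?ps.
have pk' : pB k' = b by rewrite /k' vproj_add ?vproj_scale ?ps' -?ee'.
have kk : pA k = vzero WQ (qB b).
  by rewrite /k pA_addB ?vproj_scale ?ps // pA_scaleB split_pA // vsubrr h1.
have kk' : pA k' = vzero WQ (qB b).
  by rewrite /k' pA_addB ?vproj_scale ?ps' -?ee' // pA_scaleB split_pA // vsubrr h2.
have eE : e = s +[VB] k by rewrite vaddNK // ps.
have eE' : e' = s' +[VB] k' by rewrite vaddNK // ps' -ee'.
clearbody k k'.
have k0 : pair k k' = 0 by apply: pair_kernel; rewrite ?pk ?pk'.
have s0 : pair s s' = 0 by exact: (lag_isotropic lag).
have -> : acov e (pA e') = pair k s'.
  by rewrite /acov -/b -/s' {1}eE (pairDl pm) ?ps ?ps' ?pk // s0 add0r.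
have -> : acov e' (pA e) = pair k' s.
  rewrite /acov -ee' -/b -/s {1}eE' (pairDl pm) ?ps ?ps' ?pk' //.
  by rewrite (pairC pm) ?ps ?ps' // s0 add0r.
rewrite {1}eE {1}eE' (pairDl pm) ?(pairDr pm) ?vproj_add ?ps ?ps' ?pk ?pk' //.
by rewrite s0 k0 addr0 add0r addrC (pairC pm (e := s)) ?ps ?pk'.
Qed.

(** [pB], [pA] and [acov] are the three components of the decomposition of [E] by the splitting into
    [B], [Q] and the core; by [pair_split] the pairing depends on nothing else. *)
Lemma E_sep e e' : pB e = pB e' -> pA e = pA e' ->
  (forall q, qA q = qB (pB e) -> acov e q = acov e' q) -> e = e'.
Proof.
move=> hB hA h; apply: (pair_sep pm) => // e1 p1.
rewrite !pair_split -?p1 // -?hB ?p1 // hA; congr (_ + _).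
by rewrite h // base_split p1.
Qed.

Lemma dA_covector a b : (forall m, covector WQ m a) -> covector VB b (fun e => a (pA e)).
Proof.
move=> h; split=> [e e' eb eb'|r e eb].
  have [h1 _] := h (qB b).
  by rewrite pA_addB ?eb // h1 // base_split ?eb ?eb'.
by have [_ h2] := h (qB b); rewrite pA_scaleB h2 // base_split eb.
Qed.

Lemma dagger_riesz tau : dual_section WQ tau ->
  exists2 s, section VB s & forall e, pair (s (pB e)) e = tau (pA e).
Proof.
move=> [st ct]; apply: (riesz pm); split.
  exact: smooth_map_fun (vproj_smooth VA) st.
by move=> b; exact: dA_covector.
Qed.

(** The section representing [tau \o pA], taken at the zero vector of [B], is the required element:
    it pairs to zero with the core, so its projection to [Q] vanishes. The choice in [core_of] thus
    never falls back on its default. *)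
Lemma core_ofP m a : covector WQ m a ->
  is_core DD m (core_of DD pair m a) /\
  forall e, pB e = vzero WB m -> pair (core_of DD pair m a) e = a (pA e).
Proof.
move=> ca; have [tau dtau tE] := dual_through ca.
have [s hs sE] := dagger_riesz dtau.
pose c := s (vzero WB m).
have cB : pB c = vzero WB m by exact: section_proj hs.
have cE e : pB e = vzero WB m -> pair c e = a (pA e).
  by move=> pe; rewrite -tE ?base_split ?pe ?vproj_zero // -sE pe.
have cc : is_core DD m c.
  split => //; have [la [h1 [h2 _]]] := pair_core_lambda.
  apply: h2; first by rewrite base_split cB vproj_zero.
  move=> c' hc'; have := h1 c c'; rewrite cB vproj_zero => <- //.
  rewrite core_at_zero // cE; last by case: hc'.
  by have [-> _] := hc'; exact: covector_zero ca.
rewrite /core_of; apply: (@xgetPex _ _ [set c | is_core DD m c /\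
   forall e, pB e = vzero WB m -> pair c e = a (pA e)]).
by exists c.
Qed.

(** The pairing with the core depends on [e] only through [pA e], so [e] is replaced by the lift of
    [pA e] over the zero vector, the fibre in which [core_of] is characterized. *)
Lemma pair_core_of e a : covector WQ (qB (pB e)) a ->
  pair e (core_at DD (pB e) (core_of DD pair (qB (pB e)) a)) = a (pA e).
Proof.
move=> ca; have [hc hE] := core_ofP ca.
have h0 : qA (pA e) = qB (vzero WB (qB (pB e))) by rewrite vproj_zero base_split.
have p0 := split_pB h0.
rewrite (@pair_core_indep e (S (pA e) (vzero WB (qB (pB e))))); last 2 first.
- by rewrite split_pA.
- by rewrite base_split.
rewrite p0 core_at_zero // (pairC pm) ?p0; last by case: hc.
by rewrite hE // split_pA.
Qed.

Lemma core_at_acov b a q : covector WQ (qB b) a -> qA q = qB b ->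
  acov (core_at DD b (core_of DD pair (qB b) a)) q = a q.
Proof.
move=> ca hq; have [hc _] := core_ofP ca.
rewrite /acov core_at_pB // (pairC pm) ?core_at_pB ?split_pB //.
have := @pair_core_of (S q b) a; rewrite split_pB // split_pA //.
exact.
Qed.

Local Notation dag := (dual_dagger DD pair).
Local Notation sig := (horizontal_lift DD S).

Lemma dag_pB tau b : dual_section WQ tau -> pB (dag tau b) = b.
Proof. by move=> dt; have [hc _] := core_ofP (dual_sectionP dt (qB b)); exact: core_at_pB. Qed.

Lemma dag_pA tau b : dual_section WQ tau -> pA (dag tau b) = vzero WQ (qB b).
Proof. by move=> dt; have [hc _] := core_ofP (dual_sectionP dt (qB b)); exact: core_at_pA. Qed.

Lemma dag_acov tau b q : dual_section WQ tau -> qA q = qB b -> acov (dag tau b) q = tau q.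
Proof. by move=> dt hq; exact: core_at_acov (dual_sectionP dt _) hq. Qed.

Lemma pair_dag tau e : dual_section WQ tau -> pair (dag tau (pB e)) e = tau (pA e).
Proof.
move=> dt; rewrite (pairC pm) ?dag_pB //.
exact: pair_core_of (dual_sectionP dt _).
Qed.

Lemma section_dag tau : dual_section WQ tau -> section VB (dag tau).
Proof.
move=> dt; have [s hs sE] := dagger_riesz dt.
suff -> : dag tau = s by [].
apply/funext => b; apply: (pair_sep pm); first by rewrite dag_pB // section_proj.
by move=> e; rewrite dag_pB // => pe; rewrite -{1}pe pair_dag // -sE pe.
Qed.

Lemma core_section_dag tau : dual_section WQ tau -> core_section DD (dag tau).
Proof.
move=> dt; exists (fun m => core_of DD pair m tau); split => //; last first.
  by move=> m; have [] := core_ofP (dual_sectionP dt m).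
rewrite (_ : (fun _ => _) = dag tau \o vzero WB).
  exact: smooth_map_comp (vzero_smooth WB) (section_dag dt).1.
apply/funext => m; rewrite /= /dual_dagger /dagger vproj_zero core_at_zero //.
by have [] := core_ofP (dual_sectionP dt m).
Qed.

(** The covector [tau] is read off from [c] along the zero section of [B]. This is enough, as a core
    section pairs with [e] through [pA e] only. *)
Lemma core_sectionP s : core_section DD s -> exists2 tau, dual_section WQ tau & s = dag tau.
Proof.
move=> [c [sc cc sE]].
pose tau q := pair (c (qA q)) (S q (vzero WB (qA q))).
have z q : qA q = qB (vzero WB (qA q)) by rewrite vproj_zero.
have cB m : pB (c m) = vzero WB m by case: (cc m).
have acE q : tau q = acov (c (qA q)) q by rewrite /acov cB.
have dt : dual_section WQ tau.
  split; last first.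
    move=> m; apply: covector_eq (_ : covector WQ m (acov (c m))).
      by move=> q qm; rewrite acE qm.
    by have := acov_covector (c m); rewrite cB vproj_zero.
  have [h _ _ _] := pm; apply: (h Q (c \o qA) (fun q => S q (vzero WB (qA q)))).
  - exact: smooth_map_comp (vproj_smooth WQ) sc.
  - apply: (split_smooth (f := id)) => //; first exact: smooth_map_id.
    exact: smooth_map_comp (vproj_smooth WQ) (vzero_smooth WB).
  - by move=> q; rewrite /= cB split_pB.
exists tau => //; apply/funext => b; rewrite sE /dagger.
have hc : is_core DD (qB b) (c (qB b)) by exact: cc.
apply: (pair_sep pm); first by rewrite core_at_pB // dag_pB.
move=> e; rewrite core_at_pB // => pe.
rewrite -[in RHS]pe pair_dag // (pairC pm) ?core_at_pB // -{1}pe.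
have h0 : qA (pA e) = qB (vzero WB (qB b)) by rewrite vproj_zero base_split pe.
have p0 := split_pB h0.
rewrite (@pair_core_indep e (S (pA e) (vzero WB (qB b)))); last 2 first.
- by rewrite split_pA.
- by rewrite base_split pe.
rewrite p0 core_at_zero // (pairC pm) ?p0 ?cB // /tau.
by rewrite base_split pe.
Qed.

Lemma sig_pA q b : section WQ q -> pA (sig q b) = q (qB b).
Proof. by move=> hq; rewrite /horizontal_lift split_pA // section_proj. Qed.

Lemma sig_pB q b : section WQ q -> pB (sig q b) = b.
Proof. by move=> hq; rewrite /horizontal_lift split_pB // section_proj. Qed.

Lemma section_sig q : section WQ q -> section VB (sig q).
Proof.
move=> hq; split; last by move=> b; exact: sig_pB.
apply: (split_smooth (f := q \o qB) (g := id)) => //=.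
- exact: smooth_map_comp (vproj_smooth WB) hq.1.
- exact: smooth_map_id.
- by move=> b; rewrite section_proj.
Qed.

Lemma linear_section_sig q : section WQ q -> linear_section DD (sig q).
Proof.
move=> hq; split; first exact: section_sig.
exists q => //; split.
- exact: hq.1.
- exact: (section_sig hq).1.
- by move=> b; exact: sig_pA.
- move=> b b' bb'; rewrite /horizontal_lift vproj_add // (ls_addB ls) -?bb' //.
    by rewrite section_proj.
  by rewrite section_proj.
- by move=> r b; rewrite /horizontal_lift vproj_scale (ls_scaleB ls) // section_proj.
Qed.

Lemma sig_acov q b q' : section WQ q -> qA q' = qB b -> acov (sig q b) q' = 0.
Proof.
move=> hq hq'; rewrite /acov sig_pB //; apply: (lag_isotropic lag) => //.
exact: section_proj.
Qed.

Lemma linear_pair_dual s s' : linear_section DD s -> linear_section DD s' ->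
  dual_section WB (fun b => pair (s b) (s' b)).
Proof.
move=> [hs [a ha [_ _ h1 h2 h3]]] [hs' [a' ha' [_ _ h1' h2' h3']]]; split.
  exact: (pair_smooth pm).
move=> m; split=> [b b' bm bm'|r b bm].
  rewrite h2 ?bm ?bm' // h2' ?bm ?bm' // (md_add md) // ?h1 ?h1' ?bm ?bm' //.
  - by rewrite !section_proj.
  - by rewrite !section_proj.
by rewrite h3 h3' (md_scale md) // !section_proj.
Qed.

Lemma gen_through e : exists q tau, [/\ section WQ q, dual_section WQ tau,
  q (qB (pB e)) = pA e, forall q', qA q' = qB (pB e) -> tau q' = acov e q'
  & sig q (pB e) +[VB] dag tau (pB e) = e].
Proof.
have [q hq qE] := section_through WQ (pA e); rewrite base_split in qE.
have [tau dt tE] := dual_through (acov_covector e).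
exists q, tau; split => //.
have p1 := sig_pB (pB e) hq; have p2 := dag_pB (pB e) dt.
apply: E_sep.
- by rewrite vproj_add p1 ?p2.
- by rewrite pA_addB ?p1 ?p2 // sig_pA // dag_pA // -qE -{2}(section_proj (qB (pB e)) hq) vaddr0.
move=> q'; rewrite vproj_add ?p1 ?p2 // => hq'.
rewrite {1}/acov vproj_add ?p1 ?p2 // (pairDl pm) ?split_pB ?p1 ?p2 //;
  last by rewrite section_proj.
have := sig_acov hq hq'; rewrite /acov p1 => ->.
have := dag_acov dt hq'; rewrite /acov p2 => ->.
by rewrite add0r tE.
Qed.

Lemma gen_tensor b L : section_tensor VB b L ->
  (forall q, section WQ q -> L (sig q) = 0) ->
  (forall tau, dual_section WQ tau -> L (dag tau) = 0) ->
  forall s, section VB s -> L s = 0.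
Proof.
move=> hL h1 h2 s hs; have [q [tau [hq dt _ _ sE]]] := gen_through (s b).
have hsig := section_sig hq; have hdag := section_dag dt.
rewrite (section_tensor_eq hL hs (section_add hsig hdag)).
  by have [-> //] := hL; rewrite h1 // h2 // addr0.
by rewrite /sadd -[LHS]sE section_proj.
Qed.

Lemma acovD e e' q : pB e = pB e' -> qA q = qB (pB e) ->
  acov (e +[VB] e') q = acov e q + acov e' q.
Proof.
move=> ee' hq; rewrite /acov vproj_add // (pairDl pm) ?split_pB // -?ee' //.
Qed.

Lemma acovZ r e q : qA q = qB (pB e) -> acov (r *[VB] e) q = r * acov e q.
Proof. by move=> hq; rewrite /acov vproj_scale (pairZl pm) ?split_pB. Qed.

Lemma acov_smooth s q : section VB s -> section WQ q ->
  smooth_fun (fun b => acov (s b) (q (qB b))).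
Proof.
move=> hs hq; rewrite (_ : (fun _ => _) = fun b => pair (s b) (sig q b)).
  exact: (pair_smooth pm) hs (section_sig hq).
by apply/funext => b; rewrite /acov section_proj.
Qed.

(** The sections [sig (q i)] and [dag (t i)] built from a frame of [Q] and its dual frame behave as
    a frame of [E] where [chi] is 1. Expanding [s] there writes [a \o s] as a finite sum of products
    of smooth functions. *)
Lemma dual_section_gen a : (forall b, covector VB b a) ->
  (forall q, section WQ q -> smooth_fun (a \o sig q)) ->
  (forall tau, dual_section WQ tau -> smooth_fun (a \o dag tau)) ->
  dual_section VB a.
Proof.
move=> ca h1 h2; apply: dual_section_of_smooth => // s hs.
apply: (sc_near (@smf R B)) => b0.
have [chi [q [t F]]] := frame_exists WQ (qB b0).
exists (fun b => \sum_i t i (pA (s b)) * (a \o sig (q i)) b +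
                 \sum_i acov (s b) (q i (qB b)) * (a \o dag (t i)) b).
  apply: (scD (@smf R B)); apply: (sc_sum (@smf R B)) => i; apply: (scM (@smf R B)).
  - apply: (smooth_map_fun1 (f := fun e => t i (pA e)) hs.1).
    apply: (smooth_map_fun1 (f := t i) (vproj_smooth VA)).
    exact: dual_section_smooth (fr_dual F i).
  - by apply: h1; exact: fr_sec F i.
  - by apply: acov_smooth => //; exact: fr_sec F i.
  - by apply: h2; exact: fr_dual F i.
have := near_comp (smooth_map_cont (vproj_smooth WB)) (fr_near F).
apply: filterS => b c1.
pose w1 := lincomb VB (index_enum _) (fun i _ => t i (pA (s b))) (fun i => sig (q i)) b.
pose w2 := lincomb VB (index_enum _) (fun i _ => acov (s b) (q i (qB b))) (fun i => dag (t i)) b.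
have ps := section_proj b hs.
have p1 : pB w1 = b.
  apply: section_proj; apply: section_lincomb => i; first exact: (sc_cst (@smf R B)).
  by apply: section_sig; exact: fr_sec F i.
have p2 : pB w2 = b.
  apply: section_proj; apply: section_lincomb => i; first exact: (sc_cst (@smf R B)).
  by apply: section_dag; exact: fr_dual F i.
have s1 i : pB (sig (q i) b) = b by apply: sig_pB; exact: fr_sec F i.
have s2 i : pB (dag (t i) b) = b by apply: dag_pB; exact: fr_dual F i.
have sE : s b = w1 +[VB] w2.
  apply: (pair_sep pm); first by rewrite vproj_add ?p1.
  move=> e; rewrite ps => pe; rewrite (pairDl pm) ?p1 ?p2 // pair_split ?ps //.
  rewrite (pairC pm (e := w1)) ?p1 // (pairC pm (e := w2)) ?p2 //.
  rewrite !covector_lincomb //; try exact: (pair_covectorP pm).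
  rewrite addrC; congr (_ + _).
    rewrite -[LHS]mul1r -c1.
    have := fr_expand F (e := pA (s b)) (a := acov e).
    rewrite base_split ps => ->; last by rewrite -pe; exact: acov_covector.
    by apply: eq_bigr => i _; rewrite /acov pe.
  rewrite -[LHS]mul1r -c1.
  have := fr_expand F (e := pA e) (a := acov (s b)); rewrite base_split pe => ->.
    apply: eq_bigr => i _; rewrite mulrC; congr (_ * _).
    have := @pair_dag (t i) e (fr_dual F i); rewrite pe => <-.
    by rewrite (pairC pm) // s2.
  by have := acov_covector (s b); rewrite ps.
have [aD _] := ca b.
rewrite /= sE aD // /w1 /w2 !covector_lincomb //.
by rewrite -/w1 -/w2 -sE.
Qed.

End Metric.
End MetricDoubleBundles.

(** * Invariant and symmetric brackets *)

Section PreCourant.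
Variables (R : realType) (E N : manifold R) (V : vbundle E N).
Variables (pair : E -> E -> R) (rho : E -> (N -> R) -> R).
Variable br : (N -> E) -> (N -> E) -> N -> E.
Hypotheses (pm : metric V pair) (an : anchored V rho) (bs : bracket_on_sections V br).
Hypothesis inv : forall e1 e2 e3 x,
    section V e1 -> section V e2 -> section V e3 ->
    rho (e1 x) (fun y => pair (e2 y) (e3 y)) =
    pair (br e1 e2 x) (e3 x) + pair (e2 x) (br e1 e3 x).
Hypothesis sym : forall e1 e2 e3 x,
    section V e1 -> section V e2 -> section V e3 ->
    pair (sadd V (br e1 e2) (br e2 e1) x) (e3 x) =
    rho (e3 x) (fun y => pair (e1 y) (e2 y)).

Lemma anchor_tangent s x : section V s -> tangent x (rho (s x)).
Proof. by move=> hs; have [h _ _ _] := an; have := h (s x); rewrite section_proj. Qed.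

Lemma anchor_smooth s f : section V s -> smooth_fun f -> smooth_fun (fun y => rho (s y) f).
Proof.
move=> hs sf; have [_ h _ _] := an.
exact: (smooth_map_fun1 (f := fun e => rho e f) hs.1 (h f sf)).
Qed.

Lemma anchor_dual f : smooth_fun f -> dual_section V (fun e => rho e f).
Proof.
move=> sf; have [_ h1 h2 h3] := an; split; first exact: h1.
by move=> x; split=> [e e' ex ex'|r e ex]; [apply: h2 => //; rewrite ex|exact: h3].
Qed.

Lemma anchor_zero x f : smooth_fun f -> rho (vzero V x) f = 0.
Proof. by move=> sf; rewrite (dual_zero x (anchor_dual sf)). Qed.

Lemma br_section s s' : section V s -> section V s' -> section V (br s s').
Proof. by have [h _ _ _ _] := bs; exact: h. Qed.

Lemma pair_sm s s' : section V s -> section V s' -> smooth_fun (fun y => pair (s y) (s' y)).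
Proof. exact: (pair_smooth pm). Qed.

Hint Resolve br_section pair_sm anchor_smooth section_add section_scale : core.

Lemma pairC_sec s s' x : section V s -> section V s' -> pair (s x) (s' x) = pair (s' x) (s x).
Proof. by move=> hs hs'; apply: (pairC pm); rewrite !section_proj. Qed.

Lemma pair_add_sec s1 s2 s x : section V s1 -> section V s2 -> section V s ->
  pair (sadd V s1 s2 x) (s x) = pair (s1 x) (s x) + pair (s2 x) (s x).
Proof. by move=> *; apply: (pairDl pm); rewrite !section_proj. Qed.

Lemma pair_scale_sec f s s' x : section V s -> section V s' ->
  pair (sscale V f s x) (s' x) = f x * pair (s x) (s' x).
Proof. by move=> *; apply: (pairZl pm); rewrite !section_proj. Qed.

Lemma section_pair_eq s s' : section V s -> section V s' ->
  (forall s1 x, section V s1 -> pair (s x) (s1 x) = pair (s' x) (s1 x)) -> s = s'.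
Proof.
move=> hs hs' h; apply/funext => x; apply: (pair_sep pm); first by rewrite !section_proj.
move=> e; rewrite section_proj // => pe; have [s1 hs1 s1E] := section_through V e.
by rewrite -s1E pe h.
Qed.

Lemma br_invariant e1 e2 e3 x : section V e1 -> section V e2 -> section V e3 ->
  pair (br e1 e2 x) (e3 x) =
  rho (e1 x) (fun y => pair (e2 y) (e3 y)) - pair (e2 x) (br e1 e3 x).
Proof. by move=> h1 h2 h3; rewrite inv // addrK. Qed.

Lemma br_symmetric e1 e2 e3 x : section V e1 -> section V e2 -> section V e3 ->
  pair (br e1 e2 x) (e3 x) + pair (br e2 e1 x) (e3 x) =
  rho (e3 x) (fun y => pair (e1 y) (e2 y)).
Proof. by move=> h1 h2 h3; rewrite -sym // pair_add_sec; auto. Qed.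

(** Neither Leibniz rule is an axiom. This one results from invariance, by applying the derivation
    [rho (e1 x)] to the product of [f] and a pairing; the rule for the first argument then results
    from symmetry, which adds the gradient of [f]. *)
Lemma br_leibniz_r e1 e2 e3 f x : section V e1 -> section V e2 -> section V e3 ->
  smooth_fun f ->
  pair (br e1 (sscale V f e2) x) (e3 x) =
  f x * pair (br e1 e2 x) (e3 x) + rho (e1 x) f * pair (e2 x) (e3 x).
Proof.
move=> h1 h2 h3 sf; rewrite !br_invariant; auto.
rewrite pair_scale_sec; auto.
have -> : (fun y => pair (sscale V f e2 y) (e3 y)) = fun y => f y * pair (e2 y) (e3 y).
  by apply/funext => y; rewrite pair_scale_sec.
rewrite (tangentM (anchor_tangent x h1)); auto; ring.
Qed.

Lemma br_leibniz_l e1 e2 e3 f x : section V e1 -> section V e2 -> section V e3 ->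
  smooth_fun f ->
  pair (br (sscale V f e1) e2 x) (e3 x) =
  f x * pair (br e1 e2 x) (e3 x) - rho (e2 x) f * pair (e1 x) (e3 x) +
  pair (e1 x) (e2 x) * rho (e3 x) f.
Proof.
move=> h1 h2 h3 sf.
have := br_symmetric x (section_scale sf h1) h2 h3.
rewrite br_leibniz_r; auto.
have -> : (fun y => pair (sscale V f e1 y) (e2 y)) = fun y => f y * pair (e1 y) (e2 y).
  by apply/funext => y; rewrite pair_scale_sec.
rewrite (tangentM (anchor_tangent x h3)); auto.
have := br_symmetric x h1 h2 h3 => <-.
move=> h; apply/eqP; rewrite -subr_eq0; apply/eqP; move/eqP: h; rewrite -subr_eq0 => /eqP <-; ring.
Qed.

Lemma br_leibniz_r_sec e1 e2 f : section V e1 -> section V e2 -> smooth_fun f ->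
  br e1 (sscale V f e2) =
  sadd V (sscale V f (br e1 e2)) (sscale V (fun y => rho (e1 y) f) e2).
Proof.
move=> h1 h2 sf; have sr := anchor_smooth h1 sf.
apply: section_pair_eq; auto => s1 x hs1.
by rewrite br_leibniz_r // pair_add_sec ?pair_scale_sec; auto.
Qed.

(** * The anchor defect and the Jacobiator *)

Definition anchor_defect e1 e2 f x :=
  rho (e1 x) (fun y => rho (e2 y) f) - rho (e2 x) (fun y => rho (e1 y) f)
  - rho (br e1 e2 x) f.

Definition jacobiator e1 e2 e3 e4 x :=
  pair (br e1 (br e2 e3) x) (e4 x) - pair (br (br e1 e2) e3 x) (e4 x)
  - pair (br e2 (br e1 e3) x) (e4 x).

(** Invariance and symmetry remove all nested brackets. What remains are anchors applied to pairings
    and pairings of simple brackets, an expression in which permutations of the arguments can be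
    compared. *)
Lemma jacobiatorE e1 e2 e3 e4 x :
  section V e1 -> section V e2 -> section V e3 -> section V e4 ->
  jacobiator e1 e2 e3 e4 x =
  rho (e1 x) (fun y => pair (br e2 e3 y) (e4 y))
  - rho (e2 x) (fun y => pair (br e1 e3 y) (e4 y))
  + rho (e3 x) (fun y => pair (br e1 e2 y) (e4 y))
  - rho (e4 x) (fun y => pair (br e1 e2 y) (e3 y))
  - pair (br e2 e3 x) (br e1 e4 x) + pair (br e1 e3 x) (br e2 e4 x)
  - pair (br e1 e2 x) (br e3 e4 x).
Proof.
move=> h1 h2 h3 h4; rewrite /jacobiator.
rewrite (br_invariant (e1 := e1) (e2 := br e2 e3)); auto.
rewrite (br_invariant (e1 := e2) (e2 := br e1 e3)); auto.
have := br_symmetric x (br_section h1 h2) h3 h4.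
rewrite (br_invariant (e1 := e3) (e2 := br e1 e2)); auto.
move/(canRL (addrK _)) => ->; ring.
Qed.

Lemma jacobiator_scale3 e1 e2 e3 e4 f x :
  section V e1 -> section V e2 -> section V e3 -> section V e4 -> smooth_fun f ->
  jacobiator e1 e2 (sscale V f e3) e4 x =
  f x * jacobiator e1 e2 e3 e4 x + anchor_defect e1 e2 f x * pair (e3 x) (e4 x).
Proof.
move=> h1 h2 h3 h4 sf; have s1 := anchor_smooth h1 sf; have s2 := anchor_smooth h2 sf.
rewrite /jacobiator !br_leibniz_r_sec; auto.
have [_ _ addr _ _] := bs.
rewrite !addr; auto.
rewrite !pair_add_sec; auto.
by rewrite !br_leibniz_r; auto; rewrite !pair_scale_sec; auto; rewrite /anchor_defect; ring.
Qed.

Lemma anchor_defectC e1 e2 f x : anchor_defect e1 e2 f x =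
  - anchor_defect e2 e1 f x - (rho (br e1 e2 x) f + rho (br e2 e1 x) f).
Proof. by rewrite /anchor_defect; ring. Qed.

(** The derivatives of the coefficient cancel against the Leibniz rule of the bracket. In the first
    argument the rule also produces the anchor of a gradient, which is not yet known to vanish;
    hence the asymmetry. *)
Lemma anchor_defect_tensorr e1 f x : section V e1 -> smooth_fun f ->
  section_tensor V x (fun e2 => anchor_defect e1 e2 f x).
Proof.
move=> h1 sf; have t1 := anchor_tangent x h1; have [_ _ addr _ _] := bs.
split=> [e e' he he'|h e sh he]; rewrite /anchor_defect.
  have hE : (fun y => rho (sadd V e e' y) f) = fun y => rho (e y) f + rho (e' y) f.
    by apply/funext => y; rewrite (dual_add (anchor_dual sf)) ?section_proj.
  rewrite addr // hE (tangentD t1); auto.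
  rewrite /sadd (dual_add (anchor_dual sf)) ?section_proj; auto.
  by rewrite (dual_add (anchor_dual (anchor_smooth h1 sf))) ?section_proj //; ring.
have hE : (fun y => rho (sscale V h e y) f) = fun y => h y * rho (e y) f.
  by apply/funext => y; rewrite (dual_scale _ _ (anchor_dual sf)).
have sr := anchor_smooth h1 sh.
rewrite br_leibniz_r_sec // hE (tangentM t1); auto.
rewrite /sadd /sscale (dual_add (anchor_dual sf)) ?vproj_scale ?section_proj; auto.
rewrite !(dual_scale _ _ (anchor_dual sf)).
by rewrite (dual_scale _ _ (anchor_dual (anchor_smooth h1 sf))); ring.
Qed.

(** The symmetric part of the defect is the anchor of the symmetrized bracket, which is the gradient
    of the pairing of [e1] and [e2] and is killed by assumption. *)
Lemma anchor_defect_skew :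
  (forall f g s x, smooth_fun f -> smooth_fun g -> section V s ->
     (forall e, pair (s (vproj V e)) e = rho e f) -> rho (s x) g = 0) ->
  forall e1 e2 f x, section V e1 -> section V e2 -> smooth_fun f ->
    anchor_defect e1 e2 f x = - anchor_defect e2 e1 f x.
Proof.
move=> grad0 e1 e2 f x h1 h2 sf; rewrite anchor_defectC.
have hb12 := br_section h1 h2; have hb21 := br_section h2 h1.
rewrite -(dual_add (anchor_dual sf)) ?section_proj // (_ : rho _ f = 0) ?subr0 //.
apply: (grad0 (fun y => pair (e1 y) (e2 y)) f (sadd V (br e1 e2) (br e2 e1))); auto.
move=> e; have [s hs sE] := section_through V e; rewrite -sE section_proj //.
exact: sym.
Qed.

Section Antisymmetry.
Hypothesis A0 : forall e1 e2 f x, section V e1 -> section V e2 -> smooth_fun f ->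
  anchor_defect e1 e2 f x = 0.

Lemma anchor_br e1 e2 f x : section V e1 -> section V e2 -> smooth_fun f ->
  rho (br e1 e2 x) f =
  rho (e1 x) (fun y => rho (e2 y) f) - rho (e2 x) (fun y => rho (e1 y) f).
Proof. by move=> h1 h2 sf; apply/esym/eqP; rewrite -subr_eq0; apply/eqP; exact: A0. Qed.

Lemma jacobiator_tensor3 e1 e2 e4 x : section V e1 -> section V e2 -> section V e4 ->
  section_tensor V x (fun e3 => jacobiator e1 e2 e3 e4 x).
Proof.
move=> h1 h2 h4; split=> [e e' he he'|f e sf he]; last first.
  by rewrite jacobiator_scale3 // A0 // mul0r addr0.
have [_ addl addr _ _] := bs.
have HE s : section V s -> br s (sadd V e e') = sadd V (br s e) (br s e').
  by move=> hs; apply/funext => y; exact: addr.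
rewrite /jacobiator !HE; auto.
by rewrite !addr ?pair_add_sec; auto; ring.
Qed.

(** The sum of the two Jacobiators is, up to sign, the anchor defect of [e3] and [e4] on the
    function [h], the pairing of [e1] and [e2]. The other transpositions behave alike: the defect is
    that of the two arguments not exchanged, applied to the pairing of the two that are. *)
Lemma jacobiator_swap12 e1 e2 e3 e4 x :
  section V e1 -> section V e2 -> section V e3 -> section V e4 ->
  jacobiator e1 e2 e3 e4 x = - jacobiator e2 e1 e3 e4 x.
Proof.
move=> h1 h2 h3 h4; apply/eqP; rewrite -addr_eq0; apply/eqP; rewrite !jacobiatorE //.
set h := fun y => pair (e1 y) (e2 y).
have sh : smooth_fun h by exact: (pair_smooth pm).
have E3 : rho (e3 x) (fun y => pair (br e1 e2 y) (e4 y)) +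
    rho (e3 x) (fun y => pair (br e2 e1 y) (e4 y)) = rho (e3 x) (fun y => rho (e4 y) h).
  rewrite -(tangentD (anchor_tangent x h3)); auto; congr (rho _ _).
  by apply/funext => y; exact: br_symmetric.
have E4 : rho (e4 x) (fun y => pair (br e1 e2 y) (e3 y)) +
    rho (e4 x) (fun y => pair (br e2 e1 y) (e3 y)) = rho (e4 x) (fun y => rho (e3 y) h).
  rewrite -(tangentD (anchor_tangent x h4)); auto; congr (rho _ _).
  by apply/funext => y; exact: br_symmetric.
have E5 := br_symmetric x h1 h2 (br_section h3 h4).
have E6 := anchor_br x h3 h4 sh; rewrite -/h in E5.
rewrite -E5 -E3 -E4 in E6.
apply/eqP; move/eqP: E6; rewrite -subr_eq0 -oppr_eq0 => /eqP E6; apply/eqP.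
rewrite -[RHS]E6; ring.
Qed.

Lemma jacobiator_swap23 e1 e2 e3 e4 x :
  section V e1 -> section V e2 -> section V e3 -> section V e4 ->
  jacobiator e1 e2 e3 e4 x = - jacobiator e1 e3 e2 e4 x.
Proof.
move=> h1 h2 h3 h4; apply/eqP; rewrite -addr_eq0; apply/eqP; rewrite !jacobiatorE //.
set h := fun y => pair (e2 y) (e3 y).
have sh : smooth_fun h by exact: (pair_smooth pm).
have E3 : rho (e1 x) (fun y => pair (br e2 e3 y) (e4 y)) +
    rho (e1 x) (fun y => pair (br e3 e2 y) (e4 y)) = rho (e1 x) (fun y => rho (e4 y) h).
  rewrite -(tangentD (anchor_tangent x h1)); auto; congr (rho _ _).
  by apply/funext => y; exact: br_symmetric.
have E4 : rho (e4 x) (fun y => pair (br e1 e2 y) (e3 y)) +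
    rho (e4 x) (fun y => pair (br e1 e3 y) (e2 y)) = rho (e4 x) (fun y => rho (e1 y) h).
  rewrite -(tangentD (anchor_tangent x h4)); auto; congr (rho _ _).
  apply/funext => y; rewrite /h inv //; congr (_ + _); apply: pairC_sec; auto.
have E5 := br_symmetric x h2 h3 (br_section h1 h4).
have E6 := anchor_br x h1 h4 sh; rewrite -/h in E5.
rewrite -E5 -E3 -E4 in E6.
apply/eqP; move/eqP: E6; rewrite -subr_eq0 -oppr_eq0 => /eqP E6; apply/eqP.
rewrite -[RHS]E6; ring.
Qed.

Lemma jacobiator_swap34 e1 e2 e3 e4 x :
  section V e1 -> section V e2 -> section V e3 -> section V e4 ->
  jacobiator e1 e2 e3 e4 x = - jacobiator e1 e2 e4 e3 x.
Proof.
move=> h1 h2 h3 h4; apply/eqP; rewrite -addr_eq0; apply/eqP; rewrite !jacobiatorE //.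
set h := fun y => pair (e3 y) (e4 y).
have sh : smooth_fun h by exact: (pair_smooth pm).
have E3 : rho (e1 x) (fun y => pair (br e2 e3 y) (e4 y)) +
    rho (e1 x) (fun y => pair (br e2 e4 y) (e3 y)) = rho (e1 x) (fun y => rho (e2 y) h).
  rewrite -(tangentD (anchor_tangent x h1)); auto; congr (rho _ _).
  apply/funext => y; rewrite /h inv //; congr (_ + _); apply: pairC_sec; auto.
have E4 : rho (e2 x) (fun y => pair (br e1 e3 y) (e4 y)) +
    rho (e2 x) (fun y => pair (br e1 e4 y) (e3 y)) = rho (e2 x) (fun y => rho (e1 y) h).
  rewrite -(tangentD (anchor_tangent x h2)); auto; congr (rho _ _).
  apply/funext => y; rewrite /h inv //; congr (_ + _); apply: pairC_sec; auto.
have E5 := br_symmetric x h3 h4 (br_section h1 h2).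
have E6 := anchor_br x h1 h2 sh; rewrite -/h in E5.
rewrite -E5 -E3 -E4 in E6.
rewrite (pairC_sec x (br_section h2 h4) (br_section h1 h3)).
rewrite (pairC_sec x (br_section h2 h3) (br_section h1 h4)).
rewrite (pairC_sec x (br_section h3 h4) (br_section h1 h2)) in E6.
rewrite (pairC_sec x (br_section h4 h3) (br_section h1 h2)) in E6.
apply/eqP; move/eqP: E6; rewrite -subr_eq0 -oppr_eq0 => /eqP E6; apply/eqP.
rewrite -[RHS]E6; ring.
Qed.

End Antisymmetry.

(** * Consequences of the Jacobi identity for the anchor *)

Hypothesis jac : forall e1 e2 e3, section V e1 -> section V e2 -> section V e3 ->
  br e1 (br e2 e3) =1 sadd V (br (br e1 e2) e3) (br e2 (br e1 e3)).

Lemma jacobiator0 e1 e2 e3 e4 x :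
  section V e1 -> section V e2 -> section V e3 -> section V e4 ->
  jacobiator e1 e2 e3 e4 x = 0.
Proof.
by move=> h1 h2 h3 h4; rewrite /jacobiator jac // pair_add_sec; auto; ring.
Qed.

(** The arguments below divide by a nonzero pairing. Where there is none, nondegeneracy makes the
    fibre zero and the anchor vanishes on it. *)
Lemma pair_dichotomy x : (exists s s', [/\ section V s, section V s' & pair (s x) (s' x) != 0])
  \/ (forall s, section V s -> s x = vzero V x).
Proof.
have [h|h] := pselect (exists s s', [/\ section V s, section V s' & pair (s x) (s' x) != 0]).
  by left.
right=> s hs; apply: (pair_sep pm); first by rewrite section_proj // vproj_zero.
move=> e pe; rewrite section_proj // in pe.
rewrite -{2}pe (pair0l pm); apply/eqP/negPn/negP => n0; apply: h.
have [s' hs' s'E] := section_through V e; exists s, s'; split => //.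
by rewrite -{2}pe s'E.
Qed.

(** The defect of the anchor to be a morphism is the coefficient of the failure of
    the Jacobi identity to be tensorial. *)
Lemma jacobi_anchor e1 e2 f x : section V e1 -> section V e2 -> smooth_fun f ->
  anchor_defect e1 e2 f x = 0.
Proof.
move=> h1 h2 sf; have [[s [s' [hs hs' n0]]]|z] := pair_dichotomy x.
  have := jacobiator_scale3 x h1 h2 hs hs' sf.
  rewrite !jacobiator0; auto; rewrite mulr0 add0r => /esym/eqP.
  by rewrite mulf_eq0 (negbTE n0) orbF => /eqP.
have s1 := anchor_smooth h1 sf; have s2 := anchor_smooth h2 sf.
rewrite /anchor_defect (z _ h1) (z _ h2) (z _ (br_section h1 h2)) !anchor_zero //.
by rewrite !subr0.
Qed.

Lemma anchor_symmetric0 e1 e2 f x : section V e1 -> section V e2 -> smooth_fun f ->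
  rho (sadd V (br e1 e2) (br e2 e1) x) f = 0.
Proof.
move=> h1 h2 sf; rewrite (dual_add (anchor_dual sf)) ?section_proj; auto.
have := anchor_defectC e1 e2 f x; rewrite !jacobi_anchor // oppr0 sub0r.
by move/esym/eqP; rewrite oppr_eq0 => /eqP.
Qed.

(** The symmetrized bracket of [h s] and [s'] is [h] times that of [s] and [s'] plus the pairing of
    [s] and [s'] times the gradient of [h]. The anchor kills both symmetrized brackets, and the
    coefficient of the gradient is not zero at [x]. *)
Lemma anchor_grad g h f x : section V g -> smooth_fun h -> smooth_fun f ->
  (forall e, vproj V e = x -> pair (g x) e = rho e h) -> rho (g x) f = 0.
Proof.
move=> hg sh sf gE; have [[s [s' [hs hs' n0]]]|z] := pair_dichotomy x; last first.
  by rewrite z // anchor_zero.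
have hhs := section_scale sh hs.
pose s1 := sadd V (br (sscale V h s) s') (br s' (sscale V h s)).
pose s0 := sadd V (br s s') (br s' s).
have hs1 : section V s1 by rewrite /s1; auto.
have hs0 : section V s0 by rewrite /s0; auto.
have E1 : s1 x = (h x *[V] s0 x) +[V] (pair (s x) (s' x) *[V] g x).
  apply: (pair_sep pm).
    by rewrite vproj_add ?vproj_scale ?section_proj.
  move=> e; rewrite section_proj // => pe.
  rewrite (pairDl pm) ?(pairZl pm) ?vproj_scale ?section_proj // gE //.
  have [s2 hs2 s2E] := section_through V e; rewrite pe in s2E.
  rewrite -s2E sym // sym //.
  have -> : (fun y => pair (sscale V h s y) (s' y)) = fun y => h y * pair (s y) (s' y).
    by apply/funext => y; rewrite pair_scale_sec.
  by rewrite (tangentM (anchor_tangent x hs2)); auto.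
have := anchor_symmetric0 x hhs hs' sf; rewrite -/s1 E1.
rewrite (dual_add (anchor_dual sf)) ?vproj_scale ?section_proj //.
rewrite !(dual_scale _ _ (anchor_dual sf)) /s0 anchor_symmetric0 // mulr0 add0r.
by move/eqP; rewrite mulf_eq0 (negbTE n0) => /eqP.
Qed.

End PreCourant.

(** * Structures determined by their values on generators *)

Section SplitStructure.
Variables (R : realType) (E Q B M : manifold R) (DD : dvb E Q B M).
Variables (pair : E -> E -> R) (S : Q -> B -> E).
Hypotheses (md : metric_dvb DD pair) (lag : lagrangian_splitting DD pair S).

Local Notation VA := (dA DD).
Local Notation VB := (dB DD).
Local Notation WQ := (sA DD).
Local Notation WB := (sB DD).
Local Notation pA := (vproj VA).
Local Notation pB := (vproj VB).
Local Notation qA := (vproj WQ).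
Local Notation qB := (vproj WB).
Local Notation dag := (dual_dagger DD pair).
Local Notation sig := (horizontal_lift DD S).
Local Notation ac := (acov DD pair S).

Let pm : metric VB pair := md_metric md.
Let ls : linear_splitting DD S := lag_linear lag.

Lemma sig_add q q' : section WQ q -> section WQ q' ->
  sig (sadd WQ q q') = sadd VB (sig q) (sig q').
Proof.
move=> hq hq'; apply/funext => b.
by rewrite /horizontal_lift /sadd (ls_addA ls) // section_proj.
Qed.

Lemma sig_scale f q : section WQ q -> sig (sscale WQ f q) = sscale VB (f \o qB) (sig q).
Proof.
move=> hq; apply/funext => b.
by rewrite /horizontal_lift /sscale (ls_scaleA ls) // section_proj.
Qed.

Lemma dag_add tau tau' : dual_section WQ tau -> dual_section WQ tau' ->
  dag (fun e => tau e + tau' e) = sadd VB (dag tau) (dag tau').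
Proof.
move=> d1 d2; have d3 := dual_sectionD d1 d2; apply/funext => b.
have p1 := dag_pB md b d1; have p2 := dag_pB md b d2.
apply: (E_sep md lag); rewrite /sadd.
- by rewrite vproj_add p1 ?p2 // (dag_pB md).
- rewrite (pA_addB) ?p1 ?p2 // !(dag_pA md) //.
  by rewrite -{3}(vproj_zero WQ (qB b)) vaddr0.
move=> q; rewrite (dag_pB md) // => hq.
by rewrite (acovD md lag) ?p1 ?p2 // !(dag_acov md lag).
Qed.

Lemma dag_scale f tau : smooth_fun f -> dual_section WQ tau ->
  dag (fun e => f (qA e) * tau e) = sscale VB (f \o qB) (dag tau).
Proof.
move=> sf d1; have d3 := dual_sectionM sf d1; apply/funext => b.
have p1 := dag_pB md b d1.
apply: (E_sep md lag); rewrite /sscale.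
- by rewrite vproj_scale p1 // (dag_pB md).
- rewrite pA_scaleB !(dag_pA md) //; apply: (dual_sep (V := WQ)).
    by rewrite vproj_scale vproj_zero.
  by move=> t dt; rewrite dual_scale // dual_zero // mulr0.
move=> q; rewrite (dag_pB md) // => hq.
by rewrite (acovZ md lag) ?p1 // !(dag_acov md lag) //= hq.
Qed.

Variables (rho : Q -> (M -> R) -> R) (del : M -> (Q -> R) -> B).
Variables (Delta : (M -> Q) -> (Q -> R) -> Q -> R).
Variables (nabla : (M -> Q) -> (M -> B) -> M -> B).
Variables (Om : Q -> Q -> B -> Q -> R) (brQ : (M -> Q) -> (M -> Q) -> M -> Q).
Hypotheses (anr : anchored WQ rho) (dbm : dual_bundle_map WQ WB del).

Lemma del_section t : dual_section WQ t -> section WB (fun m => del m t).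
Proof.
move=> dt; split; first exact: (dbm_smooth dbm).
by move=> m; apply: (dbm_proj dbm); exact: dual_sectionP.
Qed.

Section Forms.
Hypothesis hO : hom_two_form WQ WB Om.

Lemma om_section_dual q1 q2 b : section WQ q1 -> section WQ q2 -> section WB b ->
  dual_section WQ (om_section WQ Om q1 q2 b).
Proof.
move=> h1 h2 hb; apply: dual_section_of_smooth.
  move=> m; have := htf_4 hO (q1 := q1 m) (q2 := q2 m) (b := b m).
  rewrite !section_proj // => /(_ erefl erefl); apply: covector_eq.
  by move=> e em; rewrite /om_section em.
move=> q hq; have := htf_smooth hO h1 h2 hb hq.
rewrite (_ : (fun _ => _) = om_section WQ Om q1 q2 b \o q) //.
by apply/funext => m; rewrite /om_section /= section_proj.
Qed.

Lemma om_star_dual q1 q2 q3 : section WQ q1 -> section WQ q2 -> section WQ q3 ->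
  dual_section WB (om_star WB Om q1 q2 q3).
Proof.
move=> h1 h2 h3; apply: dual_section_of_smooth.
  move=> m; have := htf_3 hO (q1 := q1 m) (q2 := q2 m) (q3 := q3 m).
  rewrite !section_proj // => /(_ erefl erefl); apply: covector_eq.
  by move=> e em; rewrite /om_star em.
move=> b hb; have := htf_smooth hO h1 h2 hb h3.
rewrite (_ : (fun _ => _) = om_star WB Om q1 q2 q3 \o b) //.
by apply/funext => m; rewrite /om_star /= section_proj.
Qed.

End Forms.

(** * Anchor defect and Jacobiator on generators, in the form shared by both directions *)

Variables (Theta : E -> (B -> R) -> R) (br : (B -> E) -> (B -> E) -> B -> E).
Hypotheses (an : anchored VB Theta) (bs : bracket_on_sections VB br).
Hypothesis inv : forall e1 e2 e3 x,
    section VB e1 -> section VB e2 -> section VB e3 ->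
    Theta (e1 x) (fun y => pair (e2 y) (e3 y)) =
    pair (br e1 e2 x) (e3 x) + pair (e2 x) (br e1 e3 x).
Hypothesis sym : forall e1 e2 e3 x,
    section VB e1 -> section VB e2 -> section VB e3 ->
    pair (sadd VB (br e1 e2) (br e2 e1) x) (e3 x) =
    Theta (e3 x) (fun y => pair (e1 y) (e2 y)).
Hypothesis Th_basic : forall e f, smooth_fun f -> Theta e (f \o qB) = rho (pA e) f.
Hypothesis Th_dag : forall tau b l, dual_section WQ tau -> dual_section WB l ->
  Theta (dag tau b) l = l (del (qB b) tau).

Lemma Th_split e l : dual_section WB l ->
  Theta e l = Theta (S (pA e) (pB e)) l + l (del (qB (pB e)) (ac e)).
Proof.
move=> dl; have [q [tau [hq dt qE tE eE]]] := gen_through md lag e.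
have sl := dual_section_smooth dl.
rewrite -{1}eE (dual_add (anchor_dual an sl)); last first.
  by rewrite (sig_pB lag) // (dag_pB md).
rewrite Th_dag // {1}/horizontal_lift qE; congr (_ + l _).
by apply: (dbm_fibre dbm) => q' hq'; exact: tE.
Qed.

Hypothesis Th_sig : forall q b l m, section WQ q -> section WB b -> dual_section WB l ->
  Theta (sig q (b m)) l = rho (q m) (l \o b) - l (nabla q b m).
Hypothesis Th_sig_dual : forall q l, section WQ q -> dual_section WB l ->
  dual_section WB (fun b => Theta (sig q b) l).
Hypothesis nabla_section : forall q b, section WQ q -> section WB b ->
  section WB (nabla q b).
Hypothesis Delta_section : forall q t, section WQ q -> dual_section WQ t ->
  dual_section WQ (Delta q t).
Hypothesis brQ_section : forall q1 q2, section WQ q1 -> section WQ q2 ->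
  section WQ (brQ q1 q2).
Hypothesis br_sig_pA : forall q1 q2 b, section WQ q1 -> section WQ q2 ->
  pA (br (sig q1) (sig q2) b) = brQ q1 q2 (qB b).
Hypothesis br_sig_acov : forall q1 q2 b q, section WQ q1 -> section WQ q2 -> qA q = qB b ->
  ac (br (sig q1) (sig q2) b) q = - Om (q1 (qB b)) (q2 (qB b)) b q.
Hypothesis br_sig_dag : forall q t, section WQ q -> dual_section WQ t ->
  br (sig q) (dag t) = dag (Delta q t).

Let ssig q : section WQ q -> section VB (sig q) := @section_sig _ _ _ _ _ _ _ _ lag q.
Let sdag t : dual_section WQ t -> section VB (dag t) := @section_dag _ _ _ _ _ _ _ _ md lag t.
Let bsec s s' : section VB s -> section VB s' -> section VB (br s s') :=
  @br_section _ _ _ _ _ bs s s'.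

Hint Resolve ssig sdag bsec Delta_section brQ_section nabla_section Th_sig_dual
  dual_section_smooth : core.

Lemma pair_sig_sig q q' b : section WQ q -> section WQ q' -> pair (sig q b) (sig q' b) = 0.
Proof.
by move=> hq hq'; apply: (lag_isotropic lag); rewrite section_proj.
Qed.

Lemma pair_dag_sig t q b : dual_section WQ t -> section WQ q ->
  pair (dag t b) (sig q b) = t (q (qB b)).
Proof.
move=> dt hq; have := pair_dag md lag (sig q b) dt.
by rewrite (sig_pB lag) // (sig_pA lag).
Qed.

Lemma pair_sig_dag t q b : dual_section WQ t -> section WQ q ->
  pair (sig q b) (dag t b) = t (q (qB b)).
Proof.
move=> dt hq; rewrite (pairC pm) ?pair_dag_sig //.
by rewrite (sig_pB lag) // (dag_pB md).
Qed.

Lemma pair_dag_dag t t' b : dual_section WQ t -> dual_section WQ t' ->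
  pair (dag t b) (dag t' b) = 0.
Proof.
move=> dt dt'; have := pair_dag md lag (dag t' b) dt.
by rewrite (dag_pB md) // (dag_pA md) // dual_zero.
Qed.

Lemma br_ss_sig q1 q2 q3 b : section WQ q1 -> section WQ q2 -> section WQ q3 ->
  pair (br (sig q1) (sig q2) b) (sig q3 b) = - om_star WB Om q1 q2 q3 b.
Proof.
move=> h1 h2 h3; rewrite /om_star -br_sig_acov //; last by rewrite section_proj.
by rewrite /acov section_proj //; auto.
Qed.

Lemma br_ss_dag q1 q2 t b : section WQ q1 -> section WQ q2 -> dual_section WQ t ->
  pair (br (sig q1) (sig q2) b) (dag t b) = t (brQ q1 q2 (qB b)).
Proof.
move=> h1 h2 dt; have hb : section VB (br (sig q1) (sig q2)) by auto.
rewrite (pairC pm) ?(dag_pB md) ?(section_proj b hb) //.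
have := pair_dag md lag (br (sig q1) (sig q2) b) dt.
by rewrite (section_proj b hb) br_sig_pA.
Qed.

Lemma br_ss_ss q1 q2 q3 q4 b :
  section WQ q1 -> section WQ q2 -> section WQ q3 -> section WQ q4 ->
  pair (br (sig q1) (sig q2) b) (br (sig q3) (sig q4) b) =
  - om_star WB Om q1 q2 (brQ q3 q4) b - om_star WB Om q3 q4 (brQ q1 q2) b.
Proof.
move=> h1 h2 h3 h4; have hb12 : section VB (br (sig q1) (sig q2)) by auto.
have hb34 : section VB (br (sig q3) (sig q4)) by auto.
have p12 := brQ_section h1 h2; have p34 := brQ_section h3 h4.
rewrite (pair_split md lag) ?section_proj // !br_sig_pA // !br_sig_acov //.
- by rewrite section_proj.
- by rewrite section_proj.
Qed.

Lemma br_dag_sig t q e : dual_section WQ t -> section WQ q ->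
  pair (br (dag t) (sig q) (pB e)) e = rho (pA e) (t \o q) - Delta q t (pA e).
Proof.
move=> dt hq; have [s hs sE] := section_through VB e.
have := br_symmetric pm bs sym (pB e) (sdag dt) (ssig hq) hs.
rewrite sE => /(canRL (addrK _)) ->; congr (_ - _).
  rewrite -Th_basic; last exact: (dual_smooth_on dt hq).
  by congr (Theta _ _); apply/funext => y; rewrite pair_dag_sig.
by rewrite br_sig_dag // (pair_dag md lag) //; auto.
Qed.

(** The gradient [g] of the linear function [xi1] projects to the image [q1] of [xi1] under the
    transpose of [del], and its core component is [xi1] differentiated along lifts. Its anchor on
    [xi2] therefore has one term for each of [q1] and [q2], and together they are the left-hand side
    of (D3). *)
Lemma anchor_grad_split xi1 xi2 q1 q2 g b m :
  dual_section WB xi1 -> dual_section WB xi2 -> section WQ q1 -> section WQ q2 ->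
  (forall t m, dual_section WQ t -> t (q1 m) = xi1 (del m t)) ->
  (forall t m, dual_section WQ t -> t (q2 m) = xi2 (del m t)) ->
  section VB g -> (forall e, pair (g (pB e)) e = Theta e xi1) -> section WB b ->
  Theta (g (b m)) xi2 =
  dual_connection rho nabla q1 xi2 b m + dual_connection rho nabla q2 xi1 b m.
Proof.
move=> d1 d2 h1 h2 e1 e2 hg gE hb; have bm := section_proj m hb.
have gb : pB (g (b m)) = b m by exact: section_proj.
have gA : pA (g (b m)) = q1 m.
  apply: (dual_sep (V := WQ)) => [|t dt]; first by rewrite base_split gb bm section_proj.
  have := pair_dag md lag (g (b m)) dt; rewrite gb => <-; rewrite e1 //.
  have := gE (dag t (b m)); rewrite (dag_pB md) // Th_dag // bm => <-.
  by apply: (pairC pm); rewrite (dag_pB md) // gb.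
have ge q : qA q = m -> ac (g (b m)) q = Theta (S q (b m)) xi1.
  by move=> hq; have := gE (S q (b m)); rewrite /acov gb (split_pB lag) // hq bm.
have [t dt tE] := dual_through (acov_covector md lag (g (b m))); rewrite gb bm in tE.
have tdel : del m (ac (g (b m))) = del m t.
  by apply: (dbm_fibre dbm) => q hq; rewrite tE.
rewrite Th_split // gA gb bm tdel -e2 // tE ?section_proj // ge ?section_proj //.
have SE q : section WQ q -> S (q m) (b m) = sig q (b m) by rewrite /horizontal_lift bm.
by rewrite !SE // !Th_sig.
Qed.

Lemma anchor_defect_ss_basic q1 q2 f b : section WQ q1 -> section WQ q2 -> smooth_fun f ->
  anchor_defect Theta br (sig q1) (sig q2) (f \o qB) b =
  rho (q1 (qB b)) (fun m => rho (q2 m) f) - rho (q2 (qB b)) (fun m => rho (q1 m) f)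
  - rho (brQ q1 q2 (qB b)) f.
Proof.
move=> h1 h2 sf; rewrite /anchor_defect.
have HE q : section WQ q -> (fun y => Theta (sig q y) (f \o qB)) = (fun m => rho (q m) f) \o qB.
  by move=> hq; apply/funext => y; rewrite Th_basic // (sig_pA lag).
rewrite !HE // !Th_basic ?(sig_pA lag) // ?br_sig_pA //.
- exact: (anchor_smooth anr).
- exact: (anchor_smooth anr).
Qed.

(** The second derivatives of [l \o b] cancel by the compatibility of [brQ] with [rho]. The
    curvature of [nabla] remains, and the core component of the bracket contributes [del] of [Om],
    so the vanishing of the right-hand side is the first part of (D4). The covector [a] stands for
    [Om] restricted to the fibre. *)
Lemma anchor_defect_ss_linear q1 q2 b l m (a : Q -> R) :
  section WQ q1 -> section WQ q2 -> section WB b ->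
  dual_section WB l -> covector WQ m a ->
  (forall q, qA q = m -> a q = Om (q1 m) (q2 m) (b m) q) ->
  (forall f, smooth_fun f -> rho (brQ q1 q2 m) f =
     rho (q1 m) (fun m => rho (q2 m) f) - rho (q2 m) (fun m => rho (q1 m) f)) ->
  anchor_defect Theta br (sig q1) (sig q2) l (b m) =
  l (del m a) - l (nabla q1 (nabla q2 b) m) + l (nabla q2 (nabla q1 b) m)
  + l (nabla (brQ q1 q2) b m).
Proof.
move=> h1 h2 hb dl ca aE hrho; rewrite /anchor_defect.
have slb := dual_smooth_on dl hb; have hbm := section_proj m hb.
have pbr : pB (br (sig q1) (sig q2) (b m)) = b m by apply: section_proj; auto.
have X q q' : section WQ q -> section WQ q' ->
    Theta (sig q (b m)) (fun y => Theta (sig q' y) l) =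
    rho (q m) (fun m => rho (q' m) (l \o b)) - rho (q m) (l \o nabla q' b)
    - rho (q' m) (l \o nabla q b) + l (nabla q' (nabla q b) m).
  move=> hq hq'; rewrite Th_sig //; last exact: Th_sig_dual.
  rewrite Th_sig // ?opprB ?addrA; last exact: nabla_section.
  have -> : (fun y => Theta (sig q' y) l) \o b =
      (fun m => rho (q' m) (l \o b) + -1 * (l \o nabla q' b) m).
    by apply/funext => m' /=; rewrite Th_sig // mulN1r.
  have sn : smooth_fun (l \o nabla q' b) by apply: (dual_smooth_on dl); auto.
  have t1 := anchor_tangent anr m hq.
  rewrite (tangentD t1) ?(tangentZ t1) //; last 2 first.
  - exact: (anchor_smooth anr).
  - exact: (scZ (@smf R M)).
  by rewrite mulN1r; ring.
rewrite !X // Th_split // br_sig_pA // pbr hbm.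
have -> : S (brQ q1 q2 m) (b m) = sig (brQ q1 q2) (b m) by rewrite /horizontal_lift hbm.
rewrite Th_sig //; auto; rewrite hrho //.
have -> : del m (ac (br (sig q1) (sig q2) (b m))) = -1 *[WB] del m a.
  rewrite -(dbm_scale dbm _ ca); apply: (dbm_fibre dbm) => q hq.
  by rewrite br_sig_acov ?hbm // -aE // mulN1r.
by rewrite dual_scale //; ring.
Qed.

Lemma anchor_defect_sd_basic q t f b : section WQ q -> dual_section WQ t -> smooth_fun f ->
  anchor_defect Theta br (sig q) (dag t) (f \o qB) b = 0.
Proof.
move=> hq dt sf; rewrite /anchor_defect br_sig_dag //.
have sr : smooth_fun (fun m => rho (q m) f) by exact: (anchor_smooth anr).
have z t' y : dual_section WQ t' -> forall f', smooth_fun f' -> Theta (dag t' y) (f' \o qB) = 0.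
  by move=> dt' f' sf'; rewrite Th_basic // (dag_pA md) // (anchor_zero anr).
rewrite [X in _ - X]z ?subr0 //; last by auto.
rewrite (_ : (fun y => Theta (dag t y) _) = fun=> 0); last by apply/funext => y; exact: z.
rewrite (tangent_cst (anchor_tangent an b (ssig hq))) sub0r.
rewrite (_ : (fun y => Theta (sig q y) _) = (fun m => rho (q m) f) \o qB).
  by rewrite z ?oppr0.
by apply/funext => y; rewrite Th_basic // (sig_pA lag).
Qed.

(** The anchor of a core section is vertical, so it sends [l] to a basic function, on which the lift
    acts by [rho]. The right-hand side vanishes by (D1) and, conversely, its vanishing for all [l]
    gives (D1). *)
Lemma anchor_defect_sd_linear q t l b : section WQ q -> dual_section WQ t ->
  dual_section WB l ->
  anchor_defect Theta br (sig q) (dag t) l b =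
  l (nabla q (fun m => del m t) (qB b)) - l (del (qB b) (Delta q t)).
Proof.
move=> hq dt dl; have hd := del_section dt; have dD := Delta_section hq dt.
rewrite /anchor_defect br_sig_dag // (Th_dag b dt (Th_sig_dual hq dl)) (Th_dag b dD dl).
congr (_ - _).
rewrite (_ : (fun y => Theta (dag t y) l) = (l \o (fun m => del m t)) \o qB); last first.
  by apply/funext => y; rewrite Th_dag.
rewrite Th_basic ?(sig_pA lag) //; last exact: (dual_smooth_on dl hd).
by rewrite (@Th_sig q (fun m => del m t)) //; ring.
Qed.

(** The curvature of [Delta] comes from brackets of lifts with core sections, and [Om] at [del m t]
    from differentiating the linear function [om_star] along the vertical vector of [dag t]. The
    vanishing of the right-hand side is the second part of (D4). *)
Lemma jacobiator_sdt q1 q2 t q3 b :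
  section WQ q1 -> section WQ q2 -> dual_section WQ t -> section WQ q3 ->
  hom_two_form WQ WB Om -> dual_dull_bracket WQ rho Delta brQ ->
  (forall q q', section WQ q -> section WQ q' ->
     brQ q q' =1 sscale WQ (cst (-1)) (brQ q' q)) ->
  let m := qB b in
  jacobiator pair br (sig q1) (sig q2) (dag t) (sig q3) b =
  Delta q1 (Delta q2 t) (q3 m) - Delta q2 (Delta q1 t) (q3 m)
  - Delta (brQ q1 q2) t (q3 m) - Om (q1 m) (q2 m) (del m t) (q3 m).
Proof.
move=> h1 h2 dt h3 hO dull skew m.
have h12 := brQ_section h1 h2.
rewrite /jacobiator !br_sig_dag //; auto; rewrite !pair_dag_sig; auto.
have hb12 : section VB (br (sig q1) (sig q2)) by auto.
have := br_symmetric pm bs sym b hb12 (sdag dt) (ssig h3).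
rewrite (br_invariant inv (e1 := dag t)); auto.
rewrite (_ : (fun y => pair (br (sig q1) (sig q2) y) (dag t y)) = (t \o brQ q1 q2) \o qB); last first.
  by apply/funext => y; rewrite br_ss_dag.
rewrite Th_basic ?(sig_pA lag) //; last exact: (dual_smooth_on dt h12).
rewrite (_ : (fun y => pair (br (sig q1) (sig q2) y) (sig q3 y)) =
   fun y => -1 * om_star WB Om q1 q2 q3 y); last first.
  by apply/funext => y; rewrite br_ss_sig // mulN1r.
have dom := om_star_dual hO h1 h2 h3; have sm := dual_section_smooth dom.
rewrite (tangentZ (anchor_tangent an b (sdag dt))); auto.
rewrite Th_dag // /om_star (section_proj (qB b) (del_section dt)).
have := br_dag_sig (br (sig q1) (sig q2) b) dt h3.
rewrite (section_proj b hb12) (pairC_sec pm b) //; auto.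
move=> ->; rewrite br_sig_pA // -/m.
move/(canRL (addrK _)) => ->.
(* Skew-symmetry of [brQ] equates the two expressions that duality with [Delta] gives for [t] on the
   bracket of [q3] with [brQ q1 q2]. *)
have [_ d1] := dull q3 (brQ q1 q2) h3 h12.
have [_ d2] := dull (brQ q1 q2) q3 h12 h3.
have := d1 t m dt; have := d2 t m dt; rewrite (skew _ _ h3 h12) /sscale dual_scale //=.
by move=> -> /eqP; rewrite -subr_eq0 => /eqP h; rewrite -[RHS]addr0 -h; ring.
Qed.

(** In [jacobiatorE] each anchor term becomes a dual connection applied to some [om_star], and each
    pairing of two brackets becomes two values of [om_star], by isotropy of lifts and of core
    sections. Regrouped through [Z] and [W] these are the two sides of (D6). *)
Lemma jacobiator_ssss q1 q2 q3 q4 b m :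
  section WQ q1 -> section WQ q2 -> section WQ q3 -> section WQ q4 -> section WB b ->
  hom_two_form WQ WB Om -> dual_dull_bracket WQ rho Delta brQ ->
  (forall q1 q2 q3 b, qA q1 = qB b -> qA q2 = qB b -> qA q3 = qB b ->
    Om q1 q2 b q3 = - Om q1 q3 b q2) ->
  let loz p p1 p2 := lozenge Delta nabla p (om_section WQ Om p1 p2) b (q4 m) in
  let om p1 p2 := om_section WQ Om p1 p2 b (q4 m) in
  jacobiator pair br (sig q1) (sig q2) (sig q3) (sig q4) (b m) =
  dual_connection rho nabla q4 (om_star WB Om q1 q2 q3) b m -
  (loz q1 q2 q3 - loz q2 q1 q3 + loz q3 q1 q2
      - om (brQ q1 q2) q3 + om (brQ q1 q3) q2 - om (brQ q2 q3) q1).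
Proof.
move=> h1 h2 h3 h4 hb hO dull D5 loz om.
have hbm := section_proj m hb.
rewrite (jacobiatorE pm bs inv sym); auto.
have HE i j k : section WQ i -> section WQ j -> section WQ k ->
    (fun y => pair (br (sig i) (sig j) y) (sig k y)) = fun y => -1 * om_star WB Om i j k y.
  by move=> hi hj hk; apply/funext => y; rewrite br_ss_sig // mulN1r.
have X p i j k : section WQ p -> section WQ i -> section WQ j -> section WQ k ->
    Theta (sig p (b m)) (fun y => pair (br (sig i) (sig j) y) (sig k y)) =
    - dual_connection rho nabla p (om_star WB Om i j k) b m.
  move=> hp hi hj hk; have dom := om_star_dual hO hi hj hk; have sm := dual_section_smooth dom.
  rewrite HE // (tangentZ (anchor_tangent an (b m) (ssig hp))) //.
  by rewrite Th_sig // mulN1r.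
have Z p i j : section WQ p -> section WQ i -> section WQ j ->
    loz p i j = dual_connection rho nabla p (om_star WB Om i j q4) b m -
       om_star WB Om i j (brQ p q4) (b m).
  move=> hp hi hj; rewrite /loz /lozenge /dual_connection /dual_derivation.
  have dom := om_section_dual hO hi hj hb.
  have [_ d1] := dull p q4 hp h4; have := d1 _ m dom.
  rewrite (_ : om_section WQ Om i j b \o q4 = om_star WB Om i j q4 \o b); last first.
    by apply/funext => x; rewrite /om_section /om_star /= !section_proj.
  rewrite {1}/om_section (section_proj m (brQ_section hp h4)).
  rewrite /om_section /om_star hbm (section_proj m h4).
  rewrite (section_proj m (nabla_section hp hb)) => /eqP; rewrite -subr_eq0 => /eqP h.
  by rewrite -[RHS]addr0 -h; ring.
(* The alternation of [Om] followed by (D5) moves the bracket from the first slot of the form to the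
   last. *)
have W i j k : section WQ i -> section WQ j -> section WQ k ->
    om (brQ i j) k = om_star WB Om k q4 (brQ i j) (b m).
  move=> hi hj hk; rewrite /om /om_section /om_star hbm (section_proj m h4).
  have hij := brQ_section hi hj.
  rewrite (htf_alt hO) ?section_proj // D5 ?section_proj ?opprK //.
rewrite !X // !br_ss_ss // !Z // !W //.
by ring.
Qed.

End SplitStructure.

(** * From VB-Courant algebroids to Dorfman 2-representations *)

Section SplitUnique.
Variables (R : realType) (E Q B M : manifold R) (DD : dvb E Q B M).
Variables (pair : E -> E -> R) (S : Q -> B -> E).
Hypotheses (md : metric_dvb DD pair) (lag : lagrangian_splitting DD pair S).

Local Notation VA := (dA DD).
Local Notation VB := (dB DD).
Local Notation WQ := (sA DD).
Local Notation WB := (sB DD).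
Local Notation pA := (vproj VA).
Local Notation pB := (vproj VB).
Local Notation qA := (vproj WQ).
Local Notation qB := (vproj WB).
Local Notation dag := (dual_dagger DD pair).
Local Notation sig := (horizontal_lift DD S).
Local Notation ac := (acov DD pair S).

Lemma dag_inj t t' : dual_section WQ t -> dual_section WQ t' -> dag t = dag t' -> t = t'.
Proof.
move=> dt dt' tt'; apply/funext => e.
have z : qA e = qB (vzero WB (qA e)) by rewrite vproj_zero.
have := pair_dag md lag (S e (vzero WB (qA e))) dt.
have := pair_dag md lag (S e (vzero WB (qA e))) dt'.
by rewrite (split_pA lag) // (split_pB lag) // tt' => -> ->.
Qed.

Lemma sub_hom_tilde (phi : B -> Q -> R) q e b :
  (forall b, covector WQ (qB b) (phi b)) -> section WQ q -> pB e = b ->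
  pA e = q (qB b) -> (forall q', qA q' = qB b -> ac e q' = - phi b q') ->
  e = sadd VB (sig q) (sscale VB (cst (-1)) (hom_tilde DD pair phi)) b.
Proof.
move=> cphi hq eB eA eq; rewrite /sadd /sscale /hom_tilde.
have [hc _] := core_ofP md (cphi b).
set k := core_at _ _ _; have kB : pB k = b by exact: core_at_pB.
have kA : pA k = vzero WQ (qB b) by exact: core_at_pA.
have sB := sig_pB lag b hq.
have skB : pB (cst (-1) b *[VB] k) = b by rewrite vproj_scale.
apply: (E_sep md lag).
- by rewrite vproj_add ?skB sB.
- rewrite pA_addB ?skB ?sB // (sig_pA lag) // pA_scaleB kA eA.
  by rewrite vscale_zero -{3}(section_proj (qB b) hq) vaddr0.
move=> q'; rewrite eB => hq'; rewrite eq // (acovD md lag) ?skB ?sB // (acovZ md lag) ?kB //.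
by rewrite (sig_acov lag) // add0r (core_at_acov md lag) //= mulN1r.
Qed.

End SplitUnique.

Section VBCourantToDorfman.
Variables (R : realType) (E Q B M : manifold R) (DD : dvb E Q B M).
Variables (pair : E -> E -> R) (S : Q -> B -> E).
Variables (Theta : E -> (B -> R) -> R) (rho : Q -> (M -> R) -> R).
Variables (br : (B -> E) -> (B -> E) -> B -> E) (del : M -> (Q -> R) -> B).
Hypotheses (vc : vb_courant DD pair Theta rho br).
Hypotheses (dbm : dual_bundle_map (sA DD) (sB DD) del).
Hypotheses (canc : core_anchor DD pair Theta del) (lag : lagrangian_splitting DD pair S).

Local Notation VA := (dA DD).
Local Notation VB := (dB DD).
Local Notation WQ := (sA DD).
Local Notation WB := (sB DD).
Local Notation pA := (vproj VA).
Local Notation pB := (vproj VB).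
Local Notation qA := (vproj WQ).
Local Notation qB := (vproj WB).
Local Notation dag := (dual_dagger DD pair).
Local Notation sig := (horizontal_lift DD S).
Local Notation ac := (acov DD pair S).

Let md := vbc_metric vc.
Let pm : metric VB pair := md_metric md.
Let an : anchored VB Theta := ca_anchored (vbc_courant vc).
Let bs : bracket_on_sections VB br := ca_bracket (vbc_courant vc).
Let inv := ca_invariance (vbc_courant vc).
Let sym := ca_symmetric (vbc_courant vc).
Let jac := ca_jacobi (vbc_courant vc).
Let anr : anchored WQ rho := tdm_side (vbc_anchor vc).

Let ssig q : section WQ q -> section VB (sig q) := @section_sig _ _ _ _ _ _ _ _ lag q.
Let sdag t : dual_section WQ t -> section VB (dag t) := @section_dag _ _ _ _ _ _ _ _ md lag t.
Let bsec s s' : section VB s -> section VB s' -> section VB (br s s') :=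
  @br_section _ _ _ _ _ bs s s'.
Hint Resolve ssig sdag bsec : core.

Lemma anchor_basic e f : smooth_fun f -> Theta e (f \o qB) = rho (pA e) f.
Proof. by move=> sf; have := tdm_proj (vbc_anchor vc) e sf. Qed.

Lemma anchor_dag tau b l : dual_section WQ tau -> dual_section WB l ->
  Theta (dag tau b) l = l (del (qB b) tau).
Proof.
move=> dt dl; rewrite canc //; last exact: dual_section_smooth dl.
rewrite vertical_lift_linear //.
exact: (section_proj _ (del_section dbm dt)).
Qed.

(** The lift is a morphism over [q], so the anchor at [b +[WB] b'] is the tangent sum of the anchors
    at [b] and [b']. That sum is represented by adding curves in the fibres, along which the linear
    function [l] is additive. *)
Lemma anchor_sig_dual q l : section WQ q -> dual_section WB l ->
  dual_section WB (fun b => Theta (sig q b) l).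
Proof.
move=> hq dl; have sl := dual_section_smooth dl.
have [_ [a _ [_ _ hp ha hs]]] := linear_section_sig lag hq.
split; first exact: (anchor_smooth an (ssig hq)).
move=> m; split=> [b b' bm bm'|r b bm].
  rewrite ha ?bm ?bm' //.
  have := tdm_add (vbc_anchor vc) (d := sig q b) (d' := sig q b').
  rewrite !hp bm bm' => /(_ erefl)[g1 [g2 [c1 c2 g12 gE]]].
  have [-> -> ->] := gE l sl; rewrite /velocity.
  rewrite (_ : l \o _ = (l \o g1) + (l \o g2)); last first.
    by apply/funext => t; rewrite /= (dual_add dl).
  by rewrite !derive1E deriveD //; apply: curve_derivable.
rewrite hs (tdm_scale (vbc_anchor vc)) //.
rewrite /tangent_scale /pushforward -(tangentZ (anchor_tangent an b (ssig hq))) //.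
by congr (Theta _ _); apply/funext => b'; rewrite /= (dual_scale _ _ dl).
Qed.

Definition ext_sec (e : Q) : M -> Q := s2val (cid2 (section_through WQ e)).

Lemma ext_secP e : section WQ (ext_sec e) /\ ext_sec e (qA e) = e.
Proof. by rewrite /ext_sec; case: cid2. Qed.

(** Core sections and the base sections of linear sections are determined along
    the zero section of [B], where [ind_Delta] and [ind_br] are read off. *)
Definition ind_Delta (q : M -> Q) (t : Q -> R) (e : Q) : R :=
  pair (br (sig q) (dag t) (vzero WB (qA e))) (S e (vzero WB (qA e))).

Definition ind_br (q1 q2 : M -> Q) (m : M) : Q :=
  pA (br (sig q1) (sig q2) (vzero WB m)).

(** The bracket needs sections, so the points are extended arbitrarily; [br_sig_acov] shows by
    tensoriality that the extensions do not matter. *)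
Definition ind_Om (q1 q2 : Q) (b : B) (q3 : Q) : R :=
  - ac (br (sig (ext_sec q1)) (sig (ext_sec q2)) b) q3.

Definition ind_nabla (q : M -> Q) (b : M -> B) (m : M) : B :=
  xget (vzero WB m) [set e | qB e = m /\ forall t, dual_section WB t ->
    t e = rho (q m) (t \o b) - Theta (sig q (b m)) t].

Lemma br_sig_dagE q t : section WQ q -> dual_section WQ t ->
  dual_section WQ (ind_Delta q t) /\ br (sig q) (dag t) = dag (ind_Delta q t).
Proof.
move=> hq dt.
have := vbc_lc vc (linear_section_sig lag hq) (core_section_dag md lag dt).
move/(core_sectionP md lag) => [tau dtau tE].
suff -> : ind_Delta q t = tau by [].
apply/funext => e; rewrite /ind_Delta tE.
have z : qA e = qB (vzero WB (qA e)) by rewrite vproj_zero.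
have := pair_dag md lag (S e (vzero WB (qA e))) dtau.
by rewrite (split_pA lag) // (split_pB lag).
Qed.

Lemma ind_Delta_section q t : section WQ q -> dual_section WQ t ->
  dual_section WQ (ind_Delta q t).
Proof. by move=> hq dt; have [] := br_sig_dagE hq dt. Qed.

Lemma br_sig_dag q t : section WQ q -> dual_section WQ t ->
  br (sig q) (dag t) = dag (ind_Delta q t).
Proof. by move=> hq dt; have [] := br_sig_dagE hq dt. Qed.

Lemma br_sig_sigE q1 q2 : section WQ q1 -> section WQ q2 ->
  section WQ (ind_br q1 q2) /\
  forall b, pA (br (sig q1) (sig q2) b) = ind_br q1 q2 (qB b).
Proof.
move=> h1 h2.
have [_ [a ha [_ _ hp _ _]]] := vbc_ll vc (linear_section_sig lag h1) (linear_section_sig lag h2).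
suff -> : ind_br q1 q2 = a by [].
by apply/funext => m; rewrite /ind_br hp vproj_zero.
Qed.

Lemma ind_br_section q1 q2 : section WQ q1 -> section WQ q2 -> section WQ (ind_br q1 q2).
Proof. by move=> h1 h2; have [] := br_sig_sigE h1 h2. Qed.

Lemma br_sig_pA q1 q2 b : section WQ q1 -> section WQ q2 ->
  pA (br (sig q1) (sig q2) b) = ind_br q1 q2 (qB b).
Proof. by move=> h1 h2; have [_] := br_sig_sigE h1 h2; exact. Qed.

(** The anchor terms in the Leibniz rule are multiplied by pairings of two lifts, which vanish since
    the splitting is Lagrangian. *)
Lemma br_ss_tensor1 q2 q3 b : section WQ q2 -> section WQ q3 ->
  section_tensor WQ (qB b) (fun q1 => pair (br (sig q1) (sig q2) b) (sig q3 b)).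
Proof.
move=> h2 h3; split=> [q q' hq hq'|f q sf hq].
  have [_ addl _ _ _] := bs.
  by rewrite (sig_add lag) // addl ?pair_add_sec //; auto; rewrite (pair_add_sec pm); auto.
rewrite (sig_scale lag) // (br_leibniz_l pm an bs inv sym b) //; auto; last exact: smooth_basic.
by rewrite !(pair_sig_sig lag) // mulr0 subr0 mul0r addr0.
Qed.

Lemma br_ss_tensor2 q1 q3 b : section WQ q1 -> section WQ q3 ->
  section_tensor WQ (qB b) (fun q2 => pair (br (sig q1) (sig q2) b) (sig q3 b)).
Proof.
move=> h2 h3; split=> [q q' hq hq'|f q sf hq].
  have [_ _ addr _ _] := bs.
  by rewrite (sig_add lag) // addr; auto; rewrite (pair_add_sec pm); auto.
rewrite (sig_scale lag) // (br_leibniz_r pm an bs inv b) //; auto; last exact: smooth_basic.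
by rewrite !(pair_sig_sig lag) // mulr0 addr0.
Qed.

Lemma ac_br q1 q2 q3 b : section WQ q1 -> section WQ q2 -> section WQ q3 ->
  ac (br (sig q1) (sig q2) b) (q3 (qB b)) = pair (br (sig q1) (sig q2) b) (sig q3 b).
Proof.
move=> h1 h2 h3; have hb : section VB (br (sig q1) (sig q2)) by auto.
by rewrite /acov (section_proj b hb).
Qed.

Lemma br_sig_acov q1 q2 b q : section WQ q1 -> section WQ q2 -> qA q = qB b ->
  ac (br (sig q1) (sig q2) b) q = - ind_Om (q1 (qB b)) (q2 (qB b)) b q.
Proof.
move=> h1 h2 hq; rewrite /ind_Om opprK; have [s hs] := section_through WQ q; rewrite hq => <-.
have [e1 x1] := ext_secP (q1 (qB b)); have [e2 x2] := ext_secP (q2 (qB b)).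
rewrite (section_proj _ h1) in x1; rewrite (section_proj _ h2) in x2.
rewrite !ac_br // (section_tensor_eq (br_ss_tensor1 b h2 hs) h1 e1) ?x1 //.
by rewrite (section_tensor_eq (br_ss_tensor2 b e1 hs) h2 e2) ?x2.
Qed.

(** As a function of [t] the right-hand side is a difference of two derivations, one along [b] and
    one in [B], that agree on basic functions because the anchor projects to [rho]. It is therefore
    tensorial, hence evaluation at a point. *)
Lemma ind_nablaP q b m : section WQ q -> section WB b ->
  qB (ind_nabla q b m) = m /\ forall t, dual_section WB t ->
    t (ind_nabla q b m) = rho (q m) (t \o b) - Theta (sig q (b m)) t.
Proof.
move=> hq hb; rewrite /ind_nabla.
apply: (@xgetPex _ _ [set e | qB e = m /\ forall t, dual_section WB t ->
    t e = rho (q m) (t \o b) - Theta (sig q (b m)) t]).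
have t1 := anchor_tangent anr m hq; have t2 := anchor_tangent an (b m) (ssig hq).
have hbm := section_proj m hb.
suff /dual_tensor_point [e em eE] : dual_tensor WB m
    (fun t => rho (q m) (t \o b) - Theta (sig q (b m)) t) by exists e.
split=> [t t' dt dt'|f t sf dt].
  have s1 := dual_section_smooth dt; have s2 := dual_section_smooth dt'.
  rewrite (tangentD t2) // -[X in rho _ X]/(fun m => (t \o b) m + (t' \o b) m).
  rewrite (tangentD t1); [ring|exact: (dual_smooth_on dt hb)|exact: (dual_smooth_on dt' hb)].
have s1 := dual_section_smooth dt.
rewrite (tangentM t2 (smooth_basic WB sf) s1).
rewrite (_ : (fun e => _) \o b = fun m => f m * (t \o b) m); last first.
  by apply/funext => x; rewrite /= (section_proj x hb).
rewrite (tangentM t1 sf (dual_smooth_on dt hb)) anchor_basic // (sig_pA lag) //= hbm.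
ring.
Qed.

Lemma anchor_sig q b l m : section WQ q -> section WB b -> dual_section WB l ->
  Theta (sig q (b m)) l = rho (q m) (l \o b) - l (ind_nabla q b m).
Proof.
move=> hq hb dl; have [_ ->] // := ind_nablaP m hq hb.
by rewrite opprB addrC subrK.
Qed.

Lemma ind_nabla_section q b : section WQ q -> section WB b -> section WB (ind_nabla q b).
Proof.
move=> hq hb; apply: section_of_dual => [m|l dl]; first by have [] := ind_nablaP m hq hb.
rewrite (_ : l \o _ = fun m => rho (q m) (l \o b) - Theta (sig q (b m)) l); last first.
  by apply/funext => m; have [_ h] := ind_nablaP m hq hb; exact: h.
apply: (scB (@smf R M)); first exact: (anchor_smooth anr hq (dual_smooth_on dl hb)).
exact: (dual_smooth_on (anchor_sig_dual hq dl) hb).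
Qed.

Hint Resolve ind_Delta_section ind_br_section ind_nabla_section : core.

Lemma ind_Delta_pair q t e : section WQ q -> dual_section WQ t ->
  pair (br (sig q) (dag t) (pB e)) e = ind_Delta q t (pA e).
Proof. by move=> hq dt; rewrite br_sig_dag // (pair_dag md lag); auto. Qed.

Lemma ind_br_dag q1 q2 t b : section WQ q1 -> section WQ q2 -> dual_section WQ t ->
  pair (br (sig q1) (sig q2) b) (dag t b) = t (ind_br q1 q2 (qB b)).
Proof. by move=> *; apply: (br_ss_dag md lag bs br_sig_pA). Qed.

Lemma ind_dull : dual_dull_bracket WQ rho ind_Delta ind_br.
Proof.
move=> q1 q2 h1 h2; split; first by auto.
move=> t m dt; pose b := vzero WB m; have bm : qB b = m by exact: vproj_zero.
have := inv b (ssig h1) (ssig h2) (sdag dt).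
rewrite ind_br_dag // bm.
rewrite (_ : (fun y => pair (sig q2 y) (dag t y)) = (t \o q2) \o qB); last first.
  by apply/funext => y; rewrite (pair_sig_dag md lag).
rewrite anchor_basic ?(sig_pA lag) // ?bm; last exact: (dual_smooth_on dt h2).
by rewrite br_sig_dag // (pair_sig_dag md lag) ?bm; auto; move=> ->; rewrite addrK.
Qed.

Lemma ind_Delta_eqP q t t' : section WQ q -> dual_section WQ t -> dual_section WQ t' ->
  br (sig q) (dag t) = dag t' -> ind_Delta q t =1 t'.
Proof.
move=> hq dt dt' tt'; suff -> : ind_Delta q t = t' by [].
by apply: (dag_inj md lag) => //; [auto|rewrite -br_sig_dag].
Qed.

Lemma jac_defect e1 e2 f x : section VB e1 -> section VB e2 -> smooth_fun f ->
  anchor_defect Theta br e1 e2 f x = 0.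
Proof. by move=> *; apply: (jacobi_anchor pm an bs inv jac). Qed.

(** The core section of [rho^* df] is the gradient of the basic function [f \o qB]. By invariance
    the claim is then the vanishing of the anchor defect of two lifts on this function. *)
Lemma ind_Delta_exact q f : section WQ q -> smooth_fun f ->
  ind_Delta q (fun e => rho e f) =1 (fun e => rho e (fun m => rho (q m) f)).
Proof.
move=> hq sf e.
have sr := anchor_smooth anr hq sf; have dt := anchor_dual anr sf.
have [s hs sE] := section_through WQ e.
pose b := vzero WB (qA e); have bm : qB b = qA e by exact: vproj_zero.
have := ind_Delta_pair (sig s b) hq dt.
rewrite (sig_pA lag) // (sig_pB lag) // bm sE => <-.
have sF := smooth_basic WB sf.
rewrite (br_invariant inv b (ssig hq) (sdag dt) (ssig hs)).
have gE s' : section VB s' -> (fun y => pair (dag (rho^~ f) y) (s' y)) = fun y => Theta (s' y) (f \o qB).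
  move=> hs'; apply/funext => y; have := pair_dag md lag (s' y) dt.
  by rewrite (section_proj y hs') anchor_basic.
have hbq := bsec (ssig hq) (ssig hs).
rewrite (gE _ (ssig hs)) (congr1 (@^~ b) (gE _ hbq)).
have := jac_defect b (ssig hq) (ssig hs) sF; rewrite /anchor_defect.
rewrite (_ : (fun y => Theta (sig q y) (f \o qB)) = (fun m => rho (q m) f) \o qB); last first.
  by apply/funext => y; rewrite anchor_basic // (sig_pA lag).
rewrite (anchor_basic _ sr) (sig_pA lag) // bm sE addrAC => /eqP.
by rewrite subr_eq0 => /eqP.
Qed.

Lemma ind_dorfman : dorfman_connection WQ rho ind_Delta.
Proof.
have [_ baddl baddr _ _] := bs.
split.
- exact: ind_Delta_section.
- move=> q q' t hq hq' dt.
  have d1 := ind_Delta_section hq dt; have d2 := ind_Delta_section hq' dt.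
  apply: ind_Delta_eqP => //; [exact: section_add|exact: dual_sectionD|].
  rewrite (sig_add lag) // (dag_add md lag) // -!br_sig_dag //.
  by apply/funext => b; apply: baddl; auto.
- move=> q t t' hq dt dt'.
  have d1 := ind_Delta_section hq dt; have d2 := ind_Delta_section hq dt'.
  apply: ind_Delta_eqP => //; [exact: dual_sectionD|exact: dual_sectionD|].
  rewrite !(dag_add md lag) // -!br_sig_dag //.
  by apply/funext => b; apply: baddr; auto.
- move=> q t f hq dt sf.
  have d1 := ind_Delta_section hq dt; have sr := anchor_smooth anr hq sf.
  have d2 := dual_sectionM sf d1; have d3 := dual_sectionM sr dt.
  apply: ind_Delta_eqP => //; [exact: dual_sectionM|exact: dual_sectionD|].
  rewrite (dag_add md lag d2 d3) (dag_scale md lag sf d1) (dag_scale md lag sf dt).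
  have -> : dag (fun e => rho (q (qA e)) f * t e) =
    sscale VB ((fun m => rho (q m) f) \o qB) (dag t) := dag_scale md lag sr dt.
  rewrite -br_sig_dag // (br_leibniz_r_sec pm an bs inv) //; auto; last exact: smooth_basic.
  congr (sadd _ _ (sscale _ _ _)); apply/funext => b.
  by rewrite anchor_basic // (sig_pA lag).
- move=> q t f hq dt sf e; have hfq := section_scale sf hq.
  have [s hs sE] := section_through WQ e.
  pose b := vzero WB (qA e); have bm : qB b = qA e by exact: vproj_zero.
  have Dp q' : section WQ q' -> ind_Delta q' t e = pair (br (sig q') (dag t) b) (sig s b).
    move=> hq'; have := ind_Delta_pair (sig s b) hq' dt.
    by rewrite (sig_pA lag) // (sig_pB lag) // bm sE.
  rewrite !Dp // (sig_scale lag) //.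
  rewrite (br_leibniz_l pm an bs inv sym) //; auto; last exact: smooth_basic.
  rewrite !anchor_basic // (dag_pA md) // (anchor_zero anr) // mul0r subr0.
  by rewrite (pair_sig_dag md lag) // (sig_pA lag) //= bm sE.
- exact: ind_Delta_exact.
Qed.

Lemma ind_linear : linear_connection WQ WB rho ind_nabla.
Proof.
have nP q b m l : section WQ q -> section WB b -> dual_section WB l ->
    l (ind_nabla q b m) = rho (q m) (l \o b) - Theta (sig q (b m)) l.
  by move=> hq hb dl; have [_ h] := ind_nablaP m hq hb; exact: h.
have nB q b m : section WQ q -> section WB b -> qB (ind_nabla q b m) = m.
  by move=> hq hb; have [] := ind_nablaP m hq hb.
split.
- exact: ind_nabla_section.
- move=> q q' b hq hq' hb m; have hs := section_add hq hq'.
  apply: (dual_sep (V := WB)) => [|l dl].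
    by rewrite /sadd vproj_add !nB.
  have sl := dual_section_smooth dl; have slb := dual_smooth_on dl hb.
  rewrite /sadd (dual_add dl) ?nB // !nP // (sig_add lag) // /sadd.
  rewrite (dual_add (anchor_dual anr slb)) ?section_proj //.
  by rewrite (dual_add (anchor_dual an sl)) ?(sig_pB lag) //; ring.
- move=> f q b sf hq hb m; have hs := section_scale sf hq.
  apply: (dual_sep (V := WB)) => [|l dl].
    by rewrite /sscale vproj_scale !nB.
  have sl := dual_section_smooth dl; have slb := dual_smooth_on dl hb.
  rewrite /sscale (dual_scale _ _ dl) !nP // (sig_scale lag) // /sscale.
  rewrite (dual_scale _ _ (anchor_dual anr slb)) (dual_scale _ _ (anchor_dual an sl)).
  by rewrite /= (section_proj m hb); ring.
- move=> q b b' hq hb hb' m; have hs := section_add hb hb'.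
  apply: (dual_sep (V := WB)) => [|l dl].
    by rewrite /sadd vproj_add !nB.
  have slb := dual_smooth_on dl hb; have slb' := dual_smooth_on dl hb'.
  rewrite /sadd (dual_add dl) ?nB // !nP //.
  rewrite (dual_add (anchor_sig_dual hq dl)) ?section_proj //.
  rewrite (_ : l \o _ = fun m => (l \o b) m + (l \o b') m); last first.
    by apply/funext => y; rewrite /= (dual_add dl) ?section_proj.
  by rewrite (tangentD (anchor_tangent anr m hq)) //; ring.
- move=> q f b hq sf hb m; have hs := section_scale sf hb.
  apply: (dual_sep (V := WB)) => [|l dl].
    by rewrite /sadd /sscale vproj_add ?vproj_scale !nB // section_proj.
  have slb := dual_smooth_on dl hb.
  rewrite /sadd /sscale (dual_add dl) ?vproj_scale ?nB ?section_proj //.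
  rewrite !(dual_scale _ _ dl) !nP //.
  rewrite (dual_scale _ _ (anchor_sig_dual hq dl)).
  rewrite (_ : l \o _ = fun m => f m * (l \o b) m); last first.
    by apply/funext => y; rewrite /= (dual_scale _ _ dl).
  by rewrite (tangentM (anchor_tangent anr m hq)) //=; ring.
Qed.

Lemma ind_OmE q1 q2 q3 b : section WQ q1 -> section WQ q2 -> section WQ q3 ->
  ind_Om (q1 (qB b)) (q2 (qB b)) b (q3 (qB b)) = - pair (br (sig q1) (sig q2) b) (sig q3 b).
Proof.
by move=> h1 h2 h3; rewrite -ac_br // br_sig_acov ?opprK // section_proj.
Qed.

Lemma ind_Om_ext q1 q2 q3 b : qA q1 = qB b -> qA q2 = qB b -> qA q3 = qB b ->
  exists s1 s2 s3, [/\ section WQ s1, section WQ s2, section WQ s3 &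
   [/\ s1 (qB b) = q1, s2 (qB b) = q2 & s3 (qB b) = q3]].
Proof.
have [s1 h1 <-] := section_through WQ q1; have [s2 h2 <-] := section_through WQ q2.
have [s3 h3 <-] := section_through WQ q3.
by rewrite !section_proj // => -> -> ->; exists s1, s2, s3.
Qed.

Lemma ind_Om_sym12 q1 q2 b q3 : qA q1 = qB b -> qA q2 = qB b -> qA q3 = qB b ->
  ind_Om q1 q2 b q3 = - ind_Om q2 q1 b q3.
Proof.
move=> e1 e2 e3; have [s1 [s2 [s3 [h1 h2 h3 [<- <- <-]]]]] := ind_Om_ext e1 e2 e3.
rewrite !ind_OmE //; have := br_symmetric pm bs sym b (ssig h1) (ssig h2) (ssig h3).
rewrite (_ : (fun y => pair (sig s1 y) (sig s2 y)) = fun=> 0); last first.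
  by apply/funext => y; rewrite (pair_sig_sig lag).
rewrite (tangent_cst (anchor_tangent an b (ssig h3))).
by move/eqP; rewrite addr_eq0 => /eqP ->.
Qed.

Lemma ind_Om_sym23 q1 q2 b q3 : qA q1 = qB b -> qA q2 = qB b -> qA q3 = qB b ->
  ind_Om q1 q2 b q3 = - ind_Om q1 q3 b q2.
Proof.
move=> e1 e2 e3; have [s1 [s2 [s3 [h1 h2 h3 [<- <- <-]]]]] := ind_Om_ext e1 e2 e3.
rewrite !ind_OmE //; have := inv b (ssig h1) (ssig h2) (ssig h3).
rewrite (_ : (fun y => pair (sig s2 y) (sig s3 y)) = fun=> 0); last first.
  by apply/funext => y; rewrite (pair_sig_sig lag).
rewrite (tangent_cst (anchor_tangent an b (ssig h1))).
rewrite (pairC_sec pm b (ssig h2)); auto.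
by move/esym/eqP; rewrite addr_eq0 => /eqP ->.
Qed.

Lemma ind_hom : hom_two_form WQ WB ind_Om.
Proof.
split.
- move=> q2 b q3 bq qq.
  have [s2 h2 x2] := section_through WQ q2; have [s3 h3 x3] := section_through WQ q3.
  rewrite qq -bq in x3; rewrite -bq in x2 *.
  have [aD aZ] := br_ss_tensor1 b h2 h3.
  split=> [e e' qe qe'|r e qe].
    have [s hs x] := section_through WQ e; have [s' hs' x'] := section_through WQ e'.
    rewrite qe in x; rewrite qe' in x'; have hh := section_add hs hs'.
    rewrite (_ : e +[WQ] e' = sadd WQ s s' (qB b)); last by rewrite /sadd x x'.
    by rewrite -[in X in _ = X + _]x -[in X in _ = _ + X]x' -x2 -x3 !ind_OmE // aD // opprD.
  have [s hs x] := section_through WQ e; rewrite qe in x.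
  have sr := sc_cst (@smf R M) r; have hh := section_scale sr hs.
  rewrite (_ : r *[WQ] e = sscale WQ (cst r) s (qB b)); last by rewrite /sscale x.
  by rewrite -[in RHS]x -x2 -x3 !ind_OmE // aZ // mulrN.
- by move=> q1 q2 b q3 e1 e2 e3; apply: ind_Om_sym12; rewrite ?e1 ?e2 ?e3.
- move=> q1 q2 q3 e1 e3.
  have [s1 h1 x1] := section_through WQ q1; have [s2 h2 x2] := section_through WQ q2.
  have [s3 h3 x3] := section_through WQ q3; rewrite e3 in x3; rewrite e1 in x1.
  (* Linearity in [b] comes from the linearity axiom: the bracket of two lifts is a linear section,
     and two linear sections pair to a linear function on [B]. *)
  have l12 := vbc_ll vc (linear_section_sig lag h1) (linear_section_sig lag h2).
  have dd := linear_pair_dual md l12 (linear_section_sig lag h3).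
  apply: covector_eq (dual_sectionP (dual_sectionZ (-1) dd) (qA q2)) => b bq.
  by have := ind_OmE b h1 h2 h3; rewrite bq x1 x2 x3 mulN1r => ->.
- move=> q1 q2 b e1 e2.
  have [s1 h1 x1] := section_through WQ q1; have [s2 h2 x2] := section_through WQ q2.
  rewrite e1 -e2 in x1; rewrite -e2 in x2.
  have hb := bsec (ssig h1) (ssig h2).
  have ca := acov_covector md lag (br (sig s1) (sig s2) b); rewrite (section_proj b hb) in ca.
  have [cD cZ] := ca; rewrite -e2; split=> [e e' qe qe'|r e qe].
    rewrite -x1 -x2 -[LHS]opprK -[ind_Om _ _ _ e]opprK -[ind_Om _ _ _ e']opprK.
    by rewrite -!br_sig_acov ?vproj_add ?qe // cD // opprD.
  rewrite -x1 -x2 -[LHS]opprK -[ind_Om _ _ _ e]opprK.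
  by rewrite -!br_sig_acov ?vproj_scale // cZ // mulrN.
- move=> q1 q2 b q3 h1 h2 hb h3.
  rewrite (_ : (fun _ => _) = fun m => - pair (br (sig q1) (sig q2) (b m)) (sig q3 (b m))).
    apply: (scN (@smf R M)).
    exact: (smooth_map_fun1 hb.1 (pair_smooth pm (bsec (ssig h1) (ssig h2)) (ssig h3))).
  apply/funext => m; have bm := section_proj m hb.
  by rewrite -ind_OmE // bm.
Qed.

(** * The axioms of a Dorfman 2-representation for the induced data *)

Lemma ind_br_anchor q1 q2 f m : section WQ q1 -> section WQ q2 -> smooth_fun f ->
  rho (ind_br q1 q2 m) f =
  rho (q1 m) (fun m => rho (q2 m) f) - rho (q2 m) (fun m => rho (q1 m) f).
Proof.
move=> h1 h2 sf; pose b := vzero WB m; have bm : qB b = m by exact: vproj_zero.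
have := anchor_defect_ss_basic lag anr anchor_basic br_sig_pA b h1 h2 sf.
rewrite jac_defect //; auto; last exact: smooth_basic.
by rewrite bm => /esym/eqP; rewrite subr_eq0 => /eqP.
Qed.

Lemma ind_D1 q t m : section WQ q -> dual_section WQ t ->
  del m (ind_Delta q t) = ind_nabla q (fun m' => del m' t) m.
Proof.
move=> hq dt; pose b := vzero WB m; have bm : qB b = m by exact: vproj_zero.
have dD := ind_Delta_section hq dt.
apply: (dual_sep (V := WB)) => [|l dl].
  rewrite (section_proj m (ind_nabla_section hq (del_section dbm dt))).
  exact: (section_proj m (del_section dbm dD)).
have := anchor_defect_sd_linear lag dbm anchor_basic anchor_dag anchor_sig
  anchor_sig_dual ind_Delta_section br_sig_dag b hq dt dl.
rewrite jac_defect //; auto; last exact: dual_section_smooth dl.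
by rewrite bm => /esym/eqP; rewrite subr_eq0 => /eqP.
Qed.

Lemma ind_D2 q1 q2 : section WQ q1 -> section WQ q2 ->
  ind_br q1 q2 =1 sscale WQ (cst (-1)) (ind_br q2 q1).
Proof.
move=> h1 h2 m; pose b := vzero WB m; have bm : qB b = m by exact: vproj_zero.
apply: (dual_sep (V := WQ)) => [|t dt].
  by rewrite /sscale vproj_scale !(section_proj m) //; auto.
have := br_symmetric pm bs sym b (ssig h1) (ssig h2) (sdag dt).
rewrite (_ : (fun y => pair (sig q1 y) (sig q2 y)) = fun=> 0); last first.
  by apply/funext => y; rewrite (pair_sig_sig lag).
rewrite (tangent_cst (anchor_tangent an b (sdag dt))) !ind_br_dag // bm => /eqP.
by rewrite addr_eq0 /sscale (dual_scale _ _ dt) mulN1r => /eqP.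
Qed.

Lemma ind_D3 xi1 xi2 q1 q2 : dual_section WB xi1 -> dual_section WB xi2 ->
    section WQ q1 -> section WQ q2 ->
    (forall t m, dual_section WQ t -> t (q1 m) = xi1 (del m t)) ->
    (forall t m, dual_section WQ t -> t (q2 m) = xi2 (del m t)) ->
    forall b m, section WB b ->
      dual_connection rho ind_nabla q1 xi2 b m + dual_connection rho ind_nabla q2 xi1 b m = 0.
Proof.
move=> d1 d2 h1 h2 e1 e2 b m hb; have s1 := dual_section_smooth d1; have s2 := dual_section_smooth d2.
have [g hg gE] := riesz pm (anchor_dual an s1).
rewrite -(anchor_grad_split md lag dbm an anchor_dag anchor_sig m d1 d2 h1 h2 e1 e2 hg gE hb).
apply: (anchor_grad pm an bs inv sym jac hg s1 s2) => e eb.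
by rewrite -gE eb.
Qed.

Lemma ind_dorfman_2rep :
  dorfman_2rep WQ WB rho del ind_Delta ind_nabla ind_Om ind_br.
Proof.
split.
- exact: dbm.
- exact: ind_dorfman.
- exact: ind_dull.
- exact: ind_linear.
- exact: ind_hom.
- exact: ind_D1.
- exact: ind_D2.
- exact: ind_D3.
- move=> q1 q2 b m h1 h2 hb; have bm := section_proj m hb.
  have ca := htf_4 ind_hom (q1 := q1 m) (q2 := q2 m) (b := b m).
  rewrite !section_proj // in ca; have {}ca := ca erefl erefl.
  have n12 := ind_nabla_section h1 (ind_nabla_section h2 hb).
  have n21 := ind_nabla_section h2 (ind_nabla_section h1 hb).
  have nb := ind_nabla_section (ind_br_section h1 h2) hb.
  have p12 := section_proj m n12; have p21 := section_proj m n21; have pb := section_proj m nb.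
  apply: (dual_sep (V := WB)) => [|l dl].
    rewrite (dbm_proj dbm ca) !vproj_add ?vproj_scale ?p12 ?p21 ?pb //.
  have := anchor_defect_ss_linear md lag anr dbm an bs anchor_dag anchor_sig
    anchor_sig_dual ind_nabla_section ind_br_section br_sig_pA br_sig_acov
    h1 h2 hb dl ca (fun q _ => erefl) (fun f => ind_br_anchor m h1 h2).
  rewrite jac_defect //; auto; last exact: dual_section_smooth dl.
  rewrite !(dual_add dl) ?vproj_add ?vproj_scale ?p12 ?p21 ?pb //.
  rewrite !(dual_scale _ _ dl) => h.
  by apply/eqP; rewrite -subr_eq0; apply/eqP; rewrite [RHS]h; ring.
- move=> q1 q2 t h1 h2 dt e.
  have [s hs sE] := section_through WQ e.
  pose b := vzero WB (qA e); have bm : qB b = qA e by exact: vproj_zero.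
  have := jacobiator_sdt md lag dbm an bs inv sym anchor_basic anchor_dag
    ind_Delta_section ind_br_section br_sig_pA br_sig_acov br_sig_dag b
    h1 h2 dt hs ind_hom ind_dull ind_D2.
  rewrite (jacobiator0 pm bs jac b); auto.
  by rewrite /= bm sE => /esym/eqP; rewrite subr_eq0 => /eqP ->.
- by move=> q1 q2 q3 b e1 e2 e3; exact: ind_Om_sym23.
- move=> q1 q2 q3 b q m h1 h2 h3 hb hq.
  have := jacobiator_ssss md lag an bs inv sym anchor_sig
    ind_nabla_section ind_br_section br_sig_pA br_sig_acov m
    h1 h2 h3 hq hb ind_hom ind_dull (fun q1 q2 q3 b e1 e2 e3 => ind_Om_sym23 e1 e2 e3).
  rewrite (jacobiator0 pm bs jac (b m)); auto.
  by move/esym/eqP; rewrite subr_eq0 => /eqP ->.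
Qed.

Lemma ind_splitting :
  splitting_equations DD pair S rho ind_Delta ind_nabla ind_Om ind_br Theta br.
Proof.
split.
- move=> q hq; split.
  + split=> [b|f sf]; first exact: (anchor_tangent an b (ssig hq)).
    exact: (anchor_smooth an (ssig hq) sf).
  + by move=> f b sf; rewrite anchor_basic // (sig_pA lag).
  + move=> l dl; split; first exact: anchor_sig_dual.
    by move=> b m hb; rewrite anchor_sig.
- move=> q1 q2 h1 h2 b; have hb := bsec (ssig h1) (ssig h2).
  apply: (sub_hom_tilde md lag); auto.
  + move=> b'; have := htf_4 ind_hom (q1 := q1 (qB b')) (q2 := q2 (qB b')) (b := b').
    by rewrite !section_proj //; apply.
  + exact: (section_proj b hb).
  + exact: br_sig_pA.
  + by move=> q' hq'; rewrite br_sig_acov.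
- by move=> q t hq dt b; rewrite br_sig_dag.
Qed.

End VBCourantToDorfman.

(** * Linear coordinates on vector bundles *)

Section LinearCharts.
Variables (R : realType) (E N : manifold R) (V : vbundle E N).

(** The chain rule in coordinates that are linear or basic; [H] is the Hessian of
    the coordinate expression of [f] at [e0], whence its symmetry. *)
Lemma linear_chain e0 f : smooth_fun f ->
  exists n (X h : 'I_n -> E -> R) (H : 'I_n -> 'I_n -> R),
    [/\ forall j, lin_or_basic V (X j), forall j, smooth_fun (h j),
        \forall e \near e0, forall v, tangent e v -> v f = \sum_j v (X j) * h j e,
        forall v j, tangent e0 v -> v (h j) = \sum_k v (X k) * H j k
      & forall j k, H j k = H k j].
Proof.
move=> sf; have [n [d [X [sd de lX XE]]]] := linear_coords V e0.
have sX j := lin_or_basic_smooth (lX j).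
pose F := f \o cinv d : 'rV[R]_n -> R^o.
pose U := cmap d @` cdom d; have oU : open U := @ccod_open _ _ _ d.
have sF : smooth_on U F := smooth_fun_chart sd sf.
pose D (j : 'I_n) (u : 'rV[R]_n) : R^o := 'D_(delta_mx 0 j) F u.
pose H (j k : 'I_n) : R := 'D_(delta_mx 0 k) (D j) (X e0).
have sD (j : 'I_n) : smooth_on U (D j) by exact: smooth_on_derive.
have h (j : 'I_n) : exists g : E -> R, smooth_fun g /\ \forall e \near e0, g e = D j (cmap d e).
  have [||g sg gE] := @smooth_extension R E e0 (D j \o cmap d) n d U sd de oU; last by exists g.
    exact: cmap_im.
  apply: (@smooth_on_eq _ _ _ _ (D j)) => // u /cinv_dom[_ ue].
  by rewrite /= ue.
have [g hg] := choice h.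
have sg (j : 'I_n) : smooth_fun (g j) := (hg j).1.
have gX (j : 'I_n) : \forall e \near e0, g j e = D j (X e).
  by near=> e; rewrite (near XE e) //; near: e; exact: (hg j).2.
exists n, (fun j e => X e 0 j), g, H; split; [exact: lX|exact: sg| | |].
(* The chain rule is applied at every [e] near [e0] and requires [X] to coincide with the chart
   around [e], not only around [e0]; the open set [P] provides this. *)
- have [P [oP P0] PX] : exists2 P : set E, open P /\ P e0 & forall e, P e -> X e = cmap d e /\ cdom d e.
    have : \forall e \near e0, X e = cmap d e /\ cdom d e.
      by near=> e; split; near: e; [exact: XE|exact: near_cdom].
    by rewrite /prop_near1 nbhsE => -[P [oP P0] hP]; exists P.
  have nP : nbhs e0 P by apply: open_nbhs_nbhs.
  have gA : \forall e \near e0, forall j, g j e = D j (X e) by exact: filter_forall.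
  near=> e => v tv; have Pe : P e by near: e.
  have [Xe de'] := PX e Pe.
  rewrite (tangent_chain (U := U) (F := F) (X := X) tv) //.
  + by apply: eq_bigr => j _; rewrite (near gA e).
  + by rewrite Xe; exact: cmap_im.
  have : nbhs e P by apply: open_nbhs_nbhs.
  by apply: filterS => y /PX[-> dy]; rewrite /F /= cmapK.
- move=> v j tv; apply: (tangent_chain (U := U) tv) => //.
  by rewrite (nbhs_singleton XE); exact: cmap_im.
- move=> j k; apply: (@derive_symmetric _ _ F U (X e0) _ _ oU).
    by rewrite (nbhs_singleton XE); exact: cmap_im.
  exact: sF 2%N.
Unshelve. all: by end_near.
Qed.

(** [g2] is [t |-> s (g t) + t c (g t)] for sections [s] and [c] and the base
    curve [g] of [g1]. *)
Lemma lift_curve e1 e2 v1 v2 : vproj V e1 = vproj V e2 ->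
  tangent e1 v1 -> tangent e2 v2 ->
  (forall f, smooth_fun f -> v1 (f \o vproj V) = v2 (f \o vproj V)) ->
  exists g1 g2 : R -> E, [/\ smooth_curve g1, smooth_curve g2,
    forall t, vproj V (g1 t) = vproj V (g2 t), g1 0 = e1 /\ g2 0 = e2
    & forall f, smooth_fun f -> v1 f = velocity g1 f /\ v2 f = velocity g2 f].
Proof.
move=> e12 t1 t2 v12; have [g1 [c1 g10 v1E]] := t1.
have [s hs sE] := section_through V e2.
pose x := vproj V e2.
have sbas (l : E -> R) : dual_section V l -> smooth_fun ((l \o s) \o vproj V).
  by move=> dl; apply: smooth_basic; exact: (dual_smooth_on dl hs).
(* The difference of [v2] and the velocity of [s] along the base curve is vertical: on linear
   functions it is tensorial, so it is given by an element [c0] of the fibre. *)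
have : dual_tensor V x (fun l => v2 l - v1 ((l \o s) \o vproj V)).
  split=> [l l' dl dl'|f l sf dl].
    have s1 := dual_section_smooth dl; have s2 := dual_section_smooth dl'.
    rewrite (tangentD t2) // -[X in v1 X]/(fun e => ((l \o s) \o vproj V) e + ((l' \o s) \o vproj V) e).
    by rewrite (tangentD t1); [ring|exact: sbas|exact: sbas].
  have s1 := dual_section_smooth dl; have sb := smooth_basic V sf.
  rewrite (tangentM t2 sb s1).
  rewrite (_ : (_ \o s) \o vproj V = fun e => (f \o vproj V) e * ((l \o s) \o vproj V) e); last first.
    by apply/funext => e; rewrite /= section_proj.
  rewrite (tangentM t1 sb (sbas _ dl)) (v12 _ sf) /= e12 sE -/x; ring.
move/dual_tensor_point => [c0 c0x c0E].
have [c hc cE] := section_through V c0; rewrite c0x in cE.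
pose g := vproj V \o g1.
have cg : smooth_curve g := smooth_map_curve (vproj_smooth V) c1.
have g0 : g 0 = x by rewrite /g /= g10.
pose g2 t := s (g t) +[V] (t *[V] c (g t)).
have ps t : vproj V (s (g t)) = g t by exact: section_proj.
have pc t : vproj V (t *[V] c (g t)) = g t by rewrite vproj_scale section_proj.
have pg2 t : vproj V (g2 t) = g t by rewrite /g2 vproj_add ps ?pc.
have cg2 : smooth_curve g2.
  apply/smooth_curveP; apply: sc_map_add; first exact: smooth_class_line.
  - by apply/smooth_curveP; exact: (smooth_map_curve hs.1 cg).
  - apply: sc_map_scale; [exact: smooth_class_line|exact: smooth_id1|].
    by apply/smooth_curveP; exact: (smooth_map_curve hc.1 cg).
  - by move=> t; rewrite ps pc.
have g20 : g2 0 = e2 by rewrite /g2 vscale0 section_proj // -{2}(ps 0) vaddr0 g0 sE.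
exists g1, g2; split => //.
have tg2 : tangent e2 (velocity g2) by exists g2; split.
move=> f sf; split; first exact: v1E.
apply: (tangent_bundle_eq (V := V) t2 tg2) => // l [[f0 sf0 ->]|dl].
  rewrite -v12 // v1E; last exact: smooth_basic.
  rewrite /velocity; congr (derive1 _ _); apply/funext => t.
  by rewrite /= pg2.
have lE : l \o g2 = (fun t => ((l \o s) \o g) t + t * ((l \o c) \o g) t).
  by apply/funext => t; rewrite /= (dual_add dl) ?ps ?pc // (dual_scale _ _ dl).
have d1 : derivable ((l \o s) \o g : R^o -> R^o) 0 1 := curve_derivable cg (dual_smooth_on dl hs).
have d2 : derivable ((l \o c) \o g : R^o -> R^o) 0 1 := curve_derivable cg (dual_smooth_on dl hc).
have did : derivable (id : R^o -> R^o) 0 1 by exact: derivable_id.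
rewrite /velocity lE derive1E.
apply: etrans (esym (deriveD d1 (derivableM did d2))).
rewrite (deriveM did d2) scale0r add0r derive_id.
have := v1E _ (sbas _ dl); rewrite /velocity derive1E => <-.
have := c0E l dl; rewrite -cE -g0 => h.
rewrite (_ : _%:A = l (c (g 0))); last exact: mulr1.
by rewrite h addrC subrK.
Qed.

End LinearCharts.

(** * Reduction of identities for the anchor to linear and basic functions *)

Section AnchorOverBundle.
Variables (R : realType) (E N M : manifold R) (V : vbundle E N) (W : vbundle N M).
Variables (pair : E -> E -> R) (rho : E -> (N -> R) -> R).
Variable br : (N -> E) -> (N -> E) -> N -> E.
Hypotheses (pm : metric V pair) (an : anchored V rho) (bs : bracket_on_sections V br).

(** After expanding both second-order terms with [linear_chain], the products of first derivatives
    carry the Hessian of [f] and cancel by its symmetry. What is left is the sum of the defects on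
    the coordinates [X j], weighted by [h j]. *)
Lemma anchor_defect_linear e1 e2 x : section V e1 -> section V e2 ->
  (forall g, lin_or_basic W g -> anchor_defect rho br e1 e2 g x = 0) ->
  forall f, smooth_fun f -> anchor_defect rho br e1 e2 f x = 0.
Proof.
move=> h1 h2 A0 f sf; have [n [X [h [H [lX sh fE hE Hs]]]]] := linear_chain W x sf.
have sX j := lin_or_basic_smooth (lX j).
have t1 := anchor_tangent an x h1; have t2 := anchor_tangent an x h2.
have F e : section V e -> forall v, tangent x v -> v (fun y => rho (e y) f) =
    \sum_j (rho (e x) (X j) * v (h j) + h j x * v (fun y => rho (e y) (X j))).
  move=> he v tv.
  have s1 j : smooth_fun (fun y => rho (e y) (X j)) by exact: (anchor_smooth an).
  have s2 j : smooth_fun (fun y => rho (e y) (X j) * h j y) by apply: (scM (@smf R N)).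
  rewrite (tangent_near tv (g := fun y => \sum_j rho (e y) (X j) * h j y)).
  - rewrite (tangent_sum tv) //; apply: eq_bigr => j _.
    by rewrite (tangentM tv) // addrC; ring.
  - exact: (anchor_smooth an).
  - exact: (sc_sum (@smf R N)).
  by apply: filterS fE => y; apply; exact: (anchor_tangent an).
have hb := br_section bs h1 h2.
rewrite /anchor_defect (F _ h2 _ t1) (F _ h1 _ t2).
rewrite (nbhs_singleton fE _ (anchor_tangent an x hb)).
rewrite !big_split /=.
have sw : \sum_j rho (e2 x) (X j) * rho (e1 x) (h j) = \sum_j rho (e1 x) (X j) * rho (e2 x) (h j).
  under eq_bigr => j _ do rewrite (hE _ _ t1) mulr_sumr.
  under [RHS]eq_bigr => j _ do rewrite (hE _ _ t2) mulr_sumr.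
  rewrite exchange_big /=; apply: eq_bigr => j _; apply: eq_bigr => k _.
  by rewrite Hs; ring.
rewrite sw opprD addrACA subrr add0r -!sumrB big1 // => j _.
have := A0 _ (lX j); rewrite /anchor_defect => a0.
by rewrite -[RHS](mul0r (h j x)) -a0; ring.
Qed.

(** The anchor of the gradient of [f] on [g] equals that of the gradient of [g] on [f], both being a
    pairing of gradients. Only the differentiated function can be reduced to linear and basic ones,
    so the roles are exchanged between two reductions. *)
Lemma anchor_grad_linear :
  (forall f g s x, lin_or_basic W f -> lin_or_basic W g -> section V s ->
     (forall e, pair (s (vproj V e)) e = rho e f) -> rho (s x) g = 0) ->
  forall f g s x, smooth_fun f -> smooth_fun g -> section V s ->
     (forall e, pair (s (vproj V e)) e = rho e f) -> rho (s x) g = 0.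
Proof.
move=> h.
have tz x : tangent x (rho (vzero V x)).
  by have := anchor_tangent an x (section_zero V).
have ext s x : section V s -> (forall g, lin_or_basic W g -> rho (s x) g = 0) ->
    forall g, smooth_fun g -> rho (s x) g = 0.
  move=> hs s0 g sg; rewrite -(anchor_zero an x sg).
  apply: (tangent_bundle_eq (V := W) (anchor_tangent an x hs) (tz x)) => // g' lg.
  by rewrite s0 // (anchor_zero an) //; exact: lin_or_basic_smooth lg.
have swap f f' s s' x : section V s -> section V s' ->
    (forall e, pair (s (vproj V e)) e = rho e f) ->
    (forall e, pair (s' (vproj V e)) e = rho e f') -> rho (s x) f' = rho (s' x) f.
  move=> hs hs' sE sE'; rewrite -sE' -sE !section_proj //.
  exact: (pairC_sec pm).
move=> f g s x sf sg hs sE.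
have [s' hs' sE'] := riesz pm (anchor_dual an sg).
rewrite (swap f g s s') //; apply: (ext) => // f' lf'.
have [s1 hs1 sE1] := riesz pm (anchor_dual an (lin_or_basic_smooth lf')).
rewrite (swap g f' s' s1) //; apply: (ext) => // g' lg'.
exact: (h f').
Qed.

End AnchorOverBundle.

(** * The anchor of a Dorfman 2-representation *)

Section AnchorConstruction.
Variables (R : realType) (E Q B M : manifold R) (DD : dvb E Q B M).
Variables (pair : E -> E -> R) (S : Q -> B -> E).
Variables (rho : Q -> (M -> R) -> R) (del : M -> (Q -> R) -> B).
Variables (Delta : (M -> Q) -> (Q -> R) -> Q -> R).
Variables (nabla : (M -> Q) -> (M -> B) -> M -> B).
Variables (Om : Q -> Q -> B -> Q -> R) (brQ : (M -> Q) -> (M -> Q) -> M -> Q).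
Hypotheses (md : metric_dvb DD pair) (lag : lagrangian_splitting DD pair S).
Hypotheses (anr : anchored (sA DD) rho).
Hypothesis rep : dorfman_2rep (sA DD) (sB DD) rho del Delta nabla Om brQ.

Local Notation VA := (dA DD).
Local Notation VB := (dB DD).
Local Notation WQ := (sA DD).
Local Notation WB := (sB DD).
Local Notation pA := (vproj VA).
Local Notation pB := (vproj VB).
Local Notation qA := (vproj WQ).
Local Notation qB := (vproj WB).
Local Notation dag := (dual_dagger DD pair).
Local Notation sig := (horizontal_lift DD S).
Local Notation ac := (acov DD pair S).

Let ls : linear_splitting DD S := lag_linear lag.
Let dbm := d2_del rep.
Let dD := d2_Delta rep.
Let dull := d2_br rep.
Let lc := d2_nabla rep.

Let ssig q : section WQ q -> section VB (sig q) := @section_sig _ _ _ _ _ _ _ _ lag q.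
Let sdag t : dual_section WQ t -> section VB (dag t) := @section_dag _ _ _ _ _ _ _ _ md lag t.
Hint Resolve ssig sdag : core.

Lemma del_zero m a : (forall q, qA q = m -> a q = 0) -> del m a = vzero WB m.
Proof.
move=> a0; have c0 := dual_sectionP (dual_section0 WQ) m.
rewrite (dbm_fibre dbm (a' := fun q => 0 * (fun=> 0) q)); last first.
  by move=> q /a0 ->; rewrite mulr0.
by rewrite (dbm_scale dbm _ c0) vscale0 (dbm_proj dbm c0).
Qed.

Lemma del_acovD e e' : pB e = pB e' ->
  del (qB (pB e)) (ac (e +[VB] e')) =
  del (qB (pB e)) (ac e) +[WB] del (qB (pB e)) (ac e').
Proof.
move=> ee'; have c1 := acov_covector md lag e; have c2 := acov_covector md lag e'.
rewrite -ee' in c2; rewrite -(dbm_add dbm c1 c2); apply: (dbm_fibre dbm) => q hq.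
exact: (acovD md lag).
Qed.

Lemma del_acovZ r e : del (qB (pB e)) (ac (r *[VB] e)) = r *[WB] del (qB (pB e)) (ac e).
Proof.
rewrite -(dbm_scale dbm _ (acov_covector md lag e)); apply: (dbm_fibre dbm) => q hq.
exact: (acovZ md lag).
Qed.

(** The derivatives of the coefficient of [b] in [rho] and in [nabla] cancel. The expression depends
    only on [b m], so a vector at a point of [B] can be defined with any section through that
    point. *)
Lemma nabla_tensorr q l m : section WQ q -> dual_section WB l ->
  section_tensor WB m (fun b => rho (q m) (l \o b) - l (nabla q b m)).
Proof.
move=> hq dl; have tq := anchor_tangent anr m hq.
have hn b : section WB b -> section WB (nabla q b) by exact: (lc_section lc hq).
split=> [b b' hb hb'|f b sf hb].
  rewrite (lc_addr lc) // /sadd (dual_add dl) ?section_proj //; auto.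
  rewrite (_ : l \o _ = fun y => (l \o b) y + (l \o b') y); last first.
    by apply/funext => y; rewrite /= (dual_add dl) ?section_proj.
  by rewrite (tangentD tq (dual_smooth_on dl hb) (dual_smooth_on dl hb')); ring.
rewrite (lc_leibniz lc) // /sadd /sscale (dual_add dl) ?vproj_scale ?section_proj //; auto.
rewrite !(dual_scale _ _ dl).
rewrite (_ : l \o _ = fun y => f y * (l \o b) y); last first.
  by apply/funext => y; rewrite /= (dual_scale _ _ dl).
by rewrite (tangentM tq sf (dual_smooth_on dl hb)) /=; ring.
Qed.

Lemma nabla_tensorl b l m : section WB b -> dual_section WB l ->
  section_tensor WQ m (fun q => l (nabla q b m)).
Proof.
move=> hb dl; have hn q : section WQ q -> section WB (nabla q b) by move=> hq; exact: (lc_section lc hq).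
split=> [q q' hq hq'|f q sf hq].
  by rewrite (lc_addl lc) // /sadd (dual_add dl) ?section_proj //; auto.
by rewrite (lc_scalel lc) // /sscale (dual_scale _ _ dl).
Qed.

Lemma nabla_eq q q' b b' l m : section WQ q -> section WQ q' -> section WB b ->
  section WB b' -> dual_section WB l -> q m = q' m -> b m = b' m ->
  rho (q m) (l \o b) - l (nabla q b m) = rho (q' m) (l \o b') - l (nabla q' b' m).
Proof.
move=> hq hq' hb hb' dl qq bb.
rewrite (section_tensor_eq (nabla_tensorr m hq dl) hb hb' bb) qq.
by rewrite (section_tensor_eq (nabla_tensorl m hb' dl) hq hq' qq).
Qed.

(** The vector [T b (rho q)], vertically corrected by [- nabla_q b] and by the image
    under [del] of the core component. *)
Definition anchor_at (e : E) (v : (B -> R) -> R) : Prop :=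
  [/\ tangent (pB e) v, forall f, smooth_fun f -> v (f \o qB) = rho (pA e) f
    & forall q b l, section WQ q -> section WB b -> dual_section WB l ->
        q (qB (pB e)) = pA e -> b (qB (pB e)) = pB e ->
        v l = rho (pA e) (l \o b) - l (nabla q b (qB (pB e)))
              + l (del (qB (pB e)) (ac e))].

Definition rep_anchor (e : E) : (B -> R) -> R := xget (fun=> 0) (anchor_at e).

(** A tangent vector has to come from a curve, so the pushforward and the two vertical lifts are
    combined by [tangent_lin]. Independence of the extensions of [pA e] and [pB e] is [nabla_eq]. *)
Lemma rep_anchorP e : anchor_at e (rep_anchor e).
Proof.
rewrite /rep_anchor; apply: (@xgetPex _ _ (anchor_at e)).
set m := qB (pB e).
have [q hq qE] := section_through WQ (pA e); rewrite base_split -/m in qE.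
have [b hb bE] := section_through WB (pB e); rewrite -/m in bE.
have bm := section_proj m hb.
have hn := lc_section lc hq hb.
have t1 : tangent (pB e) (pushforward b (rho (q m))).
  by rewrite -bE; apply: tangent_pushforward hb.1 (anchor_tangent anr m hq).
have p2 : qB (nabla q b (qB (pB e))) = qB (pB e) by exact: section_proj.
have t2 := vertical_lift_tangent p2.
have p3 : qB ((fun=> del m (ac e)) (qB (pB e))) = qB (pB e).
  exact: (dbm_proj dbm (acov_covector md lag e)).
have t3 := vertical_lift_tangent (s := fun=> del m (ac e)) p3.
have t12 : tangent (pB e) (fun f => 1 * pushforward b (rho (q m)) f +
    -1 * vertical_lift WB (nabla q b) (pB e) f) by exact: (tangent_lin t1 t2).
exists (fun f => 1 * (1 * pushforward b (rho (q m)) f +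
    -1 * vertical_lift WB (nabla q b) (pB e) f) +
    1 * vertical_lift WB (fun=> del m (ac e)) (pB e) f); split.
- exact: (tangent_lin t12 t3).
- move=> f sf; rewrite !vertical_lift_basic // /pushforward.
  rewrite (_ : (f \o qB) \o b = f); last first.
    by apply/funext => y; rewrite /= section_proj.
  by rewrite qE; ring.
- move=> q' b' l hq' hb' dl qE' bE'; rewrite !vertical_lift_linear // /pushforward.
  have := nabla_eq hq hq' hb hb' dl (m := m); rewrite qE bE => /(_ (esym qE') (esym bE')).
  by rewrite qE' => <-; rewrite -/m; ring.
Qed.

Lemma rep_anchor_tangent e : tangent (pB e) (rep_anchor e).
Proof. by have [] := rep_anchorP e. Qed.

Lemma rep_anchor_basic e f : smooth_fun f -> rep_anchor e (f \o qB) = rho (pA e) f.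
Proof. by have [_ h _] := rep_anchorP e; exact: h. Qed.

Lemma rep_anchor_linear e q b l : section WQ q -> section WB b -> dual_section WB l ->
  q (qB (pB e)) = pA e -> b (qB (pB e)) = pB e ->
  rep_anchor e l = rho (pA e) (l \o b) - l (nabla q b (qB (pB e)))
              + l (del (qB (pB e)) (ac e)).
Proof. by have [_ _ h] := rep_anchorP e; exact: h. Qed.

Lemma through_split e : exists q b, [/\ section WQ q, section WB b,
  q (qB (pB e)) = pA e & b (qB (pB e)) = pB e].
Proof.
have [q hq qE] := section_through WQ (pA e); rewrite base_split in qE.
by have [b hb bE] := section_through WB (pB e); exists q, b.
Qed.

Lemma rep_anchor_lin_add e e' l : pB e = pB e' -> dual_section WB l ->
  rep_anchor (e +[VB] e') l = rep_anchor e l + rep_anchor e' l.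
Proof.
move=> ee' dl; set m := qB (pB e).
have pe : pB (e +[VB] e') = pB e by rewrite vproj_add.
have [q [b [hq hb qE bE]]] := through_split e.
have [q' [_ [hq' _ qE' _]]] := through_split e'; rewrite -ee' in qE'.
have hqq := section_add hq hq'; have slb := dual_smooth_on dl hb.
have qq : sadd WQ q q' m = pA (e +[VB] e') by rewrite pA_addB // /sadd qE qE'.
rewrite (rep_anchor_linear (q := sadd WQ q q') (b := b)) ?pe //.
rewrite (rep_anchor_linear (e := e) hq hb) // (rep_anchor_linear (e := e') hq' hb) -?ee' //.
rewrite del_acovD // (dual_add dl); last first.
  have c1 := acov_covector md lag e; have c2 := acov_covector md lag e'.
  by rewrite -ee' in c2; rewrite (dbm_proj dbm c1) (dbm_proj dbm c2).
have [-> // _] := nabla_tensorl m hb dl.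
rewrite pA_addB // (dual_add (anchor_dual anr slb)); last by rewrite !base_split ee'.
by rewrite -/m; ring.
Qed.

Lemma rep_anchor_lin_scale r e l : dual_section WB l ->
  rep_anchor (r *[VB] e) l = r * rep_anchor e l.
Proof.
move=> dl; set m := qB (pB e).
have pe : pB (r *[VB] e) = pB e by rewrite vproj_scale.
have [q [b [hq hb qE bE]]] := through_split e.
have sr := sc_cst (@smf R M) r.
have hrq := section_scale sr hq; have slb := dual_smooth_on dl hb.
have qq : sscale WQ (cst r) q m = pA (r *[VB] e) by rewrite pA_scaleB /sscale qE.
rewrite (rep_anchor_linear (q := sscale WQ (cst r) q) (b := b)) ?pe //.
rewrite (rep_anchor_linear (e := e) hq hb) // del_acovZ (dual_scale _ _ dl).
have [_ -> //] := nabla_tensorl m hb dl.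
rewrite pA_scaleB (dual_scale _ _ (anchor_dual anr slb)) /=.
by rewrite -/m; ring.
Qed.

Lemma rep_anchor_lin_addA e e' l : pA e = pA e' -> dual_section WB l ->
  rep_anchor (e +[VA] e') l = rep_anchor e l + rep_anchor e' l.
Proof.
move=> ee' dl; set m := qB (pB e).
have mm : qB (pB e') = m by rewrite -base_split -ee' base_split.
have pAe : pA (e +[VA] e') = pA e by rewrite vproj_add.
have pBe : pB (e +[VA] e') = pB e +[WB] pB e' by rewrite pB_addA.
have pm' : qB (pB (e +[VA] e')) = m by rewrite pBe vproj_add.
have [q [b [hq hb qE bE]]] := through_split e.
have [_ [b' [_ hb' _ bE']]] := through_split e'; rewrite mm in bE'.
have hbb := section_add hb hb'.
have bb : sadd WB b b' m = pB (e +[VA] e') by rewrite pBe /sadd bE bE'.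
rewrite (rep_anchor_linear (q := q) (b := sadd WB b b')) ?pm' ?pAe //.
rewrite (rep_anchor_linear (e := e) hq hb) // (rep_anchor_linear (e := e') hq hb') ?mm -?ee' //.
have dE : del m (ac (e +[VA] e')) = del m (ac e) +[WB] del m (ac e').
  have c1 := acov_covector md lag e; have c2 := acov_covector md lag e'.
  rewrite mm in c2; rewrite -(dbm_add dbm c1 c2); apply: (dbm_fibre dbm) => x hx.
  rewrite /acov pBe (ls_addB ls) ?mm //.
  by rewrite (md_add md) ?(split_pA lag) ?(split_pB lag) ?mm.
have c1 := acov_covector md lag e; have c2 := acov_covector md lag e'; rewrite mm in c2.
rewrite dE (dual_add dl) ?(dbm_proj dbm c1) ?(dbm_proj dbm c2) //.
have [h _] := nabla_tensorr m hq dl.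
by have := h b b' hb hb'; rewrite qE -/m => ->; ring.
Qed.

Lemma rep_anchor_lin_scaleA r e l : dual_section WB l ->
  rep_anchor (r *[VA] e) l = r * rep_anchor e l.
Proof.
move=> dl; set m := qB (pB e).
have pAe : pA (r *[VA] e) = pA e by rewrite vproj_scale.
have pBe : pB (r *[VA] e) = r *[WB] pB e by rewrite pB_scaleA.
have pm' : qB (pB (r *[VA] e)) = m by rewrite pBe vproj_scale.
have [q [b [hq hb qE bE]]] := through_split e.
have sr := sc_cst (@smf R M) r; have hrb := section_scale sr hb.
have bb : sscale WB (cst r) b m = pB (r *[VA] e) by rewrite pBe /sscale bE.
rewrite (rep_anchor_linear (q := q) (b := sscale WB (cst r) b)) ?pm' ?pAe //.
rewrite (rep_anchor_linear (e := e) hq hb) //.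
have c1 := acov_covector md lag e.
have dE : del m (ac (r *[VA] e)) = r *[WB] del m (ac e).
  rewrite -(dbm_scale dbm _ c1); apply: (dbm_fibre dbm) => x hx.
  rewrite /acov pBe (ls_scaleB ls) //.
  by rewrite (md_scale md) ?(split_pB lag).
rewrite dE (dual_scale _ _ dl).
have [_ h] := nabla_tensorr m hq dl.
by have := h _ b sr hb; rewrite qE -/m => ->; rewrite /=; ring.
Qed.

Lemma rep_anchor_sig q b l m : section WQ q -> section WB b -> dual_section WB l ->
  rep_anchor (sig q (b m)) l = rho (q m) (l \o b) - l (nabla q b m).
Proof.
move=> hq hb dl; have bm := section_proj m hb.
have sB := sig_pB lag (b m) hq; have sA := sig_pA lag (b m) hq.
rewrite (rep_anchor_linear (q := q) (b := b)) ?sB ?sA ?bm //.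
rewrite del_zero ?(dual_zero _ dl) ?addr0 // => x hx.
by rewrite (sig_acov lag) // bm.
Qed.

Lemma rep_anchor_dag t b l : dual_section WQ t -> dual_section WB l ->
  rep_anchor (dag t b) l = l (del (qB b) t).
Proof.
move=> dt dl; have hz := section_zero WQ.
have dB := dag_pB md b dt; have dA := dag_pA md b dt.
have [b' hb' bE'] := section_through WB b.
have slb := dual_smooth_on dl hb'.
rewrite (rep_anchor_linear (q := vzero WQ) (b := b')) ?dB ?dA //.
rewrite (anchor_zero anr) //; have [_ h] := nabla_tensorl (qB b) hb' dl.
have := h (cst 0) _ (sc_cst (@smf R M) 0) hz.
rewrite (_ : sscale WQ (cst 0) (vzero WQ) = vzero WQ) ?mul0r; last first.
  by apply/funext => y; exact: vscale_zero.
move=> ->; rewrite subr0 add0r; congr (l _); apply: (dbm_fibre dbm) => x hx.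
by rewrite (dag_acov md lag).
Qed.

Lemma rep_anchor_sig_dual q l : section WQ q -> dual_section WB l ->
  dual_section WB (fun b => rep_anchor (sig q b) l).
Proof.
move=> hq dl; have [_ [a _ [_ _ hp ha hs]]] := linear_section_sig lag hq.
apply: dual_section_of_smooth => [m|b hb].
  split=> [b b' bm bm'|r b bm]; last by rewrite hs rep_anchor_lin_scaleA.
  by rewrite ha ?bm ?bm' // rep_anchor_lin_addA // !hp bm bm'.
rewrite (_ : _ \o b = fun m => rho (q m) (l \o b) - l (nabla q b m)); last first.
  by apply/funext => m; exact: rep_anchor_sig.
apply: (scB (@smf R M)); first exact: (anchor_smooth anr hq (dual_smooth_on dl hb)).
exact: (dual_smooth_on dl (lc_section lc hq hb)).
Qed.

Lemma rep_anchor_lin_dual l : dual_section WB l -> dual_section VB (fun e => rep_anchor e l).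
Proof.
move=> dl; apply: (dual_section_gen md lag) => [b|q hq|t dt].
- split=> [e e' eb eb'|r e eb]; last exact: rep_anchor_lin_scale.
  by apply: rep_anchor_lin_add => //; rewrite eb.
- exact: (dual_section_smooth (rep_anchor_sig_dual hq dl)).
rewrite (_ : _ \o _ = (l \o fun m => del m t) \o qB); last first.
  by apply/funext => b; exact: rep_anchor_dag.
by apply: smooth_basic; exact: (dual_smooth_on dl (del_section dbm dt)).
Qed.

Lemma rep_anchor_lob_dual g : lin_or_basic WB g -> dual_section VB (fun e => rep_anchor e g).
Proof.
move=> [[f sf ->]|dl]; last exact: rep_anchor_lin_dual.
have dr := anchor_dual anr sf.
rewrite (_ : (fun _ => _) = (fun e => rho (pA e) f)); last first.
  by apply/funext => e; exact: rep_anchor_basic.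
split; first exact: (smooth_map_fun (vproj_smooth VA) dr.1).
by move=> b; apply: (dA_covector (a := fun x => rho x f)); exact: (dual_sectionP dr).
Qed.

(** Everything is known on linear and basic functions. For smoothness on a general [f],
    [linear_chain] expresses the anchor on [f] by its values on such functions, with coefficients
    [h j] that are fixed functions on [B] near the point. *)
Lemma rep_anchor_anchored : anchored VB rep_anchor.
Proof.
have tD e e' : pB e = pB e' -> tangent (pB e) (fun f => 1 * rep_anchor e f + 1 * rep_anchor e' f).
  move=> ee'; have t' := rep_anchor_tangent e'; rewrite -ee' in t'.
  exact: (tangent_lin (rep_anchor_tangent e) t').
split.
- exact: rep_anchor_tangent.
- move=> f sf; apply: (sc_near (@smf R E)) => e0.
  have [n [X [h [_ [lX sh fE _ _]]]]] := linear_chain WB (pB e0) sf.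
  exists (fun e => \sum_j rep_anchor e (X j) * h j (pB e)).
    apply: (sc_sum (@smf R E)) => j; apply: (scM (@smf R E)).
      exact: (dual_section_smooth (rep_anchor_lob_dual (lX j))).
    exact: (smooth_map_fun1 (vproj_smooth VB) (sh j)).
  have := near_comp (p := e0) (smooth_map_cont (vproj_smooth VB)) fE.
  by apply: filterS => e; apply; exact: rep_anchor_tangent.
- move=> e e' f ee' sf; rewrite -[RHS]mul1r mulrDr.
  have te : tangent (pB e) (rep_anchor (e +[VB] e')).
    by have := rep_anchor_tangent (e +[VB] e'); rewrite vproj_add.
  apply: (tangent_bundle_eq (V := WB) te (tD _ _ ee')) => // g /rep_anchor_lob_dual dg.
  by rewrite (dual_add dg) // !mul1r.
- move=> r e f sf.
  have te : tangent (pB e) (rep_anchor (r *[VB] e)).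
    by have := rep_anchor_tangent (r *[VB] e); rewrite vproj_scale.
  rewrite -[RHS]addr0 -[X in _ + X](mul0r (rep_anchor e f)).
  have tr : tangent (pB e) (fun f => r * rep_anchor e f + 0 * rep_anchor e f).
    exact: (tangent_lin (rep_anchor_tangent e) (rep_anchor_tangent e)).
  apply: (tangent_bundle_eq (V := WB) te tr) => // g /rep_anchor_lob_dual dg.
  by rewrite (dual_scale _ _ dg) mul0r addr0.
Qed.

Lemma rep_anchor_dvb : tangent_dvb_morphism DD rep_anchor rho.
Proof.
split.
- exact: rep_anchor_anchored.
- exact: anr.
- by move=> e f sf; exact: rep_anchor_basic.
- move=> e e' ee'.
  have mm : qB (pB e) = qB (pB e') by rewrite -!base_split ee'.
  (* Both vectors project to [rho (pA e)], so they are represented by curves over a common curve in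
     [M], which can be added in the fibres. *)
  have [|g1 [g2 [c1 c2 g12 [g10 g20] gE]]] :=
    lift_curve mm (rep_anchor_tangent e) (rep_anchor_tangent e').
    by move=> f sf; rewrite !rep_anchor_basic // ee'.
  exists g1, g2; split => // f sf; have [E1 E2] := gE f sf; split => //.
  have cs : smooth_curve (fun t => g1 t +[WB] g2 t).
    apply/smooth_curveP; apply: sc_map_add; first exact: smooth_class_line.
    - exact/smooth_curveP.
    - exact/smooth_curveP.
    - by [].
  have ts : tangent (pB (e +[VA] e')) (velocity (fun t => g1 t +[WB] g2 t)).
    by exists (fun t => g1 t +[WB] g2 t); split => //; rewrite g10 g20 pB_addA.
  apply: (tangent_bundle_eq (V := WB) (rep_anchor_tangent _) ts) => // l [[f0 sf0 ->]|dl].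
    rewrite rep_anchor_basic // vproj_add // -rep_anchor_basic //.
    have [-> _] := gE _ (smooth_basic WB sf0).
    rewrite /velocity (_ : (f0 \o qB) \o (fun t => _) = (f0 \o qB) \o g1) //.
    by apply/funext => t; rewrite /= vproj_add.
  rewrite rep_anchor_lin_addA //; have [-> ->] := gE _ (dual_section_smooth dl).
  rewrite /velocity (_ : l \o (fun t => g1 t +[WB] g2 t) = (l \o g1) + (l \o g2)); last first.
    by apply/funext => t; rewrite /= (dual_add dl).
  by rewrite !derive1E deriveD //; apply: curve_derivable => //; exact: dual_section_smooth dl.
- move=> r e f sf.
  have ss : smooth_map (vscale WB r).
    apply/smooth_mapP; apply: (@sc_map_scale _ _ _ WB B _ (fun=> r) id (@smf R B)).
      exact: (sc_cst (@smf R B)).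
    by apply/smooth_mapP; exact: smooth_map_id.
  have t1 := rep_anchor_tangent (r *[VA] e); rewrite pB_scaleA in t1.
  have t2 := tangent_pushforward ss (rep_anchor_tangent e).
  rewrite /tangent_scale; apply: (tangent_bundle_eq (V := WB) t1 t2) => // l [[f0 sf0 ->]|dl].
    rewrite rep_anchor_basic // vproj_scale -rep_anchor_basic // /pushforward.
    by congr (rep_anchor _ _); apply/funext => b; rewrite /= vproj_scale.
  rewrite rep_anchor_lin_scaleA // /pushforward.
  rewrite -(tangentZ (rep_anchor_tangent e) _ (dual_section_smooth dl)).
  by congr (rep_anchor _ _); apply/funext => b; rewrite /= (dual_scale _ _ dl).
Qed.

Lemma rep_core_anchor : core_anchor DD pair rep_anchor del.
Proof.
move=> t b f dt sf.
have ps : qB ((fun m => del m t) (qB b)) = qB b by exact: (section_proj _ (del_section dbm dt)).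
have tg := rep_anchor_tangent (dag t b); rewrite (dag_pB md b dt) in tg.
apply: (tangent_bundle_eq (V := WB) tg (vertical_lift_tangent ps)) => // l [[f0 sf0 ->]|dl].
  by rewrite vertical_lift_basic // rep_anchor_basic // (dag_pA md) // (anchor_zero anr).
by rewrite vertical_lift_linear // rep_anchor_dag.
Qed.

(** In (D1) for [f q] the connection [nabla] is linear over functions, while [Delta] produces the
    extra term [t (q m)] times [rho^* df]; [del] has to kill it. Where all the numbers [t (q m)]
    vanish, so does [rho^* df]. *)
Lemma del_exact f m : smooth_fun f -> del m (fun e => rho e f) = vzero WB m.
Proof.
move=> sf; have dr := anchor_dual anr sf.
have [[q [t [hq dt n0]]]|z] :=
    pselect (exists q t, [/\ section WQ q, dual_section WQ t & t (q m) != 0]); last first.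
  apply: del_zero => e em; have [q hq qE] := section_through WQ e; rewrite em in qE.
  apply/eqP/negPn/negP => n0; apply: z; exists q, (fun e => rho e f).
  by rewrite qE.
have hfq := section_scale sf hq.
have hdt := del_section dbm dt.
have d1 := dc_section dD hq dt.
have c1 := dual_sectionP d1 m; have cr := dual_sectionP dr m.
have c2 := dual_sectionP (dual_sectionZ (f m) d1) m.
have c3 := dual_sectionP (dual_sectionZ (t (q m)) dr) m.
have := d2_D1 rep m hfq dt; rewrite (lc_scalel (lc)) // /sscale -(d2_D1 rep) //.
rewrite (dbm_fibre dbm (a' := fun e => f m * Delta q t e + t (q m) * rho e f)); last first.
  by move=> e em; rewrite (dc_scalel dD) // em.
rewrite (dbm_add dbm c2 c3) (dbm_scale dbm _ c1) (dbm_scale dbm _ cr) => h.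
apply: (dual_sep (V := WB)) => [|l dl]; first by rewrite (dbm_proj dbm cr) vproj_zero.
have /(congr1 l) := h.
rewrite (dual_add dl) ?vproj_scale ?(dbm_proj dbm cr) ?(dbm_proj dbm c1) //.
rewrite !(dual_scale _ _ dl) (dual_zero _ dl) => /(canRL (addKr _)); rewrite addNr => /eqP.
by rewrite mulf_eq0 (negbTE n0) => /eqP.
Qed.

(** This is the axiom on [Delta_q] of [rho^* df], seen through the duality of [Delta] and [brQ]. *)
Lemma br_anchor q1 q2 f m : section WQ q1 -> section WQ q2 -> smooth_fun f ->
  rho (brQ q1 q2 m) f =
  rho (q1 m) (fun m => rho (q2 m) f) - rho (q2 m) (fun m => rho (q1 m) f).
Proof.
move=> h1 h2 sf; have [_ h] := dull h1 h2.
by rewrite (h _ m (anchor_dual anr sf)) (dc_exact dD).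
Qed.

End AnchorConstruction.

(** * Extension of a bracket from generators *)

Section Generators.
Variables (R : realType) (E Q B M : manifold R) (DD : dvb E Q B M).
Variables (pair : E -> E -> R) (S : Q -> B -> E).
Hypotheses (md : metric_dvb DD pair) (lag : lagrangian_splitting DD pair S).

Local Notation VB := (dB DD).
Local Notation WQ := (sA DD).
Local Notation WB := (sB DD).
Local Notation pB := (vproj VB).
Local Notation qA := (vproj WQ).
Local Notation qB := (vproj WB).
Local Notation dag := (dual_dagger DD pair).
Local Notation sig := (horizontal_lift DD S).
Local Notation G := ((M -> Q) * (Q -> R))%type.

Let pm : metric VB pair := md_metric md.

(** A pair of a section of [Q] and one of its dual stands for the sum of a lift and a core section.
    Treating both kinds together gives one family of generators, a module over the functions of [M]
    whose values exhaust the fibres of [E]. *)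
Definition is_gen (g : G) := section WQ g.1 /\ dual_section WQ g.2.
Definition gen (g : G) : B -> E := sadd VB (sig g.1) (dag g.2).
Definition gadd (g g' : G) : G := (sadd WQ g.1 g'.1, fun e => g.2 e + g'.2 e).
Definition gscale (f : M -> R) (g : G) : G := (sscale WQ f g.1, fun e => f (qA e) * g.2 e).

Lemma is_gen_add g g' : is_gen g -> is_gen g' -> is_gen (gadd g g').
Proof. by move=> [? ?] [? ?]; split; [exact: section_add|exact: dual_sectionD]. Qed.

Lemma is_gen_scale f g : smooth_fun f -> is_gen g -> is_gen (gscale f g).
Proof. by move=> sf [? ?]; split; [exact: section_scale|exact: dual_sectionM]. Qed.

Lemma is_gen_sig q : section WQ q -> is_gen (q, fun=> 0).
Proof. by move=> hq; split => //; exact: dual_section0. Qed.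

Lemma is_gen_dag t : dual_section WQ t -> is_gen (vzero WQ, t).
Proof. by move=> dt; split => //; exact: section_zero. Qed.

Lemma section_gen g : is_gen g -> section VB (gen g).
Proof.
move=> [hq dt]; apply: section_add; [exact: (section_sig lag)|exact: (section_dag md lag)].
Qed.

Lemma gen_pB g b : is_gen g -> pB (gen g b) = b.
Proof. by move=> ig; exact: (section_proj b (section_gen ig)). Qed.

Lemma gen_at e : exists2 g, is_gen g & gen g (pB e) = e.
Proof. by have [q [t [hq dt _ _ qtE]]] := gen_through md lag e; exists (q, t). Qed.

Lemma gen_ext b u v : pB u = b -> pB v = b ->
  (forall g, is_gen g -> pair u (gen g b) = pair v (gen g b)) -> u = v.
Proof.
move=> ub vb h; apply: (pair_sep pm); first by rewrite ub.
by move=> e; rewrite ub => eb; have [g ig <-] := gen_at e; rewrite eb; exact: h.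
Qed.

Lemma gen_add g g' : is_gen g -> is_gen g' -> gen (gadd g g') = sadd VB (gen g) (gen g').
Proof.
move=> [h1 d1] [h2 d2]; rewrite /gen /= (sig_add lag) // (dag_add md lag) //.
have s1 := section_sig lag h1; have s2 := section_sig lag h2.
have t1 := section_dag md lag d1; have t2 := section_dag md lag d2.
apply/funext => b; apply: (dual_sep (V := VB)); rewrite /sadd.
  by rewrite !vproj_add ?section_proj // vproj_add ?section_proj.
move=> t dt; rewrite !(dual_add dt) ?vproj_add ?section_proj //.
by ring.
Qed.

Lemma gen_scale f g : smooth_fun f -> is_gen g ->
  gen (gscale f g) = sscale VB (f \o qB) (gen g).
Proof.
move=> sf [h1 d1]; rewrite /gen /= (sig_scale lag) // (dag_scale md lag) //.
have s1 := section_sig lag h1; have t1 := section_dag md lag d1.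
apply/funext => b; apply: (dual_sep (V := VB)); rewrite /sadd /sscale.
  by rewrite !vproj_add ?vproj_scale ?vproj_add ?section_proj.
move=> t dt; rewrite (dual_scale _ _ dt) !(dual_add dt) ?vproj_scale ?section_proj //.
by rewrite !(dual_scale _ _ dt) mulrDr.
Qed.

Lemma gen_sig q : section WQ q -> gen (q, fun=> 0) = sig q.
Proof.
move=> hq; apply/funext => b; rewrite /gen /sadd /=.
have d0 := dual_section0 WQ; have p0 := dag_pB md b d0.
suff -> : dag (fun=> 0) b = vzero VB b.
  by rewrite -{2}(sig_pB lag b hq) vaddr0.
apply: (pair_sep pm); first by rewrite p0 vproj_zero.
move=> e; rewrite p0 => eb; have := pair_dag md lag e d0; rewrite eb => ->.
by rewrite -eb (pair0l pm).
Qed.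

Lemma gen_dag t : dual_section WQ t -> gen (vzero WQ, t) = dag t.
Proof.
move=> dt; apply/funext => b; rewrite /gen /sadd /=.
have -> : sig (vzero WQ) b = vzero VB b.
  rewrite /horizontal_lift (vzeroE WQ) (ls_scaleA (lag_linear lag)) ?vproj_zero //.
  by rewrite vscale0 (split_pB lag) // vproj_zero.
by rewrite -{1}(dag_pB md b dt) vadd0l.
Qed.

Lemma pair_gen_gen g g' : is_gen g -> is_gen g' ->
  (fun b => pair (gen g b) (gen g' b)) = (fun m => g.2 (g'.1 m) + g'.2 (g.1 m)) \o qB.
Proof.
move=> [h1 d1] [h2 d2]; apply/funext => b.
have s1 := section_sig lag h1; have s2 := section_sig lag h2.
have t1 := section_dag md lag d1; have t2 := section_dag md lag d2.
rewrite /gen (pair_add_sec pm) //; last exact: section_add.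
rewrite /sadd !(pairDr pm) ?section_proj // (pair_sig_sig lag) // (pair_dag_dag md lag) //.
by rewrite (pair_sig_dag md lag) // (pair_dag_sig md lag) //= add0r addr0 addrC.
Qed.

(** At [b] the prescribed values on lifts form a covector of [Q], the core component, and those on
    core sections determine a point of [Q], its projection. Together they give an element of the
    fibre, and [riesz] turns smoothness of the pairings into smoothness of the section. *)
Lemma gen_riesz (P : B -> G -> R) :
  (forall b g g', is_gen g -> is_gen g' -> P b (gadd g g') = P b g + P b g') ->
  (forall b f g, smooth_fun f -> is_gen g -> P b (gscale f g) = f (qB b) * P b g) ->
  (forall g, is_gen g -> smooth_fun (fun b => P b g)) ->
  exists s, section VB s /\ forall b g, is_gen g -> pair (s b) (gen g b) = P b g.
Proof.
move=> PD PZ Ps.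
have zz : sadd WQ (vzero WQ) (vzero WQ) = vzero WQ.
  apply/funext => m; have := @vaddr0 _ _ _ WQ (vzero WQ m).
  by rewrite vproj_zero.
have h b : exists e, pB e = b /\ forall g, is_gen g -> pair e (gen g b) = P b g.
  have [|a ca aE] := @section_tensor_covector _ _ _ WQ (qB b) (fun q => P b (q, fun=> 0)).
    split=> [q q' hq hq'|f q sf hq].
      rewrite -PD; [|exact: is_gen_sig|exact: is_gen_sig].
      by rewrite /gadd /=; congr (P b (_, _)); apply/funext => e; rewrite addr0.
    rewrite -PZ //; last exact: is_gen_sig.
    by rewrite /gscale /=; congr (P b (_, _)); apply/funext => e; rewrite mulr0.
  have [|x xb xE] := @dual_tensor_point _ _ _ WQ (qB b) (fun t => P b (vzero WQ, t)).
    split=> [t t' dt dt'|f t sf dt].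
      rewrite -PD; [|exact: is_gen_dag|exact: is_gen_dag].
      by rewrite /gadd /= zz.
    rewrite -PZ //; last exact: is_gen_dag.
    rewrite /gscale /=; congr (P b (_, _)).
    by apply/funext => m; rewrite /sscale vscale_zero.
  have [t0 dt0 t0E] := dual_through ca.
  have [q0 hq0 q0E] := section_through WQ x; rewrite xb in q0E.
  have i0 : is_gen (q0, t0) by [].
  exists (gen (q0, t0) b); split; first exact: gen_pB.
  move=> g ig; have [hq dt] := ig.
  rewrite (congr1 (@^~ b) (pair_gen_gen i0 ig)) /= q0E xE // t0E ?section_proj // -aE //.
  rewrite -PD; [|exact: is_gen_sig|exact: is_gen_dag].
  case: g {ig} hq dt => q t /= hq dt; rewrite /gadd /=; congr (P b (_, _)).
    by apply/funext => m; rewrite /sadd -{2}(section_proj m hq) vaddr0.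
  by apply/funext => e; rewrite add0r.
have [s hs] := choice h; exists s; split; last by move=> b; have [] := hs b.
have sB b : pB (s b) = b by have [] := hs b.
have [|s' hs' sE'] := riesz pm (a := fun e => pair (s (pB e)) e).
  apply: (dual_section_gen md lag) => [b|q hq|t dt].
  - apply: (covector_eq (a := pair (s b))) => [e eb|]; first by rewrite eb.
    exact: (pair_covectorP pm).
  - rewrite (_ : _ \o _ = fun b => P b (q, fun=> 0)); first exact: Ps (is_gen_sig hq).
    apply/funext => b; have ig := is_gen_sig hq; have [_ <-] := hs b; last exact: ig.
    by rewrite gen_sig //= (sig_pB lag).
  - rewrite (_ : _ \o _ = fun b => P b (vzero WQ, t)); first exact: Ps (is_gen_dag dt).
    apply/funext => b; have ig := is_gen_dag dt; have [_ <-] := hs b; last exact: ig.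
    by rewrite gen_dag //= (dag_pB md).
suff -> : s = s' by [].
apply/funext => b; apply: (pair_sep pm); first by rewrite sB section_proj.
by move=> e; rewrite sB => eb; have := sE' e; rewrite eb.
Qed.

(** * The bracket with a generator, then the bracket of arbitrary sections *)

Section Extension.
Variables (Theta : E -> (B -> R) -> R) (GB : G -> G -> B -> E).
Hypothesis an : anchored VB Theta.
Hypothesis GB_section : forall g g', is_gen g -> is_gen g' -> section VB (GB g g').
Hypothesis GB_add : forall g g1 g2 b, is_gen g -> is_gen g1 -> is_gen g2 ->
  GB g (gadd g1 g2) b = GB g g1 b +[VB] GB g g2 b.
Hypothesis GB_scale : forall g f g1 b, is_gen g -> smooth_fun f -> is_gen g1 ->
  GB g (gscale f g1) b =
  (f (qB b) *[VB] GB g g1 b) +[VB] (Theta (gen g b) (f \o qB) *[VB] gen g1 b).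
Hypothesis GB_inv : forall g1 g2 g3 b, is_gen g1 -> is_gen g2 -> is_gen g3 ->
  Theta (gen g1 b) (fun y => pair (gen g2 y) (gen g3 y)) =
  pair (GB g1 g2 b) (gen g3 b) + pair (GB g1 g3 b) (gen g2 b).
Hypothesis GB_sym : forall g1 g2 e, is_gen g1 -> is_gen g2 ->
  pair (GB g1 g2 (pB e)) e + pair (GB g2 g1 (pB e)) e =
  Theta e (fun y => pair (gen g1 y) (gen g2 y)).

Hint Resolve section_gen is_gen_add is_gen_scale GB_section section_add section_scale
  smooth_basic pair_smooth : core.

Let pair_sm s s' : section VB s -> section VB s' -> smooth_fun (fun y => pair (s y) (s' y)) :=
  @pair_smooth _ _ _ _ _ pm s s'.
Let an_sm s f : section VB s -> smooth_fun f -> smooth_fun (fun y => Theta (s y) f) :=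
  @anchor_smooth _ _ _ _ _ an s f.
Let tang s b : section VB s -> tangent b (Theta (s b)) := @anchor_tangent _ _ _ _ _ an s b.
Hint Resolve pair_sm an_sm tang : core.

Let pairD s s1 s2 : section VB s -> section VB s1 -> section VB s2 ->
  (fun y => pair (s y) (sadd VB s1 s2 y)) = fun y => pair (s y) (s1 y) + pair (s y) (s2 y).
Proof. by move=> *; apply/funext => y; rewrite /sadd (pairDr pm) ?section_proj. Qed.

Let pairZ s f s1 : section VB s -> section VB s1 ->
  (fun y => pair (s y) (sscale VB f s1 y)) = fun y => f y * pair (s y) (s1 y).
Proof. by move=> *; apply/funext => y; rewrite /sscale (pairZr pm) ?section_proj. Qed.

Let pairDL s s1 s2 : section VB s -> section VB s1 -> section VB s2 ->
  (fun y => pair (sadd VB s1 s2 y) (s y)) = fun y => pair (s1 y) (s y) + pair (s2 y) (s y).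
Proof. by move=> *; apply/funext => y; rewrite (pair_add_sec pm). Qed.

Let pairZL s f s1 : section VB s -> section VB s1 ->
  (fun y => pair (sscale VB f s1 y) (s y)) = fun y => f y * pair (s1 y) (s y).
Proof. by move=> *; apply/funext => y; rewrite (pair_scale_sec pm). Qed.

Let pairS s s' : section VB s -> section VB s' ->
  (fun y => pair (s y) (s' y)) = fun y => pair (s' y) (s y).
Proof. by move=> hs hs'; apply/funext => y; exact: (pairC_sec pm). Qed.

Definition lie_spec g e (s : B -> E) := section VB s /\ forall b g3, is_gen g3 ->
  pair (s b) (gen g3 b) =
  Theta (gen g b) (fun y => pair (e y) (gen g3 y)) - pair (GB g g3 b) (e b).

(** The bracket with a generator in the first argument. *)
Definition lie g e : B -> E := xget (vzero VB) (lie_spec g e).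

Lemma lieP g e : is_gen g -> section VB e -> lie_spec g e (lie g e).
Proof.
move=> ig he; rewrite /lie; apply: (@xgetPex _ _ (lie_spec g e)).
apply: gen_riesz => [b g1 g2 i1 i2|b f g1 sf i1|g1 i1].
- rewrite gen_add // pairD; auto.
  rewrite GB_add // (pairDl pm) ?section_proj //; auto.
  by rewrite (tangentD (tang b (section_gen ig))); auto; ring.
- rewrite gen_scale // pairZ; auto.
  rewrite GB_scale // (pairDl pm) ?vproj_scale ?section_proj //; auto.
  rewrite !(pairZl pm) ?section_proj //; auto.
  rewrite (tangentM (tang b (section_gen ig))); auto.
  by rewrite (pairC_sec pm b he) /=; auto; ring.
- by apply: (scB (@smf R B)); auto.
Qed.

Lemma lie_section g e : is_gen g -> section VB e -> section VB (lie g e).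
Proof. by move=> ig he; have [] := lieP ig he. Qed.

Lemma pair_lie g e b g3 : is_gen g -> section VB e -> is_gen g3 ->
  pair (lie g e b) (gen g3 b) =
  Theta (gen g b) (fun y => pair (e y) (gen g3 y)) - pair (GB g g3 b) (e b).
Proof. by move=> ig he; have [_ h] := lieP ig he; exact: h. Qed.

Hint Resolve lie_section : core.

Lemma lie_add g e e' b : is_gen g -> section VB e -> section VB e' ->
  lie g (sadd VB e e') b = lie g e b +[VB] lie g e' b.
Proof.
move=> ig he he'; apply: (@gen_ext b); rewrite ?vproj_add ?section_proj //; auto.
move=> g3 i3; rewrite (pairDl pm) ?section_proj //; auto.
rewrite !pair_lie //; auto.
rewrite pairDL; auto.
rewrite (tangentD (tang b (section_gen ig))); auto.
by rewrite /sadd (pairDr pm) ?section_proj //; auto; ring.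
Qed.

Lemma lie_scale g f e b : is_gen g -> smooth_fun f -> section VB e ->
  lie g (sscale VB f e) b =
  (f b *[VB] lie g e b) +[VB] (Theta (gen g b) f *[VB] e b).
Proof.
move=> ig sf he; apply: (@gen_ext b).
- by rewrite section_proj; auto.
- by rewrite vproj_add ?vproj_scale ?section_proj //; auto.
move=> g3 i3; rewrite (pairDl pm) ?vproj_scale ?section_proj //; auto.
rewrite !(pairZl pm) ?section_proj //; auto.
rewrite !pair_lie //; auto.
rewrite pairZL; auto.
rewrite (tangentM (tang b (section_gen ig))); auto.
by rewrite /sscale (pairZr pm) ?section_proj //; auto; ring.
Qed.

Lemma lie_gen g g' b : is_gen g -> is_gen g' -> lie g (gen g') b = GB g g' b.
Proof.
move=> ig ig'; apply: (@gen_ext b); rewrite ?section_proj //; auto.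
by move=> g3 i3; rewrite pair_lie //; auto; rewrite GB_inv // addrK.
Qed.

(** The difference of the two sides is tensorial in [e']; for a generator [e'] it vanishes by the
    definition of [lie] together with [lie_gen]. *)
Lemma lie_metric g e e' b : is_gen g -> section VB e -> section VB e' ->
  Theta (gen g b) (fun y => pair (e y) (e' y)) =
  pair (lie g e b) (e' b) + pair (e b) (lie g e' b).
Proof.
move=> ig he he'; pose L e' := Theta (gen g b) (fun y => pair (e y) (e' y)) -
  pair (lie g e b) (e' b) - pair (e b) (lie g e' b).
have tL : section_tensor VB b L.
  split=> [s s' hs hs'|f s sf hs]; rewrite /L.
    rewrite pairD // (tangentD (tang b (section_gen ig))); auto.
    rewrite lie_add // /sadd !(pairDr pm) ?section_proj //; auto; ring.
  rewrite pairZ // (tangentM (tang b (section_gen ig))); auto.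
  rewrite lie_scale // /sscale (pairDr pm) ?vproj_scale ?section_proj //; auto.
  by rewrite !(pairZr pm) ?section_proj //; auto; ring.
suff : L e' = 0 by rewrite /L -addrA -opprD => /eqP; rewrite subr_eq0 => /eqP.
have [g' ig' gE] := gen_at (e' b); rewrite section_proj // in gE.
rewrite (section_tensor_eq tL he' (section_gen ig') (esym gE)) /L pair_lie // lie_gen //.
by rewrite (pairC_sec pm b he) //; auto; ring.
Qed.

(** [GB] is assumed to be additive in its second argument only. Symmetry exchanges the arguments at
    the cost of a gradient, which is additive as well; in [lie_gscale] the gradient also leaves the
    last term of the Leibniz rule. *)
Lemma lie_gadd g g' e x : is_gen g -> is_gen g' -> section VB e ->
  pair (lie (gadd g g') e (pB x)) x = pair (lie g e (pB x)) x + pair (lie g' e (pB x)) x.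
Proof.
move=> ig ig' he; have [g3 i3 <-] := gen_at x; set b := pB x; rewrite gen_pB //.
have igg := is_gen_add ig ig'.
rewrite !pair_lie // gen_add // {1}/sadd (dual_add (anchor_dual an _)) ?section_proj //; auto.
have s1 := GB_sym (e b) ig i3; have s2 := GB_sym (e b) ig' i3.
have s3 := GB_sym (e b) igg i3.
rewrite section_proj // in s1 s2 s3.
rewrite (canRL (addrK _) s1) (canRL (addrK _) s2) (canRL (addrK _) s3).
rewrite gen_add // GB_add // (pairDl pm) ?section_proj //; auto.
rewrite pairDL; auto.
by rewrite (tangentD (tang b he)); auto; ring.
Qed.

Lemma lie_gscale g f e x : is_gen g -> smooth_fun f -> section VB e ->
  pair (lie (gscale f g) e (pB x)) x =
  f (qB (pB x)) * pair (lie g e (pB x)) x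
  - Theta (e (pB x)) (f \o qB) * pair (gen g (pB x)) x
  + pair (gen g (pB x)) (e (pB x)) * Theta x (f \o qB).
Proof.
move=> ig sf he; have [g3 i3 <-] := gen_at x; set b := pB x; rewrite gen_pB //.
have igg := is_gen_scale sf ig.
rewrite !pair_lie // gen_scale // {1}/sscale (dual_scale _ _ (anchor_dual an _)); auto.
have s1 := GB_sym (e b) ig i3; have s3 := GB_sym (e b) igg i3.
rewrite section_proj // in s1 s3.
rewrite (canRL (addrK _) s1) (canRL (addrK _) s3).
rewrite gen_scale // GB_scale // (pairDl pm) ?vproj_scale ?section_proj //; auto.
rewrite !(pairZl pm) ?section_proj //; auto.
rewrite pairZL; auto.
rewrite (tangentM (tang b he)); auto.
by rewrite /=; ring.
Qed.

(** By invariance [<[e1, e2], g> = Theta(e1) <e2, g> - <e2, [e1, g]>], and [[e1, g]]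
    is the gradient of [<e1, g>] minus [[g, e1]] by symmetry. *)
Definition ext_spec e1 e2 (s : B -> E) := section VB s /\ forall b g3, is_gen g3 ->
  pair (s b) (gen g3 b) =
  Theta (e1 b) (fun y => pair (e2 y) (gen g3 y)) -
  Theta (e2 b) (fun y => pair (e1 y) (gen g3 y)) + pair (lie g3 e1 b) (e2 b).

Definition ext_br e1 e2 : B -> E := xget (vzero VB) (ext_spec e1 e2).

Lemma ext_brP e1 e2 : section VB e1 -> section VB e2 -> ext_spec e1 e2 (ext_br e1 e2).
Proof.
move=> h1 h2; rewrite /ext_br; apply: (@xgetPex _ _ (ext_spec e1 e2)).
apply: gen_riesz => [b g g' ig ig'|b f g sf ig|g ig].
- rewrite gen_add // (pairD h2 (section_gen ig) (section_gen ig')).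
  rewrite (pairD h1 (section_gen ig) (section_gen ig')).
  rewrite (tangentD (tang b h1)); auto; rewrite (tangentD (tang b h2)); auto.
  have := lie_gadd (e2 b) ig ig' h1; rewrite section_proj // => ->; ring.
- rewrite gen_scale // !pairZ; auto.
  rewrite (tangentM (tang b h1)); auto; rewrite (tangentM (tang b h2)); auto.
  have := lie_gscale (e2 b) ig sf h1; rewrite section_proj // => ->.
  by rewrite (pairC_sec pm b h1) ?(pairC_sec pm b h2); auto; rewrite /=; ring.
- by apply: (scD (@smf R B)); [apply: (scB (@smf R B))|]; auto.
Qed.

Lemma ext_br_section e1 e2 : section VB e1 -> section VB e2 -> section VB (ext_br e1 e2).
Proof. by move=> h1 h2; have [] := ext_brP h1 h2. Qed.
Hint Resolve ext_br_section : core.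

Lemma pair_ext_br e1 e2 b g3 : section VB e1 -> section VB e2 -> is_gen g3 ->
  pair (ext_br e1 e2 b) (gen g3 b) =
  Theta (e1 b) (fun y => pair (e2 y) (gen g3 y)) -
  Theta (e2 b) (fun y => pair (e1 y) (gen g3 y)) + pair (lie g3 e1 b) (e2 b).
Proof. by move=> h1 h2; have [_ h] := ext_brP h1 h2; exact: h. Qed.

Lemma ext_br_addl e1 e1' e2 b : section VB e1 -> section VB e1' -> section VB e2 ->
  ext_br (sadd VB e1 e1') e2 b = ext_br e1 e2 b +[VB] ext_br e1' e2 b.
Proof.
move=> h1 h1' h2; apply: (@gen_ext b); rewrite ?vproj_add ?section_proj //; auto.
move=> g ig; rewrite (pairDl pm) ?section_proj //; auto.
rewrite !pair_ext_br //; auto.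
rewrite {1}/sadd (dual_add (anchor_dual an _)) ?section_proj //; auto.
rewrite pairDL; auto.
rewrite (tangentD (tang b h2)); auto.
by rewrite lie_add // (pairDl pm) ?section_proj //; auto; ring.
Qed.

Lemma ext_br_addr e1 e2 e2' b : section VB e1 -> section VB e2 -> section VB e2' ->
  ext_br e1 (sadd VB e2 e2') b = ext_br e1 e2 b +[VB] ext_br e1 e2' b.
Proof.
move=> h1 h2 h2'; apply: (@gen_ext b); rewrite ?vproj_add ?section_proj //; auto.
move=> g ig; rewrite (pairDl pm) ?section_proj //; auto.
rewrite !pair_ext_br //; auto.
rewrite {2}/sadd (dual_add (anchor_dual an _)) ?section_proj //; auto.
rewrite pairDL; auto.
rewrite (tangentD (tang b h1)); auto.
by rewrite /sadd (pairDr pm) ?section_proj //; auto; ring.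
Qed.

Lemma ext_br_scalel f e1 e2 x : smooth_fun f -> section VB e1 -> section VB e2 ->
  pair (ext_br (sscale VB f e1) e2 (pB x)) x =
  f (pB x) * pair (ext_br e1 e2 (pB x)) x - Theta (e2 (pB x)) f * pair (e1 (pB x)) x
  + pair (e1 (pB x)) (e2 (pB x)) * Theta x f.
Proof.
move=> sf h1 h2; have [g ig <-] := gen_at x; set b := pB x; rewrite gen_pB //.
rewrite !pair_ext_br //; auto.
rewrite {1}/sscale (dual_scale _ _ (anchor_dual an _)); auto.
rewrite pairZL; auto.
rewrite (tangentM (tang b h2)); auto.
rewrite lie_scale // (pairDl pm) ?vproj_scale ?section_proj //; auto.
rewrite !(pairZl pm) ?section_proj //; auto.
by ring.
Qed.

Lemma ext_br_scaler f e1 e2 b : smooth_fun f -> section VB e1 -> section VB e2 ->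
  ext_br e1 (sscale VB f e2) b =
  (f b *[VB] ext_br e1 e2 b) +[VB] (Theta (e1 b) f *[VB] e2 b).
Proof.
move=> sf h1 h2; apply: (@gen_ext b).
- by rewrite section_proj; auto.
- by rewrite vproj_add ?vproj_scale ?section_proj //; auto.
move=> g ig; rewrite (pairDl pm) ?vproj_scale ?section_proj //; auto.
rewrite !(pairZl pm) ?section_proj //; auto.
rewrite !pair_ext_br //; auto.
rewrite pairZL; auto.
rewrite (tangentM (tang b h1)); auto.
rewrite {1}/sscale (dual_scale _ _ (anchor_dual an _)); auto.
rewrite /sscale (pairZr pm) ?section_proj //; auto.
by ring.
Qed.

Lemma ext_br_symmetric e1 e2 x : section VB e1 -> section VB e2 ->
  pair (ext_br e1 e2 (pB x)) x + pair (ext_br e2 e1 (pB x)) x =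
  Theta x (fun y => pair (e1 y) (e2 y)).
Proof.
move=> h1 h2; have [g ig <-] := gen_at x; set b := pB x; rewrite gen_pB //.
rewrite !pair_ext_br // lie_metric //.
by rewrite (pairC_sec pm b h1); auto; ring.
Qed.

Lemma ext_br_gen g g' b : is_gen g -> is_gen g' -> ext_br (gen g) (gen g') b = GB g g' b.
Proof.
move=> ig ig'; apply: (@gen_ext b); rewrite ?section_proj //; auto.
move=> g3 i3; rewrite pair_ext_br //; auto.
rewrite lie_gen //; have := GB_sym (gen g' b) i3 ig; rewrite gen_pB //.
move/(canRL (addrK _)) => ->; rewrite (GB_inv b ig ig' i3).
by rewrite (pairS (section_gen i3)); auto; ring.
Qed.

Lemma ext_bracket : bracket_on_sections VB ext_br.
Proof.
split.
- exact: ext_br_section.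
- by move=> *; move=> b; exact: ext_br_addl.
- by move=> *; move=> b; exact: ext_br_addr.
- move=> r e1 e2 h1 h2 b; have sr := sc_cst (@smf R B) r.
  have hr := section_scale sr h1; have hs := section_proj b (ext_br_section hr h2).
  have hb := section_proj b (ext_br_section h1 h2).
  apply: (pair_sep pm); first by rewrite hs /sscale vproj_scale hb.
  move=> x; rewrite hs => xb; have := ext_br_scalel x sr h1 h2; rewrite xb => ->.
  rewrite /sscale (pairZl pm) ?hb //.
  rewrite (tangent_cst (tang b h2)).
  have tx : tangent (pB x) (Theta x) by have [h _ _ _] := an.
  by rewrite (tangent_cst tx) /=; ring.
- move=> r e1 e2 h1 h2 b; have sr := sc_cst (@smf R B) r.
  rewrite ext_br_scaler // (tangent_cst (tang b h1)) /sscale.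
  have hb := section_proj b (ext_br_section h1 h2).
  apply: (dual_sep (V := VB)).
    by rewrite vproj_add ?vproj_scale ?section_proj //; auto.
  move=> t dt; rewrite (dual_add dt) ?vproj_scale ?section_proj //; auto.
  by rewrite !(dual_scale _ _ dt) mul0r addr0.
Qed.

(** The defect [D] is tensorial in its first and third arguments and symmetric in the last two, so
    all three arguments can be replaced by generators. *)
Lemma ext_br_invariant e1 e2 e3 b : section VB e1 -> section VB e2 -> section VB e3 ->
  Theta (e1 b) (fun y => pair (e2 y) (e3 y)) =
  pair (ext_br e1 e2 b) (e3 b) + pair (e2 b) (ext_br e1 e3 b).
Proof.
pose D e1 e2 e3 := Theta (e1 b) (fun y => pair (e2 y) (e3 y)) -
  pair (ext_br e1 e2 b) (e3 b) - pair (e2 b) (ext_br e1 e3 b).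
move=> h1 h2 h3.
suff : D e1 e2 e3 = 0 by rewrite /D -addrA -opprD => /eqP; rewrite subr_eq0 => /eqP.
have t3 s1 s2 : section VB s1 -> section VB s2 -> section_tensor VB b (D s1 s2).
  move=> k1 k2; split=> [s s' hs hs'|f s sf hs]; rewrite /D.
    rewrite pairD // (tangentD (tang b k1)); auto.
    rewrite ext_br_addr // /sadd !(pairDr pm) ?section_proj //; auto; ring.
  rewrite pairZ // (tangentM (tang b k1)); auto.
  rewrite ext_br_scaler // /sscale (pairDr pm) ?vproj_scale ?section_proj //; auto.
  by rewrite !(pairZr pm) ?section_proj //; auto; ring.
have t1 s2 s3 : section VB s2 -> section VB s3 -> section_tensor VB b (fun s => D s s2 s3).
  move=> k2 k3; split=> [s s' hs hs'|f s sf hs]; rewrite /D.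
    rewrite !ext_br_addl // /sadd (dual_add (anchor_dual an _)) ?section_proj //; auto.
    by rewrite !(pairDl pm, pairDr pm) ?section_proj //; auto; ring.
  rewrite /sscale (dual_scale _ _ (anchor_dual an _)); auto; rewrite -/(sscale VB f s).
  have := ext_br_scalel (s3 b) sf hs k2; rewrite section_proj // => ->.
  have := ext_br_scalel (s2 b) sf hs k3; rewrite section_proj // => h.
  rewrite (pairC_sec pm b k2) ?h; auto.
  by rewrite (pairC_sec pm b k2); auto; ring.
have sw s1 s2 s3 : section VB s1 -> section VB s2 -> section VB s3 -> D s1 s2 s3 = D s1 s3 s2.
  move=> k1 k2 k3; rewrite /D (pairS k2 k3) (pairC_sec pm b (ext_br_section k1 k2)) //.
  by rewrite (pairC_sec pm b k2); auto; ring.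
have red s : section VB s -> exists2 g, is_gen g & s b = gen g b.
  by move=> hs; have [g ig gE] := gen_at (s b); exists g => //; rewrite -[LHS]gE section_proj.
have [g1 i1 E1] := red _ h1; have [g2 i2 E2] := red _ h2; have [g3 i3 E3] := red _ h3.
have k1 := section_gen i1; have k2 := section_gen i2; have k3 := section_gen i3.
rewrite (section_tensor_eq (t3 _ _ h1 h2) h3 k3 E3) sw //.
rewrite (section_tensor_eq (t3 _ _ h1 k3) h2 k2 E2).
rewrite (section_tensor_eq (t1 _ _ k3 k2) h1 k1 E1) /D !ext_br_gen //.
by rewrite GB_inv // (pairC_sec pm b k3); auto; ring.
Qed.

End Extension.
End Generators.

(** * The Courant algebroid of a Dorfman 2-representation *)

Section RepBracket.
Variables (R : realType) (E Q B M : manifold R) (DD : dvb E Q B M).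
Variables (pair : E -> E -> R) (S : Q -> B -> E).
Variables (rho : Q -> (M -> R) -> R) (del : M -> (Q -> R) -> B).
Variables (Delta : (M -> Q) -> (Q -> R) -> Q -> R).
Variables (nabla : (M -> Q) -> (M -> B) -> M -> B).
Variables (Om : Q -> Q -> B -> Q -> R) (brQ : (M -> Q) -> (M -> Q) -> M -> Q).
Hypotheses (md : metric_dvb DD pair) (lag : lagrangian_splitting DD pair S).
Hypotheses (anr : anchored (sA DD) rho).
Hypothesis rep : dorfman_2rep (sA DD) (sB DD) rho del Delta nabla Om brQ.

Local Notation VA := (dA DD).
Local Notation VB := (dB DD).
Local Notation WQ := (sA DD).
Local Notation WB := (sB DD).
Local Notation pA := (vproj VA).
Local Notation pB := (vproj VB).
Local Notation qA := (vproj WQ).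
Local Notation qB := (vproj WB).
Local Notation dag := (dual_dagger DD pair).
Local Notation sig := (horizontal_lift DD S).
Local Notation ac := (acov DD pair S).
Local Notation G := ((M -> Q) * (Q -> R))%type.
Local Notation gen := (gen DD pair S).
Local Notation is_gen := (@is_gen R E Q B M DD).
Local Notation gadd := (@gadd R E Q B M DD).
Local Notation gscale := (@gscale R E Q B M DD).
Local Notation Theta := (rep_anchor DD pair S rho del nabla).

Let pm : metric VB pair := md_metric md.
Let dD := d2_Delta rep.
Let dull := d2_br rep.
Let hO := d2_Om rep.
Let an : anchored VB Theta := rep_anchor_anchored md lag anr rep.

Let ssig q : section WQ q -> section VB (sig q) := @section_sig _ _ _ _ _ _ _ _ lag q.
Let sdag t : dual_section WQ t -> section VB (dag t) := @section_dag _ _ _ _ _ _ _ _ md lag t.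
Hint Resolve ssig sdag : core.

Lemma brQ_section q q' : section WQ q -> section WQ q' -> section WQ (brQ q q').
Proof. by move=> h h'; have [] := dull h h'. Qed.

Lemma brQ_dual q q' t m : section WQ q -> section WQ q' -> dual_section WQ t ->
  t (brQ q q' m) = rho (q m) (t \o q') - Delta q t (q' m).
Proof. by move=> h h' dt; have [_ k] := dull h h'; exact: k. Qed.

Hint Resolve brQ_section : core.

Lemma Delta_section q t : section WQ q -> dual_section WQ t -> dual_section WQ (Delta q t).
Proof. exact: (dc_section dD). Qed.
Hint Resolve Delta_section : core.

Lemma brQ_addr q q1 q2 m : section WQ q -> section WQ q1 -> section WQ q2 ->
  brQ q (sadd WQ q1 q2) m = brQ q q1 m +[WQ] brQ q q2 m.
Proof.
move=> h h1 h2; have h12 := section_add h1 h2.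
apply: (dual_sep (V := WQ)); first by rewrite vproj_add !section_proj; auto.
move=> t dt; rewrite (dual_add dt) ?section_proj; auto.
rewrite !brQ_dual // {2}/sadd (dual_add (Delta_section h dt)) ?section_proj //.
rewrite (_ : t \o sadd WQ q1 q2 = fun y => (t \o q1) y + (t \o q2) y); last first.
  by apply/funext => y; rewrite /= (dual_add dt) ?section_proj.
rewrite (tangentD (anchor_tangent anr m h) (dual_smooth_on dt h1) (dual_smooth_on dt h2)).
by ring.
Qed.

Lemma brQ_scaler q f q1 m : section WQ q -> smooth_fun f -> section WQ q1 ->
  brQ q (sscale WQ f q1) m = (f m *[WQ] brQ q q1 m) +[WQ] (rho (q m) f *[WQ] q1 m).
Proof.
move=> h sf h1; have hf1 := section_scale sf h1.
apply: (dual_sep (V := WQ)).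
  by rewrite vproj_add ?vproj_scale !section_proj; auto.
move=> t dt; rewrite (dual_add dt) ?vproj_scale ?section_proj; auto.
rewrite !(dual_scale _ _ dt) !brQ_dual // {2}/sscale (dual_scale _ _ (Delta_section h dt)).
rewrite (_ : t \o sscale WQ f q1 = fun y => f y * (t \o q1) y); last first.
  by apply/funext => y; rewrite /= (dual_scale _ _ dt).
by rewrite (tangentM (anchor_tangent anr m h) sf (dual_smooth_on dt h1)) /=; ring.
Qed.

Lemma Delta0r q e : section WQ q -> Delta q (fun=> 0) e = 0.
Proof.
move=> hq; have d0 := dual_section0 WQ; have := dc_addr dD hq d0 d0 e.
rewrite (_ : (fun e => _) = fun=> 0); last by apply/funext => y; rewrite addr0.
by move/eqP; rewrite -subr_eq0 opprD addrA subrr sub0r oppr_eq0 => /eqP.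
Qed.

Lemma Delta0l t e : dual_section WQ t -> Delta (vzero WQ) t e = 0.
Proof.
move=> dt; have hz := section_zero WQ.
have := dc_addl dD hz hz dt e.
rewrite (_ : sadd WQ _ _ = vzero WQ); last first.
  by apply/funext => m; have := @vaddr0 _ _ _ WQ (vzero WQ m); rewrite vproj_zero.
by move/eqP; rewrite -subr_eq0 opprD addrA subrr sub0r oppr_eq0 => /eqP.
Qed.

Lemma brQ0r q m : section WQ q -> brQ q (vzero WQ) m = vzero WQ m.
Proof.
move=> hq; have hz := section_zero WQ.
apply: (dual_sep (V := WQ)); first by rewrite vproj_zero section_proj; auto.
move=> t dt; rewrite brQ_dual // (_ : t \o vzero WQ = fun=> 0); last first.
  by apply/funext => y; rewrite /= (dual_zero _ dt).
by rewrite (tangent_cst (anchor_tangent anr m hq)) !dual_zero //; auto; rewrite subr0.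
Qed.

Lemma om_covector2 q1 b q3 : qA q1 = qB b -> qA q3 = qB b ->
  covector WQ (qB b) (fun q2 => Om q1 q2 b q3).
Proof.
move=> e1 e3; have [cD cZ] := htf_1 hO (q2 := q1) (b := b) (q3 := q3) (esym e1) (etrans e3 (esym e1)).
rewrite e1 in cD cZ.
split=> [q q' hq hq'|r q hq].
  by rewrite !(htf_alt hO (q1 := q1)) ?vproj_add ?hq ?hq' // cD // opprD.
by rewrite !(htf_alt hO (q1 := q1)) ?vproj_scale ?hq // cZ // mulrN.
Qed.

Lemma om_covector4 q1 q2 b : qA q1 = qB b -> qA q2 = qB b -> covector WQ (qB b) (Om q1 q2 b).
Proof. by move=> e1 e2; have := htf_4 hO (q1 := q1) (q2 := q2) (b := b); rewrite e2; apply. Qed.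

(** [genC g1 g2 e] is the pairing with [e] of the bracket of the generators [g1]
    and [g2] prescribed by the representation. *)
Definition genC (g1 g2 : G) (e : E) : R :=
  let m := qB (pB e) in
  - Om (g1.1 m) (g2.1 m) (pB e) (pA e) + ac e (brQ g1.1 g2.1 m)
  + Delta g1.1 g2.2 (pA e) - Delta g2.1 g1.2 (pA e) + rho (pA e) (g1.2 \o g2.1).

Lemma gen_pA g b : is_gen g -> pA (gen g b) = g.1 (qB b).
Proof.
move=> [hq dt]; rewrite /gen /sadd pA_addB ?(sig_pB lag) ?(dag_pB md) //.
rewrite (sig_pA lag) // (dag_pA md) //.
by rewrite -{2}(section_proj (qB b) hq) vaddr0.
Qed.

Lemma gen_ac g b q : is_gen g -> qA q = qB b -> ac (gen g b) q = g.2 q.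
Proof.
move=> [hq dt] qb; rewrite /gen /sadd (acovD md lag) ?(sig_pB lag) ?(dag_pB md) //.
by rewrite (sig_acov lag) // (dag_acov md lag) // add0r.
Qed.

Lemma genC_gen g1 g2 g3 b : is_gen g1 -> is_gen g2 -> is_gen g3 ->
  let m := qB b in
  genC g1 g2 (gen g3 b) =
  - Om (g1.1 m) (g2.1 m) b (g3.1 m) + g3.2 (brQ g1.1 g2.1 m)
  + Delta g1.1 g2.2 (g3.1 m) - Delta g2.1 g1.2 (g3.1 m) + rho (g3.1 m) (g1.2 \o g2.1).
Proof.
move=> i1 i2 i3 m; have [h1 _] := i1; have [h2 _] := i2.
rewrite /genC (gen_pB md lag) // gen_pA // gen_ac //.
by rewrite section_proj; auto.
Qed.

Lemma genC_dual g1 g2 : is_gen g1 -> is_gen g2 -> dual_section VB (genC g1 g2).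
Proof.
move=> i1 i2; have [h1 d1] := i1; have [h2 d2] := i2.
have h12 := brQ_section h1 h2.
have D12 := Delta_section h1 d2; have D21 := Delta_section h2 d1.
have sr := dual_smooth_on d1 h2; have dr := anchor_dual anr sr.
have pAB e : qA (pA e) = qB (pB e) by exact: base_split.
apply: (dual_section_gen md lag) => [b|q hq|t dt].
- have oc : covector WQ (qB b) (Om (g1.1 (qB b)) (g2.1 (qB b)) b).
    by apply: om_covector4; rewrite section_proj.
  have [oD oZ] := oc.
  split=> [e e' eb eb'|r e eb]; rewrite /genC.
    rewrite vproj_add ?eb ?eb' // pA_addB ?eb ?eb' // oD ?pAB ?eb ?eb' //.
    rewrite (acovD md lag) ?eb ?eb' ?section_proj // !(dual_add D12) ?(dual_add D21) ?(dual_add dr) ?pAB ?eb ?eb' //.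
    ring.
  rewrite vproj_scale eb pA_scaleB oZ ?pAB ?eb // (acovZ md lag) ?eb ?section_proj //.
  by rewrite (dual_scale _ _ D12) (dual_scale _ _ D21) (dual_scale _ _ dr); ring.
- have iq := is_gen_sig hq.
  rewrite (_ : _ \o _ = fun b => - om_star WB Om g1.1 g2.1 q b +
     ((Delta g1.1 g2.2 \o q) \o qB) b - ((Delta g2.1 g1.2 \o q) \o qB) b +
     ((fun m => rho (q m) (g1.2 \o g2.1)) \o qB) b); last first.
    apply/funext => b; by rewrite /= -(gen_sig md lag hq) genC_gen //= addr0.
  apply: (scD (@smf R B)); last exact: (smooth_basic WB (anchor_smooth anr hq sr)).
  apply: (scB (@smf R B)); last exact: (smooth_basic WB (dual_smooth_on D21 hq)).
  apply: (scD (@smf R B)); last exact: (smooth_basic WB (dual_smooth_on D12 hq)).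
  by apply: (scN (@smf R B)); exact: (dual_section_smooth (om_star_dual hO h1 h2 hq)).
have it := is_gen_dag dt; have hz := section_zero WQ.
rewrite (_ : _ \o _ = (t \o brQ g1.1 g2.1) \o qB).
  exact: (smooth_basic WB (dual_smooth_on dt h12)).
apply/funext => b; rewrite /= -(gen_dag md lag dt) genC_gen //=.
rewrite (dual_zero _ D12) (dual_zero _ D21) (dual_zero _ dr).
rewrite (covector_zero (om_covector4 _ _)) ?section_proj //.
by ring.
Qed.

Definition gen_br (g1 g2 : G) : B -> E :=
  xget (vzero VB) [set s | section VB s /\ forall e, pair (s (pB e)) e = genC g1 g2 e].

Lemma gen_brP g1 g2 : is_gen g1 -> is_gen g2 ->
  section VB (gen_br g1 g2) /\ forall e, pair (gen_br g1 g2 (pB e)) e = genC g1 g2 e.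
Proof.
move=> i1 i2; rewrite /gen_br.
apply: (@xgetPex _ _ [set s | section VB s /\ forall e, pair (s (pB e)) e = genC g1 g2 e]).
by have [s hs sE] := riesz pm (genC_dual i1 i2); exists s.
Qed.

Lemma gen_br_section g1 g2 : is_gen g1 -> is_gen g2 -> section VB (gen_br g1 g2).
Proof. by move=> i1 i2; have [] := gen_brP i1 i2. Qed.

Lemma pair_gen_br g1 g2 b e : is_gen g1 -> is_gen g2 -> pB e = b ->
  pair (gen_br g1 g2 b) e = genC g1 g2 e.
Proof. by move=> i1 i2 <-; have [_ h] := gen_brP i1 i2; exact: h. Qed.

Lemma gen_br_gen g1 g2 g3 b : is_gen g1 -> is_gen g2 -> is_gen g3 ->
  let m := qB b in
  pair (gen_br g1 g2 b) (gen g3 b) =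
  - Om (g1.1 m) (g2.1 m) b (g3.1 m) + g3.2 (brQ g1.1 g2.1 m)
  + Delta g1.1 g2.2 (g3.1 m) - Delta g2.1 g1.2 (g3.1 m) + rho (g3.1 m) (g1.2 \o g2.1).
Proof. by move=> i1 i2 i3 m; rewrite (pair_gen_br i1 i2 (gen_pB md lag b i3)) genC_gen. Qed.

Lemma anchor_gen g b f : is_gen g -> smooth_fun f -> Theta (gen g b) (f \o qB) = rho (g.1 (qB b)) f.
Proof. by move=> ig sf; rewrite (rep_anchor_basic md lag anr rep) // gen_pA. Qed.

Hint Resolve gen_br_section : core.
Let sgen g : is_gen g -> section VB (gen g) := @section_gen _ _ _ _ _ _ _ _ md lag g.
Hint Resolve sgen is_gen_add is_gen_scale : core.

Lemma gen_br_add g g1 g2 b : is_gen g -> is_gen g1 -> is_gen g2 ->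
  gen_br g (gadd g1 g2) b = gen_br g g1 b +[VB] gen_br g g2 b.
Proof.
move=> ig i1 i2; have i12 := is_gen_add i1 i2.
have [h d] := ig; have [h1 d1] := i1; have [h2 d2] := i2.
apply: (gen_ext md lag (b := b)); rewrite ?vproj_add ?section_proj //; auto.
move=> g3 i3; have [h3 d3] := i3.
rewrite (pairDl pm) ?section_proj //; auto.
rewrite !gen_br_gen //=; have [oD _] := om_covector2 (section_proj (qB b) h) (section_proj (qB b) h3).
rewrite {1}/sadd oD ?section_proj // brQ_addr // (dual_add d3) ?section_proj //; auto.
rewrite (dc_addr dD) // (dc_addl dD) //.
rewrite (_ : g.2 \o sadd WQ _ _ = fun y => (g.2 \o g1.1) y + (g.2 \o g2.1) y); last first.
  by apply/funext => y; rewrite /= (dual_add d) ?section_proj.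
rewrite (tangentD (anchor_tangent anr (qB b) h3) (dual_smooth_on d h1) (dual_smooth_on d h2)).
by ring.
Qed.

Lemma gen_br_scale g f g1 b : is_gen g -> smooth_fun f -> is_gen g1 ->
  gen_br g (gscale f g1) b =
  (f (qB b) *[VB] gen_br g g1 b) +[VB] (Theta (gen g b) (f \o qB) *[VB] gen g1 b).
Proof.
move=> ig sf i1; have if1 := is_gen_scale sf i1.
have [h d] := ig; have [h1 d1] := i1.
apply: (gen_ext md lag (b := b)).
- by rewrite section_proj; auto.
- by rewrite vproj_add ?vproj_scale ?section_proj //; auto.
move=> g3 i3; have [h3 d3] := i3.
rewrite (pairDl pm) ?vproj_scale ?section_proj //; auto.
rewrite !(pairZl pm) ?section_proj //; auto.
rewrite anchor_gen // (congr1 (@^~ b) (pair_gen_gen md lag i1 i3)) /=.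
rewrite !gen_br_gen //=; have [_ oZ] := om_covector2 (section_proj (qB b) h) (section_proj (qB b) h3).
rewrite {1}/sscale oZ ?section_proj // brQ_scaler // (dual_add d3) ?vproj_scale ?section_proj //; auto.
rewrite !(dual_scale _ _ d3) (dc_leibniz dD) // (dc_scalel dD) // !section_proj //.
rewrite (_ : g.2 \o sscale WQ _ _ = fun y => f y * (g.2 \o g1.1) y); last first.
  by apply/funext => y; rewrite /= (dual_scale _ _ d).
rewrite (tangentM (anchor_tangent anr (qB b) h3) sf (dual_smooth_on d h1)) /=.
by ring.
Qed.

(** (D5) cancels the values of [Om]. The terms with [g2.2] and [g3.2] match by the duality of
    [Delta] and [brQ], and those with [g1.2] cancel by the same duality and (D2). *)
Lemma gen_br_inv g1 g2 g3 b : is_gen g1 -> is_gen g2 -> is_gen g3 ->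
  Theta (gen g1 b) (fun y => pair (gen g2 y) (gen g3 y)) =
  pair (gen_br g1 g2 b) (gen g3 b) + pair (gen_br g1 g3 b) (gen g2 b).
Proof.
move=> i1 i2 i3; have [h1 d1] := i1; have [h2 d2] := i2; have [h3 d3] := i3.
have s23 := dual_smooth_on d2 h3; have s32 := dual_smooth_on d3 h2.
rewrite (pair_gen_gen md lag i2 i3) anchor_gen //; last exact: (scD (@smf R M)).
rewrite !gen_br_gen //; set m := qB b.
rewrite (tangentD (anchor_tangent anr m h1) s23 s32).
have := d2_D5 rep (q1 := g1.1 m) (q2 := g2.1 m) (q3 := g3.1 m) (b := b).
rewrite !section_proj // => -> //.
rewrite (brQ_dual m h1 h2 d3) (brQ_dual m h1 h3 d2).
have := brQ_dual m h2 h3 d1; have := brQ_dual m h3 h2 d1.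
rewrite (d2_D2 rep h2 h3) /sscale (dual_scale _ _ d1) mulN1r => ->.
move/eqP; rewrite -subr_eq0 => /eqP h.
by rewrite -[LHS]addr0 -[X in _ + X = _]oppr0 -h; ring.
Qed.

Lemma gen_br_sym g1 g2 e : is_gen g1 -> is_gen g2 ->
  pair (gen_br g1 g2 (pB e)) e + pair (gen_br g2 g1 (pB e)) e =
  Theta e (fun y => pair (gen g1 y) (gen g2 y)).
Proof.
move=> i1 i2; have [h1 d1] := i1; have [h2 d2] := i2.
have [g3 i3 <-] := gen_at md lag e; have [h3 d3] := i3; set b := pB e.
have s12 := dual_smooth_on d1 h2; have s21 := dual_smooth_on d2 h1.
rewrite (gen_pB md lag) // (pair_gen_gen md lag i1 i2) anchor_gen //; last exact: (scD (@smf R M)).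
rewrite !gen_br_gen //; set m := qB b.
rewrite (tangentD (anchor_tangent anr m h3) s12 s21).
rewrite (htf_alt hO (q1 := g2.1 m)) ?section_proj //.
rewrite (d2_D2 rep h2 h1) /sscale (dual_scale _ _ d3) /=.
by ring.
Qed.

Definition rep_br : (B -> E) -> (B -> E) -> B -> E := ext_br DD pair S Theta gen_br.

Local Notation br := rep_br.

Lemma rep_bracket : bracket_on_sections VB br.
Proof. exact: (ext_bracket md lag an gen_br_section gen_br_add gen_br_scale gen_br_sym). Qed.

Let bs := rep_bracket.

Let bsec s s' : section VB s -> section VB s' -> section VB (br s s') :=
  @br_section _ _ _ _ _ bs s s'.
Hint Resolve bsec : core.

Lemma rep_br_gen g g' b : is_gen g -> is_gen g' -> br (gen g) (gen g') b = gen_br g g' b.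
Proof.
exact: (ext_br_gen md lag an gen_br_section gen_br_add gen_br_scale gen_br_inv gen_br_sym).
Qed.

Lemma rep_br_invariant e1 e2 e3 b : section VB e1 -> section VB e2 -> section VB e3 ->
  Theta (e1 b) (fun y => pair (e2 y) (e3 y)) =
  pair (br e1 e2 b) (e3 b) + pair (e2 b) (br e1 e3 b).
Proof.
exact: (ext_br_invariant md lag an gen_br_section gen_br_add gen_br_scale gen_br_inv gen_br_sym).
Qed.

Lemma rep_br_symmetric e1 e2 e3 b : section VB e1 -> section VB e2 -> section VB e3 ->
  pair (sadd VB (br e1 e2) (br e2 e1) b) (e3 b) = Theta (e3 b) (fun y => pair (e1 y) (e2 y)).
Proof.
move=> h1 h2 h3; rewrite (pair_add_sec pm); auto.
have := ext_br_symmetric md lag an gen_br_section gen_br_add gen_br_scale gen_br_inv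
  gen_br_sym (e3 b) h1 h2.
by rewrite section_proj.
Qed.

Lemma rep_br_sig_pA q1 q2 b : section WQ q1 -> section WQ q2 ->
  pA (br (sig q1) (sig q2) b) = brQ q1 q2 (qB b).
Proof.
move=> h1 h2; have i1 := is_gen_sig h1; have i2 := is_gen_sig h2.
have h12 := brQ_section h1 h2; have hb := section_proj b (bsec (ssig h1) (ssig h2)).
apply: (dual_sep (V := WQ)); first by rewrite base_split hb section_proj.
move=> t dt; have it := is_gen_dag dt.
have := pair_dag md lag (br (sig q1) (sig q2) b) dt; rewrite hb => <-.
rewrite (pairC_sec pm b (sdag dt) (bsec (ssig h1) (ssig h2))).
rewrite -(gen_sig md lag h1) -(gen_sig md lag h2) -(gen_dag md lag dt) rep_br_gen //.
rewrite gen_br_gen //= !Delta0r // (covector_zero (om_covector4 _ _)) ?section_proj //.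
have s0 := sc_cst (@smf R M) (0 : R).
have tz : rho (vzero WQ (qB b)) ((fun=> 0) \o q2) = 0 by exact: (anchor_zero anr).
by rewrite tz; ring.
Qed.

Lemma rep_br_sig_acov q1 q2 b q : section WQ q1 -> section WQ q2 -> qA q = qB b ->
  ac (br (sig q1) (sig q2) b) q = - Om (q1 (qB b)) (q2 (qB b)) b q.
Proof.
move=> h1 h2 hq; have i1 := is_gen_sig h1; have i2 := is_gen_sig h2.
have hb := section_proj b (bsec (ssig h1) (ssig h2)).
have [q3 h3 q3E] := section_through WQ q; rewrite hq in q3E.
have i3 := is_gen_sig h3.
rewrite /acov hb -q3E -/(sig q3 b) -(gen_sig md lag h1) -(gen_sig md lag h2) rep_br_gen //.
rewrite -/(horizontal_lift DD S q3 b) -(gen_sig md lag h3) gen_br_gen //= !Delta0r //.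
have tz : rho (q3 (qB b)) ((fun=> 0) \o q2) = 0.
  exact: (tangent_cst (anchor_tangent anr (qB b) h3)).
by rewrite tz; ring.
Qed.

Lemma rep_br_sig_dag q t : section WQ q -> dual_section WQ t ->
  br (sig q) (dag t) = dag (Delta q t).
Proof.
move=> hq dt; have i1 := is_gen_sig hq; have i2 := is_gen_dag dt.
have hz := section_zero WQ; have d0 := dual_section0 WQ; have dDt := Delta_section hq dt.
apply/funext => b; have hb := section_proj b (bsec (ssig hq) (sdag dt)).
apply: (gen_ext md lag (b := b)); rewrite ?(dag_pB md) //.
move=> g3 i3; have [h3 d3] := i3.
have := pair_dag md lag (gen g3 b) dDt; rewrite (gen_pB md lag) // gen_pA // => ->.
rewrite -(gen_sig md lag hq) -(gen_dag md lag dt) rep_br_gen // gen_br_gen //=.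
rewrite brQ0r // (dual_zero _ d3) Delta0r //.
rewrite (covector_zero (om_covector2 _ _)) ?section_proj //.
have tz : rho (g3.1 (qB b)) ((fun=> 0) \o vzero WQ) = 0.
  exact: (tangent_cst (anchor_tangent anr (qB b) h3)).
by rewrite tz; ring.
Qed.

Lemma rep_br_dag_dag t t' : dual_section WQ t -> dual_section WQ t' ->
  br (dag t) (dag t') =1 vzero VB.
Proof.
move=> dt dt' b; have i1 := is_gen_dag dt; have i2 := is_gen_dag dt'.
have hz := section_zero WQ.
have hb := section_proj b (bsec (sdag dt) (sdag dt')).
apply: (gen_ext md lag (b := b)); rewrite ?vproj_zero //.
move=> g3 i3; have [h3 d3] := i3; have hg := gen_pB md lag b i3.
rewrite -{3}hg (pair0l pm) -(gen_dag md lag dt) -(gen_dag md lag dt') rep_br_gen // gen_br_gen //=.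
rewrite brQ0r // (dual_zero _ d3) !Delta0l //.
rewrite (covector_zero (om_covector2 _ _)) ?section_proj ?vproj_zero //.
have tz : rho (g3.1 (qB b)) (t \o vzero WQ) = 0.
  rewrite (_ : t \o _ = fun=> 0); last by apply/funext => y; exact: dual_zero.
  exact: (tangent_cst (anchor_tangent anr (qB b) h3)).
by rewrite tz; ring.
Qed.

End RepBracket.

(** * Compatibility of the anchor with the bracket, and the Jacobi identity *)

Section RepCourant.
Variables (R : realType) (E Q B M : manifold R) (DD : dvb E Q B M).
Variables (pair : E -> E -> R) (S : Q -> B -> E).
Variables (rho : Q -> (M -> R) -> R) (del : M -> (Q -> R) -> B).
Variables (Delta : (M -> Q) -> (Q -> R) -> Q -> R).
Variables (nabla : (M -> Q) -> (M -> B) -> M -> B).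
Variables (Om : Q -> Q -> B -> Q -> R) (brQ : (M -> Q) -> (M -> Q) -> M -> Q).
Hypotheses (md : metric_dvb DD pair) (lag : lagrangian_splitting DD pair S).
Hypotheses (anr : anchored (sA DD) rho).
Hypothesis rep : dorfman_2rep (sA DD) (sB DD) rho del Delta nabla Om brQ.

Local Notation VB := (dB DD).
Local Notation WQ := (sA DD).
Local Notation WB := (sB DD).
Local Notation pB := (vproj VB).
Local Notation qA := (vproj WQ).
Local Notation qB := (vproj WB).
Local Notation dag := (dual_dagger DD pair).
Local Notation sig := (horizontal_lift DD S).
Local Notation Theta := (rep_anchor DD pair S rho del nabla).
Local Notation br := (rep_br DD pair S rho del Delta nabla Om brQ).

Let pm : metric VB pair := md_metric md.
Let dbm := d2_del rep.
Let dD := d2_Delta rep.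
Let dull := d2_br rep.
Let lc := d2_nabla rep.
Let hO := d2_Om rep.
Let an : anchored VB Theta := rep_anchor_anchored md lag anr rep.
Let bs : bracket_on_sections VB br := rep_bracket md lag anr rep.
Let inv := rep_br_invariant md lag anr rep.
Let sym := rep_br_symmetric md lag anr rep.
Let Th_basic := rep_anchor_basic md lag anr rep.
Let Th_dag := rep_anchor_dag md lag anr rep.
Let Th_sig := rep_anchor_sig md lag anr rep.
Let Th_sig_dual := rep_anchor_sig_dual md lag anr rep.
Let br_pA := rep_br_sig_pA md lag anr rep.
Let br_ac := rep_br_sig_acov md lag anr rep.
Let br_sd := rep_br_sig_dag md lag anr rep.
Let br_dd := rep_br_dag_dag md lag anr rep.
Let brQs := brQ_section rep.
Let Ds := dc_section dD.
Let ns := lc_section lc.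

Let ssig q : section WQ q -> section VB (sig q) := @section_sig _ _ _ _ _ _ _ _ lag q.
Let sdag t : dual_section WQ t -> section VB (dag t) := @section_dag _ _ _ _ _ _ _ _ md lag t.
Let bsec s s' : section VB s -> section VB s' -> section VB (br s s') :=
  @br_section _ _ _ _ _ bs s s'.
Hint Resolve ssig sdag bsec : core.

(** (D3) speaks of sections of [Q] that represent the transpose of [del] on [xi]; biduality provides
    them. *)
Lemma del_transpose xi : dual_section WB xi -> exists2 q, section WQ q &
  forall t m, dual_section WQ t -> t (q m) = xi (del m t).
Proof.
move=> dx.
have h m : exists e, qA e = m /\ forall t, dual_section WQ t -> t e = xi (del m t).
  suff /dual_tensor_point [e em eE] : dual_tensor WQ m (fun t => xi (del m t)) by exists e.
  split=> [t t' dt dt'|f t sf dt].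
    have c := dual_sectionP dt m; have c' := dual_sectionP dt' m.
    by rewrite (dbm_add dbm c c') (dual_add dx) // (dbm_proj dbm c) (dbm_proj dbm c').
  rewrite (dbm_fibre dbm (a' := fun e => f m * t e)); last by move=> e ->.
  by rewrite (dbm_scale dbm _ (dual_sectionP dt m)) (dual_scale _ _ dx).
have [q hq] := choice h; exists q; last by move=> t m; have [_] := hq m; apply.
apply: section_of_dual => [m|t dt]; first by have [] := hq m.
rewrite (_ : _ \o q = xi \o (fun m => del m t)).
  exact: (dual_smooth_on dx (del_section dbm dt)).
by apply/funext => m; have [_] := hq m; apply.
Qed.

(** Only linear and basic functions matter by [anchor_grad_linear]. The gradient of a basic function
    is the core section of [rho^* df], whose anchor is vertical and vanishes on linear functions by
    [del_exact]. A linear and a basic function are exchanged by symmetry of the pairing, and two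
    linear ones are (D3). *)
Lemma rep_grad0 f g s b : smooth_fun f -> smooth_fun g -> section VB s ->
  (forall e, pair (s (pB e)) e = Theta e f) -> Theta (s b) g = 0.
Proof.
move=> sf sg hs sE; apply: (anchor_grad_linear (W := WB) pm an _ b sf sg hs sE).
have basic0 f0 g' s' b' : smooth_fun f0 -> lin_or_basic WB g' -> section VB s' ->
    (forall e, pair (s' (pB e)) e = Theta e (f0 \o qB)) -> Theta (s' b') g' = 0.
  move=> sf0 lg hs' sE'; have dr := anchor_dual anr sf0.
  have -> : s' b' = dag (fun e => rho e f0) b'.
    apply: (pair_sep pm); first by rewrite section_proj // (dag_pB md).
    move=> e; rewrite section_proj // => <-.
    by rewrite sE' Th_basic // (pair_dag md lag).
  case: lg => [[g0 sg0 ->]|dg]; first by rewrite Th_basic // (dag_pA md) // (anchor_zero anr).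
  by rewrite Th_dag // (del_exact anr rep) // (dual_zero _ dg).
move=> {}f {}g {}s {sf sg hs sE}b lf lg hs sE; have sg := lin_or_basic_smooth lg.
have sf := lin_or_basic_smooth lf.
case: (lf) => [[f0 sf0 fE]|df]; first by apply: (basic0 f0) => //; rewrite -fE.
case: (lg) => [[g0 sg0 gE]|dg].
  have [s' hs' sE'] := riesz pm (anchor_dual an sg).
  have := sE (s' b); rewrite section_proj // (pairC_sec pm b hs hs').
  have := sE' (s b); rewrite section_proj // => -> ->.
  by apply: (basic0 g0) => //; rewrite -gE.
have [q1 h1 e1] := del_transpose df; have [q2 h2 e2] := del_transpose dg.
have [b' hb' bE] := section_through WB b.
rewrite -bE (anchor_grad_split md lag dbm an Th_dag Th_sig (qB b) df dg h1 h2 e1 e2 hs sE hb').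
exact: (d2_D3 rep).
Qed.

Lemma rep_defect_skew e1 e2 f b : section VB e1 -> section VB e2 -> smooth_fun f ->
  anchor_defect Theta br e1 e2 f b = - anchor_defect Theta br e2 e1 f b.
Proof. exact: (anchor_defect_skew pm an bs sym rep_grad0). Qed.

(** For two lifts the defect is the compatibility of [brQ] with [rho] on basic functions and the
    first part of (D4) on linear ones; for a lift and a core section it is (D1). Two core sections
    have vertical anchors, which send linear functions to basic ones and kill the latter. *)
Lemma rep_defect_gen e1 e2 f b :
  (exists2 q, section WQ q & e1 = sig q) \/ (exists2 t, dual_section WQ t & e1 = dag t) ->
  (exists2 q, section WQ q & e2 = sig q) \/ (exists2 t, dual_section WQ t & e2 = dag t) ->
  smooth_fun f -> anchor_defect Theta br e1 e2 f b = 0.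
Proof.
have sd q t f' : section WQ q -> dual_section WQ t -> smooth_fun f' ->
    anchor_defect Theta br (sig q) (dag t) f' b = 0.
  move=> hq dt; apply: (anchor_defect_linear (W := WB) an bs); auto.
  move=> l [[f0 sf0 ->]|dl]; first exact: (anchor_defect_sd_basic md lag anr an Th_basic Ds br_sd).
  rewrite (anchor_defect_sd_linear lag dbm Th_basic Th_dag Th_sig Th_sig_dual Ds br_sd) //.
  by rewrite (d2_D1 rep) // subrr.
move=> [[q1 h1 ->]|[t1 d1 ->]] [[q2 h2 ->]|[t2 d2 ->]] sf.
- move: f sf; apply: (anchor_defect_linear (W := WB) an bs); auto.
  move=> l [[f0 sf0 ->]|dl].
    rewrite (anchor_defect_ss_basic lag anr Th_basic br_pA) //.
    by rewrite (br_anchor anr rep) // subrr.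
  have [b' hb bE] := section_through WB b; rewrite -bE; set m := qB b.
  have bm := section_proj m hb.
  have ca := htf_4 hO (q1 := q1 m) (q2 := q2 m) (b := b' m).
  rewrite !section_proj // in ca; have {}ca := ca erefl erefl.
  rewrite (anchor_defect_ss_linear md lag anr dbm an bs Th_dag Th_sig Th_sig_dual ns brQs
    br_pA br_ac h1 h2 hb dl ca) //; last by move=> f0 sf0; exact: (br_anchor anr rep).
  rewrite (d2_D4_nabla rep) //.
  have p12 := section_proj m (ns h1 (ns h2 hb)); have p21 := section_proj m (ns h2 (ns h1 hb)).
  have pb := section_proj m (ns (brQs h1 h2) hb).
  rewrite !(dual_add dl) ?vproj_add ?vproj_scale ?p12 ?p21 ?pb // !(dual_scale _ _ dl).
  by ring.
- exact: sd.
- by rewrite rep_defect_skew; auto; rewrite sd // oppr0.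
- move: f sf; apply: (anchor_defect_linear (W := WB) an bs); auto.
  have z t y f0 : dual_section WQ t -> smooth_fun f0 -> Theta (dag t y) (f0 \o qB) = 0.
    by move=> dt sf0; rewrite Th_basic // (dag_pA md) // (anchor_zero anr).
  have zz x f' : smooth_fun f' -> Theta (br (dag t1) (dag t2) x) f' = 0.
    by move=> sf'; rewrite br_dd // (anchor_zero an).
  have tg t : dual_section WQ t -> tangent b (Theta (dag t b)).
    by move=> dt; exact: (anchor_tangent an b (sdag dt)).
  move=> l [[f0 sf0 ->]|dl]; rewrite /anchor_defect.
    rewrite zz ?subr0; last exact: smooth_basic.
    have hE t : dual_section WQ t -> (fun y => Theta (dag t y) (f0 \o qB)) = fun=> 0.
      by move=> dt; apply/funext => y; exact: z.
    by rewrite !hE // !(tangent_cst (tg _ _)) // subrr.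
  rewrite zz ?subr0; last exact: dual_section_smooth dl.
  have hE t : dual_section WQ t -> (fun y => Theta (dag t y) l) = (l \o (fun m => del m t)) \o qB.
    by move=> dt; apply/funext => y; exact: Th_dag.
  rewrite !hE // !z ?subrr //; exact: (dual_smooth_on dl (del_section dbm _)).
Qed.

(** Tensoriality is available in the second argument only; skew-symmetry carries it over to the
    first. *)
Lemma rep_defect0 e1 e2 f b : section VB e1 -> section VB e2 -> smooth_fun f ->
  anchor_defect Theta br e1 e2 f b = 0.
Proof.
move=> h1 h2 sf.
have step e : section VB e ->
    (forall e', (exists2 q, section WQ q & e' = sig q) \/
       (exists2 t, dual_section WQ t & e' = dag t) -> anchor_defect Theta br e e' f b = 0) ->
    forall e', section VB e' -> anchor_defect Theta br e e' f b = 0.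
  move=> he h; apply: (gen_tensor md lag (anchor_defect_tensorr pm an bs inv b he sf)).
    by move=> q hq; apply: h; left; exists q.
  by move=> t dt; apply: h; right; exists t.
have gsec e : (exists2 q, section WQ q & e = sig q) \/
    (exists2 t, dual_section WQ t & e = dag t) -> section VB e.
  by move=> [[q hq ->]|[t dt ->]]; auto.
apply: (step) => // e' ge'; rewrite rep_defect_skew //; last exact: gsec.
rewrite (step e') ?oppr0 //; first exact: gsec.
by move=> e ge; exact: rep_defect_gen.
Qed.

(** * Vanishing of the Jacobiator *)

Local Notation J := (jacobiator pair br).
Let A0 := rep_defect0.

Let sw12 e1 e2 e3 e4 b : section VB e1 -> section VB e2 -> section VB e3 -> section VB e4 ->
  J e1 e2 e3 e4 b = - J e2 e1 e3 e4 b := @jacobiator_swap12 _ _ _ _ _ _ _ pm an bs inv sym A0 e1 e2 e3 e4 b.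
Let sw23 e1 e2 e3 e4 b : section VB e1 -> section VB e2 -> section VB e3 -> section VB e4 ->
  J e1 e2 e3 e4 b = - J e1 e3 e2 e4 b := @jacobiator_swap23 _ _ _ _ _ _ _ pm an bs inv sym A0 e1 e2 e3 e4 b.
Let sw34 e1 e2 e3 e4 b : section VB e1 -> section VB e2 -> section VB e3 -> section VB e4 ->
  J e1 e2 e3 e4 b = - J e1 e2 e4 e3 b := @jacobiator_swap34 _ _ _ _ _ _ _ pm an bs inv sym A0 e1 e2 e3 e4 b.

Let is_g e := (exists2 q, section WQ q & e = sig q) \/ (exists2 t, dual_section WQ t & e = dag t).

Lemma cyc e1 e2 e3 e4 b : section VB e1 -> section VB e2 -> section VB e3 -> section VB e4 ->
  J e1 e2 e3 e4 b = J e2 e3 e1 e4 b.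
Proof. by move=> h1 h2 h3 h4; rewrite (sw12 b h1 h2 h3 h4) (sw23 b h2 h1 h3 h4) opprK. Qed.

Lemma g_sec e : is_g e -> section VB e.
Proof. by move=> [[q hq ->]|[t dt ->]]; auto. Qed.
Hint Resolve g_sec : core.

(** Tensoriality is used in the third argument alone; each other argument is brought there by
    transpositions. *)
Lemma gen3 e1 e2 e4 b : section VB e1 -> section VB e2 -> section VB e4 ->
  (forall g, is_g g -> J e1 e2 g e4 b = 0) -> forall e3, section VB e3 -> J e1 e2 e3 e4 b = 0.
Proof.
move=> h1 h2 h4 hg.
apply: (gen_tensor md lag (jacobiator_tensor3 pm an bs inv A0 b h1 h2 h4)).
  by move=> q hq; apply: hg; left; exists q.
by move=> t dt; apply: hg; right; exists t.
Qed.

(** Symmetry turns the bracket into minus that of the lift with the core section, plus the gradient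
    of the basic function given by [t \o q]; both are core sections. *)
Lemma rep_br_dag_sig t q : dual_section WQ t -> section WQ q ->
  exists2 x, dual_section WQ x & br (dag t) (sig q) = dag x.
Proof.
move=> dt hq; have dx := dual_sectionD (anchor_dual anr (dual_smooth_on dt hq))
  (dual_sectionZ (-1) (Ds hq dt)).
exists (fun e => rho e (t \o q) + -1 * Delta q t e) => //; apply/funext => b.
have hb := section_proj b (bsec (sdag dt) (ssig hq)).
apply: (pair_sep pm); first by rewrite hb (dag_pB md).
move=> e; rewrite hb => <-; rewrite (pair_dag md lag) //.
by rewrite (br_dag_sig md lag bs sym Th_basic Ds br_sd) // mulN1r.
Qed.

Lemma br_dag_g t e : dual_section WQ t -> is_g e ->
  exists2 x, dual_section WQ x & br (dag t) e = dag x.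
Proof.
move=> dt [[q hq ->]|[t' dt' ->]]; first exact: rep_br_dag_sig.
have d0 := dual_section0 WQ; exists (fun=> 0) => //; apply/funext => b.
apply: (pair_sep pm); rewrite br_dd //; first by rewrite (dag_pB md) // vproj_zero.
by move=> e'; rewrite vproj_zero => <-; rewrite (pair0l pm) (pair_dag md lag).
Qed.

Lemma anchor_dag_basic t b f : dual_section WQ t -> smooth_fun f -> Theta (dag t b) (f \o qB) = 0.
Proof. by move=> dt sf; rewrite Th_basic // (dag_pA md) // (anchor_zero anr). Qed.

Lemma core_pair0 t x e b : dual_section WQ t -> dual_section WQ x -> is_g e ->
  Theta (dag t b) (fun y => pair (dag x y) (e y)) = 0.
Proof.
move=> dt dx [[q hq ->]|[t' dt' ->]].
  rewrite (_ : (fun y => _) = (x \o q) \o qB); last first.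
    by apply/funext => y; rewrite (pair_dag_sig md lag).
  by apply: anchor_dag_basic => //; exact: (dual_smooth_on dx hq).
rewrite (_ : (fun y => _) = fun=> 0); first exact: (tangent_cst (anchor_tangent an b (sdag dt))).
by apply/funext => y; rewrite (pair_dag_dag md lag).
Qed.

Lemma pair_dd0 t t' s : dual_section WQ t -> dual_section WQ t' -> section VB s ->
  (fun y => pair (br (dag t) (dag t') y) (s y)) = fun=> 0.
Proof.
move=> dt dt' hs; apply/funext => y; rewrite br_dd //.
by have := pair0l pm (s y); rewrite section_proj.
Qed.

(** Two core arguments leave no term in [jacobiatorE]: brackets of a core section with generators
    are core sections, core sections are orthogonal to each other and have zero bracket, and their
    anchors kill the basic functions obtained by pairing a core section with a generator. *)
Lemma jacobiator_ddgg t t' e3 e4 b : dual_section WQ t -> dual_section WQ t' ->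
  is_g e3 -> is_g e4 -> J (dag t) (dag t') e3 e4 b = 0.
Proof.
move=> dt dt' g3 g4; have h3 := g_sec g3; have h4 := g_sec g4.
rewrite (jacobiatorE pm bs inv sym); auto.
have [x3 dx3 ->] := br_dag_g dt' g3; have [y3 dy3 ->] := br_dag_g dt g3.
have [x4 dx4 ->] := br_dag_g dt' g4; have [y4 dy4 ->] := br_dag_g dt g4.
rewrite !core_pair0 // !pair_dd0 // !(pair_dag_dag md lag) //.
rewrite !(tangent_cst (anchor_tangent an b _)) //.
rewrite (congr1 (@^~ b) (pair_dd0 dt dt' (bsec h3 h4))).
by ring.
Qed.

Lemma jacobiator_dd t t' e3 e4 b : dual_section WQ t -> dual_section WQ t' ->
  section VB e3 -> section VB e4 -> J (dag t) (dag t') e3 e4 b = 0.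
Proof.
move=> dt dt' h3 h4; apply: (gen3 (sdag dt) (sdag dt') h4) => // g3 i3.
rewrite (sw34 b (sdag dt) (sdag dt') (g_sec i3) h4) (gen3 (sdag dt) (sdag dt') (g_sec i3)) ?oppr0 //.
by move=> g4 i4; exact: jacobiator_ddgg.
Qed.

(** A cyclic permutation brings the core section to the third argument, where the Jacobiator is the
    defect in the second part of (D4). *)
Lemma jacobiator_dsss t q2 q3 q4 b : dual_section WQ t -> section WQ q2 -> section WQ q3 ->
  section WQ q4 -> J (dag t) (sig q2) (sig q3) (sig q4) b = 0.
Proof.
move=> dt h2 h3 h4; rewrite (cyc b (sdag dt) (ssig h2) (ssig h3) (ssig h4)).
rewrite (jacobiator_sdt md lag dbm an bs inv sym Th_basic Th_dag Ds brQs br_pA br_ac br_sd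
  b h2 h3 dt h4 hO dull (d2_D2 rep)) /=; set m := qB b.
have := d2_D4_Delta rep h2 h3 dt (q4 m); rewrite /om_section section_proj // => ->.
by rewrite subrr.
Qed.

Lemma jacobiator_d t e2 e3 e4 b : dual_section WQ t -> section VB e2 -> section VB e3 ->
  section VB e4 -> J (dag t) e2 e3 e4 b = 0.
Proof.
move=> dt.
have ds q e3' e4' : section WQ q -> section VB e3' -> section VB e4' ->
    J (dag t) (sig q) e3' e4' b = 0.
  move=> hq h3 h4; apply: (gen3 (sdag dt) (ssig hq) h4) => // _ [[q3 hq3 ->]|[t' dt' ->]].
    rewrite (sw34 b (sdag dt) (ssig hq) (ssig hq3) h4) (gen3 (sdag dt) (ssig hq) (ssig hq3)) ?oppr0 //.
    move=> _ [[q4 hq4 ->]|[t' dt' ->]]; first exact: jacobiator_dsss.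
    by rewrite (sw23 b (sdag dt) (ssig hq) (sdag dt') (ssig hq3)) jacobiator_dd ?oppr0; auto.
  by rewrite (sw23 b (sdag dt) (ssig hq) (sdag dt') h4) jacobiator_dd ?oppr0; auto.
move=> h2 h3 h4; rewrite (sw23 b (sdag dt) h2 h3 h4) (gen3 (sdag dt) h3 h4) ?oppr0 //.
move=> _ [[q hq ->]|[t' dt' ->]].
  by rewrite (sw23 b (sdag dt) h3 (ssig hq) h4) ds ?oppr0.
by rewrite (sw23 b (sdag dt) h3 (sdag dt') h4) jacobiator_dd ?oppr0.
Qed.

Lemma jacobiator_3d e1 e2 t e4 b : section VB e1 -> section VB e2 -> dual_section WQ t ->
  section VB e4 -> J e1 e2 (dag t) e4 b = 0.
Proof.
by move=> h1 h2 dt h4; rewrite -(cyc b (sdag dt) h1 h2 h4) jacobiator_d.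
Qed.

Lemma jacobiator_sss q1 q2 q4 e3 b : section WQ q1 -> section WQ q2 -> section WQ q4 ->
  section VB e3 -> J (sig q1) (sig q2) e3 (sig q4) b = 0.
Proof.
move=> h1 h2 h4; apply: (gen3 (ssig h1) (ssig h2) (ssig h4)).
move=> _ [[q3 h3 ->]|[t dt ->]]; last by apply: jacobiator_3d; auto.
have [b' hb bE] := section_through WB b; rewrite -bE.
rewrite (jacobiator_ssss md lag an bs inv sym Th_sig ns brQs br_pA br_ac (qB b)
  h1 h2 h3 h4 hb hO dull (d2_D5 rep)) /=.
by rewrite (d2_D6 rep) // subrr.
Qed.

Lemma rep_jacobiator e1 e2 e3 e4 b : section VB e1 -> section VB e2 -> section VB e3 ->
  section VB e4 -> J e1 e2 e3 e4 b = 0.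
Proof.
have ss q1 q2 f3 f4 : section WQ q1 -> section WQ q2 -> section VB f3 -> section VB f4 ->
    J (sig q1) (sig q2) f3 f4 b = 0.
  move=> h1 h2 k3 k4; rewrite (sw34 b (ssig h1) (ssig h2) k3 k4) (gen3 (ssig h1) (ssig h2) k3) ?oppr0 //.
  move=> _ [[q h ->]|[t dt ->]]; last by apply: jacobiator_3d; auto.
  by rewrite (sw34 b (ssig h1) (ssig h2) (ssig h) k3) jacobiator_sss ?oppr0.
have s1 q1 f2 f3 f4 : section WQ q1 -> section VB f2 -> section VB f3 -> section VB f4 ->
    J (sig q1) f2 f3 f4 b = 0.
  move=> h1 k2 k3 k4; rewrite (sw23 b (ssig h1) k2 k3 k4) (gen3 (ssig h1) k3 k4) ?oppr0 //.
  move=> _ [[q h ->]|[t dt ->]]; last by apply: jacobiator_3d; auto.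
  by rewrite (sw23 b (ssig h1) k3 (ssig h) k4) ss ?oppr0.
move=> h1 h2 h3 h4; rewrite (cyc b h1 h2 h3 h4); apply: (gen3 h2 h3 h4) => //.
move=> _ [[q h ->]|[t dt ->]]; last exact: jacobiator_3d.
by rewrite -(cyc b (ssig h) h2 h3 h4) s1.
Qed.

Lemma rep_courant : courant_algebroid VB pair Theta br.
Proof.
split => //; move=> e1 e2 e3 h1 h2 h3 b.
have k := section_add (bsec (bsec h1 h2) h3) (bsec h2 (bsec h1 h3)).
apply: (pair_sep pm); first by rewrite !section_proj; auto.
move=> e; rewrite section_proj; auto => eb.
have [s hs sE] := section_through VB e; rewrite eb in sE; rewrite -sE.
rewrite (pair_add_sec pm); auto.
have := rep_jacobiator b h1 h2 h3 hs; rewrite /jacobiator.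
by move/eqP; rewrite -addrA -opprD subr_eq0 => /eqP.
Qed.

End RepCourant.

(** * Linear and core sections recognized by their pairings with generators *)

Section LinearSections.
Variables (R : realType) (E Q B M : manifold R) (DD : dvb E Q B M).
Variables (pair : E -> E -> R) (S : Q -> B -> E).
Hypotheses (md : metric_dvb DD pair) (lag : lagrangian_splitting DD pair S).

Local Notation VA := (dA DD).
Local Notation VB := (dB DD).
Local Notation WQ := (sA DD).
Local Notation WB := (sB DD).
Local Notation pA := (vproj VA).
Local Notation qA := (vproj WQ).
Local Notation qB := (vproj WB).
Local Notation dag := (dual_dagger DD pair).
Local Notation sig := (horizontal_lift DD S).
Local Notation ac := (acov DD pair S).

Let pm : metric VB pair := md_metric md.
Let ls : linear_splitting DD S := lag_linear lag.

Lemma pair_sec_dag s t b : section VB s -> dual_section WQ t ->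
  pair (s b) (dag t b) = t (pA (s b)).
Proof.
move=> hs dt; have := pair_dag md lag (s b) dt; rewrite (section_proj b hs) => <-.
exact: (pairC_sec pm b hs (section_dag md lag dt)).
Qed.

Lemma acov_sec s q b : section VB s -> section WQ q ->
  ac (s b) (q (qB b)) = pair (s b) (sig q b).
Proof. by move=> hs hq; rewrite /acov section_proj. Qed.

(** Pairings with core sections give the projection of [s] to [Q], which is constant along the
    fibres of [B] when they are basic. Pairings with lifts give the core component, which is linear.
    By [E_sep] these two components determine [s] on sums and multiples. *)
Lemma linear_sectionI s : section VB s ->
  (forall t, dual_section WQ t -> exists h, forall b, pair (s b) (dag t b) = h (qB b)) ->
  (forall q, section WQ q -> dual_section WB (fun b => pair (s b) (sig q b))) ->
  linear_section DD s.
Proof.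
move=> hs hd hl; split => //; pose a m := pA (s (vzero WB m)).
have qa m : qA (a m) = m by rewrite base_split section_proj // vproj_zero.
have pa b : pA (s b) = a (qB b).
  apply: (dual_sep (V := WQ)) => [|t dt]; first by rewrite base_split section_proj // qa.
  have [h hE] := hd t dt; rewrite -pair_sec_dag // hE /a -pair_sec_dag // hE.
  by rewrite vproj_zero.
have sa : smooth_map a.
  exact: smooth_map_comp (smooth_map_comp (vzero_smooth WB) hs.1) (vproj_smooth VA).
exists a => //; split => //; first exact: hs.1.
- move=> b b' bb'; have sb := section_proj b hs; have sb' := section_proj b' hs.
  have aa : pA (s b) = pA (s b') by rewrite !pa bb'.
  apply: (E_sep md lag).
  + by rewrite pB_addA // !section_proj.
  + by rewrite vproj_add // !pa vproj_add.
  move=> x; rewrite (section_proj _ hs) vproj_add // => xb.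
  have [q hq qE] := section_through WQ x; rewrite xb in qE.
  have [hD _] := dual_sectionP (hl q hq) (qB b).
  have := hD b b' erefl (esym bb'); rewrite /horizontal_lift vproj_add // -bb' qE => hE.
  rewrite /acov (section_proj _ hs) pB_addA // sb sb' hE (ls_addB ls) ?xb //.
  by rewrite (md_add md) ?(split_pA lag) ?(split_pB lag) ?sb ?sb' ?xb.
- move=> r b; have sb := section_proj b hs.
  apply: (E_sep md lag).
  + by rewrite pB_scaleA !section_proj.
  + by rewrite vproj_scale !pa vproj_scale.
  move=> x; rewrite (section_proj _ hs) vproj_scale => xb.
  have [q hq qE] := section_through WQ x; rewrite xb in qE.
  have [_ hZ] := dual_sectionP (hl q hq) (qB b).
  have := hZ r b erefl; rewrite /horizontal_lift vproj_scale qE => hE.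
  rewrite /acov (section_proj _ hs) pB_scaleA sb hE (ls_scaleB ls) ?xb //.
  by rewrite (md_scale md) ?(split_pB lag) ?sb ?xb.
Qed.

(** Vanishing pairings with core sections make the projection of [s] to [Q] zero. Basic pairings
    with lifts define the covector [x], read off along the zero section of [B]. *)
Lemma core_sectionI s : section VB s ->
  (forall t b, dual_section WQ t -> pair (s b) (dag t b) = 0) ->
  (forall q, section WQ q -> exists h, forall b, pair (s b) (sig q b) = h (qB b)) ->
  core_section DD s.
Proof.
move=> hs hd hl.
pose x e := pair (s (vzero WB (qA e))) (S e (vzero WB (qA e))).
have xE q b : section WQ q -> x (q (qB b)) = pair (s b) (sig q b).
  move=> hq; have [h hE] := hl q hq.
  rewrite hE /x section_proj // -[S _ _]/(S (q (qB b)) _).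
  have := hE (vzero WB (qB b)); rewrite /horizontal_lift vproj_zero => ->.
  by [].
have dx : dual_section WQ x.
  apply: dual_section_of_smooth => [m|q hq].
    have := acov_covector md lag (s (vzero WB m)); rewrite section_proj // vproj_zero.
    by apply: covector_eq => e em; rewrite /acov /x em section_proj.
  rewrite (_ : x \o q = (fun b => pair (s b) (sig q b)) \o vzero WB).
    exact: (smooth_map_fun (vzero_smooth WB) (pair_smooth pm hs (section_sig lag hq))).
  by apply/funext => m; rewrite /= -xE // vproj_zero.
suff -> : s = dag x by exact: (core_section_dag md lag dx).
apply/funext => b; have sb := section_proj b hs; apply: (E_sep md lag).
- by rewrite sb (dag_pB md).
- rewrite (dag_pA md) //; apply: (dual_sep (V := WQ)) => [|t dt].
    by rewrite base_split sb vproj_zero.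
  by rewrite (dual_zero _ dt) -pair_sec_dag // hd.
move=> e; rewrite sb => eb; rewrite (dag_acov md lag) //.
have [q hq <-] := section_through WQ e; rewrite eb acov_sec //.
by rewrite xE.
Qed.

Lemma linear_section_base s : linear_section DD s -> exists2 a, section WQ a &
  forall t b, dual_section WQ t -> pair (s b) (dag t b) = ((t \o a) \o qB) b.
Proof.
move=> [hs [a ha [_ _ h _ _]]]; exists a => // t b dt.
by rewrite pair_sec_dag // h.
Qed.

Lemma linear_section_pair s q : linear_section DD s -> section WQ q ->
  dual_section WB (fun b => pair (s b) (sig q b)).
Proof. by move=> hs hq; apply: (linear_pair_dual md hs); exact: (linear_section_sig lag). Qed.

End LinearSections.

(** * The VB-Courant structure and its uniqueness *)

Section RepVBCourant.
Variables (R : realType) (E Q B M : manifold R) (DD : dvb E Q B M).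
Variables (pair : E -> E -> R) (S : Q -> B -> E).
Variables (rho : Q -> (M -> R) -> R) (del : M -> (Q -> R) -> B).
Variables (Delta : (M -> Q) -> (Q -> R) -> Q -> R).
Variables (nabla : (M -> Q) -> (M -> B) -> M -> B).
Variables (Om : Q -> Q -> B -> Q -> R) (brQ : (M -> Q) -> (M -> Q) -> M -> Q).
Hypotheses (md : metric_dvb DD pair) (lag : lagrangian_splitting DD pair S).
Hypotheses (anr : anchored (sA DD) rho).
Hypothesis rep : dorfman_2rep (sA DD) (sB DD) rho del Delta nabla Om brQ.

Local Notation VA := (dA DD).
Local Notation VB := (dB DD).
Local Notation WQ := (sA DD).
Local Notation WB := (sB DD).
Local Notation pA := (vproj VA).
Local Notation pB := (vproj VB).
Local Notation qB := (vproj WB).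
Local Notation dag := (dual_dagger DD pair).
Local Notation sig := (horizontal_lift DD S).
Local Notation Theta := (rep_anchor DD pair S rho del nabla).
Local Notation br := (rep_br DD pair S rho del Delta nabla Om brQ).

Let pm : metric VB pair := md_metric md.
Let hO := d2_Om rep.
Let an : anchored VB Theta := rep_anchor_anchored md lag anr rep.
Let bs : bracket_on_sections VB br := rep_bracket md lag anr rep.
Let inv := rep_br_invariant md lag anr rep.
Let sym := rep_br_symmetric md lag anr rep.
Let Th_basic := rep_anchor_basic md lag anr rep.
Let Th_dag := rep_anchor_dag md lag anr rep.
Let br_pA := rep_br_sig_pA md lag anr rep.
Let br_ac := rep_br_sig_acov md lag anr rep.
Let br_sd := rep_br_sig_dag md lag anr rep.
Let br_dd := rep_br_dag_dag md lag anr rep.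
Let brQs := brQ_section rep.
Let Ds := dc_section (d2_Delta rep).

Let ssig q : section WQ q -> section VB (sig q) := @section_sig _ _ _ _ _ _ _ _ lag q.
Let sdag t : dual_section WQ t -> section VB (dag t) := @section_dag _ _ _ _ _ _ _ _ md lag t.
Let bsec s s' : section VB s -> section VB s' -> section VB (br s s') :=
  @br_section _ _ _ _ _ bs s s'.
Let lsec s : linear_section DD s -> section VB s.
Proof. by case. Qed.
Hint Resolve ssig sdag bsec lsec : core.

Lemma rep_anchor_linear_section s l : linear_section DD s -> dual_section WB l ->
  dual_section WB (fun b => Theta (s b) l).
Proof.
move=> [hs [a _ [_ _ hp ha hz]]] dl; split.
  exact: (anchor_smooth an hs (dual_section_smooth dl)).
move=> m; split=> [b b' bm bm'|r b bm]; last first.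
  by rewrite hz (rep_anchor_lin_scaleA md lag anr rep).
rewrite ha ?bm ?bm' // (rep_anchor_lin_addA md lag anr rep) //.
by rewrite !hp bm bm'.
Qed.

Lemma rep_br_ll_sig q1 q2 : section WQ q1 -> section WQ q2 ->
  linear_section DD (br (sig q1) (sig q2)).
Proof.
move=> h1 h2; apply: (linear_sectionI md lag); auto.
  move=> t dt; exists (t \o brQ q1 q2) => b.
  exact: (br_ss_dag md lag bs br_pA).
move=> q hq; rewrite (_ : (fun b => _) = fun b => -1 * om_star WB Om q1 q2 q b).
  by apply: dual_sectionZ; exact: (om_star_dual hO).
by apply/funext => b; rewrite (br_ss_sig lag bs br_ac) // mulN1r.
Qed.

(** The bracket is known explicitly on generators, so one argument at a time is widened from a lift
    to a linear section: invariance widens the second argument, and symmetry then exchanges the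
    two. *)
Lemma rep_br_sig_linear q s : section WQ q -> linear_section DD s ->
  linear_section DD (br (sig q) s).
Proof.
move=> hq ls; have hs := lsec ls; have [a ha aE] := linear_section_base md lag ls.
apply: (linear_sectionI md lag); auto.
  move=> t dt; exists (fun m => rho (q m) (t \o a) + -1 * Delta q t (a m)) => b.
  have hf : (fun y => pair (s y) (dag t y)) = (t \o a) \o qB by apply/funext => y; exact: aE.
  rewrite (br_invariant inv b) ?hf ?br_sd; auto.
  by rewrite Th_basic ?(sig_pA lag) ?aE //=; auto; [ring|exact: (dual_smooth_on dt ha)].
move=> q' hq'; rewrite (_ : (fun b => _) = fun b => Theta (sig q b) (fun y => pair (s y) (sig q' y)) +
    -1 * pair (s b) (br (sig q) (sig q') b)).
  apply: dual_sectionD.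
    apply: rep_anchor_linear_section; first exact: (linear_section_sig lag).
    exact: linear_section_pair md lag _ _ ls hq'.
  by apply: dual_sectionZ; apply: (linear_pair_dual md ls); exact: rep_br_ll_sig.
by apply/funext => b; rewrite (br_invariant inv b) ?mulN1r; auto.
Qed.

Lemma rep_br_linear_sig s q : linear_section DD s -> section WQ q ->
  linear_section DD (br s (sig q)).
Proof.
move=> ls hq; have hs := lsec ls; have lqs := rep_br_sig_linear hq ls.
have [a ha aE] := linear_section_base md lag lqs.
have lp := linear_section_pair md lag ls hq.
have symE e b : section VB e -> pair (br s (sig q) b) (e b) =
    Theta (e b) (fun y => pair (s y) (sig q y)) + -1 * pair (br (sig q) s b) (e b).
  by move=> he; rewrite -(br_symmetric pm bs sym b) //; auto; ring.
apply: (linear_sectionI md lag); auto.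
  move=> t dt; exists (fun m => pair (s (del m t)) (sig q (del m t)) + -1 * (t \o a) m) => b.
  by rewrite symE ?Th_dag ?aE; auto.
move=> q' hq'; rewrite (_ : (fun b => _) = fun b =>
    Theta (sig q' b) (fun y => pair (s y) (sig q y)) + -1 * pair (br (sig q) s b) (sig q' b)).
  apply: dual_sectionD; first by apply: rep_anchor_linear_section => //; exact: (linear_section_sig lag).
  by apply: dual_sectionZ; exact: linear_section_pair md lag _ _ lqs hq'.
by apply/funext => b; apply: symE; auto.
Qed.

(** Against core sections every term of invariance and symmetry vanishes. Against a lift the result
    is basic, because the anchor of [dag t] turns the linear function pairing [s] with the lift into
    its value at [del m t]. *)
Lemma rep_br_linear_core s t : linear_section DD s -> dual_section WQ t ->
  core_section DD (br s (dag t)).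
Proof.
move=> ls dt; have hs := lsec ls; have [a ha aE] := linear_section_base md lag ls.
have fE t' : dual_section WQ t' -> (fun y => pair (s y) (dag t' y)) = (t' \o a) \o qB.
  by move=> dt'; apply/funext => y; exact: aE.
have Z t1 t2 b : dual_section WQ t1 -> dual_section WQ t2 ->
    Theta (dag t1 b) (fun y => pair (s y) (dag t2 y)) = 0.
  move=> d1 d2; rewrite fE // (anchor_dag_basic md lag anr rep) //.
  exact: (dual_smooth_on d2 ha).
have symE e b : section VB e -> pair (br s (dag t) b) (e b) =
    Theta (e b) (fun y => pair (s y) (dag t y)) - pair (br (dag t) s b) (e b).
  by move=> he; rewrite -(br_symmetric pm bs sym b) //; auto; ring.
apply: (core_sectionI md lag); auto.
  move=> t' b dt'; rewrite symE ?Z; auto; rewrite (br_invariant inv b) ?Z; auto.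
  rewrite br_dd // -{2}(section_proj b hs) (pairC pm) ?vproj_zero //.
  by rewrite (pair0l pm) !subr0.
move=> q hq; have [x dx xE] := rep_br_dag_sig md lag anr rep dt hq.
have lp := linear_section_pair md lag ls hq.
exists (fun m => rho (q m) (t \o a) - (pair (s (del m t)) (sig q (del m t)) - x (a m))) => b.
rewrite symE ?fE; auto; rewrite Th_basic ?(sig_pA lag) //; last exact: (dual_smooth_on dt ha).
by rewrite (br_invariant inv b) ?xE ?Th_dag ?aE; auto.
Qed.

Lemma rep_br_linear s s' : linear_section DD s -> linear_section DD s' ->
  linear_section DD (br s s').
Proof.
move=> ls ls'; have hs := lsec ls; have hs' := lsec ls'.
have [a ha aE] := linear_section_base md lag ls.
have [a' ha' aE'] := linear_section_base md lag ls'.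
have pa b : pA (s b) = a (qB b).
  apply: (dual_sep (V := WQ)); first by rewrite base_split !section_proj.
  by move=> t dt; rewrite -(pair_sec_dag md lag b hs dt) aE.
apply: (linear_sectionI md lag); auto.
  move=> t dt; have /(core_sectionP md lag)[x dx xE] := rep_br_linear_core ls dt.
  exists (fun m => rho (a m) (t \o a') - x (a' m)) => b.
  have hf : (fun y => pair (s' y) (dag t y)) = (t \o a') \o qB by apply/funext => y; exact: aE'.
  rewrite (br_invariant inv b) ?xE ?aE' ?hf; auto.
  by rewrite Th_basic ?pa //; exact: (dual_smooth_on dt ha').
move=> q hq; rewrite (_ : (fun b => _) = fun b => Theta (s b) (fun y => pair (s' y) (sig q y)) +
    -1 * pair (s' b) (br s (sig q) b)).
  apply: dual_sectionD.
    apply: rep_anchor_linear_section => //; exact: linear_section_pair md lag _ _ ls' hq.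
  by apply: dual_sectionZ; apply: (linear_pair_dual md ls'); exact: rep_br_linear_sig.
by apply/funext => b; rewrite (br_invariant inv b) ?mulN1r; auto.
Qed.

Lemma rep_vb_courant : vb_courant DD pair Theta rho br.
Proof.
split.
- exact: md.
- exact: (rep_courant md lag anr rep).
- exact: (rep_anchor_dvb md lag anr rep).
- exact: rep_br_linear.
- by move=> s s' ls /(core_sectionP md lag)[t dt ->]; exact: rep_br_linear_core.
- move=> s s' /(core_sectionP md lag)[t dt ->] /(core_sectionP md lag)[t' dt' ->].
  exact: br_dd.
Qed.

Lemma rep_splitting : splitting_equations DD pair S rho Delta nabla Om brQ Theta br.
Proof.
split.
- move=> q hq; split.
  + split=> [b|f sf]; first exact: (anchor_tangent an b (ssig hq)).
    exact: (anchor_smooth an (ssig hq) sf).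
  + by move=> f b sf; rewrite Th_basic // (sig_pA lag).
  + move=> l dl; split; first exact: (rep_anchor_sig_dual md lag anr rep).
    by move=> b m hb; rewrite (rep_anchor_sig md lag anr rep).
- move=> q1 q2 h1 h2 b; have hb := bsec (ssig h1) (ssig h2).
  apply: (sub_hom_tilde md lag); auto.
  + move=> b'; have := htf_4 hO (q1 := q1 (qB b')) (q2 := q2 (qB b')) (b := b').
    by rewrite !section_proj //; apply.
  + exact: (section_proj b hb).
- by move=> q t hq dt b; rewrite br_sd.
Qed.

(** * Uniqueness of the structure *)

Section Unique.
Variables (Theta' : E -> (B -> R) -> R) (br' : (B -> E) -> (B -> E) -> B -> E).
Hypothesis ca : courant_algebroid VB pair Theta' br'.
Hypothesis se : splitting_equations DD pair S rho Delta nabla Om brQ Theta' br'.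
Hypothesis co : core_anchor DD pair Theta' del.
Hypothesis dd : forall t1 t2, dual_section WQ t1 -> dual_section WQ t2 ->
  br' (dag t1) (dag t2) =1 vzero VB.

Let an' := ca_anchored ca.
Let bs' := ca_bracket ca.
Let inv' := ca_invariance ca.
Let sym' := ca_symmetric ca.
Let bsec' s s' : section VB s -> section VB s' -> section VB (br' s s') :=
  @br_section _ _ _ _ _ bs' s s'.
Hint Resolve bsec' : core.

Lemma rep_anchor_unique e f : smooth_fun f -> Theta' e f = Theta e f.
Proof.
move=> sf; have [t' _ _ _] := an'; have [t _ _ _] := an.
apply: (tangent_bundle_eq (V := WB) (t' e) (t e)) => // g lg.
have sg := lin_or_basic_smooth lg.
have [q [tau [hq dt _ _ <-]]] := gen_through md lag e; set b := pB e.
rewrite (dual_add (anchor_dual an' sg)) ?(dual_add (anchor_dual an sg)) ?(sig_pB lag) ?(dag_pB md) //.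
rewrite (co b dt sg) (rep_core_anchor md lag anr rep b dt sg); congr (_ + _).
have [_ hb hl] := se_anchor se hq; have [_ kb kl] := se_anchor rep_splitting hq.
case: lg => [[f0 sf0 ->]|dl]; first by rewrite hb // kb.
have [b' hb' bE] := section_through WB b; rewrite -bE.
have [_ hE] := hl _ dl; have [_ kE] := kl _ dl.
exact: etrans (hE _ _ hb') (esym (kE _ _ hb')).
Qed.

(** Both brackets obey the same Leibniz rules since their anchors agree, so their difference is
    tensorial in each argument and is tested on generators. *)
Lemma rep_br_unique s1 s2 : section VB s1 -> section VB s2 -> br' s1 s2 =1 br s1 s2.
Proof.
move=> h1 h2 b; apply: (pair_sep pm); first by rewrite !section_proj; auto.
move=> e; rewrite section_proj; auto => eb.
have [s3 h3 sE] := section_through VB e; rewrite eb in sE; rewrite -sE.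
pose L s s' := pair (br' s s' b) (s3 b) - pair (br s s' b) (s3 b).
suff : L s1 s2 = 0 by move/eqP; rewrite subr_eq0 => /eqP.
have [_ addl addr _ _] := bs; have [_ addl' addr' _ _] := bs'.
have tr s : section VB s -> section_tensor VB b (L s).
  move=> hs; split=> [e1 e2 k1 k2|f e1 sf k1]; rewrite /L.
    by rewrite addr // addr' // !(pair_add_sec pm); auto; ring.
  rewrite (br_leibniz_r pm an bs inv) // (br_leibniz_r pm an' bs' inv') //.
  by rewrite rep_anchor_unique //; ring.
have tl s : section VB s -> section_tensor VB b (fun s' => L s' s).
  move=> hs; split=> [e1 e2 k1 k2|f e1 sf k1]; rewrite /L.
    by rewrite addl // addl' // !(pair_add_sec pm); auto; ring.
  rewrite (br_leibniz_l pm an bs inv sym) // (br_leibniz_l pm an' bs' inv' sym') //.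
  by rewrite !rep_anchor_unique //; ring.
have sd q t : section WQ q -> dual_section WQ t -> L (sig q) (dag t) = 0.
  by move=> hq dt; rewrite /L (se_lc se) // br_sd // subrr.
apply: (gen_tensor md lag (tr _ h1)) => // [q hq|t dt].
  apply: (gen_tensor md lag (tl _ (ssig hq))) => // [q' hq'|t dt].
    by rewrite /L (se_ll se) // (se_ll rep_splitting) // subrr.
  (* The bracket of a core section with a lift is not among the prescribed ones; symmetry, with
     equal anchors, reduces it to the bracket in the other order. *)
  have := sd q t hq dt; rewrite /L.
  have := br_symmetric pm bs sym b (sdag dt) (ssig hq) h3 => /(canRL (addrK _)) ->.
  have := br_symmetric pm bs' sym' b (sdag dt) (ssig hq) h3 => /(canRL (addrK _)) ->.
  rewrite rep_anchor_unique; last exact: (pair_smooth pm (sdag dt) (ssig hq)).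
  by move=> h; rewrite -[RHS]oppr0 -h; ring.
apply: (gen_tensor md lag (tl _ (sdag dt))) => // [q hq|t' dt']; first exact: sd.
by rewrite /L dd // br_dd // subrr.
Qed.

End Unique.

End RepVBCourant.

(** That the equations define the structure is expressed by existence and uniqueness. Uniqueness
    holds among all Courant algebroid structures with the given pairing that satisfy the equations,
    and compares anchors on smooth functions and brackets on smooth sections only, since other
    values are unconstrained. *)
Theorem theorem6p7 (R : realType) (M Q B E : manifold R)
    (DD : dvb E Q B M) (pair : E -> E -> R) (S : Q -> B -> E) :
  (forall (Theta : E -> (B -> R) -> R) (rho : Q -> (M -> R) -> R)
      (brE : (B -> E) -> (B -> E) -> B -> E) (del : M -> (Q -> R) -> B),
    vb_courant DD pair Theta rho brE ->
    dual_bundle_map (sA DD) (sB DD) del ->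
    core_anchor DD pair Theta del ->
    lagrangian_splitting DD pair S ->
    exists (Delta : (M -> Q) -> (Q -> R) -> Q -> R)
      (nabla : (M -> Q) -> (M -> B) -> M -> B)
      (Om : Q -> Q -> B -> Q -> R) (br : (M -> Q) -> (M -> Q) -> M -> Q),
      dorfman_2rep (sA DD) (sB DD) rho del Delta nabla Om br /\
      splitting_equations DD pair S rho Delta nabla Om br Theta brE)
  /\
  (forall (rho : Q -> (M -> R) -> R) (del : M -> (Q -> R) -> B)
      (Delta : (M -> Q) -> (Q -> R) -> Q -> R)
      (nabla : (M -> Q) -> (M -> B) -> M -> B)
      (Om : Q -> Q -> B -> Q -> R) (br : (M -> Q) -> (M -> Q) -> M -> Q),
    metric_dvb DD pair ->
    lagrangian_splitting DD pair S ->
    anchored (sA DD) rho ->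
    dorfman_2rep (sA DD) (sB DD) rho del Delta nabla Om br ->
    let equations Theta brE :=
      [/\ splitting_equations DD pair S rho Delta nabla Om br Theta brE,
          core_anchor DD pair Theta del
        & forall t1 t2, dual_section (sA DD) t1 -> dual_section (sA DD) t2 ->
            brE (dual_dagger DD pair t1) (dual_dagger DD pair t2) =1
            vzero (dB DD)] in
    exists (Theta : E -> (B -> R) -> R) (brE : (B -> E) -> (B -> E) -> B -> E),
      [/\ vb_courant DD pair Theta rho brE,
          equations Theta brE
        & forall Theta' brE',
            courant_algebroid (dB DD) pair Theta' brE' ->
            equations Theta' brE' ->
            (forall e f, smooth_fun f -> Theta' e f = Theta e f) /\
            (forall s1 s2, section (dB DD) s1 -> section (dB DD) s2 ->
               brE' s1 s2 =1 brE s1 s2)]).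
Proof.
split; first move=> Theta rho brE del vc dbm canc lag.
  exists (ind_Delta DD pair S brE), (ind_nabla DD S Theta rho), (ind_Om DD pair S brE),
    (ind_br DD S brE).
  by split; [exact: ind_dorfman_2rep|exact: ind_splitting].
move=> rho del Delta nabla Om br md lag anr rep equations.
exists (rep_anchor DD pair S rho del nabla), (rep_br DD pair S rho del Delta nabla Om br).
split.
- exact: rep_vb_courant.
- split; [exact: rep_splitting|exact: (rep_core_anchor md lag anr rep)|].
  exact: (rep_br_dag_dag md lag anr rep).
- move=> Theta' brE' ca [se co dd]; split.
    exact: (rep_anchor_unique md lag anr rep ca se co).
  exact: (rep_br_unique md lag anr rep ca se co dd).
Qed.
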